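(* Let $C$ be of finite type. For each $\alpha\in\mathbb N^{\mathbb I}$ and $b\in\mathbf C$ there exists a unique element $C_{\alpha,b}\in\widehat{\mathbf B}^\imath_\tau$ which is bar-invariant, $\overline{C_{\alpha,b}}=C_{\alpha,b}$, and satisfies $$C_{\alpha,b}\in\mathbb K_\alpha\diamond\iota(b)+\sum_{(\alpha,b)\prec(\beta,b')}v^{-1}\mathbb Z[v^{-1}]\cdot\mathbb K_\beta\diamond\iota(b').$$ In addition, $C_{\alpha,b}=\mathbb K_\alpha\diamond C_{0,b}$. Moreover $\{C_{\alpha,b}\mid\alpha\in\mathbb N^{\mathbb I},\,b\in\mathbf C\}$ is a basis of $\widehat{\mathbf B}^\imath_\tau$ (called the dual canonical basis of $\widehat{\mathbf B}^\imath_\tau\equiv\widehat{\mathbf U}^\imath$).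
   Context: Root data. $C=(c_{ij})_{i,j\in\mathbb I}$ is a Cartan matrix of finite type, $D=\mathrm{diag}(d_i)$, $d_i\in\mathbb Z_{>0}$, $DC$ symmetric; $\mathbb Z^{\mathbb I}=\bigoplus_i\mathbb Z\alpha_i\supset\mathbb N^{\mathbb I}$, $(\alpha_i,\alpha_j)=d_ic_{ij}$. $v$ is an indeterminate, $v_i=v^{d_i}$. $\tau$ is a permutation of $\mathbb I$ with $\tau^2=\mathrm{id}$, $c_{\tau i,\tau j}=c_{ij}$, $d_{\tau i}=d_i$, extended linearly to $\mathbb Z^{\mathbb I}$. iHopf algebra. $\mathbf f$ is the $\mathbb Q(v^{1/2})$-algebra generated by $\vartheta_i$ ($i\in\mathbb I$) subject to the quantum Serre relations, $\mathbb N^{\mathbb I}$-graded by $\mathrm{wt}(\vartheta_i)=\alpha_i$; it is Lusztig's algebra with $\vartheta_i=(v_i-v_i^{-1})\theta_i$, $\theta_i$ being Lusztig's generators. $\widehat{\mathbf B}$ is the algebra generated by $\mathbf f$ and commuting elements $h_i$ (not assumed invertible) with $h_i\vartheta_j=v_i^{c_{ij}}\vartheta_jh_i$; $h_\alpha=\prod h_i^{a_i}$ for $\alpha=\sum a_i\alpha_i$. It is a bialgebra with $\Delta(\vartheta_i)=\vartheta_i\otimes1+h_i\otimes\vartheta_i$, $\Delta(h_i)=h_i\otimes h_i$, with the symmetric Hopf pairing $\varphi$ ($\varphi(ab,c)=\sum\varphi(a,c_{(1)})\varphi(b,c_{(2)})$, $\varphi(a,bc)=\sum\varphi(a_{(1)},b)\varphi(a_{(2)},c)$)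 given by $\varphi(\vartheta_i,\vartheta_j)=\delta_{ij}(v_i-v_i^{-1})$, $\varphi(h_i,h_j)=v_i^{c_{ij}}$, $\varphi(\vartheta_i,h_j)=0$. $\tau$ acts by $\vartheta_i\mapsto\vartheta_{\tau i}$, $h_i\mapsto h_{\tau i}$. The iHopf algebra $\widehat{\mathbf B}^\imath_\tau$ is the vector space $\widehat{\mathbf B}$ with the associative product $a*b=\sum\varphi(\tau b_{(2)},a_{(1)})\,a_{(2)}b_{(1)}$; it is isomorphic to the universal quasi-split iquantum group $\widehat{\mathbf U}^\imath$ attached to $(\mathbb I,\tau)$. $\iota:\mathbf f\to\widehat{\mathbf B}^\imath_\tau$ is the inclusion of vector spaces. $\mathbb K_\alpha=v^{\frac12(\alpha,\tau\alpha)}h_{\tau\alpha}$. The $\diamond$-action is $h_\alpha\diamond x=v^{\frac12(\tau\alpha-\alpha,\mathrm{wt}(x))}h_\alpha*x$ for homogeneous $x$ (where $\mathrm{wt}(h_\alpha)=\alpha+\tau\alpha$ and $\mathrm{wt}(\iota(x))=\mathrm{wt}(x)$), extended linearly in $h_\alpha$. The bar involution is the $\mathbb Q$-algebra anti-involution of $(\widehat{\mathbf B}^\imath_\tau,* )$ with $\overline{v^{1/2}}=v^{-1/2}$, $\overline{\vartheta_i}=\vartheta_i$, $\overline{h_\alpha}=v^{(\alpha,\tau\alpha)}h_\alpha$. Dual canonical basis of $\mathbf f$. Let $\mathbf C^{\mathrm{can}}$ be the Lusztig–Kashiwara canonical basis of $\mathbf f$, and $\{b^*\}$ its dual basis with respect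 to $\varphi|_{\mathbf f\times\mathbf f}$: $\varphi(b^*,b')=\delta_{b,b'}$. Put $\mathrm{ht}(\sum a_i\alpha_i)=\sum d_ia_i$, $\mathtt N(\alpha)=\frac12(\alpha,\alpha)-\mathrm{ht}(\alpha)$, and $\mathbf C=\{v^{\frac12\mathtt N(\mathrm{wt}(b))}b^*\mid b\in\mathbf C^{\mathrm{can}}\}$. Order. On $\mathbb N^{\mathbb I}\times\mathbf C$: $(\alpha,b)\prec(\beta,b')$ iff $\alpha+\tau\alpha+\mathrm{wt}(b)=\beta+\tau\beta+\mathrm{wt}(b')$ and $0\ne\beta-\alpha\in\mathbb N^{\mathbb I}$. *)

(* Defs.v *)
From HB Require Import structures.
From mathcomp Require Import all_boot all_order all_algebra.
From mathcomp Require Import generic_quotient fraction finmap.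
From mathcomp.multinomials Require Import monalg.
From mathcomp Require Import boolp classical_sets.
Set Implicit Arguments. Unset Strict Implicit. Unset Printing Implicit Defensive.
Import Order.TTheory GRing.Theory Num.Theory.
Local Open Scope ring_scope.
Local Open Scope quotient_scope.

Notation freeAlg K X := {malg K[{fmonom X}]}.

Section FreeAlgebra.
Variables (K : fieldType) (X : choiceType).
Local Notation Fr := (freeAlg K X).

Definition fgen (x : X) : Fr := << fmu x >>.

Definition feval (B : lalgType K) (g : X -> B) (p : Fr) : B :=
  \sum_(w <- msupp p) p@_w *: \prod_(x <- (w : seq X)) g x.

Lemma freeAlg_scalerAr (k : K) (x y : Fr) : k *: (x * y) = x * (k *: y).
Proof.
apply/malgP => w; rewrite [LHS]mcoeffZ [X in _ * X = _]mcoeffMl.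
rewrite (mcoeffMlw _ (fsubset_refl _) (msuppZ_le _ _)).
rewrite big_distrr; apply: eq_bigr => /= w1 _.
rewrite big_distrr; apply: eq_bigr => /= w2 _.
by rewrite mcoeffZ mulrCA mulrnAr.
Qed.

Lemma feval_mmap (B : lalgType K) (g : X -> B) (p : Fr) :
  feval g p = mmap (in_alg B) (fun w : {fmonom X} => \prod_(x <- (w : seq X)) g x) p.
Proof. by apply: eq_bigr => w _; rewrite mulr_algl. Qed.

Section Eval.
Variables (B : algType K) (g : X -> B).
Let h (w : {fmonom X}) := \prod_(x <- (w : seq X)) g x.
Let h_mm : mmorphism h.
Proof.
split; last by rewrite /h fm1 big_nil.
by move=> x y; rewrite /h fmM big_cat.
Qed.
HB.instance Definition _ := monalg.isMultiplicative.Build _ _ h h_mm.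

Lemma feval_gen x : feval g (fgen x) = g x.
Proof. by rewrite feval_mmap mmapU /= scale1r mul1r fmU big_seq1. Qed.

Lemma fevalM : {morph feval g : p r / p * r}.
Proof.
move=> p r; rewrite !feval_mmap.
have := @commr_mmap_is_multiplicative _ _ _ (in_alg B) h.
by move=> /(_ (fun p m m' => comm_alg _ _))[-> _].
Qed.

Lemma fevalB : {morph feval g : p r / p - r}.
Proof. by move=> p r; rewrite !feval_mmap mmapB. Qed.

Lemma feval_sum J (s : seq J) (Q : pred J) (F : J -> Fr) :
  feval g (\sum_(j <- s | Q j) F j) = \sum_(j <- s | Q j) feval g (F j).
Proof.
rewrite feval_mmap raddf_sum; apply: eq_bigr => j _.
by rewrite feval_mmap.
Qed.

Lemma fevalZ k p : feval g (k *: p) = k *: feval g p.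
Proof. by rewrite !feval_mmap (@mmapZ _ _ _ (in_alg B) h) mulr_algl. Qed.
End Eval.
End FreeAlgebra.

Arguments fgen K {X} x.

(* The evaluation [paug] kills the relations, so that the presented algebra is
   nonzero, as algType requires. *)
Record presentation (K : fieldType) (X : choiceType) := Presentation {
  prels : set (freeAlg K X);
  paug : X -> K;
  paugP : forall r, prels r -> feval (paug : X -> K^o) r = 0 }.

Section Presented.
Variables (K : fieldType) (X : choiceType) (P : presentation K X).
Local Notation Fr := (freeAlg K X).

Definition in_ideal (x : Fr) : Prop := exists s : seq (Fr * Fr * Fr),
  (forall t, t \in s -> prels P t.1.2) /\ x = \sum_(t <- s) t.1.1 * t.1.2 * t.2.

Definition ideal : {pred Fr} := [pred x | `[< in_ideal x >]].

Lemma in_idealD x y : in_ideal x -> in_ideal y -> in_ideal (x + y).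
Proof.
move=> [s [Ps ->]] [t [Pt ->]]; exists (s ++ t); split; last by rewrite big_cat.
by move=> u; rewrite mem_cat => /orP[/Ps|/Pt].
Qed.

Lemma in_idealM a b x : in_ideal x -> in_ideal (a * x * b).
Proof.
move=> [s [Ps ->]]; exists [seq (a * t.1.1, t.1.2, t.2 * b) | t <- s]; split.
  by move=> _ /mapP[t /Ps Pt ->].
have E (R : nzRingType) (c y1 y2 y3 e : R) : c * (y1 * y2 * y3) * e = c * y1 * y2 * (y3 * e).
  by rewrite !mulrA.
by rewrite big_map mulr_sumr mulr_suml; apply: eq_bigr => t _; apply: E.
Qed.

Lemma ideal_zmod_closed : zmod_closed ideal.
Proof.
split; first by apply/asboolP; exists [::]; rewrite big_nil.
move=> x y /asboolP Ix /asboolP Iy; apply/asboolP/in_idealD => //.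
by have := in_idealM (-1) 1 Iy; rewrite mulr1 mulN1r.
Qed.
HB.instance Definition _ := GRing.isZmodClosed.Build Fr ideal ideal_zmod_closed.

Lemma feval_ideal (B : algType K) (g : X -> B) x :
  (forall r, prels P r -> feval g r = 0) -> in_ideal x -> feval g x = 0.
Proof.
move=> g0 [s [Ps ->]]; rewrite feval_sum big_seq big1 // => t /Ps Pt.
by rewrite !fevalM (g0 _ Pt) mulr0 mul0r.
Qed.

Definition presAlg := Quotient.quot ideal.
HB.instance Definition _ := GRing.Zmodule.on presAlg.
HB.instance Definition _ := EqQuotient.on presAlg.

Definition ppi (x : Fr) : presAlg := \pi_presAlg x.
Definition prepr (a : presAlg) : Fr := repr a.

Lemma prepK : cancel prepr ppi.
Proof. exact: reprK. Qed.

Lemma ppi_eq x y : ppi x = ppi y <-> in_ideal (x - y).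
Proof.
rewrite /ppi; split=> [/eqP|I]; last apply/eqP; rewrite -Quotient.idealrBE.
  by move/asboolP.
exact/asboolP.
Qed.

Lemma ppiB : {morph ppi : x y / x - y}.
Proof. exact: raddfB. Qed.
Lemma ppiD : {morph ppi : x y / x + y}.
Proof. exact: raddfD. Qed.

Definition pone : presAlg := ppi 1.

(* Locked: comparing two products would otherwise unfold the product of
   {malg K[_]}, which is very slow. *)
Fact presAlg_key : unit. Proof. by []. Qed.
Definition pmul : presAlg -> presAlg -> presAlg :=
  locked_with presAlg_key (fun a b => ppi (prepr a * prepr b)).
Definition pscale : K -> presAlg -> presAlg :=
  locked_with presAlg_key (fun k a => ppi (k *: prepr a)).

Lemma prepr_ideal x : in_ideal (prepr (ppi x) - x).
Proof. by apply/ppi_eq; rewrite prepK. Qed.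

Lemma ppiM x y : pmul (ppi x) (ppi y) = ppi (x * y).
Proof.
rewrite /pmul unlock; apply/ppi_eq; set x' := prepr _; set y' := prepr _.
have -> : x' * y' - x * y = 1 * (x' - x) * y' + x * (y' - y) * 1.
  by rewrite mul1r mulr1 mulrBl mulrBr addrA subrK.
by apply: in_idealD; apply: in_idealM; apply: prepr_ideal.
Qed.

Lemma ppiZ k x : pscale k (ppi x) = ppi (k *: x).
Proof.
rewrite /pscale unlock; apply/ppi_eq; rewrite -scalerBr -mul_malgC -[_ * _]mulr1.
exact/in_idealM/prepr_ideal.
Qed.

Let rewr := (=^~ ppiD, ppiM, ppiZ).
Lemma pmulA : associative pmul.
Proof. by move=> a b c; rewrite -[a]prepK -[b]prepK -[c]prepK !rewr mulrA. Qed.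
Lemma pmul1 : left_id pone pmul.
Proof. by move=> a; rewrite -[a]prepK !rewr mul1r. Qed.
Lemma pmulr1 : right_id pone pmul.
Proof. by move=> a; rewrite -[a]prepK !rewr mulr1. Qed.
Lemma pmulDl : left_distributive pmul +%R.
Proof. by move=> a b c; rewrite -[a]prepK -[b]prepK -[c]prepK !rewr mulrDl. Qed.
Lemma pmulDr : right_distributive pmul +%R.
Proof. by move=> a b c; rewrite -[a]prepK -[b]prepK -[c]prepK !rewr mulrDr. Qed.
Lemma pone_neq0 : pone != 0.
Proof.
apply/eqP => /(congr1 (fun a => a - 0)); rewrite subrr subr0.
have <- : ppi 0 = 0 :> presAlg by rewrite -[X in ppi X](subrr 0) ppiB subrr.
move/ppi_eq; rewrite subr0 => /(feval_ideal (@paugP _ _ P)); rewrite feval_mmap.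
rewrite -mpolyC1E mmapU /= scale1r mul1r fm1 big_nil => /eqP.
by rewrite oner_eq0.
Qed.
HB.instance Definition _ := GRing.Zmodule_isNzRing.Build presAlg
  pmulA pmul1 pmulr1 pmulDl pmulDr pone_neq0.

Lemma pscaleA k l (a : presAlg) : pscale k (pscale l a) = pscale (k * l) a.
Proof. by rewrite -[a]prepK !rewr scalerA. Qed.
Lemma pscale1 : left_id 1 pscale.
Proof. by move=> a; rewrite -[a]prepK !rewr scale1r. Qed.
Lemma pscaleDr : right_distributive pscale +%R.
Proof. by move=> k a b; rewrite -[a]prepK -[b]prepK !rewr scalerDr. Qed.
Lemma pscaleDl (a : presAlg) : {morph pscale^~ a : k l / k + l}.
Proof. by move=> k l; rewrite -[a]prepK !rewr scalerDl. Qed.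
HB.instance Definition _ := GRing.Zmodule_isLmodule.Build K presAlg
  pscaleA pscale1 pscaleDr pscaleDl.

Lemma pscaleAl (k : K) (a b : presAlg) : k *: (a * b) = (k *: a) * b.
Proof.
by rewrite -[a]prepK -[b]prepK /GRing.scale /GRing.mul /= !rewr scalerAl.
Qed.
HB.instance Definition _ := GRing.Lmodule_isLalgebra.Build K presAlg pscaleAl.

Lemma pscaleAr (k : K) (a b : presAlg) : k *: (a * b) = a * (k *: b).
Proof.
by rewrite -[a]prepK -[b]prepK /GRing.scale /GRing.mul /= !rewr freeAlg_scalerAr.
Qed.
HB.instance Definition _ := GRing.Lalgebra_isAlgebra.Build K presAlg pscaleAr.

Definition pgen (x : X) : presAlg := ppi (fgen K x).

(* The homomorphism with [pgen x |-> g x], when the [g x] satisfy the relations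
   (see [pevalE]): any representative gives the same value. *)
Definition peval (B : lalgType K) (g : X -> B) (a : presAlg) : B :=
  feval g (prepr a).

Lemma pevalE (B : algType K) (g : X -> B) (x : Fr) :
  (forall r, prels P r -> feval g r = 0) -> peval g (ppi x) = feval g x.
Proof.
move=> g0; apply/eqP; rewrite -subr_eq0 -fevalB.
by rewrite (feval_ideal g0 (prepr_ideal x)).
Qed.

End Presented.

Section Grading.
Variables (I : finType) (K : fieldType) (X : choiceType) (P : presentation K X).
Variable deg : X -> {ffun I -> nat}.

Definition homog (a : {ffun I -> nat}) (x : presAlg P) : Prop :=
  exists p : freeAlg K X, ppi P p = x /\
    forall w, w \in msupp p -> \sum_(y <- (w : seq X)) deg y = a.

(* Meaningful for nonzero homogeneous elements only. *)
Definition weight (x : presAlg P) : {ffun I -> nat} :=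
  xget 0 [set a | homog a x].

End Grading.

Section LinearAlgebra.
Variables (K : fieldType) (V : lmodType K).

Definition lincomb (A : set K) (S : set V) : set V :=
  [set x | exists s : seq (K * V),
    (forall t, t \in s -> A t.1 /\ S t.2) /\ x = \sum_(t <- s) t.1 *: t.2].

Definition lin_indep (J : choiceType) (D : set J) (F : J -> V) : Prop :=
  forall (s : seq J) (k : J -> K), uniq s -> (forall j, j \in s -> D j) ->
    \sum_(j <- s) k j *: F j = 0 -> forall j, j \in s -> k j = 0.

Definition is_basis (J : choiceType) (D : set J) (F : J -> V) : Prop :=
  lin_indep D F /\ forall x, lincomb setT (F @` D) x.

End LinearAlgebra.

(* Here and below q stands for v^(1/2); it is specialized to the generator of
   Q(v^(1/2)) at the end of the file. *)
Section Scalars.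
Variables (Kv : fieldType) (q : Kv).
Definition v : Kv := q ^+ 2.

(* The set Z[v, v^-1]. *)
Definition laurentZ : set Kv :=
  [set c | exists (p : {poly int}) (n : nat), c = (map_poly intr p).[v] * v ^- n].

(* The set v^-1 Z[v^-1]. *)
Definition vinvZ : set Kv :=
  [set c | exists p : {poly int}, c = v^-1 * (map_poly intr p).[v^-1]].

(* The elements of Q(v) regular at v = oo. *)
Definition regular_oo : set Kv :=
  [set c | exists n d : {poly rat}, [/\ d != 0, (size n <= size d)%N
    & c = (map_poly ratr n).[v] / (map_poly ratr d).[v]]].

End Scalars.

Section QuantumIntegers.
Variable Kv : fieldType.

Definition qint (u : Kv) (k : nat) : Kv := (u ^+ k - u ^- k) / (u - u^-1).
Definition qfact (u : Kv) (n : nat) : Kv := \prod_(1 <= k < n.+1) qint u k.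

Definition divpow (A : lalgType Kv) (u : Kv) (x : A) (n : nat) : A :=
  (qfact u n)^-1 *: x ^+ n.

End QuantumIntegers.

Section CartanDatum.
Variables (Kv : fieldType) (q : Kv).
Local Notation v := (v q).
Variables (I : finType) (C : I -> I -> int) (d : I -> nat) (tau : I -> I).

Definition Nroot := {ffun I -> nat}.
Definition Zroot := {ffun I -> int}.

Definition sroot (i : I) : Nroot := [ffun j => (j == i : nat)].
Definition NZ (a : Nroot) : Zroot := [ffun i => (a i)%:Z].

Definition zform (a b : Zroot) : int :=
  \sum_i \sum_j a i * b j * ((d i)%:Z * C i j).

Definition nform (a b : Nroot) : int := zform (NZ a) (NZ b).

(* [tau] is an involution, so (tau a)_i = a_(tau i). *)
Definition tauN (a : Nroot) : Nroot := [ffun i => a (tau i)].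

Definition ht (a : Nroot) : int := \sum_i (d i)%:Z * (a i)%:Z.

(* (a, a) is even. *)
Definition Nfun (a : Nroot) : int := (nform a a %/ 2)%Z - ht a.

Record finite_cartan : Prop := FiniteCartan {
  cartan_diag : forall i, C i i = 2;
  cartan_offdiag : forall i j, i != j -> C i j <= 0;
  cartan_zero : forall i j, C i j = 0 -> C j i = 0;
  cartan_dpos : forall i, (0 < d i)%N;
  cartan_sym : forall i j, (d i)%:Z * C i j = (d j)%:Z * C j i;
  cartan_posdef : forall a : Zroot, a != 0 -> 0 < zform a a }.

Record diagram_involution : Prop := DiagramInvolution {
  tauK : involutive tau;
  tau_cartan : forall i j, C (tau i) (tau j) = C i j;
  tau_d : forall i, d (tau i) = d i }.

Definition vi (i : I) : Kv := v ^+ d i.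

Definition serre (A : lalgType Kv) (x : I -> A) (i j : I) : A :=
  let n := absz (1 - C i j) in
  \sum_(k < n.+1)
    (-1) ^+ k *: (divpow (vi i) (x i) k * x j * divpow (vi i) (x i) (n - k)).

Lemma serre_eval0 (X : choiceType) (x : I -> X) (g : X -> Kv^o) i j :
  g (x j) = 0 -> feval g (serre (fun i => fgen Kv (x i)) i j) = 0.
Proof.
move=> g0; rewrite /serre feval_sum big1 // => k _.
by rewrite fevalZ !fevalM feval_gen g0 mulr0 mul0r scaler0.
Qed.

Definition f_rels : set (freeAlg Kv I) :=
  [set r | exists i j, i != j /\ r = serre (fgen Kv) i j].

Lemma f_augP r : f_rels r -> feval ((fun _ => 0) : I -> Kv^o) r = 0.
Proof. by move=> [i [j [_ ->]]]; apply: serre_eval0. Qed.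

Definition f_pres : presentation Kv I := Presentation f_augP.
Definition fAlg := presAlg f_pres.
HB.instance Definition _ := GRing.Algebra.on fAlg.

Definition ftheta (i : I) : fAlg := pgen f_pres i.

Definition B_relations (A : lalgType Kv) (t h : I -> A) : set A :=
  [set r | [\/ exists i j, i != j /\ r = serre t i j,
    exists i j, r = h i * h j - h j * h i
  | exists i j, r = h i * t j - vi i ^ C i j *: (t j * h i)]].

Lemma B_relations_eval0 (X : choiceType) (t h : I -> X) (g : X -> Kv^o) r :
  (forall i, g (t i) = 0) ->
  B_relations (fun i => fgen Kv (t i)) (fun i => fgen Kv (h i)) r ->
  feval g r = 0.
Proof.
move=> g0 [[i [j [_ ->]]]|[i [j ->]]|[i [j ->]]]; first exact: serre_eval0.
  by rewrite fevalB [X in X - _]fevalM [X in _ - X]fevalM !feval_gen mulrC subrr.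
rewrite fevalB fevalZ [X in X - _]fevalM [X in _ - _ *: X]fevalM.
by rewrite !feval_gen g0 mulr0 mul0r scaler0 subrr.
Qed.

(* [inl i] stands for vartheta_i and [inr i] for h_i. *)
Definition Bgen : choiceType := (I + I)%type.

Definition B_rels : set (freeAlg Kv Bgen) :=
  B_relations (fun i => fgen Kv (inl i : Bgen)) (fun i => fgen Kv (inr i : Bgen)).

Definition B_aug (x : Bgen) : Kv := if x is inl _ then 0 else 1.

Lemma B_augP r : B_rels r -> feval (B_aug : Bgen -> Kv^o) r = 0.
Proof. exact: B_relations_eval0. Qed.

Definition B_pres : presentation Kv Bgen := Presentation B_augP.
Definition Bhat := presAlg B_pres.
HB.instance Definition _ := GRing.Algebra.on Bhat.

Definition theta (i : I) : Bhat := pgen B_pres (inl i).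
Definition hh (i : I) : Bhat := pgen B_pres (inr i).

Definition hroot (a : Nroot) : Bhat := \prod_i hh i ^+ a i.

Definition deg_f (i : I) : Nroot := sroot i.

(* The grading of the iHopf algebra, in which h_i has weight i + tau i. *)
Definition deg_B (x : Bgen) : Nroot :=
  match x with inl i => sroot i | inr i => sroot i + sroot (tau i) end.

Definition wt_f (x : fAlg) : Nroot := weight deg_f x.
Definition wt_B (x : Bhat) : Nroot := weight deg_B x.

Definition iotaB (x : fAlg) : Bhat := peval theta x.

Definition tauB (x : Bhat) : Bhat :=
  peval (fun y : Bgen => match y with
    inl i => theta (tau i) | inr i => hh (tau i) end) x.

Definition counit (x : Bhat) : Kv := peval (B_aug : Bgen -> Kv^o) x.

(* A list of pairs (a_1, a_2) stands for the tensor \sum a_1 (x) a_2. The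
   coproduct is the algebra homomorphism given on the generators by [coprod_gen];
   [coprod] is computed on a representative in the free algebra, and another
   representative would give a list standing for the same tensor. *)
Definition coprod_gen (x : Bgen) : seq (Bhat * Bhat) :=
  match x with
  | inl i => [:: (theta i, 1); (hh i, theta i)]
  | inr i => [:: (hh i, hh i)]
  end.

Definition coprod_word (w : seq Bgen) : seq (Bhat * Bhat) :=
  foldr (fun x s => [seq (t.1 * u.1, t.2 * u.2) | t <- coprod_gen x, u <- s])
    [:: (1, 1)] w.

Definition coprod (a : Bhat) : seq (Bhat * Bhat) :=
  flatten [seq [seq ((prepr a)@_w *: t.1, t.2) | t <- coprod_word w]
    | w <- msupp (prepr a)].

Record hopf_pairing (phi : Bhat -> Bhat -> Kv) : Prop := HopfPairing {
  phi_linl : forall k a b c, phi (k *: a + b) c = k * phi a c + phi b c;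
  phi_linr : forall k a b c, phi a (k *: b + c) = k * phi a b + phi a c;
  phi_sym : forall a b, phi a b = phi b a;
  phi_unit : forall a, phi 1 a = counit a;
  phi_mull : forall a b c,
    phi (a * b) c = \sum_(t <- coprod c) phi a t.1 * phi b t.2;
  phi_mulr : forall a b c,
    phi a (b * c) = \sum_(t <- coprod a) phi t.1 b * phi t.2 c;
  phi_theta : forall i j,
    phi (theta i) (theta j) = if i == j then vi i - (vi i)^-1 else 0;
  phi_h : forall i j, phi (hh i) (hh j) = vi i ^ C i j;
  phi_theta_h : forall i j, phi (theta i) (hh j) = 0 }.

(* The product of the iHopf algebra, which has Bhat as underlying space; [*]
   remains the product of the bialgebra. *)
Definition star (phi : Bhat -> Bhat -> Kv) (a b : Bhat) : Bhat :=
  \sum_(s <- coprod a) \sum_(t <- coprod b)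
    phi (tauB t.2) s.1 *: (s.2 * t.1).

Record bar_involution (phi : Bhat -> Bhat -> Kv) (bar : Bhat -> Bhat) : Prop :=
  BarInvolution {
  bar_add : forall a b, bar (a + b) = bar a + bar b;
  bar_vhalf : forall a, bar (q *: a) = q^-1 *: bar a;
  bar_star : forall a b, bar (star phi a b) = star phi (bar b) (bar a);
  bar_bar : involutive bar;
  bar_theta : forall i, bar (theta i) = theta i;
  bar_h : forall a, bar (hroot a) = v ^ nform a (tauN a) *: hroot a }.

(* h_a <> x, for x homogeneous; v^(m/2) is q ^ m. *)
Definition hdia (phi : Bhat -> Bhat -> Kv) (a : Nroot) (x : Bhat) : Bhat :=
  q ^ zform (NZ (tauN a) - NZ a) (NZ (wt_B x)) *: star phi (hroot a) x.

(* K_a <> x, where K_a = v^((a, tau a)/2) h_(tau a). *)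
Definition Kdia (phi : Bhat -> Bhat -> Kv) (a : Nroot) (x : Bhat) : Bhat :=
  q ^ nform a (tauN a) *: hdia phi (tauN a) x.

(* Lusztig's generators theta_i and their divided powers. *)
Definition ltheta (i : I) : fAlg := (vi i - (vi i)^-1)^-1 *: ftheta i.
Definition ldp (i : I) (n : nat) : fAlg := divpow (vi i) (ltheta i) n.

(* The Z[v, v^-1]-subalgebra generated by the divided powers. *)
Definition f_integral : set fAlg :=
  lincomb (laurentZ q) (range (fun s : seq (I * nat) => \prod_(u <- s) ldp u.1 u.2)).

Record bar_f (psi : fAlg -> fAlg) : Prop := BarF {
  bar_f_add : forall x y, psi (x + y) = psi x + psi y;
  bar_f_vhalf : forall x, psi (q *: x) = q^-1 *: psi x;
  bar_f_mul : forall x y, psi (x * y) = psi x * psi y;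
  bar_f_one : psi 1 = 1;
  bar_f_theta : forall i, psi (ltheta i) = ltheta i }.

(* Lusztig's skew derivation _i r, which is Kashiwara's e'_i. *)
Record skew_derivation (i : I) (D : fAlg -> fAlg) : Prop := SkewDerivation {
  skew_lin : forall k x y, D (k *: x + y) = k *: D x + D y;
  skew_one : D 1 = 0;
  skew_theta : forall j, D (ltheta j) = (i == j)%:R;
  skew_mul : forall a x y, homog deg_f a x ->
    D (x * y) = D x * y + v ^ nform (sroot i) a *: (x * D y) }.

(* y = f~_i x: if x = \sum theta_i^(n) x_n with e'_i x_n = 0, then
   f~_i x = \sum theta_i^(n+1) x_n. *)
Definition kashiwara_f (i : I) (x y : fAlg) : Prop :=
  exists (D : fAlg -> fAlg) (s : seq (nat * fAlg)),
    [/\ skew_derivation i D, forall t, t \in s -> D t.2 = 0,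
      x = \sum_(t <- s) ldp i t.1 * t.2
    & y = \sum_(t <- s) ldp i t.1.+1 * t.2].

(* The elements f~_(i_1) ... f~_(i_k) 1. *)
Inductive crystal_elt : fAlg -> Prop :=
| crystal_one : crystal_elt 1
| crystal_f i x y : crystal_elt x -> kashiwara_f i x y -> crystal_elt y.

(* The crystal lattice L(oo), at v = oo; B(oo) is the image of [crystal_elt] in
   L(oo) / v^-1 L(oo). *)
Definition crystal_lattice : set fAlg := lincomb (regular_oo q) crystal_elt.

Definition crystal_congr (x y : fAlg) : Prop :=
  exists2 z, crystal_lattice z & x - y = v^-1 *: z.

(* The Lusztig-Kashiwara canonical (lower global crystal) basis. *)
Record canonical_basis (B : set fAlg) : Prop := CanonicalBasis {
  can_basis : is_basis B id;
  can_integral : f_integral = lincomb (laurentZ q) B;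
  can_bar : exists2 psi, bar_f psi & forall b, B b -> psi b = b;
  can_lattice : crystal_lattice = lincomb (regular_oo q) B;
  can_crystal : forall b, B b -> exists2 x, crystal_elt x & crystal_congr b x;
  can_crystal_surj : forall x, crystal_elt x -> exists2 b, B b & crystal_congr b x }.

Definition dual_elt (phi : Bhat -> Bhat -> Kv) (B : set fAlg) (b y : fAlg) : Prop :=
  forall b', B b' -> phi (iotaB y) (iotaB b') = (b == b')%:R.

(* The rescaled dual basis { v^(N(wt b)/2) b^* }. *)
Definition dual_can (phi : Bhat -> Bhat -> Kv) (B : set fAlg) : set fAlg :=
  [set x | exists b y, [/\ B b, dual_elt phi B b y & x = q ^ Nfun (wt_f b) *: y]].

Definition prec (x y : Nroot * fAlg) : Prop :=
  [/\ x.1 + tauN x.1 + wt_f x.2 = y.1 + tauN y.1 + wt_f y.2,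
    x.1 != y.1 & forall i, (x.1 i <= y.1 i)%N].

(* The element x is bar-invariant and lies in
   K_a <> b + \sum v^-1 Z[v^-1] K_a' <> b', over the (a', b') above (a, b). *)
Definition dual_canonical (phi : Bhat -> Bhat -> Kv) (bar : Bhat -> Bhat)
    (Cb : set fAlg) (a : Nroot) (b : fAlg) (x : Bhat) : Prop :=
  bar x = x /\
  lincomb (vinvZ q)
    [set Kdia phi u.1 (iotaB u.2) | u in [set u | Cb u.2 /\ prec (a, b) u]]
    (x - Kdia phi a (iotaB b)).

End CartanDatum.

(* Q(v^(1/2)), where the variable of the polynomial ring is v^(1/2). *)
Definition Qvhalf : fieldType := {fraction {poly rat}}.
Definition vhalf : Qvhalf := tofrac 'X.

(* Main.v *)
Require Import Defs.
From HB Require Import structures.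
From mathcomp Require Import all_boot all_order all_algebra.
From mathcomp Require Import generic_quotient fraction finmap ring zify.
From mathcomp.multinomials Require Import monalg.
From mathcomp Require Import boolp classical_sets.
Set Implicit Arguments. Unset Strict Implicit. Unset Printing Implicit Defensive.
Import Order.TTheory GRing.Theory Num.Theory.
Local Open Scope ring_scope.
Local Open Scope classical_set_scope.

(** The bar involution is unitriangular with respect to the basis of the K_a <> b, and the
    theorem is the Kazhdan-Lusztig lemma for unitriangular semilinear involutions whose
    coefficients lie in Z[v, v^-1]; since K_a <> - commutes with the bar involution,
    C_(a,b) = K_a <> C_(0,b).

    For y in f one has bar (iota y) = \sum_a iota (S_a (rho y)) h_a, where S_a is the sum,
    over the canonical basis elements b of weight a, of the adjoint of left multiplication by
    tau b^* composed with the adjoint of right multiplication by b; this follows by induction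
    from the formulas for the products of the iHopf algebra with vartheta_i and h_i. The map
    rho satisfies <rho y, psi z> = v^(N(wt y)) conj <y, z>, psi being Lusztig's bar involution,
    hence fixes the rescaled dual canonical basis. The coefficients are Laurent polynomials
    because the dual basis b^* belongs to the integral form: the lattice dual to the integral
    form pairs with itself into Z[v, v^-1], which reduces to rank one by splitting off
    highest weight vectors. *)

(** * Graded algebras given by a presentation *)

(** The form and the canonical basis are known only through their axioms, so the usual facts about
    them have to be derived. A vector of nonzero weight killed by all skew derivations has positive
    weight for some simple coroot, by positive definiteness; in an integrable rank-one module a
    vector of positive weight that cannot be lowered is 0, and integrability comes from the Serre
    relations. This gives nondegeneracy. The rank-one identity used is an alternating sum of raising
    and lowering divided powers whose coefficients have no weight-dependent denominators, unlike the
    extremal projector; hence it also serves for integrality. Integrality of $b^*$ cannot be avoided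
    because the coefficients of the bar involution contain $b$ and $b^*$ together. The rescaling by
    $v^{\mathtt N/2}$ is forced twice: it makes the dual basis fixed by [rho], and since $\mathtt
    N(\alpha+\beta)=\mathtt N(\alpha)+\mathtt N(\beta)+(\alpha,\beta)$ it cancels the half powers of
    $v$ in the coefficients, leaving $v^{\mathtt N(a)}$ times the pairing of an integral element
    with an element of the dual lattice. *)

Section PresentedAlgebra.
Variables (K : fieldType) (X : choiceType) (P : presentation K X).
Local Notation Fr := (freeAlg K X).
Local Notation A := (presAlg P).

Lemma ppi_mul (x y : Fr) : ppi P (x * y) = ppi P x * ppi P y.
Proof. by rewrite -ppiM. Qed.
Lemma ppi_scale k (x : Fr) : ppi P (k *: x) = k *: ppi P x.
Proof. by rewrite -ppiZ. Qed.
Lemma ppi_one : ppi P 1 = 1. Proof. by []. Qed.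
Lemma ppi0 : ppi P 0 = 0.
Proof. by rewrite -[X in ppi P X](subrr 0) ppiB subrr. Qed.

Lemma ppi_sum J (s : seq J) (Q : pred J) (F : J -> Fr) :
  ppi P (\sum_(j <- s | Q j) F j) = \sum_(j <- s | Q j) ppi P (F j).
Proof. by apply: (big_morph _ (ppiD P)); apply: ppi0. Qed.

Lemma ppi_rel r : prels P r -> ppi P r = 0.
Proof.
move=> Pr; rewrite -ppi0; apply/ppi_eq; rewrite subr0.
exists [:: (1, r, 1)]; rewrite big_seq1 /= mul1r mulr1; split=> // t.
by rewrite inE => /eqP ->.
Qed.

Definition fword (s : seq X) : A := \prod_(x <- s) pgen P x.

Lemma fmonomU_mul (w w' : {fmonom X}) :
  << w >> * << w' >> = << (mmul w w') >> :> Fr.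
Proof. by rewrite malgM_def fgmulUU mulr1. Qed.

Lemma fword_ppi (w : {fmonom X}) : ppi P << w >> = fword w.
Proof.
case: w => s; rewrite /fword /=; elim: s => [|x s IH].
  rewrite big_nil -ppi_one; congr (ppi P << _ >>).
  by apply: val_inj; rewrite /= fm1.
have -> : FMonom (x :: s) = mmul (fmu x) (FMonom s).
  by apply: val_inj; rewrite /= fmM fmU.
by rewrite -fmonomU_mul ppi_mul IH big_cons.
Qed.

Lemma malg_sumZ (p : Fr) : p = \sum_(w <- msupp p) p@_w *: << w >>.
Proof.
rewrite {1}[p]monalgE; apply: eq_bigr => w _.
by rewrite -mul_malgC malgM_def fgmulUU mul1m !mulr1.
Qed.

Lemma pres_ind (Q : A -> Prop) :
  (forall s, Q (fword s)) -> (forall k a, Q a -> Q (k *: a)) ->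
  (forall a b, Q a -> Q b -> Q (a + b)) -> forall a, Q a.
Proof.
move=> Qw QZ QD a; rewrite -[a]prepK [prepr a]malg_sumZ ppi_sum.
apply: big_ind => //; last by move=> w _; rewrite ppi_scale fword_ppi; apply/QZ/Qw.
by rewrite -(scale0r (fword [::])); apply: QZ.
Qed.

(** Two linear maps obeying the same rule for multiplication by a generator are shown equal by this
    induction; words span, so nothing is checked against the relations. *)
Lemma pres_indl (Q : A -> Prop) :
  Q 1 -> (forall k a, Q a -> Q (k *: a)) -> (forall a b, Q a -> Q b -> Q (a + b)) ->
  (forall x a, Q a -> Q (pgen P x * a)) -> forall a, Q a.
Proof.
move=> Q1 QZ QD QM; apply: pres_ind => // s.
by elim: s => [|x s IH]; rewrite /fword ?big_nil ?big_cons //; apply: QM.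
Qed.

Lemma pres_indr (Q : A -> Prop) :
  Q 1 -> (forall k a, Q a -> Q (k *: a)) -> (forall a b, Q a -> Q b -> Q (a + b)) ->
  (forall x a, Q a -> Q (a * pgen P x)) -> forall a, Q a.
Proof.
move=> Q1 QZ QD QM; apply: pres_ind => // s.
elim/last_ind: s => [|s x IH]; rewrite /fword ?big_nil // -cats1 big_cat big_seq1.
exact: QM.
Qed.

Section Hom.
Variables (B : algType K) (g : X -> B).
Hypothesis g0 : forall r, prels P r -> feval g r = 0.
Local Notation f := (peval g).

Lemma peval1 : f (1 : A) = 1.
Proof.
rewrite -ppi_one pevalE // feval_mmap -mpolyC1E mmapU /= scale1r mul1r.
by rewrite fm1 big_nil.
Qed.
Lemma pevalM (a b : A) : f (a * b) = f a * f b.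
Proof. by rewrite -[a]prepK -[b]prepK -ppi_mul !pevalE // fevalM. Qed.
Lemma pevalB (a b : A) : f (a - b) = f a - f b.
Proof. by rewrite -[a]prepK -[b]prepK -ppiB !pevalE // fevalB. Qed.
Lemma pevalZ k (a : A) : f (k *: a) = k *: f a.
Proof. by rewrite -[a]prepK -ppi_scale !pevalE // fevalZ. Qed.
Lemma peval0 : f (0 : A) = 0.
Proof. by rewrite -(subrr 0) pevalB subrr. Qed.
Lemma pevalN (a : A) : f (- a) = - f a.
Proof. by rewrite -sub0r pevalB peval0 sub0r. Qed.
Lemma pevalD (a b : A) : f (a + b) = f a + f b.
Proof. by rewrite -{1}[b]opprK pevalB pevalN opprK. Qed.
Lemma peval_gen x : f (pgen P x) = g x.
Proof. by rewrite pevalE // feval_gen. Qed.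
Lemma peval_sum J (s : seq J) (Q : pred J) (F : J -> A) :
  f (\sum_(j <- s | Q j) F j) = \sum_(j <- s | Q j) f (F j).
Proof. by apply: (big_morph _ pevalD peval0). Qed.
Lemma peval_exp (a : A) n : f (a ^+ n) = f a ^+ n.
Proof. by elim: n => [|n IH]; rewrite ?expr0 ?peval1 // !exprS pevalM IH. Qed.
End Hom.

End PresentedAlgebra.

(** * Gradings of an algebra with homogeneous relations *)

Section GradedPresentation.
Variables (I : finType) (K : fieldType) (X : choiceType) (P : presentation K X).
Variable deg : X -> {ffun I -> nat}.
Local Notation Fr := (freeAlg K X).
Local Notation A := (presAlg P).
Local Notation N := {ffun I -> nat}.
Implicit Types (a b : N) (p r : Fr) (x y : A).

Definition wdeg (w : {fmonom X}) : N := \sum_(y <- (w : seq X)) deg y.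
Definition fhomog a p := forall w, w \in msupp p -> wdeg w = a.

Lemma fhomog0 a : fhomog a 0.
Proof. by move=> w; rewrite msupp0 inE. Qed.
Lemma fhomogD a p r : fhomog a p -> fhomog a r -> fhomog a (p + r).
Proof. by move=> hp hr w /(fsubsetP (msuppD_le _ _)); rewrite inE => /orP[/hp|/hr]. Qed.
Lemma fhomogN a p : fhomog a p -> fhomog a (- p).
Proof. by move=> hp w; rewrite msuppN; apply: hp. Qed.
Lemma fhomogZ a k p : fhomog a p -> fhomog a (k *: p).
Proof. by move=> hp w /(fsubsetP (msuppZ_le _ _)); apply: hp. Qed.
Lemma fhomog_sum a J (s : seq J) (Q : pred J) (F : J -> Fr) :
  (forall j, Q j -> fhomog a (F j)) -> fhomog a (\sum_(j <- s | Q j) F j).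
Proof. by move=> h; apply: big_ind => //; [exact: fhomog0 | exact: fhomogD]. Qed.
Lemma wdegM (w w' : {fmonom X}) : wdeg (mmul w w') = wdeg w + wdeg w'.
Proof. by rewrite /wdeg fmM big_cat. Qed.
Lemma fhomogM a b p r : fhomog a p -> fhomog b r -> fhomog (a + b) (p * r).
Proof.
move=> hp hr w /msuppM_le[w1 [w2 [/hp <- /hr <- ->]]].
exact: wdegM.
Qed.
Lemma fhomog_mono w : fhomog (wdeg w) << w >>.
Proof. by move=> w'; rewrite msuppU1 inE => /eqP ->. Qed.
Lemma fhomog_gen (z : X) : fhomog (deg z) (fgen K z).
Proof.
have -> : deg z = wdeg (fmu z) by rewrite /wdeg fmU big_seq1.
exact: fhomog_mono.
Qed.
Lemma fhomog1 : fhomog 0 1.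
Proof.
have -> : (0 : N) = wdeg mone by rewrite /wdeg fm1 big_nil.
exact: fhomog_mono.
Qed.
Lemma fhomogX a p n : fhomog a p -> fhomog (a *+ n) (p ^+ n).
Proof.
move=> hp; elim: n => [|n IH]; rewrite ?expr0 ?mulr0n; first exact: fhomog1.
by rewrite exprS mulrS; apply: fhomogM.
Qed.

Definition fproj a p : Fr := \sum_(w <- msupp p | wdeg w == a) p@_w *: << w >>.

Lemma fproj_coef a p w : (fproj a p)@_w = if wdeg w == a then p@_w else 0.
Proof.
rewrite /fproj (big_morph _ (mcoeffD w) (mcoeff0 w)).
have E w' : (p@_w' *: << w' >>)@_w = if w' == w then p@_w else 0.
  by rewrite mcoeffZ mcoeffU1; case: eqP => [->|_]; rewrite ?mulr1 ?mulr0.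
under eq_bigr => w' _ do rewrite E.
case: (boolP (w \in msupp p)) => [wp|wp]; last first.
  rewrite (mcoeff_outdom wp) if_same big1 // => w' _; by case: ifP.
rewrite big_mkcond (bigD1_seq w) //= eqxx big1 ?addr0 //.
by move=> w' /negbTE ->; rewrite if_same.
Qed.

Lemma fprojD a p r : fproj a (p + r) = fproj a p + fproj a r.
Proof.
apply/malgP => w; rewrite [RHS]mcoeffD !fproj_coef [(p + r)@_w]mcoeffD.
by case: (wdeg w == a); [apply: erefl | rewrite addr0].
Qed.
Lemma fprojZ a k p : fproj a (k *: p) = k *: fproj a p.
Proof.
apply/malgP => w; rewrite [RHS]mcoeffZ !fproj_coef [(k *: p)@_w]mcoeffZ.
by case: (wdeg w == a); [apply: erefl | rewrite mulr0].
Qed.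
Lemma fproj_sum a J (s : seq J) (Q : pred J) (F : J -> Fr) :
  fproj a (\sum_(j <- s | Q j) F j) = \sum_(j <- s | Q j) fproj a (F j).
Proof.
apply: (big_morph _ (fprojD a)).
by rewrite -(scale0r 0) fprojZ !scale0r.
Qed.
Lemma fproj_homog a b p : fhomog b p -> fproj a p = if b == a then p else 0.
Proof.
move=> hp; apply/malgP => w; rewrite fproj_coef.
case: (boolP (w \in msupp p)) => [/hp ->|wp]; first by case: ifP; rewrite ?mcoeff0.
by rewrite !(mcoeff_outdom wp); do !case: ifP; rewrite ?mcoeff0 // (mcoeff_outdom wp).
Qed.
Lemma fhomog_fproj a p : fhomog a (fproj a p).
Proof.
move=> w; rewrite -mcoeff_neq0 fproj_coef; case: (wdeg w =P a) => // _.
by rewrite eqxx.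
Qed.

Hypothesis rel_homog : forall r, prels P r -> exists a, fhomog a r.

Lemma in_ideal_sum J (s : seq J) (F : J -> Fr) :
  (forall j, in_ideal P (F j)) -> in_ideal P (\sum_(j <- s) F j).
Proof.
move=> h; apply: big_ind => //; last exact: in_idealD.
by exists [::]; rewrite big_nil.
Qed.

Lemma mulr_suml_sumr (R : nzRingType) J J' (s : seq J) (t : seq J') (f : J -> R) (g : J' -> R) (r : R) :
  (\sum_(j <- s) f j) * r * (\sum_(k <- t) g k) =
  \sum_(j <- s) \sum_(k <- t) f j * r * g k.
Proof.
by rewrite !mulr_suml; apply: eq_bigr => j _; rewrite mulr_sumr.
Qed.

(** After $y$ and $z$ are expanded into monomials every summand is homogeneous, so its component is
    itself or 0, and both lie in the ideal. *)
Lemma in_ideal_fprojM a (y r z : Fr) : prels P r -> in_ideal P (fproj a (y * r * z)).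
Proof.
move=> Pr; have [b hb] := rel_homog Pr.
have -> : y * r * z = \sum_(w <- msupp y) \sum_(w' <- msupp z)
    (y@_w *: << w >>) * r * (z@_w' *: << w' >>).
  by rewrite {1}[y]malg_sumZ {1}[z]malg_sumZ; apply: mulr_suml_sumr.
rewrite fproj_sum; apply: in_ideal_sum => w; rewrite fproj_sum.
apply: in_ideal_sum => w'; set p1 := _ *: _; set p2 := _ *: _.
have hw : fhomog (wdeg w + b + wdeg w') (p1 * r * p2).
  by apply: fhomogM; [apply: fhomogM => //|]; apply/fhomogZ/fhomog_mono.
rewrite (fproj_homog _ hw); case: ifP => _; last by exists [::]; rewrite big_nil.
exists [:: (p1, r, p2)]; rewrite big_seq1; split=> // t.
by rewrite inE => /eqP ->.
Qed.

Lemma in_ideal_fproj a p : in_ideal P p -> in_ideal P (fproj a p).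
Proof.
move=> [s [Ps ->]]; rewrite fproj_sum big_seq; apply: big_ind.
- by exists [::]; rewrite big_nil.
- exact: in_idealD.
by move=> t /Ps Pr; apply: in_ideal_fprojM.
Qed.

Definition gproj a x : A := ppi P (fproj a (prepr x)).

Lemma gproj_ppi a p : gproj a (ppi P p) = ppi P (fproj a p).
Proof.
apply/ppi_eq; have := in_ideal_fproj a (prepr_ideal P p).
by rewrite fprojD -scaleN1r fprojZ scaleN1r.
Qed.

Lemma gprojD a x y : gproj a (x + y) = gproj a x + gproj a y.
Proof. by rewrite -[x]prepK -[y]prepK -ppiD !gproj_ppi fprojD ppiD. Qed.
Lemma gprojZ a k x : gproj a (k *: x) = k *: gproj a x.
Proof. by rewrite -[x]prepK -ppi_scale !gproj_ppi fprojZ ppi_scale. Qed.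
Lemma gproj0 a : gproj a 0 = 0.
Proof. by rewrite -(scale0r 0) gprojZ !scale0r. Qed.
Lemma gproj_sum a J (s : seq J) (Q : pred J) (F : J -> A) :
  gproj a (\sum_(j <- s | Q j) F j) = \sum_(j <- s | Q j) gproj a (F j).
Proof. by apply: (big_morph _ (gprojD a) (gproj0 a)). Qed.

Lemma homogP a x : homog deg a x <-> exists2 p, ppi P p = x & fhomog a p.
Proof. by split=> [[p [px hp]]|[p px hp]]; exists p. Qed.

Lemma gproj_homog a b x : homog deg b x -> gproj a x = if b == a then x else 0.
Proof.
move=> /homogP[p <- hp]; rewrite gproj_ppi (fproj_homog _ hp).
by case: ifP => // _; apply: ppi0.
Qed.
Lemma homog_gproj a x : homog deg a (gproj a x).
Proof. by apply/homogP; exists (fproj a (prepr x)) => //; apply: fhomog_fproj. Qed.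

(** Stated for every list containing the support, so that a prescribed degree can be added to the
    list and then split off from the sum. *)
Lemma gproj_decomp x : exists2 s : seq N, uniq s & forall t : seq N, uniq t ->
  {subset s <= t} -> x = \sum_(a <- t) gproj a x.
Proof.
exists (undup [seq wdeg w | w <- msupp (prepr x)]); first exact: undup_uniq.
move=> t ut st; rewrite -{1}[x]prepK [X in ppi P X]malg_sumZ ppi_sum.
rewrite /gproj /fproj; under [RHS]eq_bigr => a _ do rewrite ppi_sum.
rewrite (exchange_big_dep xpredT) //= big_seq [RHS]big_seq; apply: eq_bigr => w wp.
rewrite -big_filter (_ : [seq i <- t | _] = [:: wdeg w]) ?big_seq1 //.
under eq_filter => i do rewrite eq_sym.
rewrite (filter_pred1_uniq ut) //; apply: st; rewrite mem_undup.
exact: map_f.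
Qed.

Lemma homog_inj a b x : homog deg a x -> homog deg b x -> x != 0 -> a = b.
Proof.
move=> /(gproj_homog b) Ea /(gproj_homog b) Eb; move: Ea; rewrite Eb eqxx.
by case: (eqVneq a b) => // _ ->; rewrite eqxx.
Qed.

Lemma gproj_eq0 x : (forall a, gproj a x = 0) -> x = 0.
Proof.
move=> x0; have [s us ds] := gproj_decomp x.
by rewrite (ds s us (fun _ h => h)) big1.
Qed.

Lemma weight_homog a x : homog deg a x -> x != 0 -> weight deg x = a.
Proof.
move=> ha x0; have hw : homog deg (weight deg x) x.
  by rewrite /weight; case: xgetP => [b -> //|/(_ a)].
exact: homog_inj hw ha x0.
Qed.

End GradedPresentation.

Section HomogClosure.
Variables (I : finType) (K : fieldType) (X : choiceType) (P : presentation K X).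
Variable deg : X -> {ffun I -> nat}.
Local Notation A := (presAlg P).
Local Notation N := {ffun I -> nat}.
Implicit Types (a b : N) (x y : A).

Lemma homog0 a : homog deg a (0 : A).
Proof. by apply/homogP; exists 0; [apply: ppi0 | apply: fhomog0]. Qed.
Lemma homog1 : homog deg 0 (1 : A).
Proof. by apply/homogP; exists 1 => //; apply: fhomog1. Qed.
Lemma homogD a x y : homog deg a x -> homog deg a y -> homog deg a (x + y).
Proof.
move=> /homogP[p <- hp] /homogP[r <- hr]; apply/homogP.
by exists (p + r); [rewrite ppiD | apply: fhomogD].
Qed.
Lemma homogZ a k x : homog deg a x -> homog deg a (k *: x).
Proof.
move=> /homogP[p <- hp]; apply/homogP.
by exists (k *: p); [rewrite ppi_scale | apply: fhomogZ].
Qed.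
Lemma homogN a x : homog deg a x -> homog deg a (- x).
Proof. by move=> h; rewrite -scaleN1r; apply: homogZ. Qed.
Lemma homogM a b x y : homog deg a x -> homog deg b y -> homog deg (a + b) (x * y).
Proof.
move=> /homogP[p <- hp] /homogP[r <- hr]; apply/homogP.
by exists (p * r); [rewrite ppi_mul | apply: fhomogM].
Qed.
Lemma homog_gen i : homog deg (deg i) (pgen P i).
Proof. by apply/homogP; exists (fgen K i) => //; apply: fhomog_gen. Qed.
Lemma homog_sum a J (s : seq J) (Q : pred J) (F : J -> A) :
  (forall j, Q j -> homog deg a (F j)) -> homog deg a (\sum_(j <- s | Q j) F j).
Proof. by move=> h; apply: big_ind => //; [exact: homog0 | exact: homogD]. Qed.
Lemma homogX a x n : homog deg a x -> homog deg (a *+ n) (x ^+ n).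
Proof.
move=> hp; elim: n => [|n IH]; rewrite ?expr0 ?mulr0n; first exact: homog1.
by rewrite exprS mulrS; apply: homogM.
Qed.
Lemma homog_fword s : homog deg (\sum_(y <- s) deg y) (fword P s).
Proof.
elim: s => [|x s IH]; rewrite /fword ?big_nil ?big_cons; first exact: homog1.
by apply: homogM => //; apply: homog_gen.
Qed.
End HomogClosure.

(** * Iterated $q$-commutators and the quantum Serre expression *)

Section QuantumCommutators.
Variables (K : fieldType) (u : K).
Hypothesis u0 : u != 0.
Hypothesis qint_neq0 : forall n, qint u n.+1 != 0.

Definition zqint (z : int) : K := (u ^ z - u ^ (- z)) / (u - u^-1).

Lemma zqint_nat (n : nat) : zqint n = qint u n.
Proof. by rewrite /zqint /qint -exprnN. Qed.

Lemma qden_neq0 : u - u^-1 != 0.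
Proof. by apply: contraNneq (qint_neq0 0) => E; rewrite /qint E invr0 mulr0. Qed.

Lemma qfactS n : qfact u n.+1 = qint u n.+1 * qfact u n.
Proof. by rewrite /qfact big_nat_recr //= mulrC. Qed.

Lemma qfact0 : qfact u 0 = 1.
Proof. by rewrite /qfact big_geq. Qed.

Lemma qfact_neq0 n : qfact u n != 0.
Proof. by elim: n => [|n IH]; rewrite ?qfact0 ?oner_eq0 // qfactS mulf_neq0. Qed.

Lemma qden_neq0' : u ^+ 2 - 1 != 0.
Proof.
apply: contraNneq qden_neq0 => E; rewrite -(inj_eq (mulfI u0)) mulrBr divff //.
by rewrite mulr0 -expr2 E.
Qed.

(** The $q$-Pascal rule behind the induction in [qadE]. *)
Lemma qint_split (m n : nat) :
  u ^- n * qint u m + u ^+ m * qint u n = qint u (m + n).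
Proof.
have h := qden_neq0'; rewrite /qint !exprD.
have um : u ^+ m != 0 by rewrite expf_neq0.
have un : u ^+ n != 0 by rewrite expf_neq0.
move: (u ^+ m) (u ^+ n) um un => a b um un.
by field; rewrite u0 um un h.
Qed.

Variable A : algType K.
Implicit Types (x y z w : A).
Local Notation dp := (divpow u).

Lemma dp0 x : dp x 0 = 1.
Proof. by rewrite /divpow qfact0 invr1 scale1r expr0. Qed.
Lemma dpS x n : x * dp x n = qint u n.+1 *: dp x n.+1.
Proof.
rewrite /divpow -scalerAr -exprS scalerA qfactS invfM mulrA divff //.
by rewrite mul1r.
Qed.
Lemma dpSr x n : dp x n * x = qint u n.+1 *: dp x n.+1.
Proof. by rewrite -dpS /divpow -scalerAl -scalerAr -exprSr -exprS. Qed.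
Lemma dpE x n : x ^+ n = qfact u n *: dp x n.
Proof. by rewrite /divpow scalerA divff ?scale1r ?qfact_neq0. Qed.

Definition qcom x (e : int) z : A := x * z - u ^ e *: (z * x).

(** The product of the commuting operators $L_x-u^{e+2k}R_x$, $0\le k<n$, applied to $z$, where
    $L_x$ and $R_x$ are left and right multiplication. A factor can be peeled off at either end
    ([qadS], [qadSr]). *)
Fixpoint qad x (e : int) (n : nat) z : A :=
  if n is n'.+1 then qcom x (e + (n'.*2)%:Z) (qad x e n' z) else z.

Lemma qcomC x e f z : qcom x e (qcom x f z) = qcom x f (qcom x e z).
Proof.
rewrite /qcom !mulrBr !mulrBl !scalerBr -!scalerAl -!scalerAr !mulrA !scalerA.
rewrite !opprB !addrA [u ^ e * _]mulrC; by rewrite -!addrA; congr (_ + _); rewrite addrCA [RHS]addrCA; congr (_ + _); rewrite addrC.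
Qed.

Lemma qad_qcom x e n f z : qad x e n (qcom x f z) = qcom x f (qad x e n z).
Proof. by elim: n => //= n ->; rewrite qcomC. Qed.

Lemma qadS x e n z : qad x e n.+1 z = qad x (e + 2) n (qcom x e z).
Proof.
elim: n => [|n IH] /=; first by rewrite addr0.
by rewrite -IH /= -addrA; congr (qcom x (e + _) _); rewrite doubleS -addn2 PoszD addrC.
Qed.

Lemma qadSr x e n z : qad x e n.+1 z = qad x e n (qcom x (e + (n.*2)%:Z) z).
Proof. by rewrite qad_qcom. Qed.

(** The $q$-binomial theorem for left and right multiplication by $x$; the Gaussian coefficients are
    absorbed by the divided powers. *)
Lemma qadE x e n z : qad x e n z = qfact u n *: \sum_(b < n.+1)
  ((-1) ^+ b * u ^ (b%:Z * (e + n%:Z - 1))) *: (dp x (n - b) * z * dp x b).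
Proof.
elim: n => [|n IH] /=.
  by rewrite big_ord1 mul0r expr0z expr0 !mul1r dp0 mulr1 qfact0 !scale1r mul1r.
rewrite IH /qcom -scalerAr -scalerAl scalerA mulrC -scalerA -scalerBr.
rewrite qfactS [qint _ _ * _]mulrC -scalerA; congr (_ *: _).
rewrite mulr_sumr mulr_suml scaler_sumr -sumrB [RHS]scaler_sumr.
set F := fun b : nat => (qint u (n.+1 - b) * ((-1) ^+ b * u ^ (b%:Z * (e + n%:Z - 1)))) *: (dp x (n.+1 - b) * z * dp x b).
set G := fun b : nat => (u ^ (e + (n.*2)%:Z) * (qint u b.+1 * ((-1) ^+ b * u ^ (b%:Z * (e + n%:Z - 1))))) *: (dp x (n - b) * z * dp x b.+1).
transitivity (\sum_(b < n.+1) (F b - G b)).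
  apply: eq_bigr => b _; have bn : (b <= n)%N by rewrite -ltnS.
  rewrite -[x * (_ *: _)]scalerAr -[_ *: _ * x]scalerAl !mulrA dpS -subSn // -[_ *: _ * z]scalerAl -[_ *: _ * dp x b]scalerAl /F /G; congr (_ - _).
    by rewrite scalerA mulrC mulrA.
  rewrite -[_ * dp x b * x]mulrA dpSr -[_ * (_ *: _)]scalerAr !scalerA.
  by congr (_ *: _); rewrite mulrAC -!mulrA.
rewrite sumrB.
(* The added term carries the factor [qint u 0], which is 0; now [F] matches [G] after a shift by
   one. *)
have -> : \sum_(b < n.+1) F b = \sum_(b < n.+2) F b.
  by rewrite [RHS]big_ord_recr /= /F subnn /qint expr0 invr1 subrr mul0r mul0r scale0r addr0.
rewrite big_ord_recl [RHS]big_ord_recl -addrA -sumrB; congr (_ + _).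
  by rewrite /F scalerA !mul0r !expr0z !expr0 !mulr1.
apply: eq_bigr => b _; rewrite /F /G !lift0 -scalerBl scalerA; congr (_ *: _).
have bn : (b <= n)%N by rewrite -ltnS.
rewrite exprS subSS.
have -> : u ^ (e + n.*2%:Z) = u ^ (e + n%:Z) * u ^+ n.
  by rewrite exprnP -expfzDr // -addnn PoszD addrA.
have -> : u ^ (b.+1%:Z * (e + n%:Z - 1)) = u ^ (b%:Z * (e + n%:Z - 1)) * u ^ (e + n%:Z) * u^-1.
  by rewrite -expfzDr // -[u^-1]/(u ^ (-1)) -expfzDr //; congr (u ^ _); rewrite -addn1 PoszD; ring.
have -> : u ^ (b.+1%:Z * (e + n.+1%:Z - 1)) = u ^ (b%:Z * (e + n%:Z - 1)) * u ^ (e + n%:Z) * u ^+ b.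
  by rewrite exprnP -!expfzDr //; congr (u ^ _); rewrite -!addn1 !PoszD; ring.
have -> : qint u n.+1 = u ^- b.+1 * qint u (n - b) + u ^+ (n - b) * qint u b.+1.
  by rewrite qint_split; congr qint; lia.
have -> : u ^+ n = u ^+ (n - b) * u ^+ b by rewrite -exprD subnK.
have ub : u ^+ b != 0 by rewrite expf_neq0.
rewrite exprS; move: (u ^+ (n - b)) (qint u (n - b)) (qint u b.+1) => c1 c2 c3.
move: (u ^+ b) ub => c4 ub.
by field; rewrite u0 ub.
Qed.

Definition qserre n x z : A :=
  \sum_(k < n.+1) (-1) ^+ k *: (dp x k * z * dp x (n - k)).

(** For $e=1-n$ the exponent $b(e+n-1)$ in [qadE] vanishes. As an iterated commutator the Serre
    expression can be evaluated on a sum of $q$-commuting elements. *)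
Lemma qserreE n x z :
  qad x (1 - n%:Z) n z = (qfact u n * (-1) ^+ n) *: qserre n x z.
Proof.
rewrite qadE -scalerA; congr (_ *: _); rewrite /qserre scaler_sumr.
rewrite [RHS](reindex_inj rev_ord_inj); apply: eq_bigr => b _ /=.
have bn : (b <= n)%N by rewrite -ltnS.
rewrite scalerA subSS subKn // (_ : b%:Z * _ = 0); last by ring.
rewrite expr0z mulr1; congr (_ *: _).
have -> : (-1) ^+ n = (-1) ^+ (n - b) * (-1) ^+ b :> K by rewrite -exprD subnK.
by rewrite mulrAC -expr2 sqrr_sign mul1r.
Qed.

Lemma qserre_eq0 n x z : (qserre n x z == 0) = (qad x (1 - n%:Z) n z == 0).
Proof.
by rewrite qserreE scaler_eq0 mulf_eq0 (negbTE (qfact_neq0 n)) /= signr_eq0.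
Qed.

Section SumOfQCommuting.
Variables (X Y : A).
Hypothesis YX : Y * X = u ^+ 2 *: (X * Y).

(** The hypothesis removes $Y$ from the innermost factor, and because $YX=u^2XY$ it reproduces
    itself with $e+2$ for the next one. *)
Lemma qad_sumX e n z : Y * z = u ^ e *: (z * Y) ->
  qad (X + Y) e n z = qad X e n z.
Proof.
elim: n e z => [|n IH] e z Yz //; rewrite !qadS.
have -> : qcom (X + Y) e z = qcom X e z.
  rewrite /qcom mulrDl mulrDr Yz scalerDr opprD addrACA subrr addr0 //.
apply: IH; rewrite /qcom mulrBr mulrBl scalerBr -!scalerAr -!scalerAl !mulrA.
have e2 : u ^ (e + 2) = u ^+ 2 * u ^ e by rewrite exprnP -expfzDr // addrC.
congr (_ - _).
  by rewrite YX -scalerAl -mulrA Yz -scalerAr scalerA mulrA e2.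
rewrite Yz -[_ *: _ * X]scalerAl -mulrA YX -[_ * (_ *: _)]scalerAr mulrA !scalerA.
by congr (_ *: _); rewrite e2; ring.
Qed.

(** The mirror image: the factor of largest exponent is peeled off first, and it is $X$ that drops
    out. *)
Lemma qad_sumY e n z : z * X = u ^ (- (e + n.*2%:Z - 2)) *: (X * z) ->
  qad (X + Y) e n z = qad Y e n z.
Proof.
elim: n z => [|n IH] z zX //; rewrite !qadSr.
have Xz : X * z = u ^ (e + n.*2%:Z) *: (z * X).
  rewrite zX scalerA -expfzDr // (_ : _ + _ = 0) ?expr0z ?scale1r //.
  by rewrite doubleS -addn2 PoszD; ring.
have -> : qcom (X + Y) (e + n.*2%:Z) z = qcom Y (e + n.*2%:Z) z.
  by rewrite /qcom mulrDl mulrDr Xz scalerDr opprD addrACA subrr add0r.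
apply: IH; rewrite /qcom mulrBr mulrBl scalerBr -!scalerAr -!scalerAl !mulrA.
have zX' : z * X = u ^ (- (e + n.*2%:Z)) *: (X * z).
  by rewrite Xz scalerA -expfzDr // addNr expr0z scale1r.
have XY : X * Y = u ^ (- 2) *: (Y * X).
  by rewrite YX scalerA exprnP -expfzDr // expr0z scale1r.
have e2 : u ^ (- (e + n.*2%:Z - 2)) = u ^ 2 * u ^ (- (e + n.*2%:Z)).
  by rewrite -expfzDr //; congr (u ^ _); ring.
congr (_ - _).
  rewrite -[Y * z * X]mulrA zX' -scalerAr !mulrA YX -scalerAl !scalerA e2.
  by rewrite -exprnP mulrC.
rewrite -[z * Y * X]mulrA YX -scalerAr mulrA zX' -!scalerAl !scalerA e2.
by rewrite -exprnP -mulrA; congr (_ *: _); ring.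
Qed.

Lemma qserre_sum n zX zY : 
  Y * zX = u ^ (1 - n%:Z) *: (zX * Y) -> zY * X = u ^ (1 - n%:Z) *: (X * zY) ->
  qserre n X zX = 0 -> qserre n Y zY = 0 -> qserre n (X + Y) (zX + zY) = 0.
Proof.
move=> h1 h2 /eqP; rewrite qserre_eq0 => /eqP s1 /eqP; rewrite qserre_eq0 => /eqP s2.
have qadD x e m z w : qad x e m (z + w) = qad x e m z + qad x e m w.
  elim: m => //= m ->; rewrite /qcom mulrDr mulrDl scalerDr opprD.
  by rewrite !addrA; congr (_ + _); rewrite addrAC.
apply/eqP; rewrite qserre_eq0 qadD (qad_sumX n h1) s1 add0r (qad_sumY (n:=n)) ?s2 //.
rewrite h2; congr (u ^ _ *: _); rewrite -addnn PoszD; ring.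
Qed.
End SumOfQCommuting.

End QuantumCommutators.

(** * The coproduct and the skew derivations *)

Local Open Scope quotient_scope.
Section TensorSquare.
Variables (K : fieldType) (B : algType K).
Implicit Types (m : B -> B -> B) (s : seq (B * B)).

Definition bilin m := (forall k a b c, m (k *: a + b) c = k *: m a c + m b c) /\
  (forall k a b c, m a (k *: b + c) = k *: m a b + m a c).

Definition tev m s := \sum_(t <- s) m t.1 t.2.

(** Two lists stand for the same tensor when no bilinear map into [B] separates them. Such maps
    include the contractions with a functional and the map whose value on the coproduct is the iHopf
    product, and the lists [coprod a] get classes directly. *)
Definition teqv s (t : seq (B * B)) := `[< forall m, bilin m -> tev m s = tev m t >].

Lemma teqv_refl : reflexive teqv. Proof. by move=> s; apply/asboolP. Qed.
Lemma teqv_sym : symmetric teqv.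
Proof. by move=> s t; apply/asboolP/asboolP => h m /h. Qed.
Lemma teqv_trans : transitive teqv.
Proof.
by move=> t s r /asboolP h1 /asboolP h2; apply/asboolP => m bm; rewrite h1 ?h2.
Qed.
Canonical teqv_equiv := EquivRel teqv teqv_refl teqv_sym teqv_trans.

Definition tens := {eq_quot teqv}.
HB.instance Definition _ := Choice.on tens.
HB.instance Definition _ := EqQuotient.on tens.

Definition tcls s : tens := \pi_tens s.
Definition tevq m (a : tens) := tev m (repr a).

Lemma tevq_cls m s : bilin m -> tevq m (tcls s) = tev m s.
Proof.
move=> bm; rewrite /tevq /tcls.
have : teqv (repr (\pi_tens s)) s by rewrite -[teqv _ _]/(teqv_equiv _ _) -eqmodE reprK.
by move/asboolP; apply.
Qed.

Lemma tens_ext (a b : tens) : (forall m, bilin m -> tevq m a = tevq m b) -> a = b.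
Proof.
move=> h; rewrite -[a]reprK -[b]reprK; apply/eqmodP.
by rewrite /= ; apply/asboolP => m /h.
Qed.

Lemma bilin_sum (J : Type) (r : seq J) (F : J -> B -> B -> B) :
  (forall j, bilin (F j)) -> bilin (fun x y => \sum_(j <- r) F j x y).
Proof.
move=> bF; split=> k x y z; rewrite scaler_sumr -big_split; apply: eq_bigr => j _.
  exact: (bF j).1.
exact: (bF j).2.
Qed.

Definition tadd (a b : tens) := tcls (repr a ++ repr b).
Definition tscale k (a : tens) := tcls [seq (k *: t.1, t.2) | t <- repr a].
Definition tzero := tcls [::].
Definition tone := tcls [:: (1, 1)].
Definition tmul (a b : tens) :=
  tcls [seq (s.1 * t.1, s.2 * t.2) | s : B * B <- repr a, t : B * B <- repr b].

Lemma bilinZl m k x y : bilin m -> m (k *: x) y = k *: m x y.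
Proof.
move=> [h _]; have := h 1 0 0 y; rewrite !scale1r addr0 -[X in X = _ -> _]addr0.
by move=> /addrI h0; have := h k x 0 y; rewrite addr0 -h0 addr0.
Qed.

Lemma tevq_add m a b : bilin m -> tevq m (tadd a b) = tevq m a + tevq m b.
Proof. by move=> bm; rewrite tevq_cls // /tev big_cat. Qed.
Lemma tevq_scale m k a : bilin m -> tevq m (tscale k a) = k *: tevq m a.
Proof.
move=> bm; rewrite tevq_cls // /tev big_map scaler_sumr.
by apply: eq_bigr => t _; rewrite bilinZl.
Qed.
Lemma tevq_zero m : bilin m -> tevq m tzero = 0.
Proof. by move=> bm; rewrite tevq_cls // /tev big_nil. Qed.
Lemma tevq_one m : bilin m -> tevq m tone = m 1 1.
Proof. by move=> bm; rewrite tevq_cls // /tev big_seq1. Qed.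
Lemma tevq_mul m a b : bilin m -> tevq m (tmul a b) =
  tevq (fun x y => tevq (fun x' y' => m (x * x') (y * y')) b) a.
Proof. by move=> bm; rewrite tevq_cls // /tevq /tev big_allpairs_dep. Qed.

Lemma bilin_mulr m x y : bilin m -> bilin (fun x' y' => m (x * x') (y * y')).
Proof.
by move=> bm; split=> k a b c; rewrite mulrDr -scalerAr ?bm.1 ?bm.2.
Qed.
Lemma bilin_mull m x y : bilin m -> bilin (fun x' y' => m (x' * x) (y' * y)).
Proof.
by move=> bm; split=> k a b c; rewrite mulrDl -scalerAl ?bm.1 ?bm.2.
Qed.
Lemma bilin_tev m b : bilin m -> bilin (fun x y => tevq (fun x' y' => m (x * x') (y * y')) b).
Proof. by move=> bm; apply: bilin_sum => t; apply: bilin_mull. Qed.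

Lemma eq_tevq m m' a : (forall x y, m x y = m' x y) -> tevq m a = tevq m' a.
Proof. by move=> h; apply: eq_bigr => t _. Qed.

Lemma taddA : associative tadd.
Proof. by move=> a b c; apply: tens_ext => m bm; rewrite !tevq_add // addrA. Qed.
Lemma taddC : commutative tadd.
Proof. by move=> a b; apply: tens_ext => m bm; rewrite !tevq_add // addrC. Qed.
Lemma tadd0 : left_id tzero tadd.
Proof. by move=> a; apply: tens_ext => m bm; rewrite tevq_add // tevq_zero // add0r. Qed.
Lemma taddN : left_inverse tzero (tscale (-1)) tadd.
Proof.
move=> a; apply: tens_ext => m bm.
by rewrite tevq_add // tevq_zero // tevq_scale // scaleN1r addNr.
Qed.
HB.instance Definition _ := GRing.isZmodule.Build tens taddA taddC tadd0 taddN.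

Lemma tmulA : associative tmul.
Proof.
move=> a b c; apply: tens_ext => m bm.
rewrite tevq_mul // [RHS]tevq_mul // [RHS]tevq_mul; last exact: bilin_tev.
apply: eq_tevq => x y; rewrite tevq_mul; last exact: bilin_mulr.
by apply: eq_tevq => x' y'; apply: eq_tevq => x2 y2; rewrite !mulrA.
Qed.
Lemma tmul1 : left_id tone tmul.
Proof.
move=> a; apply: tens_ext => m bm; rewrite tevq_mul // tevq_one; last exact: bilin_tev.
by apply: eq_tevq => x y; rewrite !mul1r.
Qed.
Lemma tmulr1 : right_id tone tmul.
Proof.
move=> a; apply: tens_ext => m bm; rewrite tevq_mul //; apply: eq_tevq => x y.
by rewrite tevq_one ?mulr1 //; apply: bilin_mulr.
Qed.
Lemma tmulDl : left_distributive tmul +%R.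
Proof.
move=> a b c; apply: tens_ext => m bm.
by rewrite tevq_mul // !tevq_add // -?tevq_mul //; apply: bilin_tev.
Qed.
Lemma tmulDr : right_distributive tmul +%R.
Proof.
move=> a b c; apply: tens_ext => m bm; rewrite [RHS]tevq_add // !tevq_mul //.
rewrite /tevq -big_split; apply: eq_bigr => t _; rewrite -/(tevq _ _).
by rewrite -[LHS]/(tevq _ _) tevq_add //; apply: bilin_mulr.
Qed.
Lemma tone_neq0 : tone != 0.
Proof.
apply/eqP => /(congr1 (tevq (fun x y => x * y))).
have bm : bilin (fun x y : B => x * y).
  by split=> k x y z; rewrite ?mulrDl ?mulrDr -?scalerAl -?scalerAr.
rewrite tevq_one // mulr1 -[0 : tens]/tzero tevq_zero // => /eqP.
by rewrite oner_eq0.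
Qed.
HB.instance Definition _ := GRing.Zmodule_isNzRing.Build tens
  tmulA tmul1 tmulr1 tmulDl tmulDr tone_neq0.

Lemma tscaleA k l a : tscale k (tscale l a) = tscale (k * l) a.
Proof. by apply: tens_ext => m bm; rewrite !tevq_scale // scalerA. Qed.
Lemma tscale1 : left_id 1 tscale.
Proof. by move=> a; apply: tens_ext => m bm; rewrite tevq_scale // scale1r. Qed.
Lemma tscaleDr : right_distributive tscale +%R.
Proof.
move=> k a b; apply: tens_ext => m bm.
by rewrite tevq_scale // !tevq_add // !tevq_scale // scalerDr.
Qed.
Lemma tscaleDl a : {morph tscale^~ a : k l / k + l}.
Proof.
move=> k l; apply: tens_ext => m bm.
by rewrite tevq_scale // !tevq_add // !tevq_scale // scalerDl.
Qed.
HB.instance Definition _ := GRing.Zmodule_isLmodule.Build K tens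
  tscaleA tscale1 tscaleDr tscaleDl.

Lemma tscaleAl k (a b : tens) : k *: (a * b) = (k *: a) * b.
Proof.
apply: tens_ext => m bm; rewrite [LHS]tevq_scale // [X in _ *: X]tevq_mul //.
by rewrite [RHS]tevq_mul // [RHS]tevq_scale //; apply: bilin_tev.
Qed.
HB.instance Definition _ := GRing.Lmodule_isLalgebra.Build K tens tscaleAl.

Lemma tscaleAr k (a b : tens) : k *: (a * b) = a * (k *: b).
Proof.
apply: tens_ext => m bm; rewrite [LHS]tevq_scale // [X in _ *: X]tevq_mul //.
rewrite [RHS]tevq_mul // /tevq [LHS]scaler_sumr; apply: eq_bigr => t _.
by rewrite -![tev _ (repr _)]/(tevq _ _) tevq_scale //; apply: bilin_mulr.
Qed.
HB.instance Definition _ := GRing.Lalgebra_isAlgebra.Build K tens tscaleAr.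

Definition pure x y : tens := tcls [:: (x, y)].

Lemma tevq_pure m x y : bilin m -> tevq m (pure x y) = m x y.
Proof. by move=> bm; rewrite tevq_cls // /tev big_seq1. Qed.

Lemma pureM x y x' y' : pure x y * pure x' y' = pure (x * x') (y * y').
Proof.
apply: tens_ext => m bm; rewrite tevq_mul // !tevq_pure //; first last.
- exact: bilin_tev.
exact: bilin_mulr.
Qed.

Lemma pureDl x x' y : pure (x + x') y = pure x y + pure x' y.
Proof.
apply: tens_ext => m bm; rewrite tevq_add // !tevq_pure //.
by have := bm.1 1 x x' y; rewrite !scale1r.
Qed.
Lemma pureDr x y y' : pure x (y + y') = pure x y + pure x y'.
Proof.
apply: tens_ext => m bm; rewrite tevq_add // !tevq_pure //.
by have := bm.2 1 x y y'; rewrite !scale1r.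
Qed.
Lemma pureZl k x y : pure (k *: x) y = k *: pure x y.
Proof. by apply: tens_ext => m bm; rewrite tevq_scale // !tevq_pure // bilinZl. Qed.
Lemma pureZr k x y : pure x (k *: y) = k *: pure x y.
Proof.
apply: tens_ext => m bm; rewrite tevq_scale // !tevq_pure //.
have bm' : bilin (fun a b => m b a) by split=> *; [apply: bm.2 | apply: bm.1].
exact: (bilinZl _ _ _ bm').
Qed.

Lemma tcls_sum s : tcls s = \sum_(t <- s) pure t.1 t.2.
Proof.
elim: s => [|t s IH]; first by rewrite big_nil.
rewrite big_cons -IH; apply: tens_ext => m bm.
by rewrite tevq_add // !tevq_cls // /tev big_cons big_seq1.
Qed.

End TensorSquare.

(** * The opposite algebra, for anti-homomorphisms out of a presentation *)

Section OppositeAlgebra.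
Variables (K : fieldType) (A : algType K).
Definition opalg : Type := A.
HB.instance Definition _ := GRing.Zmodule.on opalg.
Definition opmul (x y : opalg) : opalg := (y : A) * (x : A).
Lemma opmulA : associative opmul. Proof. by move=> x y z; rewrite /opmul mulrA. Qed.
Lemma opmul1 : left_id (1 : A) opmul. Proof. by move=> x; apply: mulr1. Qed.
Lemma opmulr1 : right_id (1 : A) opmul. Proof. by move=> x; apply: mul1r. Qed.
Lemma opmulDl : left_distributive opmul +%R.
Proof. by move=> x y z; apply: mulrDr. Qed.
Lemma opmulDr : right_distributive opmul +%R.
Proof. by move=> x y z; apply: mulrDl. Qed.
Lemma opone_neq0 : (1 : A) != 0 :> opalg. Proof. exact: oner_neq0. Qed.
HB.instance Definition _ := GRing.Zmodule_isNzRing.Build opalg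
  opmulA opmul1 opmulr1 opmulDl opmulDr opone_neq0.
Definition opscale (k : K) (x : opalg) : opalg := k *: (x : A).
Lemma opscaleA k l (a : opalg) : opscale k (opscale l a) = opscale (k * l) a.
Proof. exact: scalerA. Qed.
Lemma opscale1 : left_id 1 opscale. Proof. exact: scale1r. Qed.
Lemma opscaleDr : right_distributive opscale +%R. Proof. by move=> k a b; apply: scalerDr. Qed.
Lemma opscaleDl (a : opalg) : {morph opscale^~ a : k l / k + l}.
Proof. by move=> k l; apply: scalerDl. Qed.
HB.instance Definition _ := GRing.Zmodule_isLmodule.Build K opalg
  opscaleA opscale1 opscaleDr opscaleDl.
Lemma opscaleAl (k : K) (a b : opalg) : k *: (a * b) = (k *: a) * b.
Proof. exact: (@scalerAr K A). Qed.
HB.instance Definition _ := GRing.Lmodule_isLalgebra.Build K opalg opscaleAl.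
Lemma opscaleAr (k : K) (a b : opalg) : k *: (a * b) = a * (k *: b).
Proof. exact: (@scalerAl K A). Qed.
HB.instance Definition _ := GRing.Lalgebra_isAlgebra.Build K opalg opscaleAr.

Lemma opalgM (x y : opalg) : x * y = (y : A) * (x : A). Proof. by []. Qed.
Lemma opalgX (x : opalg) n : x ^+ n = (x : A) ^+ n.
Proof. by elim: n => // n IH; rewrite exprSr [RHS]exprS IH. Qed.
Lemma op_divpow u (x : opalg) n : divpow u x n = divpow u (x : A) n.
Proof. by rewrite /divpow opalgX. Qed.

(** Reversing products exchanges the terms $k$ and $n-k$, so only the sign $(-1)^n$ appears. *)
Lemma op_qserre u n (x z : opalg) :
  @qserre K u opalg n x z = (-1) ^+ n *: (@qserre K u A n x z : opalg).
Proof.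
rewrite /qserre [RHS]scaler_sumr (reindex_inj rev_ord_inj).
apply: eq_bigr => b _ /=; have bn : (b <= n)%N by rewrite -ltnS.
rewrite !op_divpow subSS subKn // scalerA.
have -> : (-1) ^+ n = (-1) ^+ (n - b) * (-1) ^+ b :> K by rewrite -exprD subnK.
rewrite -[_ * _ * (-1) ^+ b]mulrA -[(-1) ^+ b * _]expr2 sqrr_sign mulr1; congr (_ *: _).
by rewrite !opalgM mulrA.
Qed.
End OppositeAlgebra.

(** * Homomorphisms out of f and out of the bialgebra *)

Section Morphisms.
Variables (Kv : fieldType) (q : Kv) (I : finType) (C : I -> I -> int) (d : I -> nat).
Local Notation vi := (vi q d).
Local Notation serre := (serre q C d).
Local Notation theta := (theta q C d).
Local Notation hh := (hh q C d).
Local Notation ftheta := (ftheta q C d).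

Lemma serreE (A : algType Kv) (x : I -> A) i j :
  serre x i j = qserre (vi i) `|1 - C i j| (x i) (x j).
Proof. by []. Qed.

Lemma serre_hom (A A' : lalgType Kv) (x : I -> A) (F : A -> A') :
  (forall x y, F (x * y) = F x * F y) -> (forall k x, F (k *: x) = k *: F x) ->
  (forall x y, F (x + y) = F x + F y) -> F 1 = 1 ->
  forall i j, F (serre x i j) = serre (fun i => F (x i)) i j.
Proof.
move=> FM FZ FD F1 i j; have F0 : F 0 = 0 by rewrite -(scale0r 0) FZ !scale0r.
have FX p n : F (p ^+ n) = F p ^+ n.
  by elim: n => [|n IH]; rewrite ?expr0 // !exprS FM IH.
rewrite /Defs.serre (big_morph F FD F0); apply: eq_bigr => k _.
by rewrite FZ !FM /divpow !FZ !FX.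
Qed.

Lemma feval_serre (X : choiceType) (A : algType Kv) (g : X -> A) (x : I -> X) i j :
  feval g (serre (fun i => fgen Kv (x i)) i j) = serre (fun i => g (x i)) i j.
Proof.
have h1 : feval g 1 = 1.
  by rewrite feval_mmap -mpolyC1E mmapU /= scale1r mul1r fm1 big_nil.
have hD (p r : freeAlg Kv X) : feval g (p + r) = feval g p + feval g r.
  by rewrite !feval_mmap mmapD.
have hZ k (p : freeAlg Kv X) : feval g (k *: p) = k *: feval g p by apply: fevalZ.
have hM (p r : freeAlg Kv X) : feval g (p * r) = feval g p * feval g r.
  exact: fevalM.
have -> : (fun i => g (x i)) = (fun i => feval g (fgen Kv (x i))).
  by apply/funext => k; rewrite feval_gen.
exact: (serre_hom (fun i => fgen Kv (x i)) hM hZ hD h1).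
Qed.

Definition serre_rel (A : algType Kv) (x : I -> A) :=
  forall i j, i != j -> serre x i j = 0.

Lemma f_hom (A : algType Kv) (g : I -> A) :
  serre_rel g -> forall r, prels (f_pres q C d) r -> feval g r = 0.
Proof. by move=> hg r [i [j [ij ->]]]; rewrite (feval_serre g id) hg. Qed.

Lemma B_hom (A : algType Kv) (g : Bgen I -> A) :
  serre_rel (fun i => g (inl i)) ->
  (forall i j, g (inr i) * g (inr j) = g (inr j) * g (inr i)) ->
  (forall i j, g (inr i) * g (inl j) = vi i ^ C i j *: (g (inl j) * g (inr i))) ->
  forall r, prels (B_pres q C d) r -> feval g r = 0.
Proof.
move=> g1 g2 g3 r [[i [j [ij ->]]]|[i [j ->]]|[i [j ->]]].
- by rewrite (feval_serre g (fun i => inl i : Bgen I)) g1.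
- by rewrite fevalB [X in X - _]fevalM [X in _ - X]fevalM !feval_gen g2 subrr.
rewrite fevalB fevalZ [X in X - _]fevalM [X in _ - _ *: X]fevalM !feval_gen.
by rewrite g3 subrr.
Qed.

Lemma ppi_serre (X : choiceType) (P : presentation Kv X) (x : I -> X) i j :
  ppi P (serre (fun i => fgen Kv (x i)) i j) = serre (fun i => pgen P (x i)) i j.
Proof.
exact: (serre_hom (fun i => fgen Kv (x i)) (ppi_mul P) (ppi_scale P) (ppiD P) (ppi_one P)).
Qed.

Lemma serre_ftheta : serre_rel ftheta.
Proof.
move=> i j ij; rewrite -(ppi_serre (f_pres q C d) id).
by apply: ppi_rel; exists i, j.
Qed.

Lemma serre_theta : serre_rel theta.
Proof.
move=> i j ij; rewrite -(ppi_serre (B_pres q C d) (fun i => inl i : Bgen I)).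
by apply: ppi_rel; apply: Or31; exists i, j.
Qed.

Lemma hhC i j : hh i * hh j = hh j * hh i.
Proof.
apply/eqP; rewrite -subr_eq0 -!ppi_mul -ppiB; apply/eqP/ppi_rel.
by apply: Or32; exists i, j.
Qed.

Lemma hh_theta i j : hh i * theta j = vi i ^ C i j *: (theta j * hh i).
Proof.
apply/eqP; rewrite -subr_eq0 -!ppi_mul -ppi_scale -ppiB; apply/eqP/ppi_rel.
by apply: Or33; exists i, j.
Qed.

Lemma qserre_scale (A : algType Kv) (u a b : Kv) n (x z : A) :
  qserre u n (a *: x) (b *: z) = (a ^+ n * b) *: qserre u n x z.
Proof.
rewrite /qserre scaler_sumr; apply: eq_bigr => k _.
have kn : (k <= n)%N by rewrite -ltnS.
have dpZ m : divpow u (a *: x) m = a ^+ m *: divpow u x m.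
  by rewrite /divpow exprZn !scalerA mulrC.
rewrite !dpZ; move: (divpow u x k) (divpow u x (n - k)) => X Y.
rewrite -!scalerAl -!scalerAr -!scalerAl !scalerA; congr (_ *: _).
have -> : a ^+ n = a ^+ k * a ^+ (n - k) by rewrite -exprD subnKC.
by ring.
Qed.

(** Used with $g=h_i\otimes1$ and $g'=h_j\otimes1$, which commute with $1\otimes\vartheta_i$ and
    $1\otimes\vartheta_j$. *)
Lemma qserre_comm (A : algType Kv) (u : Kv) n (g g' x z : A) :
  GRing.comm g x -> GRing.comm g z -> GRing.comm g g' -> GRing.comm g' x ->
  qserre u n (g * x) (g' * z) = g ^+ n * g' * qserre u n x z.
Proof.
move=> gx gz gg g'x; rewrite /qserre mulr_sumr; apply: eq_bigr => k _.
have kn : (k <= n)%N by rewrite -ltnS.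
have dpM m : divpow u (g * x) m = g ^+ m * divpow u x m.
  by rewrite /divpow exprMn_comm // scalerAr.
have cX m (y : A) : GRing.comm y x -> GRing.comm y (divpow u x m).
  by move=> c; rewrite /GRing.comm /divpow -scalerAr -scalerAl commrX.
have c1 := cX k _ g'x; have c2 := cX k _ gx.
have c3 : GRing.comm (divpow u x k * z) (g ^+ (n - k)).
  by apply/commr_sym; apply: commrM; apply/commr_sym/commrX/commr_sym.
rewrite !dpM; move: (divpow u x k) (divpow u x (n - k)) c1 c2 c3 => X Y c1 c2 c3.
rewrite -scalerAr; congr (_ *: _).
have -> : g ^+ n = g ^+ k * g ^+ (n - k) by rewrite -exprD subnKC.
rewrite -!mulrA; congr (_ * _); rewrite [X * (g' * _)]mulrA -c1 -!mulrA.
rewrite [RHS]mulrA -[g ^+ _ * g']/(g ^+ _ * g') [g ^+ _ * g']commr_sym; last first.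
  by apply: commrX; apply: commr_sym.
by rewrite -!mulrA; congr (_ * _); move: c3; rewrite /GRing.comm -!mulrA => c3; rewrite [z * (_ * _)]mulrA !mulrA -[X * z * _]mulrA c3 -!mulrA.
Qed.

Lemma serre_scale (A : algType Kv) (x : I -> A) (a : I -> Kv) :
  serre_rel x -> serre_rel (fun i => a i *: x i).
Proof. by move=> hx i j ij; rewrite serreE qserre_scale -serreE hx // scaler0. Qed.

Lemma serre_op (A : algType Kv) (x : I -> A) :
  serre_rel x -> serre_rel (x : I -> opalg A).
Proof. by move=> hx i j ij; rewrite serreE op_qserre -serreE hx // scaler0. Qed.

End Morphisms.

(** * The algebra f inside the bialgebra: embedding, twists and anti-involution *)

Section HalfQuantumGroup.
Variables (Kv : fieldType) (q : Kv) (I : finType) (C : I -> I -> int) (d : I -> nat).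
Hypothesis q0 : q != 0.
Hypothesis q_nroot : forall n, q ^+ n.+1 != 1.
Hypothesis hC : finite_cartan C d.
Local Notation v := (v q).
Local Notation vi := (vi q d).
Local Notation f := (fAlg q C d).
Local Notation B := (Bhat q C d).
Local Notation theta := (theta q C d).
Local Notation hh := (hh q C d).
Local Notation ftheta := (ftheta q C d).
Local Notation iota := (@iotaB Kv q I C d).
Local Notation nf := (nform C d).

Lemma v_neq0 : v != 0. Proof. by rewrite /Defs.v expf_neq0. Qed.
Lemma vi_neq0 i : vi i != 0. Proof. by rewrite /Defs.vi expf_neq0 ?v_neq0. Qed.

Lemma vi_qint i n : qint (vi i) n.+1 != 0.
Proof.
have D m : (vi i) ^+ m.+1 - (vi i) ^- m.+1 != 0.
  have h : (vi i) ^+ m.+1 != 0 by rewrite expf_neq0 ?vi_neq0.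
  rewrite -(inj_eq (mulfI h)) mulr0 mulrBr divff // subr_eq0 -expr2.
  rewrite /Defs.vi /Defs.v -!exprM; have := cartan_dpos hC i.
  by case: (d i) => // k _; rewrite !mulnS !addSn; apply: q_nroot.
by rewrite /qint mulf_neq0 ?D // invr_eq0; have := D 0; rewrite !expr1.
Qed.

Lemma vi_den i : vi i - (vi i)^-1 != 0.
Proof. exact: (qden_neq0 (vi_qint i)). Qed.

Lemma nformE a b : nf a b = \sum_i \sum_j (a i)%:Z * (b j)%:Z * ((d i)%:Z * C i j).
Proof. by apply: eq_bigr => i _; apply: eq_bigr => j _; rewrite !ffunE. Qed.
Lemma nformC a b : nf a b = nf b a.
Proof.
rewrite !nformE exchange_big; apply: eq_bigr => i _; apply: eq_bigr => j _.
by rewrite (cartan_sym hC) [_ * (b i)%:Z]mulrC.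
Qed.
Lemma nformDl a b c : nf (a + b) c = nf a c + nf b c.
Proof.
rewrite !nformE -big_split; apply: eq_bigr => i _; rewrite -big_split.
by apply: eq_bigr => j _; rewrite !ffunE PoszD !mulrDl.
Qed.
Lemma nformDr a b c : nf a (b + c) = nf a b + nf a c.
Proof. by rewrite nformC nformDl !(nformC _ a). Qed.
Lemma nform0l a : nf 0 a = 0.
Proof. by rewrite nformE big1 // => i _; rewrite big1 // => j _; rewrite ffunE !mul0r. Qed.
Lemma nform0r a : nf a 0 = 0. Proof. by rewrite nformC nform0l. Qed.
Lemma nform_sroot i j : nf (sroot i) (sroot j) = (d i)%:Z * C i j.
Proof.
rewrite nformE (bigD1 i) //= (bigD1 j) //= !ffunE !eqxx !mul1r big1 ?addr0.
  rewrite big1 ?addr0 // => k /negbTE ki; rewrite big1 // => l _.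
  by rewrite !ffunE ki !mul0r.
by move=> k /negbTE kj; rewrite !ffunE kj mulr0 mul0r.
Qed.

Lemma viC i j : vi i ^ C i j = v ^ nf (sroot i) (sroot j).
Proof. by rewrite nform_sroot /Defs.vi exprnP exprz_exp. Qed.
Lemma viCC i j : vi i ^ C i j = vi j ^ C j i.
Proof. by rewrite !viC nformC. Qed.

(** The terms $\vartheta_i\otimes1$ and $h_i\otimes\vartheta_i$ commute up to $v_i^2$, and against
    the terms for $j$ the exponent is $c_{ij}=1-n$, exactly as [qserre_sum] asks; each term alone
    satisfies the Serre relation. *)
Lemma coprod_rels (A : algType Kv) (t h : I -> A) :
  serre_rel q C d t -> (forall i j, h i * h j = h j * h i) ->
  (forall i j, h i * t j = vi i ^ C i j *: (t j * h i)) ->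
  let t2 i := pure (t i) 1 + pure (h i) (t i) in let h2 i := pure (h i) (h i) in
  [/\ serre_rel q C d t2, forall i j, h2 i * h2 j = h2 j * h2 i &
    forall i j, h2 i * t2 j = vi i ^ C i j *: (t2 j * h2 i)].
Proof.
move=> st hh ht t2 h2; split=> [i j ij|i j|i j]; last first.
- rewrite /h2 /t2 mulrDr mulrDl !pureM mul1r mulr1 scalerDr -pureZl -ht; congr (_ + _).
  by rewrite hh ht pureZr.
- by rewrite /h2 !pureM hh.
have pl1 (x y : A) : pure (x * y) 1 = pure x 1 * pure y 1 by rewrite pureM mulr1.
have pl2 (x y : A) : pure 1 (x * y) = pure 1 x * pure 1 y by rewrite pureM mulr1.
rewrite serreE; have hq := vi_qint i.
have nE : (1 : int) - `|1 - C i j|%:Z = C i j.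
  by rewrite abszE ger0_norm ?subr_ge0 ?(le_trans (cartan_offdiag hC ij)) // opprB addrC subrK.
apply: qserre_sum => //.
- exact: vi_neq0.
- by rewrite !pureM !mulr1 !mul1r ht (cartan_diag hC) pureZl exprnP.
- by rewrite !pureM !mulr1 !mul1r ht pureZl nE.
- by rewrite !pureM !mulr1 !mul1r ht viCC pureZl nE -viCC.
- have sh := serre_hom q C d t (F := fun x : A => pure x 1) pl1.
  rewrite -(serreE q C d (fun i => pure (t i) 1)) -sh //.
  + by rewrite st // -(scale0r 0) pureZl scale0r.
  + by move=> k x; rewrite pureZl.
  by move=> x y; rewrite pureDl.
have E k : pure (h k) (t k) = pure (h k) 1 * pure 1 (t k).
  by rewrite pureM mulr1 mul1r.
rewrite !E qserre_comm; try by rewrite /GRing.comm !pureM ?mul1r ?mulr1 ?(hh _ j).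
have g := serre_hom q C d t (F := fun x : A => pure 1 x) pl2.
rewrite -(serreE q C d (fun i => pure 1 (t i))) -g //.
- by rewrite st // -(scale0r 0) pureZr scale0r mulr0.
- by move=> k x; rewrite pureZr.
by move=> x y; rewrite pureDr.
Qed.

Lemma iota_rel : forall r, prels (f_pres q C d) r -> feval theta r = 0.
Proof. exact/f_hom/serre_theta. Qed.
Lemma iB1 : iota 1 = 1. Proof. exact: (peval1 iota_rel). Qed.
Lemma iBM x y : iota (x * y) = iota x * iota y. Proof. exact: (pevalM iota_rel). Qed.
Lemma iBD x y : iota (x + y) = iota x + iota y. Proof. exact: (pevalD iota_rel). Qed.
Lemma iBB x y : iota (x - y) = iota x - iota y. Proof. exact: (pevalB iota_rel). Qed.
Lemma iBZ k x : iota (k *: x) = k *: iota x. Proof. exact: (pevalZ iota_rel). Qed.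
Lemma iB0 : iota 0 = 0. Proof. exact: (peval0 iota_rel). Qed.
Lemma iB_sum J (s : seq J) (Q : pred J) (F : J -> f) :
  iota (\sum_(j <- s | Q j) F j) = \sum_(j <- s | Q j) iota (F j).
Proof. exact: (peval_sum iota_rel). Qed.
Lemma iB_theta i : iota (ftheta i) = theta i.
Proof. exact: (peval_gen iota_rel). Qed.

Lemma f_indl (Q : f -> Prop) :
  Q 1 -> (forall k a, Q a -> Q (k *: a)) -> (forall a b, Q a -> Q b -> Q (a + b)) ->
  (forall i a, Q a -> Q (ftheta i * a)) -> forall a, Q a.
Proof. exact: (@pres_indl _ _ (f_pres q C d)). Qed.
Lemma f_indr (Q : f -> Prop) :
  Q 1 -> (forall k a, Q a -> Q (k *: a)) -> (forall a b, Q a -> Q b -> Q (a + b)) ->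
  (forall i a, Q a -> Q (a * ftheta i)) -> forall a, Q a.
Proof. exact: (@pres_indr _ _ (f_pres q C d)). Qed.
Lemma B_indl (Q : B -> Prop) :
  Q 1 -> (forall k a, Q a -> Q (k *: a)) -> (forall a b, Q a -> Q b -> Q (a + b)) ->
  (forall i a, Q a -> Q (theta i * a)) -> (forall i a, Q a -> Q (hh i * a)) ->
  forall a, Q a.
Proof. by move=> h1 h2 h3 h4 h5; apply: pres_indl => // -[i|i] a; [apply: h4|apply: h5]. Qed.

(* The algebra map forgetting the h_i splits the inclusion of f. *)
Definition pi0 : B -> f :=
  peval (fun y : Bgen I => match y with inl i => ftheta i | inr _ => 0 end).
Lemma pi0_rel : forall r, prels (B_pres q C d) r ->
  feval (fun y : Bgen I => match y with inl i => ftheta i | inr _ => 0 : f end) r = 0.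
Proof.
apply: B_hom => [|i j|i j]; first exact: serre_ftheta.
  by rewrite mul0r.
by rewrite mul0r mulr0 scaler0.
Qed.
Lemma iotaK : cancel iota pi0.
Proof.
move=> x; elim/f_indl: x => [|k a IH|a b IHa IHb|i a IH].
- by rewrite iB1 /pi0 (peval1 pi0_rel).
- by rewrite iBZ /pi0 (pevalZ pi0_rel) -/(pi0 _) IH.
- by rewrite iBD /pi0 (pevalD pi0_rel) -!/(pi0 _) IHa IHb.
by rewrite iBM iB_theta /pi0 (pevalM pi0_rel) -!/(pi0 _) IH /pi0 (peval_gen pi0_rel).
Qed.
Lemma iota_inj : injective iota. Proof. exact: can_inj iotaK. Qed.
Lemma pi0Z k x : pi0 (k *: x) = k *: pi0 x. Proof. exact: (pevalZ pi0_rel). Qed.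
Lemma pi0D x y : pi0 (x + y) = pi0 x + pi0 y. Proof. exact: (pevalD pi0_rel). Qed.

(** Conjugation by $h_i$ restricted to [f] (see [hh_iota]), a scalar on each weight space. *)
Definition kap (i : I) : f -> f := peval (fun j => vi i ^ C i j *: ftheta j).
Lemma kap_rel i : forall r, prels (f_pres q C d) r ->
  feval (fun j => vi i ^ C i j *: ftheta j) r = 0.
Proof. by apply/f_hom/serre_scale/serre_ftheta. Qed.
Lemma kap1 i : kap i 1 = 1. Proof. exact: (peval1 (kap_rel i)). Qed.
Lemma kapM i x y : kap i (x * y) = kap i x * kap i y. Proof. exact: (pevalM (kap_rel i)). Qed.
Lemma kapD i x y : kap i (x + y) = kap i x + kap i y. Proof. exact: (pevalD (kap_rel i)). Qed.
Lemma kapZ i k x : kap i (k *: x) = k *: kap i x. Proof. exact: (pevalZ (kap_rel i)). Qed.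
Lemma kap0 i : kap i 0 = 0. Proof. exact: (peval0 (kap_rel i)). Qed.
Lemma kap_theta i j : kap i (ftheta j) = vi i ^ C i j *: ftheta j.
Proof. exact: (peval_gen (kap_rel i)). Qed.

Local Notation opf := (opalg f).
(** The anti-involution fixing every $\vartheta_i$, obtained as a homomorphism into the opposite
    algebra. *)
Definition sig : f -> opf := peval (ftheta : I -> opf).
Lemma sig_rel : forall r, prels (f_pres q C d) r -> feval (ftheta : I -> opf) r = 0.
Proof. exact/f_hom/serre_op/serre_ftheta. Qed.
Lemma sig1 : sig 1 = 1 :> f. Proof. exact: (peval1 sig_rel). Qed.
Lemma sigM x y : sig (x * y) = (sig y : f) * (sig x : f) :> f.
Proof. exact: (pevalM sig_rel). Qed.
Lemma sigD x y : sig (x + y) = (sig x : f) + (sig y : f) :> f.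
Proof. exact: (pevalD sig_rel). Qed.
Lemma sigZ k x : sig (k *: x) = k *: (sig x : f) :> f. Proof. exact: (pevalZ sig_rel). Qed.
Lemma sig_theta i : sig (ftheta i) = ftheta i. Proof. exact: (peval_gen sig_rel). Qed.
Lemma sigK x : sig (sig x) = x.
Proof.
elim/f_indl: x => [|k a IH|a b IHa IHb|k a IH]; first by rewrite !sig1.
- by rewrite sigZ sigZ IH.
- by rewrite sigD sigD IHa IHb.
by rewrite sigM sigM sig_theta sig_theta IH.
Qed.
Lemma kap_sig i x : kap i (sig x) = sig (kap i x).
Proof.
elim/f_indl: x => [|k a IH|a b IHa IHb|k a IH].
- by rewrite kap1 !sig1 kap1.
- by rewrite sigZ !kapZ sigZ IH.
- by rewrite sigD !kapD sigD IHa IHb.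
by rewrite sigM !kapM sigM IH kap_theta sigZ sig_theta kap_theta.
Qed.

Local Notation T := (tens B).
Definition Dgen (x : Bgen I) : T :=
  match x with
  | inl i => pure (theta i) 1 + pure (hh i) (theta i)
  | inr i => pure (hh i) (hh i)
  end.

Lemma Dgen_rel : forall r, prels (B_pres q C d) r -> feval Dgen r = 0.
Proof.
have [h1 h2 h3] := coprod_rels (serre_theta q C d) (@hhC _ q _ C d) (@hh_theta _ q _ C d).
exact: B_hom h1 h2 h3.
Qed.

End HalfQuantumGroup.

(** * The coproduct and its contractions with linear functionals *)

Section Coproduct.
Variables (Kv : fieldType) (q : Kv) (I : finType) (C : I -> I -> int) (d : I -> nat).
Hypothesis q0 : q != 0.
Hypothesis q_nroot : forall n, q ^+ n.+1 != 1.
Hypothesis hC : finite_cartan C d.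
Local Notation B := (Bhat q C d).
Local Notation theta := (theta q C d).
Local Notation hh := (hh q C d).
Local Notation Dl := (peval (@Dgen Kv q I C d)).
Let D_rel := Dgen_rel q0 q_nroot hC.

Lemma coprod_word_cls (w : seq (Bgen I)) :
  tcls (coprod_word q C d w) = \prod_(x <- w) Dgen q C d x.
Proof.
elim: w => [|x w IH] /=; first by rewrite big_nil.
rewrite big_cons -IH !tcls_sum big_allpairs_dep.
have -> : Dgen q C d x = \sum_(t <- coprod_gen q C d x) pure t.1 t.2.
  by case: x => i; rewrite /= ?big_cons big_nil !addr0.
rewrite mulr_suml; apply: eq_bigr => t _; rewrite mulr_sumr.
by apply: eq_bigr => u _; rewrite /= pureM.
Qed.

(** The list depends on a representative in the free algebra; its class does not, being the value of
    the homomorphism given by [Dgen] on the generators. *)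
Lemma coprod_cls (a : B) : tcls (coprod a) = Dl a.
Proof.
rewrite /coprod tcls_sum big_flatten big_map /peval /feval.
apply: eq_bigr => w _; rewrite big_map -coprod_word_cls tcls_sum scaler_sumr.
by apply: eq_bigr => t _; rewrite pureZl.
Qed.

Lemma coprodE (m : B -> B -> B) a : bilin m ->
  \sum_(t <- coprod a) m t.1 t.2 = tevq m (Dl a).
Proof. by move=> bm; rewrite -coprod_cls tevq_cls. Qed.

Definition linf (l : B -> Kv) := forall k a b, l (k *: a + b) = k * l a + l b.

(** Contraction of the first leg of the coproduct; [cR] contracts the second. For [l = phi a] they
    are adjoint to multiplication by [a] on the left and on the right ([phiML], [phiMR]). *)
Definition cL (l : B -> Kv) (a : B) : B := \sum_(t <- coprod a) l t.1 *: t.2.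
Definition cR (l : B -> Kv) (a : B) : B := \sum_(t <- coprod a) l t.2 *: t.1.

Lemma bilin_cL l : linf l -> bilin (fun x y : B => l x *: y).
Proof.
move=> hl; split=> k a b c; first by rewrite hl scalerDl scalerA.
by rewrite scalerDr !scalerA mulrC.
Qed.
Lemma bilin_cR l : linf l -> bilin (fun x y : B => l y *: x).
Proof.
move=> hl; split=> k a b c; last by rewrite hl scalerDl scalerA.
by rewrite scalerDr !scalerA mulrC.
Qed.

Lemma cLE l a : linf l -> cL l a = tevq (fun x y => l x *: y) (Dl a).
Proof. by move=> /bilin_cL bl; rewrite -coprodE. Qed.
Lemma cRE l a : linf l -> cR l a = tevq (fun x y => l y *: x) (Dl a).
Proof. by move=> /bilin_cR bl; rewrite -coprodE. Qed.

Lemma cLD l k a b : linf l -> cL l (k *: a + b) = k *: cL l a + cL l b.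
Proof.
move=> hl; rewrite !cLE // (pevalD D_rel) (pevalZ D_rel).
by rewrite tevq_add ?tevq_scale //; apply: bilin_cL.
Qed.
Lemma cRD l k a b : linf l -> cR l (k *: a + b) = k *: cR l a + cR l b.
Proof.
move=> hl; rewrite !cRE // (pevalD D_rel) (pevalZ D_rel).
by rewrite tevq_add ?tevq_scale //; apply: bilin_cR.
Qed.
Lemma cL_theta l i : linf l -> cL l (theta i) = l (theta i) *: 1 + l (hh i) *: theta i.
Proof.
move=> hl; rewrite cLE // (peval_gen D_rel) tevq_add; last exact: bilin_cL.
by rewrite !tevq_pure //; apply: bilin_cL.
Qed.
Lemma cL_h l i : linf l -> cL l (hh i) = l (hh i) *: hh i.
Proof. by move=> hl; rewrite cLE // (peval_gen D_rel) tevq_pure //; apply: bilin_cL. Qed.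
Lemma cR_theta l i : linf l -> cR l (theta i) = l 1 *: theta i + l (theta i) *: hh i.
Proof.
move=> hl; rewrite cRE // (peval_gen D_rel) tevq_add; last exact: bilin_cR.
by rewrite !tevq_pure //; apply: bilin_cR.
Qed.
Lemma cR_h l i : linf l -> cR l (hh i) = l (hh i) *: hh i.
Proof. by move=> hl; rewrite cRE // (peval_gen D_rel) tevq_pure //; apply: bilin_cR. Qed.
Lemma cL1 l : linf l -> cL l 1 = l 1 *: 1.
Proof. by move=> hl; rewrite cLE // (peval1 D_rel) tevq_one //; apply: bilin_cL. Qed.
Lemma cR1 l : linf l -> cR l 1 = l 1 *: 1.
Proof. by move=> hl; rewrite cRE // (peval1 D_rel) tevq_one //; apply: bilin_cR. Qed.

(** Multiplicativity of the coproduct turns a rule for $l(xy)$ into the same rule for [cL l]. Two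
    terms cover both cases that occur: characters, with second term 0, and the skew-primitive
    functional $\varphi(\vartheta_i,-)$. *)
Lemma cL_mul l a1 b1 a2 b2 x y :
  (forall x y, l (x * y) = a1 x * b1 y + a2 x * b2 y) ->
  linf l -> linf a1 -> linf b1 -> linf a2 -> linf b2 ->
  cL l (x * y) = cL a1 x * cL b1 y + cL a2 x * cL b2 y.
Proof.
move=> E hl h1 h2 h3 h4; rewrite cLE // (pevalM D_rel) tevq_mul; last exact: bilin_cL.
rewrite -!coprod_cls /tevq.
have H (m : B -> B -> B) : bilin m -> tev m (repr (tcls (coprod x))) = tev m (coprod x).
  by move=> bm; apply: tevq_cls.
rewrite H; last exact: (bilin_tev (tcls (coprod y)) (bilin_cL hl)).
rewrite /tev /cL !mulr_suml -big_split; apply: eq_bigr => s _.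
rewrite -[\sum_(t <- repr _) _]/(tevq (fun x' y' => l (s.1 * x') *: (s.2 * y')) _).
rewrite tevq_cls; last exact: (bilin_mulr _ _ (bilin_cL hl)).
rewrite /tev !mulr_sumr -big_split; apply: eq_bigr => t _.
by rewrite E scalerDl -!scalerAl -!scalerAr !scalerA.
Qed.

Lemma cR_mul l a1 b1 a2 b2 x y :
  (forall x y, l (x * y) = a1 x * b1 y + a2 x * b2 y) ->
  linf l -> linf a1 -> linf b1 -> linf a2 -> linf b2 ->
  cR l (x * y) = cR a1 x * cR b1 y + cR a2 x * cR b2 y.
Proof.
move=> E hl h1 h2 h3 h4; rewrite cRE // (pevalM D_rel) tevq_mul; last exact: bilin_cR.
rewrite -!coprod_cls /tevq.
have H (m : B -> B -> B) : bilin m -> tev m (repr (tcls (coprod x))) = tev m (coprod x).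
  by move=> bm; apply: tevq_cls.
rewrite H; last exact: (bilin_tev (tcls (coprod y)) (bilin_cR hl)).
rewrite /tev /cR !mulr_suml -big_split; apply: eq_bigr => s _.
rewrite -[\sum_(t <- repr _) _]/(tevq (fun x' y' => l (s.2 * y') *: (s.1 * x')) _).
rewrite tevq_cls; last exact: (bilin_mulr _ _ (bilin_cR hl)).
rewrite /tev !mulr_sumr -big_split; apply: eq_bigr => t _.
by rewrite E scalerDl -!scalerAl -!scalerAr !scalerA.
Qed.

Variable phi : B -> B -> Kv.
Hypothesis hphi : hopf_pairing phi.

Lemma linf_phir a : linf (phi a). Proof. by move=> k x y; apply: phi_linr. Qed.
Lemma linf0 : linf (fun _ => 0). Proof. by move=> k x y; rewrite mulr0 addr0. Qed.

Lemma linf_sum l (J : Type) (s : seq J) (F : J -> B) : linf l ->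
  l (\sum_(j <- s) F j) = \sum_(j <- s) l (F j).
Proof.
move=> hl; have l0 : l 0 = 0.
  by have := hl (-1) 0 0; rewrite scaler0 addr0 mulN1r addNr.
apply: (big_morph l _ l0) => x y; by have := hl 1 x y; rewrite scale1r mul1r.
Qed.
Lemma linfZ l k x : linf l -> l (k *: x) = k * l x.
Proof.
move=> hl; have l0 : l 0 = 0.
  by have := hl (-1) 0 0; rewrite scaler0 addr0 mulN1r addNr.
by have := hl k x 0; rewrite !addr0 l0 addr0.
Qed.

Lemma phiML a b c : phi (a * b) c = phi b (cL (phi a) c).
Proof.
rewrite (phi_mull hphi) (linf_sum _ _ (linf_phir b)); apply: eq_bigr => t _.
by rewrite (linfZ _ _ (linf_phir b)).
Qed.
Lemma phiMR a b c : phi (a * b) c = phi a (cR (phi b) c).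
Proof.
rewrite (phi_mull hphi) (linf_sum _ _ (linf_phir a)); apply: eq_bigr => t _.
by rewrite (linfZ _ _ (linf_phir a)) mulrC.
Qed.

Lemma counit1 : counit (1 : B) = 1.
Proof. by rewrite /counit (@peval1 _ _ (B_pres q C d) Kv^o) //; apply: B_augP. Qed.
Lemma counitM (x y : B) : counit (x * y) = counit x * counit y.
Proof. by rewrite /counit (@pevalM _ _ (B_pres q C d) Kv^o) //; apply: B_augP. Qed.
Lemma counit_theta i : counit (theta i) = 0.
Proof. by rewrite /counit (@peval_gen _ _ (B_pres q C d) Kv^o) //; apply: B_augP. Qed.
Lemma counit_h i : counit (hh i) = 1.
Proof. by rewrite /counit (@peval_gen _ _ (B_pres q C d) Kv^o) //; apply: B_augP. Qed.
Lemma linf_counit : linf (@counit Kv q I C d).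
Proof. by move=> k a b; rewrite -!(phi_unit hphi) phi_linr. Qed.

Lemma phi_theta_mul i x y :
  phi (theta i) (x * y) = phi (theta i) x * counit y + phi (hh i) x * phi (theta i) y.
Proof.
rewrite (phi_sym hphi) phiML cL_theta; last exact: linf_phir.
rewrite (phi_linr hphi) (linfZ _ _ (linf_phir _)) -(phi_sym hphi 1) (phi_unit hphi).
by rewrite -(phi_sym hphi (theta i)) -(phi_sym hphi (theta i)) -(phi_sym hphi (hh i)).
Qed.
Lemma phi_h_mul i x y : phi (hh i) (x * y) = phi (hh i) x * phi (hh i) y.
Proof.
rewrite (phi_sym hphi) phiML cL_h; last exact: linf_phir.
by rewrite (linfZ _ _ (linf_phir _)) -!(phi_sym hphi (hh i)).
Qed.
Lemma phi_h_theta i j : phi (hh i) (theta j) = 0.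
Proof. by rewrite (phi_sym hphi) (phi_theta_h hphi). Qed.

End Coproduct.

(** * Skew derivations as adjoints of multiplication by a generator *)

Section SkewDerivations.
Variables (Kv : fieldType) (q : Kv) (I : finType) (C : I -> I -> int) (d : I -> nat).
Hypothesis q0 : q != 0.
Hypothesis q_nroot : forall n, q ^+ n.+1 != 1.
Hypothesis hC : finite_cartan C d.
Local Notation vi := (vi q d).
Local Notation f := (fAlg q C d).
Local Notation B := (Bhat q C d).
Local Notation theta := (theta q C d).
Local Notation hh := (hh q C d).
Local Notation ftheta := (ftheta q C d).
Local Notation iota := (@iotaB Kv q I C d).
Variable phi : B -> B -> Kv.
Hypothesis hphi : hopf_pairing phi.
Local Notation kap := (@kap Kv q I C d).
Local Notation sig := (@sig Kv q I C d).
Local Notation pi0 := (@pi0 Kv q I C d).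

Definition ip (x y : f) := phi (iota x) (iota y).
Definition eps (x : f) := counit (iota x).
Definition den i := vi i - (vi i)^-1.
Lemma ipE x y : ip x y = phi (iota x) (iota y). Proof. by []. Qed.
Lemma denE i : den i = vi i - (vi i)^-1. Proof. by []. Qed.

Lemma den_neq0 i : den i != 0. Proof. exact: (vi_den q0 q_nroot hC). Qed.

Lemma ipC x y : ip x y = ip y x. Proof. exact: phi_sym. Qed.
Lemma ip_linl k x y z : ip (k *: x + y) z = k * ip x z + ip y z.
Proof. by rewrite /ip iBD iBZ phi_linl. Qed.
Lemma ipDl x y z : ip (x + y) z = ip x z + ip y z.
Proof. by have := ip_linl 1 x y z; rewrite scale1r mul1r. Qed.
Lemma ip0l z : ip 0 z = 0.
Proof. by have := ip_linl (-1) 0 0 z; rewrite scaler0 addr0 mulN1r addNr. Qed.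
Lemma ipZl k x z : ip (k *: x) z = k * ip x z.
Proof. by have := ip_linl k x 0 z; rewrite !addr0 ip0l addr0. Qed.
Lemma ipDr x y z : ip z (x + y) = ip z x + ip z y. Proof. by rewrite !(ipC z) ipDl. Qed.
Lemma ip0r z : ip z 0 = 0. Proof. by rewrite ipC ip0l. Qed.
Lemma ipZr k x z : ip z (k *: x) = k * ip z x. Proof. by rewrite !(ipC z) ipZl. Qed.
Lemma ipNr x z : ip z (- x) = - ip z x. Proof. by rewrite -scaleN1r ipZr mulN1r. Qed.
Lemma ipBr x y z : ip z (x - y) = ip z x - ip z y. Proof. by rewrite ipDr ipNr. Qed.
Lemma ip_suml J (s : seq J) (Q : pred J) (F : J -> f) z :
  ip (\sum_(j <- s | Q j) F j) z = \sum_(j <- s | Q j) ip (F j) z.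
Proof. by apply: (big_morph (ip^~ z) _ (ip0l z)) => x y; apply: ipDl. Qed.
Lemma ip_sumr J (s : seq J) (Q : pred J) (F : J -> f) z :
  ip z (\sum_(j <- s | Q j) F j) = \sum_(j <- s | Q j) ip z (F j).
Proof. by apply: (big_morph (ip z) _ (ip0r z)) => x y; apply: ipDr. Qed.

Lemma ip1 x : ip 1 x = eps x. Proof. by rewrite /ip iB1 (phi_unit hphi). Qed.
Lemma epsD x y : eps (x + y) = eps x + eps y. Proof. by rewrite -!ip1 ipDr. Qed.
Lemma epsZ k x : eps (k *: x) = k * eps x. Proof. by rewrite -!ip1 ipZr. Qed.
Lemma eps1 : eps 1 = 1. Proof. by rewrite /eps iB1 // counit1. Qed.
Lemma epsM x y : eps (x * y) = eps x * eps y.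
Proof. by rewrite /eps iBM counitM. Qed.
Lemma eps_theta i : eps (ftheta i) = 0. Proof. by rewrite /eps iB_theta // counit_theta. Qed.

Lemma cLZ l k x : linf l -> cL l (k *: x) = k *: cL l x :> B.
Proof.
move=> hl; have l0 : cL l 0 = 0 :> B.
  have := cLD q0 q_nroot hC 1 0 0 hl; rewrite !scale1r addr0 => E.
  by apply: (@addrI _ (cL l 0)); rewrite -E addr0.
by have := cLD q0 q_nroot hC k x 0 hl; rewrite l0 !addr0.
Qed.

Lemma cL_counit x : cL (@counit Kv q I C d) (iota x) = iota x.
Proof.
have hl := linf_counit hphi.
elim/f_indl: x => [|k a IH|a b IHa IHb|i a IH].
- by rewrite iB1 // cL1 // counit1 scale1r.
- by rewrite iBZ // cLZ // IH.
- by rewrite iBD // -[iota a]scale1r cLD // IHa IHb !scale1r.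
rewrite iBM // iB_theta // (cL_mul q0 q_nroot hC (l := @counit _ q _ C d) (a1 := @counit _ q _ C d)
  (b1 := @counit _ q _ C d) (a2 := fun _ => 0) (b2 := fun _ => 0)); try exact: linf0; try exact: hl.
  rewrite IH cL_theta // counit_theta counit_h scale0r add0r scale1r.
  rewrite cL_theta //; last exact: linf0.
  by rewrite !scale0r addr0 mul0r addr0.
by move=> x y; rewrite counitM mul0r addr0.
Qed.

Lemma cL_h_kap i x : cL (phi (hh i)) (iota x) = iota (kap i x).
Proof.
have hl := linf_phir hphi (hh i).
elim/f_indl: x => [|k a IH|a b IHa IHb|j a IH].
- by rewrite kap1 // iB1 // cL1 // (phi_sym hphi) (phi_unit hphi) counit_h scale1r.
- by rewrite kapZ // !iBZ // cLZ // IH.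
- by rewrite kapD // !iBD // -[iota a]scale1r cLD // IHa IHb !scale1r.
rewrite iBM // iB_theta // (cL_mul q0 q_nroot hC (l := phi (hh i)) (a1 := phi (hh i))
  (b1 := phi (hh i)) (a2 := fun _ => 0) (b2 := fun _ => 0)); try exact: linf0; try exact: hl.
  rewrite IH cL_theta // (phi_h_theta hphi) (phi_h hphi) scale0r add0r.
  rewrite cL_theta //; last exact: linf0.
  by rewrite !scale0r addr0 mul0r addr0 kapM // kap_theta // iBM // iBZ // iB_theta.
by move=> x y; rewrite (phi_h_mul q0 q_nroot hC hphi) mul0r addr0.
Qed.

Fact dL_key : unit. Proof. by []. Qed.
(* Locked: dL would otherwise unify with any scaled term. *)
Definition dL i : f -> f :=
  locked_with dL_key (fun x => (den i)^-1 *: pi0 (cL (phi (theta i)) (iota x))).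
Lemma dLE i x : dL i x = (den i)^-1 *: pi0 (cL (phi (theta i)) (iota x)).
Proof. by rewrite /dL unlock. Qed.

Lemma cL_theta_mul i x y : cL (phi (theta i)) (iota x * iota y) =
  cL (phi (theta i)) (iota x) * iota y + iota (kap i x) * cL (phi (theta i)) (iota y).
Proof.
rewrite (cL_mul q0 q_nroot hC (a1 := phi (theta i)) (b1 := @counit Kv q I C d)
  (a2 := phi (hh i)) (b2 := phi (theta i))); try exact: (linf_phir hphi).
- by rewrite cL_counit cL_h_kap.
- by move=> a b; rewrite (phi_theta_mul q0 q_nroot hC hphi).
- exact: (linf_counit hphi).
Qed.

(** The contraction stays in the image of [f], since $\varphi(\vartheta_i,h_j)=0$ leaves only
    $\vartheta_j\otimes1$ from the coproduct of a generator; so [pi0] in the definition of [dL]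
    loses nothing. *)
Lemma cL_thetaE i x : cL (phi (theta i)) (iota x) = den i *: iota (dL i x).
Proof.
suff [y E] : exists y, cL (phi (theta i)) (iota x) = iota y.
  by rewrite dLE E iBZ // iotaK // scalerA divff ?den_neq0 // scale1r.
have hl := linf_phir hphi (theta i).
elim/f_indl: x => [|k a [y IH]|a b [y IHa] [z IHb]|j a [y IH]].
- exists 0; rewrite iB1 // cL1 // (phi_sym hphi) (phi_unit hphi) counit_theta.
  by rewrite scale0r iB0.
- by exists (k *: y); rewrite !iBZ // cLZ // IH.
- by exists (y + z); rewrite !iBD // -[iota a]scale1r cLD // IHa IHb !scale1r.
exists (phi (theta i) (theta j) *: a + kap i (ftheta j) * y).
rewrite iBM // cL_theta_mul IH iBD // iBZ // iBM //; congr (_ + _).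
by rewrite iB_theta // cL_theta // (phi_theta_h hphi) scale0r addr0 -scalerAl mul1r.
Qed.

Lemma dL_mul i x y : dL i (x * y) = dL i x * y + kap i x * dL i y.
Proof.
have H (a b : f) : den i *: iota a = den i *: iota b -> a = b.
  move=> /(congr1 (fun z => (den i)^-1 *: z)); rewrite !scalerA mulVf ?den_neq0 //.
  by rewrite !scale1r => /iota_inj.
apply: H; rewrite -cL_thetaE iBM // cL_theta_mul !cL_thetaE iBD // !iBM //.
by rewrite scalerDr scalerAl scalerAr.
Qed.
Lemma dL_lin i k x y : dL i (k *: x + y) = k *: dL i x + dL i y.
Proof.
rewrite !dLE iBD // iBZ // cLD //; last exact: (linf_phir hphi).
by rewrite pi0D // pi0Z // scalerDr !scalerA mulrC.
Qed.
Lemma dLD i x y : dL i (x + y) = dL i x + dL i y.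
Proof. by have := dL_lin i 1 x y; rewrite !scale1r. Qed.
Lemma dL0 i : dL i 0 = 0.
Proof. by have := dL_lin i (-1) 0 0; rewrite scaler0 addr0 scaleN1r addNr. Qed.
Lemma dLZ i k x : dL i (k *: x) = k *: dL i x.
Proof. by have := dL_lin i k x 0; rewrite !addr0 dL0 addr0. Qed.
Lemma dL_sum i J (s : seq J) (Q : pred J) (F : J -> f) :
  dL i (\sum_(j <- s | Q j) F j) = \sum_(j <- s | Q j) dL i (F j).
Proof. by apply: (big_morph (dL i) _ (dL0 i)) => x y; apply: dLD. Qed.
Lemma dL_theta i j : dL i (ftheta j) = (i == j)%:R.
Proof.
rewrite dLE iB_theta // cL_theta //; last exact: (linf_phir hphi).
rewrite (phi_theta_h hphi) scale0r addr0 (phi_theta hphi) pi0Z // -iB1 iotaK //.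
by case: eqP => _; rewrite scalerA ?mulVf ?den_neq0 ?scale1r // mulr0 scale0r.
Qed.
Lemma dL1 i : dL i 1 = 0.
Proof.
have := dL_mul i 1 1; rewrite !mulr1 kap1 // mul1r => E.
by apply: (@addrI _ (dL i 1)); rewrite -E addr0.
Qed.
Lemma dL_thetaM i j x : dL i (ftheta j * x) =
  (i == j)%:R *: x + vi i ^ C i j *: (ftheta j * dL i x).
Proof.
rewrite dL_mul dL_theta kap_theta // scalerAl; congr (_ + _ ).
by case: eqP; rewrite ?scale1r ?mul1r // scale0r mul0r.
Qed.

Lemma ip_thetaM i x y : ip (ftheta i * x) y = den i * ip x (dL i y).
Proof.
rewrite /ip iBM // phiML // iB_theta // cL_thetaE.
by rewrite (linfZ _ _ (linf_phir hphi _)).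
Qed.

(** Transported along [sig], so that the rules for [dL] carry over. That it is adjoint to right
    multiplication is a separate fact, [ip_Mtheta]. *)
Definition dR i : f -> f := locked_with dL_key (fun x => sig (dL i (sig x)) : f).
Lemma dRE i x : dR i x = sig (dL i (sig x)).
Proof. by rewrite /dR unlock. Qed.
Lemma dRD i x y : dR i (x + y) = dR i x + dR i y.
Proof. by rewrite !dRE sigD // dLD sigD. Qed.
Lemma dRZ i k x : dR i (k *: x) = k *: dR i x.
Proof. by rewrite !dRE sigZ // dLZ sigZ. Qed.
Lemma dR0 i : dR i 0 = 0. Proof. by rewrite -(scale0r 0) dRZ !scale0r. Qed.
Lemma dR_sum i J (s : seq J) (Q : pred J) (F : J -> f) :
  dR i (\sum_(j <- s | Q j) F j) = \sum_(j <- s | Q j) dR i (F j).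
Proof. by apply: (big_morph (dR i) _ (dR0 i)) => x y; apply: dRD. Qed.
Lemma sig0 : sig 0 = 0 :> f.
Proof. by have := @sigZ Kv q I C d 0 0; rewrite !scale0r. Qed.
Lemma dR1 i : dR i 1 = 0.
Proof. by rewrite !dRE sig1 // dL1 sig0. Qed.
Lemma dR_mul i x y : dR i (x * y) = x * dR i y + dR i x * kap i y.
Proof.
rewrite !dRE sigM // dL_mul sigD // !sigM // sigK // kap_sig // sigK //.
Qed.
Lemma dR_theta i j : dR i (ftheta j) = (i == j)%:R.
Proof.
rewrite !dRE sig_theta // dL_theta; case: eqP => _; first exact: sig1.
exact: sig0.
Qed.
Lemma dR_Mtheta i j x : dR i (x * ftheta j) =
  (i == j)%:R *: x + vi i ^ C i j *: (dR i x * ftheta j).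
Proof.
rewrite dR_mul dR_theta kap_theta // scalerAr; congr (_ + _ ).
by case: eqP; rewrite ?scale1r ?mulr1 // scale0r mulr0.
Qed.

Lemma kap_dL i j x : dL i (kap j x) = vi i ^ C i j *: kap j (dL i x).
Proof.
elim/f_indl: x => [|k a IH|a b IHa IHb|k a IH].
- by rewrite kap1 // dL1 -(scale0r 1) kapZ // !scale0r scaler0.
- by rewrite kapZ // !dLZ IH kapZ // !scalerA mulrC.
- by rewrite kapD // !dLD IHa IHb kapD // scalerDr.
rewrite kapM // kap_theta // -scalerAl dLZ !dL_thetaM IH kapD // !kapZ // kapM // kap_theta //.
rewrite !scalerDr !scalerA -!scalerAl -!scalerAr !scalerA; congr (_ *: _ + _ *: _).
  by case: eqP => [->|_]; rewrite ?mulr0 // !mulr1 viCC.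
by ring.
Qed.

Lemma dL_dR i j x : dL i (dR j x) = dR j (dL i x).
Proof.
elim/f_indl: x => [|k a IH|a b IHa IHb|k a IH].
- by rewrite dR1 dL0 dL1 dR0.
- by rewrite dRZ !dLZ dRZ IH.
- by rewrite dRD !dLD dRD IHa IHb.
rewrite dR_mul dR_theta dL_thetaM dLD dRD !dRZ dL_thetaM IH dR_mul dR_theta.
rewrite scalerDr -!addrA; congr (_ + (_ + _)).
case: eqP => [->|_]; last by rewrite !mul0r dL0 scaler0.
by rewrite !mul1r kap_dL.
Qed.

Lemma eps_dL i x : eps (dL i x) = eps (dR i x).
Proof.
elim/f_indl: x => [|k a IH|a b IHa IHb|k a IH].
- by rewrite dL1 dR1.
- by rewrite dLZ dRZ !epsZ IH.
- by rewrite dLD dRD !epsD IHa IHb.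
have kapeps z : eps (kap i z) = eps z.
  elim/f_indl: z => [|c y IHy|y z IHy IHz|c y IHy]; first by rewrite kap1.
  - by rewrite kapZ // !epsZ IHy.
  - by rewrite kapD // !epsD IHy IHz.
  by rewrite kapM // kap_theta // !epsM epsZ eps_theta mulr0 !mul0r.
rewrite dL_thetaM dR_mul dR_theta epsD epsZ epsZ !epsD !epsM eps_theta !mul0r mulr0 addr0 add0r.
have e0 : eps 0 = 0 by have := epsZ 0 0; rewrite scale0r mul0r.
by rewrite kapeps; case: eqP => _; rewrite ?eps1 ?e0.
Qed.

(** Left factors of $x$ are moved across the form by [dL], which commutes with [dR]. What remains is
    $x=1$, where both derivations have the same counit ([eps_dL]). *)
Lemma ip_Mtheta i x y : ip (x * ftheta i) y = den i * ip x (dR i y).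
Proof.
elim/f_indl: x y => [|k a IH|a b IHa IHb|k a IH] y.
- by rewrite mul1r -[ftheta i]mulr1 ip_thetaM !ip1 eps_dL.
- by rewrite -scalerAl !ipZl IH mulrCA.
- by rewrite mulrDl !ipDl IHa IHb mulrDr.
by rewrite -mulrA !ip_thetaM IH dL_dR mulrCA.
Qed.

Lemma homog_theta i : homog (@deg_f I) (sroot i) (ftheta i).
Proof. exact: (@homog_gen _ _ _ (f_pres q C d) (@deg_f I)). Qed.

End SkewDerivations.

(** * Integrality of the lattice dual to the integral form *)

Section RankOne.
Variables (Kv : fieldType) (q : Kv) (I : finType) (C : I -> I -> int) (d : I -> nat).
Hypothesis q0 : q != 0.
Hypothesis q_nroot : forall n, q ^+ n.+1 != 1.
Hypothesis hC : finite_cartan C d.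
Local Notation v := (v q).
Local Notation vi := (vi q d).
Local Notation f := (fAlg q C d).
Local Notation B := (Bhat q C d).
Local Notation ftheta := (ftheta q C d).
Local Notation N := (Nroot I).
Variable phi : B -> B -> Kv.
Hypothesis hphi : hopf_pairing phi.
Local Notation kap := (@kap Kv q I C d).
Local Notation dL := (dL phi).
Local Notation dR := (dR phi).
Local Notation den := (den q d).
Variable i : I.
Local Notation u := (vi i).
Local Notation th := (ftheta i).
Local Notation dp := (divpow u).
Let u0 := vi_neq0 d q0 i.
Let uq := vi_qint q0 q_nroot hC i.

Lemma qint1 (K : fieldType) (w : K) : (forall n, qint w n.+1 != 0) -> qint w 1 = 1.
Proof. by move=> h; rewrite /qint expr1 divff ?(qden_neq0 h). Qed.

Lemma doubleSz p : (p.+1).*2%:Z = p.*2%:Z + 2.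
Proof. by rewrite doubleS -PoszD addn2. Qed.

Lemma dL_nil (j : I) (x : f) : exists m, iter m (dL j) x = 0.
Proof.
have iD m (a b : f) : iter m (dL j) (a + b) = iter m (dL j) a + iter m (dL j) b.
  by elim: m => //= m ->; rewrite dLD //.
have iZ m k (a : f) : iter m (dL j) (k *: a) = k *: iter m (dL j) a.
  by elim: m => //= m ->; rewrite dLZ //.
have i0 m : iter m (dL j) 0 = 0 by have := iZ m 0 0; rewrite !scale0r.
elim/f_indl: x => [|k a [m IH]|a b [m IHa] [m' IHb]|k a [m IH]].
- by exists 1%N; rewrite /= dL1 //.
- by exists m; rewrite iZ IH scaler0.
- by exists (m + m')%N; rewrite iD [in X in X + _]addnC !iterD IHa IHb !i0 addr0.
exists m.+1; elim: m a IH => [|m IHm] a E.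
  by rewrite /= in E; rewrite E mulr0 /= dL0.
rewrite iterSr dL_thetaM // iD !iZ E scaler0 add0r IHm ?scaler0 //.
by rewrite -iterSr.
Qed.

Lemma dR_nil (j : I) (x : f) : exists m, iter m (dR j) x = 0.
Proof.
have iD m (a b : f) : iter m (dR j) (a + b) = iter m (dR j) a + iter m (dR j) b.
  by elim: m => //= m ->; rewrite dRD //.
have iZ m k (a : f) : iter m (dR j) (k *: a) = k *: iter m (dR j) a.
  by elim: m => //= m ->; rewrite dRZ //.
have i0 m : iter m (dR j) 0 = 0 by have := iZ m 0 0; rewrite !scale0r.
elim/f_indr: x => [|k a [m IH]|a b [m IHa] [m' IHb]|k a [m IH]].
- by exists 1%N; rewrite /= dR1 //.
- by exists m; rewrite iZ IH scaler0.
- by exists (m + m')%N; rewrite iD [in X in X + _]addnC !iterD IHa IHb !i0 addr0.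
exists m.+1; elim: m a IH => [|m IHm] a E.
  by rewrite /= in E; rewrite E mul0r /= dR0.
rewrite iterSr dR_Mtheta // iD !iZ E scaler0 add0r IHm ?scaler0 //.
by rewrite -iterSr.
Qed.

Lemma iter_dR_Mtheta m (x : f) : iter m (dR i) (x * th) =
  u ^+ (2 * m) *: (iter m (dR i) x * th) +
  (if m is m'.+1 then (u ^+ m' * qint u m) *: iter m' (dR i) x else 0).
Proof.
elim: m => [|m IH]; first by rewrite muln0 expr0 scale1r addr0.
rewrite iterS IH dRD // dRZ // dR_Mtheta // eqxx scale1r (cartan_diag hC) scalerDr scalerA.
rewrite -!addrA addrCA; congr (_ + _).
  by rewrite -exprnP -exprD mulnS addnC.
case: m IH => [|m] IH.
  by rewrite dR0 // addr0 muln0 !expr0 mul1r (qint1 uq).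
rewrite dRZ // -iterS -scalerDl; congr (_ *: _).
have h := qden_neq0' u0 uq.
have -> : u ^+ (2 * m.+1) = u ^+ m * u ^+ m * u ^+ 2 by rewrite -!exprD; congr (_ ^+ _); lia.
rewrite /qint !exprS.
have um : u ^+ m != 0 by rewrite expf_neq0.
move: (u ^+ m) um => a um.
by field; rewrite u0 um h.
Qed.

(** A $q$-boson relation: if [iter m.+1 (dR i) w] is 0, then applying [iter m.+1 (dR i)] to
    $w\vartheta_i$ leaves a nonzero multiple of [iter m (dR i) w], so the nilpotency order of $w$
    drops down to 0. *)
Lemma dR_Mtheta_inj (w : f) : dR i (w * th) = 0 -> w = 0.
Proof.
move=> E; have [m] := dR_nil i w; elim: m => [//|m IH] wm; apply: IH.
have := iter_dR_Mtheta m.+1 w; rewrite iterSr E wm mul0r scaler0 add0r.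
have -> : iter m (dR i) 0 = 0 by elim: m {wm} => //= m ->; rewrite dR0 //.
move/esym/eqP; rewrite scaler_eq0 mulf_eq0 expf_eq0 (negbTE u0) andbF /=.
by rewrite (negbTE (uq m)) => /eqP.
Qed.

(** The Serre relation rewrites $\vartheta_i^n\vartheta_j$ through words with fewer than $n$ factors
    $\vartheta_i$ before $\vartheta_j$; iterating moves all but at most $n$ of the $p$ factors to
    the right. For $p<m$ the truncated exponent makes the claim empty. *)
Lemma theta_pow_comm (j : I) : exists m, forall p, exists w : f,
  th ^+ p * ftheta j = w * th ^+ (p - m).
Proof.
case: (eqVneq i j) => [<-|ij].
  by exists 0%N => p; exists th; rewrite subn0 -exprS exprSr.
set n := `|1 - C i j|%N; exists n => p.
elim/ltn_ind: p => p IH; case: (ltnP p n) => pn.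
  exists (th ^+ p * ftheta j); have -> : (p - n = 0)%N by lia.
  by rewrite expr0 mulr1.
have S : dp th n * ftheta j = \sum_(k < n)
    (- (-1) ^+ n * (-1) ^+ k / (qfact u k * qfact u (n - k))) *: (th ^+ k * ftheta j * th ^+ (n - k)).
  have := serre_ftheta q C d ij; rewrite serreE -/n /qserre big_ord_recr /=.
  rewrite subnn (dp0 u) mulr1 => /eqP; rewrite addr_eq0 => /eqP.
  move=> E; transitivity ((- (-1) ^+ n) *: (- ((-1) ^+ n *: (dp th n * ftheta j)))).
    by rewrite scalerN scaleNr opprK scalerA -expr2 sqrr_sign scale1r.
  rewrite -E scaler_sumr; apply: eq_bigr => k _.
  rewrite /divpow -!scalerAr -!scalerAl !scalerA; congr (_ *: _).
  by rewrite invfM; ring.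
have {}S : th ^+ n * ftheta j = \sum_(k < n) (qfact u n *
    (- (-1) ^+ n * (-1) ^+ k / (qfact u k * qfact u (n - k)))) *: (th ^+ k * ftheta j * th ^+ (n - k)).
  rewrite (dpE uq) -scalerAl S scaler_sumr; apply: eq_bigr => k _.
  by rewrite scalerA.
have H (k : 'I_n) : exists w : f, th ^+ (p - n) * (th ^+ k * ftheta j * th ^+ (n - k)) = w * th ^+ (p - n).
  have kn := ltn_ord k; have [|w E] := IH (p - n + k)%N; first by lia.
  rewrite !mulrA -exprD E.
  exists (w * th ^+ (p - n + k - n + (n - k) - (p - n))).
  by rewrite -!mulrA -!exprD; congr (_ * _ ^+ _); lia.
have -> : th ^+ p * ftheta j = th ^+ (p - n) * (th ^+ n * ftheta j).
  by rewrite mulrA -exprD subnK.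
have [w Hw] := choice H.
rewrite S mulr_sumr; exists (\sum_(k < n) (qfact u n *
    (- (-1) ^+ n * (-1) ^+ k / (qfact u k * qfact u (n - k)))) *: w k).
by rewrite mulr_suml; apply: eq_bigr => k _; rewrite -scalerAr Hw scalerAl.
Qed.

Lemma theta_pow_nil (x : f) r : exists p0, forall p, (p0 <= p)%N ->
  exists w : f, th ^+ p * x = w * th ^+ r.
Proof.
elim/f_indl: x r => [|k a IH|a b IHa IHb|j a IH] r.
- exists r => p rp; exists (th ^+ (p - r)); by rewrite mulr1 -exprD subnK.
- have [p0 h] := IH r; exists p0 => p /h[w E]; exists (k *: w).
  by rewrite -scalerAr E scalerAl.
- have [p0 h] := IHa r; have [p1 h'] := IHb r; exists (maxn p0 p1) => p.
  rewrite geq_max => /andP[/h[w E] /h'[w' E']]; exists (w + w').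
  by rewrite mulrDr E E' mulrDl.
have [p0 h] := IH r; have [m hm] := theta_pow_comm j.
exists (p0 + m)%N => p pm; have [w E] := hm p.
have [|w' E'] := h (p - m)%N; first by lia.
by exists (w * w'); rewrite mulrA E -mulrA E' mulrA.
Qed.

Local Notation qad := (qad u th).

(** In [qadE] every term with $b>0$ ends in $\vartheta_i$; the term $b=0$ is a multiple of
    $\vartheta_i^p x$, to which [theta_pow_nil] applies. *)
Lemma qad_nil e (x : f) : exists p0, forall p, (p0 <= p)%N -> exists w : f, qad e p x = w * th.
Proof.
have [p0 h] := theta_pow_nil x 1; exists p0.+1 => p pp0.
have [|w E] := h p; first by lia.
rewrite (qadE u0 uq) big_ord_recl /=.
exists (qfact u p *: ((((-1) ^+ 0%N * u ^ (0%N%:Z * (e + p%:Z - 1))) / qfact u p) *: w +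
  \sum_(b < p) (((-1) ^+ (lift ord0 b) * u ^ ((lift ord0 b)%:Z * (e + p%:Z - 1))) / qint u b.+1) *:
    (dp th (p - (lift ord0 b)) * x * dp th b))).
rewrite -[RHS]scalerAl mulrDl mulr_suml; congr (_ *: (_ + _)).
  rewrite subn0 (dp0 u) mulr1 /divpow -[_ *: th ^+ p * x]scalerAl E expr1 scalerA.
  by rewrite scalerAl.
apply: eq_bigr => b _; rewrite lift0 /bump leq0n add1n -[RHS]scalerAl -[_ * dp th b * th]mulrA (dpSr uq).
by rewrite -[_ * (_ *: dp th b.+1)]scalerAr scalerA divfK.
Qed.

Lemma kap_qad e (x : f) p : kap i x = u ^ e *: x -> kap i (qad e p x) = u ^ (e + p.*2%:Z) *: qad e p x.
Proof.
move=> kx; elim: p => [|p IH] /=; first by rewrite addr0.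
rewrite /qcom -scaleN1r kapD // !kapZ // !kapM // kap_theta // IH (cartan_diag hC).
rewrite -scalerAl -!scalerAr -scalerAl !scalerA scalerDr !scalerA.
by congr (_ *: _ + _ *: _); rewrite doubleSz !expfzDr //; ring.
Qed.

(** With starting exponent equal to the weight of $x$, the two undifferentiated terms of each
    commutator cancel, so [qad] acts on the kernel of [dR i]. *)
Lemma dR_qad e (x : f) p : kap i x = u ^ e *: x -> dR i x = 0 -> dR i (qad e p x) = 0.
Proof.
move=> kx x0; elim: p => [//|p IH] /=.
rewrite /qcom -scaleN1r dRD // !dRZ // dR_Mtheta // dR_mul // dR_theta // eqxx IH.
by rewrite mulr0 add0r mul0r scaler0 addr0 mul1r (kap_qad _ kx) scale1r scaleN1r subrr.
Qed.

(** Integrability of the kernel of [dR i]: for large $p$ the vector lies both in $\mathbf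
    f\vartheta_i$ and in that kernel, and only 0 does. *)
Lemma qad_vanish e (x : f) : kap i x = u ^ e *: x -> dR i x = 0 ->
  exists p0, forall p, (p0 <= p)%N -> qad e p x = 0.
Proof.
move=> kx x0; have [p0 h] := qad_nil e x; exists p0 => p /h[w E].
by rewrite E (@dR_Mtheta_inj w) ?mul0r // -E dR_qad.
Qed.

Lemma qadZ e p k (x : f) : qad e p (k *: x) = k *: qad e p x.
Proof.
elim: p => //= p ->; rewrite /qcom -scalerAl -scalerAr scalerBr !scalerA.
by rewrite [k * _]mulrC.
Qed.
Lemma qad0 e p : qad e p 0 = 0.
Proof. by have := qadZ e p 0 0; rewrite !scale0r. Qed.

Lemma kap_iter_dL n m (x : f) : kap i x = u ^ n *: x ->
  kap i (iter m (dL i) x) = u ^ (n - m.*2%:Z) *: iter m (dL i) x.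
Proof.
move=> kx; elim: m => [|m IH] /=; first by rewrite subr0.
have := kap_dL q0 q_nroot hC hphi i i (iter m (dL i) x).
rewrite IH dLZ // (cartan_diag hC) => /(congr1 (fun z => u ^ (- 2%:Z) *: z)).
rewrite !scalerA -!expfzDr // addNr expr0z scale1r => <-.
by congr (u ^ _ *: _); rewrite doubleSz; ring.
Qed.

(** The commutation rule of $U_q(\mathfrak{sl}_2)$: on the kernel of [dR i], [qad] raises, [dL i]
    lowers and $n$ is the weight. *)
Lemma dL_qad n (x : f) p : kap i x = u ^ n *: x -> dR i x = 0 ->
  dL i (qad n p.+1 x) = u ^+ (2 * p.+1) *: qad (n - 2) p.+1 (dL i x)
    - (u ^ (n + p.*2%:Z) * qint u p.+1 * zqint u (n + p%:Z) * den i) *: qad n p x.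
Proof.
move=> kx x0; have h := qden_neq0' u0 uq.
have base z e : kap i z = u ^ e *: z -> dL i (qcom u th e z) =
    (1 - u ^ (e + e)) *: z + u ^+ 2 *: qcom u th (e - 2) (dL i z).
  move=> kz; rewrite /qcom -scaleN1r dLD // !dLZ // dL_thetaM // eqxx (cartan_diag hC) dL_mul //.
  rewrite dL_theta // eqxx kz !scalerBr scalerBl !scalerDr !scalerA mulr1 !scale1r mulN1r.
  rewrite -exprnP scalerA mulNr -expfzDr // !scaleNr [X in _ + X]addrC addrACA.
  by congr (_ + (_ - _ *: _)); rewrite exprnP -expfzDr // addrC subrK.
elim: p => [|p IH].
  rewrite /= addr0 base // addr0 addrC muln1; congr (_ + _).
  rewrite -scaleNr; congr (_ *: _); rewrite (qint1 uq) mulr1 /zqint /Defs.v.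
  rewrite -[den i]/(u - u^-1) expfzDr // -invr_expz; have un : u ^ n != 0 by rewrite expfz_neq0.
  by move: (u ^ n) un => a ua; field; rewrite u0 ua h.
rewrite -[qad n p.+2 x]/(qcom u th (n + (p.+1).*2%:Z) (qad n p.+1 x)).
rewrite (base _ _ (kap_qad p.+1 kx)) IH.
have -> (z w : f) a b e : qcom u th e (a *: z - b *: w) = a *: qcom u th e z - b *: qcom u th e w.
  rewrite /qcom mulrBr mulrBl -!scalerAr -!scalerAl !scalerBr !scalerA ![u ^ e * _]mulrC !opprB.
  by rewrite -!addrA; congr (_ + _); rewrite addrCA [RHS]addrCA; congr (_ + _); rewrite addrC.
have -> : qcom u th (n + (p.+1).*2%:Z - 2) (qad (n - 2) p.+1 (dL i x)) = qad (n - 2) p.+2 (dL i x).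
  by rewrite /=; congr (qcom _ _ _ _); ring.
have -> : qcom u th (n + (p.+1).*2%:Z - 2) (qad n p x) = qad n p.+1 x.
  by rewrite /=; congr (qcom _ _ _ _); rewrite doubleSz; ring.
move: (qad (n - 2) p.+2 (dL i x)) (qad n p.+1 x) => Q2 Q1.
rewrite scalerBr !scalerA [LHS]addrCA -scalerBl; congr (_ *: _ + _).
  by rewrite -exprD; congr (_ ^+ _); lia.
rewrite -scaleNr; congr (_ *: _); rewrite -[den i]/(u - u^-1) /zqint /qint.
have -> : n + p.+1%:Z = n + p%:Z + 1 by rewrite -addn1 PoszD addrA.
have e2 : p.*2%:Z = p%:Z + p%:Z by rewrite -addnn.
rewrite doubleSz e2 -!invr_expz !expfzDr // -!exprnP !exprS.
have un : u ^ n != 0 by rewrite expfz_neq0.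
have um : u ^+ p != 0 by rewrite expf_neq0.
move: (u ^ n) un (u ^+ p) um => a ua b ub.
by field; rewrite u0 ua ub h.
Qed.

Section LowestWeightVectors.
Variables (n : int) (y : f).
Hypothesis ky : kap i y = u ^ n *: y.
Hypothesis dRy : dR i y = 0.
Hypothesis n_gt0 : 0 < n.

Local Notation yk k := (iter k (dL i) y).
Definition zG k m := qad (n - k.*2%:Z) m (yk k).
(** For $p=0$ these are the coefficients of an alternating sum of $k$-fold raising after $k$-fold
    lowering; larger $p$ adds $p$ raisings. They are fixed by requiring that [dL i] send [zZ K p.+1]
    to a multiple of [zZ K p]. The quantum factorials turn into divided powers, and no denominator
    depends on the weight. *)
Definition zc p k : Kv :=
  (-1) ^+ k * u ^+ (k * (p + k)) * den i ^- (k + p) / (qfact u (k + p) * qfact u k).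
Definition zZ K p := \sum_(k < K) zc p k *: zG k (k + p).

Lemma dR_yk k : dR i (yk k) = 0.
Proof. by elim: k => //= k IH; rewrite -dL_dR // IH dL0. Qed.

Lemma dL_zG k m : dL i (zG k m.+1) = u ^+ (2 * m.+1) *: zG k.+1 m.+1
  - (u ^ (n - k.*2%:Z + m.*2%:Z) * qint u m.+1 * zqint u (n - k.*2%:Z + m%:Z) * den i) *: zG k m.
Proof.
rewrite /zG dL_qad ?dR_yk //; last exact: kap_iter_dL.
have -> // : n - (k.+1).*2%:Z = n - k.*2%:Z - 2 by rewrite doubleSz opprD addrA.
Qed.

Lemma zc_shift p k : zc p.+1 k * u ^+ (2 * (k + p).+1) =
  - (zc p k.+1 * u ^+ (p + k.+1) * qint u k.+1).
Proof.
have e1 : u ^+ (k.+1 * (p + k.+1)) = u ^+ (k * (p.+1 + k)) * u ^+ (k + p).+1.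
  by rewrite -exprD; congr (_ ^+ _); lia.
have e2 : u ^+ (p + k.+1) = u ^+ (k + p).+1 by congr (_ ^+ _); lia.
have e3 : u ^+ (2 * (k + p).+1) = u ^+ (k + p).+1 * u ^+ (k + p).+1.
  by rewrite -exprD; congr (_ ^+ _); lia.
rewrite /zc e1 e2 e3 addnS addSn (qfactS u k) [(-1) ^+ k.+1]exprS mulN1r !mulNr opprK.
have F1 := qfact_neq0 uq (k + p).+1; have F2 := qfact_neq0 uq k; have q1 := uq k.
have D0 : den i ^+ (k + p).+1 != 0 by rewrite expf_neq0 // (den_neq0 q0 q_nroot hC).
move: (u ^+ (k + p).+1) (u ^+ (k * _)) => a b; move: F1 F2 q1 D0.
move: (qfact u (k + p).+1) (qfact u k) (qint _ _) (den i ^+ _) => F1 F2 q1 D h1 h2 h3 h4.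
by field; rewrite h1 h2 h3 h4.
Qed.

Lemma zc_diag p k : zc p.+1 k * (u ^ (n - k.*2%:Z + (k + p).*2%:Z) * qint u (k + p).+1 *
    zqint u (n - k.*2%:Z + (k + p)%:Z) * den i) =
  zc p k * (u ^ (n + p.*2%:Z + k%:Z) * zqint u (n + p%:Z - k%:Z)).
Proof.
have e1 : n - k.*2%:Z + (k + p)%:Z = n + p%:Z - k%:Z.
  by rewrite PoszD -addnn PoszD; ring.
have e2 : u ^ (n - k.*2%:Z + (k + p).*2%:Z) = u ^ (n + p.*2%:Z).
  by congr (u ^ _); rewrite -!addnn !PoszD; ring.
rewrite e1 e2 [u ^ (n + p.*2%:Z + k%:Z)]expfzDr // -exprnP.
rewrite /zc addnS (qfactS u (k + p)) exprS.
have -> : u ^+ (k * (p.+1 + k)) = u ^+ (k * (p + k)) * u ^+ k.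
  by rewrite -exprD; congr (_ ^+ _); lia.
have F1 := qfact_neq0 uq (k + p); have F2 := qfact_neq0 uq k; have q1 := uq (k + p)%N.
have D1 := den_neq0 q0 q_nroot hC i.
have D0 : den i ^+ (k + p) != 0 by rewrite expf_neq0.
move: (zqint u _) (u ^ (n + p.*2%:Z)) (u ^+ k) (u ^+ (k * (p + k))) => c1 c2 c3 c4.
move: F1 F2 q1 D1 D0.
move: (qfact u (k + p)) (qfact u k) (qint u (k + p).+1) (den i ^+ (k + p)) => F1 F2 q1 D.
by move: (den i) => D' h1 h2 h3 h4 h5; field; rewrite h1 h2 h3 h4 h5.
Qed.

Lemma dL_zZ K p : yk K = 0 ->
  dL i (zZ K p.+1) = - (u ^ (n + p.*2%:Z) * zqint u (n + p%:Z)) *: zZ K p.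
Proof.
move=> yK; rewrite /zZ dL_sum //.
(* [b] collects, shifted by one, the terms in which [dL i] reaches the inner vector, and [c] those
   in which it removes a raising. [b] vanishes at both ends, by [qint u 0 = 0] and [yk K = 0], so
   the shift costs nothing. *)
pose b k := - (zc p k * u ^+ (p + k) * qint u k) *: zG k (k + p).
pose c k := (zc p k * (u ^ (n + p.*2%:Z + k%:Z) * zqint u (n + p%:Z - k%:Z))) *: zG k (k + p).
have E k : dL i (zc p.+1 k *: zG k (k + p.+1)) = b k.+1 - c k.
  rewrite dLZ // addnS dL_zG scalerBr !scalerA zc_shift zc_diag /b /c.
  by rewrite -addSn.
transitivity (\sum_(k < K) (b k.+1 - c k)); first by apply: eq_bigr => k _.
have b0 : b 0%N = 0 by rewrite /b /qint expr0 invr1 subrr mul0r mulr0 oppr0 scale0r.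
have bK : b K = 0 by rewrite /b /zG yK qad0 scaler0.
rewrite sumrB; have -> : \sum_(k < K) b k.+1 = \sum_(k < K) b k.
  have : \sum_(k < K.+1) b k = \sum_(k < K.+1) b k by [].
  by rewrite {1}big_ord_recl big_ord_recr /= b0 bK add0r addr0 => <-.
rewrite -sumrB scaler_sumr; apply: eq_bigr => k _.
rewrite /b /c -scalerBl scalerA; congr (_ *: _).
have key : u ^+ (p + k) * qint u k + u ^ (n + p.*2%:Z + k%:Z) * zqint u (n + p%:Z - k%:Z)
    = u ^ (n + p.*2%:Z) * zqint u (n + p%:Z).
  rewrite /zqint /qint exprD.
  have -> : - (n + p%:Z - k%:Z) = k%:Z - (n + p%:Z) by rewrite opprB.
  have e2 : p.*2%:Z = p%:Z + p%:Z by rewrite -addnn.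
  rewrite e2 !expfzDr // -!invr_expz !expfzDr // -!exprnP.
  have un : u ^ n != 0 by rewrite expfz_neq0.
  have up : u ^+ p != 0 by rewrite expf_neq0.
  have uk : u ^+ k != 0 by rewrite expf_neq0.
  have h := qden_neq0' u0 uq.
  move: (u ^ n) un (u ^+ p) up (u ^+ k) uk => a1 h1 a2 h2 a3 h3.
  by field; rewrite u0 h1 h2 h3 h.
by rewrite -key; ring.
Qed.

(** For large $p$ all raisings vanish by [qad_vanish]. Descending, [dL_zZ] multiplies by $[n+p]$ and
    a power of $u$, both nonzero since $n>0$. *)
Lemma zZ_eq0 K p : yk K = 0 -> zZ K p = 0.
Proof.
move=> yK; have H (k : 'I_K) : exists p0, forall m, (p0 <= m)%N -> zG k m = 0.
  exact: (qad_vanish (kap_iter_dL k ky) (dR_yk k)).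
have [P0 HP] := choice H; have up (r : nat) : zZ K (p + r) = 0 -> zZ K p = 0.
  elim: r => [|r IH]; first by rewrite addn0.
  rewrite addnS => E; apply: IH; have := dL_zZ (p + r) yK; rewrite E dL0 // => /esym/eqP.
  rewrite scaler_eq0 oppr_eq0 mulf_eq0 (negbTE (expfz_neq0 _ u0)) /=.
  case: n n_gt0 => // -[//|n'] _; rewrite -PoszD zqint_nat addSn (negbTE (uq _)) /=.
  by move/eqP.
apply: (up (\max_(k < K) P0 k)%N); rewrite /zZ big1 // => k _.
rewrite (HP k) ?scaler0 //; apply: leq_trans (leq_addl _ _); apply: leq_trans (leq_addl _ _).
exact: (leq_bigmax k).
Qed.

(** The term $k=0$ of the vanishing sum [zZ K 0] is $y$ itself, so $y$ is expressed through its
    lowerings alone. For [K = 1] this reads $y=0$. *)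
Lemma sl2_decomp K : yk K = 0 -> y = \sum_(1 <= k < K)
  - ((-1) ^+ k * u ^+ (k * k) * den i ^- k) *: \sum_(b < k.+1)
   ((-1) ^+ b * u ^ (b%:Z * (n - k.*2%:Z + k%:Z - 1))) *:
   (dp th (k - b) * ((qfact u k)^-1 *: yk k) * dp th b).
Proof.
move=> yK; have := zZ_eq0 0 yK; rewrite /zZ; case: K yK => [|K] yK.
  by rewrite /= in yK; rewrite yK big_geq.
rewrite -(big_mkord xpredT (fun k => zc 0 k *: zG k (k + 0))) big_ltn //.
have -> : zc 0 0 *: zG 0 (0 + 0) = y.
  by rewrite /zc /zG /= mul0n !expr0 qfact0 !mulr1 invr1 !mulr1 scale1r.
move/eqP; rewrite addr_eq0 => /eqP E; rewrite {1}E -sumrN; apply: eq_bigr => k _.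
rewrite scaleNr; congr (- _); rewrite /zc /zG add0n addn0 (qadE u0 uq) scalerA.
have Fk := qfact_neq0 uq k.
have -> : (-1) ^+ k * u ^+ (k * k) * den i ^- k / (qfact u k * qfact u k) * qfact u k =
    (-1) ^+ k * u ^+ (k * k) * den i ^- k * (qfact u k)^-1.
  by rewrite -[LHS]mulrA; congr (_ * _); rewrite invfM -mulrA mulVf ?mulr1.
rewrite -scalerA; congr (_ *: _); rewrite scaler_sumr.
apply: eq_bigr => b _; move: (dp th (k - b)) (dp th b) => X Y.
by rewrite -[X * (_ *: _)]scalerAr -[_ *: _ * Y]scalerAl !scalerA; congr (_ *: _); rewrite mulrC.
Qed.
End LowestWeightVectors.
End RankOne.

(** * Weight spaces and nondegeneracy of the form on f *)

Section Weights.
Variables (Kv : fieldType) (q : Kv) (I : finType) (C : I -> I -> int) (d : I -> nat).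
Hypothesis q0 : q != 0.
Hypothesis q_nroot : forall n, q ^+ n.+1 != 1.
Hypothesis hC : finite_cartan C d.
Local Notation v := (v q).
Local Notation vi := (vi q d).
Local Notation serre := (serre q C d).
Local Notation f := (fAlg q C d).
Local Notation B := (Bhat q C d).
Local Notation ftheta := (ftheta q C d).
Local Notation N := (Nroot I).
Local Notation nf := (nform C d).
Variable phi : B -> B -> Kv.
Hypothesis hphi : hopf_pairing phi.
Local Notation kap := (@kap Kv q I C d).
Local Notation sig := (@sig Kv q I C d).
Local Notation dL := (dL phi).
Local Notation dR := (dR phi).
Local Notation ip := (ip phi).
Local Notation eps := (@eps Kv q I C d).
Local Notation homf := (homog (@deg_f I)).
Local Notation fw := (@fword Kv I (f_pres q C d)).
Local Notation wdg s := (\sum_(y <- s) deg_f y).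

(** Zero is a separate case, since there may be no word of degree [a] to scale by 0. *)
Lemma homog_ind (X : choiceType) (P : presentation Kv X) (deg : X -> N) (a : N) (Q : presAlg P -> Prop) :
  Q 0 -> (forall k x, Q x -> Q (k *: x)) -> (forall x y, Q x -> Q y -> Q (x + y)) ->
  (forall s, \sum_(y <- s) deg y = a -> Q (fword P s)) -> forall x, homog deg a x -> Q x.
Proof.
move=> Q0 QZ QD Qw x [p [<- hp]]; rewrite (malg_sumZ p) ppi_sum big_seq.
apply: big_ind => // w /hp E; rewrite ppi_scale fword_ppi.
exact/QZ/Qw.
Qed.

Lemma fhomog_serre (X : choiceType) (deg : X -> N) (x : I -> X) i j :
  exists a, fhomog deg a (serre (fun k => fgen Kv (x k)) i j).
Proof.
set n := `|1 - C i j|%N; exists (deg (x i) *+ n + deg (x j)).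
apply: fhomog_sum => k _; apply: fhomogZ.
have -> : deg (x i) *+ n + deg (x j) = deg (x i) *+ k + deg (x j) + deg (x i) *+ (n - k).
  have kn : (k <= n)%N by rewrite -ltnS ltn_ord.
  by rewrite -[in LHS](subnKC kn) mulrnDr addrAC.
apply: fhomogM; last by apply/fhomogZ/fhomogX/fhomog_gen.
by apply: fhomogM; [apply/fhomogZ/fhomogX/fhomog_gen|apply/fhomog_gen].
Qed.

Lemma f_rel_homog (r : freeAlg Kv I) : prels (f_pres q C d) r -> exists a, fhomog (@deg_f I) a r.
Proof. by move=> [i [j [_ ->]]]; apply: fhomog_serre. Qed.

Definition fpr (a : N) (x : f) : f := gproj (@deg_f I) a x.

Lemma fprD a x y : fpr a (x + y) = fpr a x + fpr a y. Proof. exact/gprojD/f_rel_homog. Qed.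
Lemma fprZ a k x : fpr a (k *: x) = k *: fpr a x. Proof. exact/gprojZ/f_rel_homog. Qed.
Lemma fpr_sum a J (s : seq J) (Q : pred J) (F : J -> f) :
  fpr a (\sum_(j <- s | Q j) F j) = \sum_(j <- s | Q j) fpr a (F j).
Proof. exact/gproj_sum/f_rel_homog. Qed.
Lemma fpr_homog a b x : homf b x -> fpr a x = if b == a then x else 0.
Proof. exact/gproj_homog/f_rel_homog. Qed.
Lemma homog_fpr a x : homf a (fpr a x). Proof. exact: homog_gproj. Qed.

Lemma NaddI (c a b : N) : a + c = b + c -> a = b.
Proof.
move=> E; apply/ffunP => i; have /ffunP/(_ i) := E; rewrite !ffunE.
exact: addIn.
Qed.

Definition hgt (a : N) : nat := \sum_i a i.
Lemma hgtD a b : hgt (a + b) = (hgt a + hgt b)%N.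
Proof. by rewrite /hgt -big_split; apply: eq_bigr => i _; rewrite ffunE. Qed.
Lemma hgt_sroot i : hgt (sroot i) = 1%N.
Proof.
rewrite /hgt (bigD1 i) //= ffunE eqxx big1 ?addn0 // => j /negbTE ji.
by rewrite ffunE ji.
Qed.
Lemma hgt_eq0 a : hgt a = 0%N -> a = 0.
Proof.
move=> /eqP; rewrite sum_nat_eq0 => /forallP h; apply/ffunP => i; rewrite ffunE.
by apply/eqP; have := h i.
Qed.
Lemma N_split (a : N) i : a i != 0%N -> exists b, a = b + sroot i.
Proof.
move=> ai; exists [ffun j => (a j - (j == i))%N]; apply/ffunP => j; rewrite !ffunE.
case: (eqVneq j i) => [->|_]; last by rewrite subn0 [RHS]addn0.
by rewrite [RHS]subnK // lt0n.
Qed.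

Lemma homog_sig a x : homf a x -> homf a (sig x).
Proof.
move: x; apply: homog_ind => [|k y|y z|s <-]; first by rewrite sig0; apply: homog0.
- by rewrite sigZ //; apply: homogZ.
- by rewrite sigD //; apply: homogD.
suff -> : sig (fw s) = fw (rev s).
  have -> : wdg s = wdg (rev s) by apply: perm_big; rewrite perm_sym perm_rev.
  exact: homog_fword.
elim: s => [|i s IH]; first by rewrite /fword big_nil sig1.
rewrite /fword big_cons sigM // IH rev_cons -cats1 big_cat big_seq1; congr (_ * _).
exact: sig_theta.
Qed.

Lemma homog_cases_dL i a x : homf a x ->
  (a i = 0%N -> dL i x = 0) /\ (forall b, a = b + sroot i -> homf b (dL i x)).
Proof.
move: x; apply: homog_ind => [|k y [h1 h2]|y z [h1 h2] [h3 h4]|s].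
- by split=> *; rewrite dL0 //; apply: homog0.
- split=> [E|b E]; rewrite dLZ //; first by rewrite h1 // scaler0.
  by apply/homogZ/h2.
- split=> [E|b E]; rewrite dLD //; first by rewrite h1 // h3 // addr0.
  by apply: homogD; [apply: h2|apply: h4].
elim: s a => [|j s IH] a; rewrite /fword.
  rewrite !big_nil => <-; rewrite dL1 //; split=> // b _; exact: homog0.
rewrite !big_cons => <-; have [h1 h2] := IH _ erefl.
rewrite -/(fw s) -[pgen _ j]/(ftheta j) dL_thetaM //; split.
  rewrite ffunE => /eqP; rewrite addn_eq0 => /andP[/eqP aj /eqP as0].
  rewrite h1 // mulr0 scaler0 addr0; move: aj; rewrite ffunE.
  by case: eqP => // _; rewrite scale0r.
move=> b E; apply: homogD.
  case: eqP => [ij|_]; last by rewrite scale0r; apply: homog0.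
  rewrite scale1r; have -> : b = wdg s.
    by apply: (@NaddI (sroot i)); rewrite -E addrC ij.
  exact: homog_fword.
apply: homogZ; have [s0|/N_split[c Ec]] := eqVneq ((wdg s) i) 0%N.
  by rewrite h1 // mulr0; apply: homog0.
have -> : b = sroot j + c.
  by apply: (@NaddI (sroot i)); rewrite -E Ec addrA.
by apply: homogM; [apply: homog_theta|apply: h2].
Qed.

Lemma homog_dL i a x : homf (a + sroot i) x -> homf a (dL i x).
Proof. by move=> /(homog_cases_dL i)[_]; apply. Qed.
Lemma homog_dL0 i a x : homf a x -> a i = 0%N -> dL i x = 0.
Proof. by move=> /(homog_cases_dL i)[]. Qed.
Lemma homog_dR i a x : homf (a + sroot i) x -> homf a (dR i x).
Proof. by move=> /homog_sig h; rewrite dRE; apply/homog_sig/homog_dL. Qed.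
Lemma homog_dR0 i a x : homf a x -> a i = 0%N -> dR i x = 0.
Proof. by move=> /homog_sig h a0; rewrite dRE (homog_dL0 h) // sig0. Qed.

Lemma homog_dL_lower i a x : homf a x -> exists2 b, homf b (dL i x) & dL i x = 0 \/ a = b + sroot i.
Proof.
move=> hx; have [a0|/N_split[b E]] := eqVneq (a i) 0%N.
  by exists a; [rewrite (homog_dL0 hx a0); apply: homog0|left; apply: (homog_dL0 hx a0)].
by exists b; [apply: homog_dL; rewrite -E|right].
Qed.
Lemma homog_dR_lower i a x : homf a x -> exists2 b, homf b (dR i x) & dR i x = 0 \/ a = b + sroot i.
Proof.
move=> hx; have [a0|/N_split[b E]] := eqVneq (a i) 0%N.
  by exists a; [rewrite (homog_dR0 hx a0); apply: homog0|left; apply: (homog_dR0 hx a0)].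
by exists b; [apply: homog_dR; rewrite -E|right].
Qed.

Lemma vD a b : v ^ (a + b) = v ^ a * v ^ b.
Proof. by rewrite expfzDr // v_neq0. Qed.

Lemma kap_homog i a x : homf a x -> kap i x = v ^ nf (sroot i) a *: x.
Proof.
move: x; apply: homog_ind => [|k y E|y z E E'|s <-].
- by rewrite kap0 // scaler0.
- by rewrite kapZ // E !scalerA mulrC.
- by rewrite kapD // E E' scalerDr.
elim: s => [|j s IH]; first by rewrite /fword !big_nil kap1 // nform0r // expr0z scale1r.
rewrite /fword !big_cons -/(fw s) kapM // IH -[pgen _ j]/(ftheta j) kap_theta // viC //.
by rewrite -scalerAl -scalerAr scalerA nformDr // vD.
Qed.

Definition rk (i : I) (a : N) : int := \sum_j C i j * (a j)%:Z.
Lemma nf_rk i a : nf (sroot i) a = (d i)%:Z * rk i a.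
Proof.
rewrite nformE // (bigD1 i) //= [X in _ + X]big1 ?addr0 => [|k /negbTE ki].
  rewrite mulr_sumr; apply: eq_bigr => j _; rewrite !ffunE eqxx mul1r mulrC.
  by rewrite mulrA.
by apply: big1 => j _; rewrite !ffunE ki !mul0r.
Qed.
Lemma vi_rk i a : v ^ nf (sroot i) a = vi i ^ rk i a.
Proof. by rewrite nf_rk -exprz_exp. Qed.

Lemma kap_rk i a x : homf a x -> kap i x = vi i ^ rk i a *: x.
Proof. by move=> /kap_homog h; rewrite h vi_rk. Qed.

Lemma nf_sum a b : nf a b = \sum_i (a i)%:Z * ((d i)%:Z * rk i b).
Proof.
rewrite nformE //; apply: eq_bigr => i _; rewrite /rk !mulr_sumr; apply: eq_bigr => j _.
by ring.
Qed.

(** Finite type enters here: $(a,a)=\sum_i a_id_i\langle\alpha_i^\vee,a\rangle$ is positive, so some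
    summand is. *)
Lemma rk_pos a : a != 0 -> exists i, 0 < rk i a.
Proof.
move=> a0; have : 0 < nf a a.
  apply: (cartan_posdef hC); apply: contraNneq a0 => /ffunP E.
  by apply/eqP/ffunP => i; have := E i; rewrite !ffunE => -[].
rewrite nf_sum; apply: contra_ltP => /forallNP h.
apply: sumr_le0 => i _; apply: mulr_ge0_le0 => //; apply: mulr_ge0_le0 => //.
by have /negP := h i; rewrite -leNgt.
Qed.

Lemma eps_homog a x : homf a x -> a != 0 -> eps x = 0.
Proof.
move=> hx a0; move: x hx; apply: homog_ind => [|k y|y z|s E].
- by have := epsZ hphi 0 0; rewrite scale0r mul0r.
- by rewrite (epsZ hphi) => ->; rewrite mulr0.
- by rewrite (epsD hphi) => -> ->; rewrite addr0.
case: s E a0 => [<-|j s _ _]; first by rewrite big_nil eqxx.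
by rewrite /fword big_cons epsM // eps_theta // mul0r.
Qed.

Lemma homog_weight0 (x : f) : homf 0 x -> exists c : Kv, x = c *: 1.
Proof.
move: x; apply: homog_ind => [|k y [c ->]|y z [c ->] [c' ->]|s].
- by exists 0; rewrite scale0r.
- by exists (k * c); rewrite scalerA.
- by exists (c + c'); rewrite scalerDl.
case: s => [_|j s]; first by exists 1; rewrite /fword big_nil scale1r.
rewrite big_cons => /ffunP/(_ j); rewrite !ffunE eqxx.
by [].
Qed.

Lemma ip_orth a b x y : homf a x -> homf b y -> a != b -> ip x y = 0.
Proof.
move=> hx; move: b y; move: x hx; apply: homog_ind => [|k z IH|z z' IH IH'|s].
- by move=> *; rewrite ip0l.
- by move=> b y hy ab; rewrite ipZl // (IH b) // mulr0.
- by move=> b y hy ab; rewrite ipDl // (IH b) // (IH' b) // addr0.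
elim: s a => [|j s IH] a; rewrite /fword.
  rewrite !big_nil => <- b y hy b0; rewrite ip1 // (eps_homog hy) // eq_sym //.
rewrite !big_cons => <- b y hy ab; rewrite ip_thetaM //.
have [c hc [->|E]] := homog_dL_lower j hy; first by rewrite ip0r // mulr0.
rewrite -/(fw s) (IH _ erefl c) ?mulr0 //; apply: contraNneq ab => ->.
by rewrite E addrC.
Qed.

Lemma ip_fpr a x y : homf a x -> ip x (fpr a y) = ip x y.
Proof.
move=> hx; have [s us ds] := @gproj_decomp _ _ _ (f_pres q C d) (@deg_f I) y.
rewrite {2}(ds (undup (a :: s)) (undup_uniq _)); last first.
  by move=> b bs; rewrite mem_undup inE bs orbT.
rewrite ip_sumr // (bigD1_seq a) ?undup_uniq ?mem_undup ?mem_head //=.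
rewrite big1 ?addr0 // => b ba; apply: (ip_orth hx (homog_gproj _ _ _)).
by rewrite eq_sym.
Qed.

(** By induction on the height, all skew derivatives of a vector in the radical vanish. If $a\ne0$,
    some simple coroot is positive on $a$, and [sl2_decomp] with its empty sum gives $y=0$. *)
Lemma ip_nondeg_homog a y : homf a y -> (forall z, ip z y = 0) -> y = 0.
Proof.
have [n] := ubnP (hgt a); elim: n a y => // n IH a y an hy h.
have [a0|a0] := eqVneq a 0.
  move: hy h; rewrite a0 => /homog_weight0[c ->] /(_ 1).
  by rewrite ipZr // ip1 // eps1 // mulr1 => ->; rewrite scale0r.
have den0 i := den_neq0 q0 q_nroot hC i.
have L0 i : dL i y = 0.
  have [b hb [//|E]] := homog_dL_lower i hy; apply: (IH b) => //.
    by move: an; rewrite E hgtD hgt_sroot addn1.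
  move=> z; have := h (ftheta i * z); rewrite ip_thetaM // => /eqP.
  by rewrite mulf_eq0 (negbTE (den0 i)) => /eqP.
have R0 i : dR i y = 0.
  have [b hb [//|E]] := homog_dR_lower i hy; apply: (IH b) => //.
    by move: an; rewrite E hgtD hgt_sroot addn1.
  move=> z; have := h (z * ftheta i); rewrite ip_Mtheta // => /eqP.
  by rewrite mulf_eq0 (negbTE (den0 i)) => /eqP.
have [i ri] := rk_pos a0.
have := sl2_decomp q0 q_nroot hC hphi (kap_rk i hy) (R0 i) ri (K := 1) (L0 i).
by rewrite big_geq.
Qed.

Lemma ip_nondeg y : (forall z, ip z y = 0) -> y = 0.
Proof.
move=> h; apply: (@gproj_eq0 _ _ _ (f_pres q C d) (@deg_f I) y) => a; apply: (ip_nondeg_homog (homog_gproj _ a y)) => z.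
rewrite ipC // -(ip_fpr z (homog_fpr a y)) ipC // (ip_fpr y (homog_fpr a z)).
exact: h.
Qed.
End Weights.

(** * The dual lattice under derivations and multiplication, and its pairing with itself *)

Section Integrality.
Variables (Kv : fieldType) (q : Kv) (I : finType) (C : I -> I -> int) (d : I -> nat).
Hypothesis q0 : q != 0.
Hypothesis q_nroot : forall n, q ^+ n.+1 != 1.
Hypothesis hC : finite_cartan C d.
Local Notation v := (v q).
Local Notation vi := (vi q d).
Local Notation f := (fAlg q C d).
Local Notation B := (Bhat q C d).
Local Notation ftheta := (ftheta q C d).
Local Notation N := (Nroot I).
Local Notation nf := (nform C d).
Variable phi : B -> B -> Kv.
Hypothesis hphi : hopf_pairing phi.
Local Notation kap := (@kap Kv q I C d).
Local Notation dL := (dL phi).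
Local Notation dR := (dR phi).
Local Notation ip := (ip phi).
Local Notation den := (den q d).
Local Notation homf := (homog (@deg_f I)).
Local Notation fpr := (@fpr Kv q I C d).
Local Notation ldp := (ldp q C d).
Local Notation ltheta := (ltheta q C d).
Local Notation A := (laurentZ q).

Let v0 : v != 0. Proof. exact: v_neq0. Qed.

Lemma lzD a b : A a -> A b -> A (a + b).
Proof.
move=> [p [n ->]] [r [m ->]]; exists (p * 'X^m + r * 'X^n), (n + m)%N.
rewrite rmorphD !rmorphM !rmorphXn /= !map_polyX hornerD !hornerM !hornerXn exprD.
have vn : v ^+ n != 0 by rewrite expf_neq0.
have vm : v ^+ m != 0 by rewrite expf_neq0.
move: (v ^+ n) (v ^+ m) (map_poly _ p).[v] (map_poly _ r).[v] vn vm => x y z w vn vm.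
by field; rewrite vn vm.
Qed.
Lemma lzM a b : A a -> A b -> A (a * b).
Proof.
move=> [p [n ->]] [r [m ->]]; exists (p * r), (n + m)%N.
by rewrite rmorphM /= hornerM exprD invfM mulrACA.
Qed.
Lemma lz_int (z : int) : A z%:~R.
Proof. by exists z%:P, 0%N; rewrite map_polyC hornerC expr0 invr1 mulr1. Qed.
Lemma lz0 : A 0. Proof. exact: (lz_int 0). Qed.
Lemma lz1 : A 1. Proof. exact: (lz_int 1). Qed.
Lemma lzN a : A a -> A (- a).
Proof. by move=> h; rewrite -mulN1r; apply: lzM => //; apply: (lz_int (-1)). Qed.
Lemma lzB a b : A a -> A b -> A (a - b).
Proof. by move=> ha hb; apply: lzD => //; apply: lzN. Qed.
Lemma lz_v (z : int) : A (v ^ z).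
Proof.
case: z => n; last by exists 1, n.+1; rewrite rmorph1 hornerC mul1r NegzE -invr_expz.
by exists 'X^n, 0%N; rewrite rmorphXn /= map_polyX hornerXn expr0 invr1 mulr1 exprnP.
Qed.
Lemma lzX a n : A a -> A (a ^+ n).
Proof. by move=> h; elim: n => [|n IH]; [apply: lz1|rewrite exprS; apply: lzM]. Qed.
Lemma lz_sum J (s : seq J) (Q : pred J) (F : J -> Kv) :
  (forall j, Q j -> A (F j)) -> A (\sum_(j <- s | Q j) F j).
Proof. by move=> h; apply: big_ind => //; [exact: lz0|exact: lzD]. Qed.
Lemma lz_vi i (z : int) : A (vi i ^ z).
Proof. by rewrite /Defs.vi exprnP exprz_exp; apply: lz_v. Qed.
Lemma lz_den i : A (den i).
Proof. by apply: lzB; [have := lz_vi i 1|have := lz_vi i (-1)]. Qed.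
Lemma lz_sign n : A ((-1) ^+ n).
Proof. by apply/lzX/lzN/lz1. Qed.

Lemma ip_lthetaM i x y : ip (ltheta i * x) y = ip x (dL i y).
Proof.
rewrite /Defs.ltheta -scalerAl ipZl // ip_thetaM // mulKf //.
exact: (den_neq0 q0 q_nroot hC i).
Qed.
Lemma ip_Mltheta i x y : ip (x * ltheta i) y = ip x (dR i y).
Proof.
rewrite /Defs.ltheta -scalerAr ipZl // ip_Mtheta // mulKf //.
exact: (den_neq0 q0 q_nroot hC i).
Qed.

Definition dLk i k (y : f) : f := (qfact (vi i) k)^-1 *: iter k (dL i) y.
Definition dRk i k (y : f) : f := (qfact (vi i) k)^-1 *: iter k (dR i) y.

Lemma ip_ldpM i k x y : ip (ldp i k * x) y = ip x (dLk i k y).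
Proof.
rewrite /Defs.ldp /divpow -scalerAl ipZl // ipZr //; congr (_ * _).
elim: k x => [|k IH] x; first by rewrite expr0 mul1r.
by rewrite exprSr -mulrA IH ip_lthetaM.
Qed.
Lemma ip_Mldp i k x y : ip (x * ldp i k) y = ip x (dRk i k y).
Proof.
rewrite /Defs.ldp /divpow -scalerAr ipZl // ipZr //; congr (_ * _).
elim: k x => [|k IH] x; first by rewrite expr0 mulr1.
by rewrite exprS mulrA IH ip_Mltheta.
Qed.

Definition dword (s : seq (I * nat)) : f := \prod_(t <- s) ldp t.1 t.2.
Lemma dwordE s : dword s = \prod_(t <- s) ldp t.1 t.2. Proof. by []. Qed.
(* The lattice dual to the integral form. *)
Definition fZd (y : f) := forall s, A (ip (dword s) y).

Lemma fZdD x y : fZd x -> fZd y -> fZd (x + y).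
Proof. by move=> hx hy s; rewrite ipDr //; apply: lzD. Qed.
Lemma fZdZ c x : A c -> fZd x -> fZd (c *: x).
Proof. by move=> hc hx s; rewrite ipZr //; apply: lzM. Qed.
Lemma fZd0 : fZd 0. Proof. by move=> s; rewrite ip0r //; apply: lz0. Qed.
Lemma fZd_sum J (s : seq J) (Q : pred J) (F : J -> f) :
  (forall j, Q j -> fZd (F j)) -> fZd (\sum_(j <- s | Q j) F j).
Proof. by move=> h; apply: big_ind => //; [exact: fZd0|exact: fZdD]. Qed.

Lemma fZd_dLk i k x : fZd x -> fZd (dLk i k x).
Proof. by move=> h s; rewrite -ip_ldpM; have := h ((i, k) :: s); rewrite /dword big_cons. Qed.
Lemma fZd_dRk i k x : fZd x -> fZd (dRk i k x).
Proof.
by move=> h s; rewrite -ip_Mldp; have := h (rcons s (i, k)); rewrite /dword -cats1 big_cat big_seq1.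
Qed.

Lemma qfact1 (u : Kv) : qfact u 1 = qint u 1. Proof. by rewrite /qfact big_nat1. Qed.
Lemma dR_dRk1 i x : dR i x = dRk i 1 x.
Proof.
rewrite /dRk qfact1 qint1 ?invr1 ?scale1r // => n.
exact: (vi_qint q0 q_nroot hC).
Qed.

Lemma ip_kap i x y : ip (kap i x) y = ip x (kap i y).
Proof.
elim/f_indl: x y => [|k a IH|a b IHa IHb|j a IH] y.
- rewrite kap1 // !ip1 //; elim/f_indl: y => [|k a IH|a b IHa IHb|j a IH].
  + by rewrite kap1.
  + by rewrite kapZ // !(epsZ hphi) IH.
  + by rewrite kapD // !(epsD hphi) IHa IHb.
  by rewrite kapM // kap_theta // -scalerAl (epsZ hphi) !epsM // eps_theta // !mul0r mulr0.
- by rewrite kapZ // !ipZl // IH.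
- by rewrite kapD // !ipDl // IHa IHb.
rewrite kapM // kap_theta // -scalerAl ipZl // !ip_thetaM // IH kap_dL // ipZr //.
by rewrite viCC // mulrCA.
Qed.

Lemma kap_dword i s : exists z : int, kap i (dword s) = v ^ z *: dword s.
Proof.
elim: s => [|[j k] s [z E]]; first by exists 0; rewrite /dword big_nil kap1 // expr0z scale1r.
have aux (a b c : Kv) (X Y : f) : a *: (b *: X) * (c *: Y) = (b * c) *: (a *: X * Y).
  move: X Y; move: (f : algType Kv) => F X Y.
  by rewrite -!scalerAl -scalerAr !scalerA; congr (_ *: _); ring.
rewrite /dword big_cons -/(dword s) kapM // E /= /Defs.ldp /divpow kapZ //.
suff [z' ->] : exists z' : int, kap i (ltheta j ^+ k) = v ^ z' *: ltheta j ^+ k.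
  by exists (z' + z); rewrite aux vD.
elim: k => [|k [z' E']]; first by exists 0; rewrite expr0 kap1 // expr0z scale1r.
rewrite exprS kapM // E' /Defs.ltheta kapZ // kap_theta // viC //.
exists (nf (sroot i) (sroot j) + z').
by rewrite vD // -!scalerAr -!scalerAl !scalerA; congr (_ *: _); ring.
Qed.

Lemma fZd_kap i x : fZd x -> fZd (kap i x).
Proof.
move=> h s; rewrite -ip_kap; have [z ->] := kap_dword i s; rewrite ipZl //.
by apply: lzM; [apply: lz_v|apply: h].
Qed.

Lemma iter_dL_Mtheta i m (x : f) : iter m (dL i) (x * ftheta i) =
  iter m (dL i) x * ftheta i +
  (if m is m'.+1 then (vi i ^+ m' * qint (vi i) m) *: kap i (iter m' (dL i) x) else 0).
Proof.
elim: m => [|m IH]; first by rewrite addr0.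
rewrite iterS IH dLD // dL_mul // dL_theta // eqxx mulr1 -addrA; congr (_ + _).
have u0 := vi_neq0 d q0 i; have uq := vi_qint q0 q_nroot hC i.
case: m IH => [|m] IH.
  by rewrite dL0 // addr0 expr0 mul1r (qint1 uq) scale1r.
rewrite dLZ // kap_dL // (cartan_diag hC) scalerA -[in X in X + _](scale1r (kap i _)) -scalerDl.
congr (_ *: _).
have h := qden_neq0' u0 uq.
rewrite /qint !exprS -exprnP.
have um : vi i ^+ m != 0 by rewrite expf_neq0.
move: (vi i) (vi i ^+ m) u0 um h => u a u0 um h.
by field; rewrite u0 um h.
Qed.

Lemma dLk_Mtheta i m (x : f) : dLk i m (x * ftheta i) = dLk i m x * ftheta i +
  (if m is m'.+1 then vi i ^+ m' *: kap i (dLk i m' x) else 0).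
Proof.
rewrite /dLk iter_dL_Mtheta scalerDr scalerAl; congr (_ + _).
case: m => [|m]; first by rewrite scaler0.
rewrite kapZ // !scalerA qfactS; congr (_ *: _).
have uq := vi_qint q0 q_nroot hC i.
have := uq m; have := qfact_neq0 uq m.
move: (qfact _ m) (qint _ _) => a b ha hb.
by field; rewrite ha hb.
Qed.

(** A divided power on the left crosses the form as [dLk], whose Leibniz rule on $x\vartheta_i$ has
    coefficients in $\mathbb Z[v,v^{-1}]$ ([dLk_Mtheta]); induction on the word does the rest. *)
Lemma fZd_Mtheta i x : fZd x -> fZd (x * ftheta i).
Proof.
move=> h s; elim: s x h => [|[j k] s IH] x h.
  rewrite /dword big_nil ip1 // epsM // eps_theta // mulr0; exact: lz0.
rewrite /dword big_cons -/(dword s) /= ip_ldpM.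
case: (eqVneq j i) => [->|ji].
  rewrite dLk_Mtheta ipDr //; apply: lzD; first exact/IH/fZd_dLk.
  case: k => [|k]; first by rewrite ip0r //; apply: lz0.
  rewrite ipZr //; apply: lzM; last exact/fZd_kap/fZd_dLk.
  by rewrite exprnP; apply: lz_vi.
have -> : dLk j k (x * ftheta i) = dLk j k x * ftheta i; last exact/IH/fZd_dLk.
rewrite /dLk -scalerAl; congr (_ *: _); elim: k => //= k ->.
by rewrite dL_mul // dL_theta // (negbTE ji) mulr0 addr0.
Qed.

Lemma fZd_fpr a x : fZd x -> fZd (fpr a x).
Proof.
move=> h s; have hs : homf (\sum_(t <- s) (sroot t.1 *+ t.2)) (dword s).
  rewrite /dword; elim: s => [|t s IH]; first by rewrite !big_nil; apply: homog1.
  rewrite !big_cons; apply: homogM => //; apply: homogZ; apply: homogX; apply: homogZ.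
  exact: homog_theta.
have [ab|ab] := eqVneq (\sum_(t <- s) (sroot t.1 *+ t.2)) a.
  by rewrite ab in hs; rewrite (ip_fpr q0 q_nroot hC hphi x hs).
rewrite (ip_orth q0 q_nroot hC hphi hs (homog_fpr _ _) ab).
exact: lz0.
Qed.

Lemma kap_theta_pow i k : kap i (ftheta i ^+ k) = vi i ^+ (2 * k) *: ftheta i ^+ k.
Proof.
elim: k => [|k IH]; first by rewrite expr0 kap1 // muln0 expr0 scale1r.
rewrite exprS kapM // IH kap_theta // (cartan_diag hC) -exprnP.
by rewrite -scalerAl -scalerAr scalerA -exprD mulnS.
Qed.

Lemma dR_theta_pow i k : dR i (ftheta i ^+ k.+1) = (vi i ^+ k * qint (vi i) k.+1) *: ftheta i ^+ k.
Proof.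
have u0 := vi_neq0 d q0 i; have uq := vi_qint q0 q_nroot hC i.
elim: k => [|k IH].
  by rewrite expr1 dR_theta // eqxx expr0 mul1r (qint1 uq) scale1r.
rewrite exprS dR_mul // IH dR_theta // eqxx mul1r kap_theta_pow -scalerAr -exprS -scalerDl.
congr (_ *: _); have h := qden_neq0' u0 uq.
have -> : vi i ^+ (2 * k.+1) = vi i ^+ k * vi i ^+ k * vi i ^+ 2.
  by rewrite -!exprD; congr (_ ^+ _); lia.
rewrite /qint !exprS.
have um : vi i ^+ k != 0 by rewrite expf_neq0.
move: (vi i) (vi i ^+ k) u0 um h => u a u0 um h.
by field; rewrite u0 um h.
Qed.

Lemma dR_dRk i k x : dR i (dRk i k x) = qint (vi i) k.+1 *: dRk i k.+1 x.
Proof.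
have uq := vi_qint q0 q_nroot hC i.
rewrite /dRk dRZ // scalerA qfactS; congr (_ *: _).
by have := uq k; have := qfact_neq0 uq k; move: (qfact _ k) (qint _ _) => a b ha hb; field; rewrite ha hb.
Qed.

(** Kashiwara's projector to the kernel of [dR i], congruent to the identity modulo $\mathbf
    f\vartheta_i$. Divided powers sit only on the derivations, so the dual lattice is preserved. *)
Definition hwp i K (y : f) : f :=
  \sum_(k < K) ((-1) ^+ k * vi i ^+ 'C(k, 2)) *: (dRk i k y * ftheta i ^+ k).

Lemma dR_hwp i K y : iter K (dR i) y = 0 -> dR i (hwp i K y) = 0.
Proof.
move=> yK; rewrite /hwp dR_sum //.
(* [g k] is the contribution in which the derivation hits $\vartheta_i^k$; the one hitting
   [dRk i k y] cancels the next [g]. *)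
pose g k := ((-1) ^+ k * vi i ^+ ('C(k, 2) + k.-1) * qint (vi i) k) *:
  (dRk i k y * ftheta i ^+ k.-1).
have g0 : g 0%N = 0 by rewrite /g /qint expr0 invr1 subrr mul0r mulr0 scale0r.
have gK : g K = 0 by rewrite /g /dRk yK scaler0 mul0r scaler0.
have E k : dR i (((-1) ^+ k * vi i ^+ 'C(k, 2)) *: (dRk i k y * ftheta i ^+ k)) = g k - g k.+1.
  rewrite dRZ // dR_mul // dR_dRk kap_theta_pow scalerDr; congr (_ + _).
    case: k => [|k]; first by rewrite g0 expr0 dR1 // mulr0 scaler0.
    rewrite dR_theta_pow -scalerAr scalerA /g; congr (_ *: _).
    by rewrite /= exprD !mulrA.
  rewrite /g /= binS bin1 -scalerAl -scalerAr !scalerA -scaleNr; congr (_ *: _).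
  have -> : vi i ^+ ('C(k, 2) + k + k) = vi i ^+ 'C(k, 2) * vi i ^+ (2 * k).
    by rewrite -exprD; congr (_ ^+ _); lia.
  by rewrite exprS; ring.
transitivity (\sum_(k < K) (g k - g k.+1)); first by apply: eq_bigr => k _; apply: E.
rewrite -(big_mkord xpredT (fun k => g k - g k.+1)).
rewrite (eq_bigr (fun k => - (g k.+1 - g k))) => [|k _]; last by rewrite opprB.
by rewrite sumrN telescope_sumr // g0 gK subrr oppr0.
Qed.

Lemma hwp_split i K y : exists y', hwp i K.+1 y = y + y' * ftheta i /\ (fZd y -> fZd y').
Proof.
exists (\sum_(k < K) ((-1) ^+ k.+1 * vi i ^+ 'C(k.+1, 2)) *: (dRk i k.+1 y * ftheta i ^+ k)); split.
  rewrite /hwp big_ord_recl mulr_suml; congr (_ + _).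
    by rewrite /= bin0n !expr0 !mulr1 scale1r /dRk qfact0 invr1 scale1r.
  apply: eq_bigr => k _; rewrite lift0 -[RHS]scalerAl -mulrA.
  by rewrite -exprSr.
move=> h; apply: fZd_sum => k _; apply: fZdZ.
  by apply: lzM; [apply: lz_sign|rewrite exprnP; apply: lz_vi].
elim: (nat_of_ord k) {1}k.+1 => [|m IH] l; first by rewrite expr0 mulr1; apply: fZd_dRk.
by rewrite exprSr mulrA; apply: fZd_Mtheta.
Qed.

Lemma kap_dR i j x : dR i (kap j x) = vi i ^ C i j *: kap j (dR i x).
Proof.
by rewrite !dRE -kap_sig // kap_dL // sigZ // kap_sig.
Qed.

Lemma kap_iter_dR i n m (x : f) : kap i x = vi i ^ n *: x ->
  kap i (iter m (dR i) x) = vi i ^ (n - m.*2%:Z) *: iter m (dR i) x.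
Proof.
have u0 := vi_neq0 d q0 i.
move=> kx; elim: m => [|m IH] /=; first by rewrite subr0.
have := kap_dR i i (iter m (dR i) x).
rewrite IH dRZ // (cartan_diag hC) => /(congr1 (fun z => vi i ^ (- 2%:Z) *: z)).
rewrite !scalerA -!expfzDr // addNr expr0z scale1r => <-.
by congr (vi i ^ _ *: _); rewrite doubleSz; ring.
Qed.

Lemma kap_hwp i K n y : kap i y = vi i ^ n *: y -> kap i (hwp i K y) = vi i ^ n *: hwp i K y.
Proof.
have u0 := vi_neq0 d q0 i.
have kD : {morph kap i : a b / a + b} by move=> *; rewrite kapD.
have k0 : kap i 0 = 0 by rewrite kap0.
move=> ky; rewrite /hwp (big_morph (kap i) kD k0) scaler_sumr.
apply: eq_bigr => k _; rewrite kapZ // kapM // kap_theta_pow /dRk kapZ // (kap_iter_dR _ ky).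
have aux (a b c e : Kv) (X Y : f) : a *: (b *: (c *: X) * (e *: Y)) = (c * e) *: (a *: (b *: X * Y)).
  move: X Y; move: (f : algType Kv) => F X Y.
  by rewrite -!scalerAl -scalerAr !scalerA; congr (_ *: _); ring.
rewrite aux exprnP -expfzDr //; congr (vi i ^ _ *: _).
by rewrite -muln2 PoszM PoszM; ring.
Qed.

Lemma homog_iter_dL i k a x : homf a x -> iter k (dL i) x = 0 \/
  exists2 b, homf b (iter k (dL i) x) & (hgt b + k = hgt a)%N.
Proof.
move=> hx; elim: k => [|k IH]; first by right; exists a; rewrite ?addn0.
case: IH => [E|[b hb <-]] /=; first by left; rewrite E dL0.
have [c hc [->|->]] := homog_dL_lower q0 q_nroot hC hphi i hb; first by left.
by right; exists c; rewrite // hgtD hgt_sroot -addnA add1n.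
Qed.
Lemma homog_iter_dR i k a x : homf a x -> iter k (dR i) x = 0 \/
  exists2 b, homf b (iter k (dR i) x) & (hgt b + k = hgt a)%N.
Proof.
move=> hx; elim: k => [|k IH]; first by right; exists a; rewrite ?addn0.
case: IH => [E|[b hb <-]] /=; first by left; rewrite E dR0.
have [c hc [->|->]] := homog_dR_lower q0 q_nroot hC hphi i hb; first by left.
by right; exists c; rewrite // hgtD hgt_sroot -addnA add1n.
Qed.

Lemma dp_ldp i k : divpow (vi i) (ftheta i) k = den i ^+ k *: ldp i k.
Proof.
have D := den_neq0 q0 q_nroot hC i.
rewrite /Defs.ldp /Defs.ltheta /divpow exprZn !scalerA; congr (_ *: _).
by rewrite -[RHS]mulrA mulrCA -exprMn mulfV // expr1n mulr1.
Qed.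

(* Splitting y into a dR_i-highest vector and an element of the right ideal of theta_i,
   where the weight pairs positively with the i-th coroot, makes both parts recursive. *)
Lemma lz_ip a x y : homf a x -> fZd x -> fZd y -> A (ip x y).
Proof.
have [n] := ubnP (hgt a); elim: n a x y => // n IH a x y an hx Zx Zy.
rewrite -(ip_fpr q0 q_nroot hC hphi y hx); move: (fpr a y) (fZd_fpr a Zy) (@homog_fpr Kv q I C d a y) => {Zy}{}y Zy hy.
have [a0|a0] := eqVneq a 0.
  move: hx Zy; rewrite a0 => /homog_weight0[c E] Zy; move: Zx; rewrite E => Zx.
  rewrite ipZl //; apply: lzM; last by have := Zy [::]; rewrite /dword big_nil.
  by have := Zx [::]; rewrite /dword big_nil ipZr // ip1 // eps1 // mulr1.
have [i ri] := rk_pos hC a0.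
(* A pairing whose left entry is $x$ after at least one skew derivation has smaller weight and falls
   under the induction hypothesis. *)
have lower k l z w : (0 < k + l)%N -> z = dLk i k (dRk i l x) -> fZd w -> A (ip z w).
  move=> kl -> Zw; have Zz := fZd_dLk i k (fZd_dRk i l Zx).
  case: (homog_iter_dR i l hx) => [E|[b hb eb]].
    by rewrite /dRk E scaler0 /dLk (_ : iter k (dL i) 0 = 0) ?scaler0 ?ip0l //; [apply: lz0|
      elim: (k) => //= m ->; rewrite dL0].
  case: (homog_iter_dL i k (homogZ (qfact (vi i) l)^-1 hb)) => [E|[c hc ec]].
    by rewrite /dLk E scaler0 ip0l //; apply: lz0.
  apply: (IH c) => //; last exact: homogZ.
  by move: an kl; rewrite -eb -ec; clear; lia.
have [K yK] := dR_nil q0 q_nroot hC hphi i y.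
have yK1 : iter K.+1 (dR i) y = 0 by rewrite iterS yK dR0.
have [y' [E Zy']] := hwp_split i K y; have {}Zy' := Zy' Zy.
have -> : y = hwp i K.+1 y - y' * ftheta i by rewrite E addrK.
rewrite ipBr //; apply: lzB; last first.
  rewrite ipC // ip_Mtheta // ipC //; apply: lzM; first exact: lz_den.
  rewrite dR_dRk1; apply: (lower 0%N 1%N) => //.
  by rewrite /dLk qfact0 invr1 scale1r.
have Zz : fZd (hwp i K.+1 y) by rewrite E; apply: fZdD => //; apply: fZd_Mtheta.
have kz := kap_hwp K.+1 (kap_rk q0 hC i hy); have Rz := dR_hwp yK1.
move: (hwp i K.+1 y) Zz kz Rz => z Zz kz Rz.
have [L zL] := dL_nil q0 q_nroot hC hphi i z.
(* Every term is flanked by divided powers of total order $k\ge1$, which the adjunctions carry over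
   to $x$. *)
rewrite (sl2_decomp q0 q_nroot hC hphi kz Rz ri zL) ip_sumr // big_nat_cond.
apply: lz_sum => k; rewrite andbT => /andP[k0 _].
rewrite ipZr // ip_sumr // mulr_sumr; apply: lz_sum => b _.
have bk : (b <= k)%N by rewrite -ltnS ltn_ord.
rewrite !dp_ldp.
have aux (g e e' : Kv) (X Y Z : f) : g *: (e *: X * Z * (e' *: Y)) = (g * e * e') *: (X * Z * Y).
  move: X Y Z; move: (f : algType Kv) => F X Y Z.
  by rewrite -!scalerAl -scalerAr !scalerA.
rewrite aux ipZr // ipC // ip_Mldp ip_ldpM ipC // -[(qfact _ k)^-1 *: _]/(dLk i k z).
have -> : (-1) ^+ k * vi i ^+ (k * k) * den i ^- k = (-1) ^+ k * vi i ^ (k * k)%N * den i ^- k by [].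
have D := den_neq0 q0 q_nroot hC i.
(* Each $\vartheta_i$ is $v_i-v_i^{-1}$ times Lusztig's generator; the $k$ such factors cancel the
   denominator coming from [sl2_decomp]. *)
have -> (c c' e w : Kv) : - (c * c' * den i ^- k) * (e * den i ^+ (k - b) * den i ^+ b * w) =
    - (c * c' * e * w).
  have -> : e * den i ^+ (k - b) * den i ^+ b = e * den i ^+ k by rewrite -mulrA -exprD subnK.
  have Dk : den i ^+ k != 0 by rewrite expf_neq0.
  by move: (den i ^+ k) Dk => D' h; field.
apply/lzN/lzM; last by apply: (lower (k - b)%N b) => //; [rewrite subnK|exact: fZd_dLk].
apply: lzM; first by apply: lzM; [apply: lz_sign|apply: lz_vi].
by apply: lzM; [apply: lz_sign|apply: lz_vi].
Qed.
End Integrality.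

(** * The canonical basis and its dual *)

Section Coordinates.
Variables (K : fieldType) (V : lmodType K) (D : set V).
Hypothesis hD : is_basis D id.

(** A list in [lincomb] may repeat a basis vector, so its coefficients are collected before linear
    independence is applied. *)
Definition cosum (s : seq (K * V)) (b : V) : K := \sum_(t <- s | t.2 == b) t.1.

Lemma cosum_cons t s b : cosum (t :: s) b = (if t.2 == b then t.1 else 0) + cosum s b.
Proof. by rewrite /cosum big_cons; case: eqP => // _; rewrite add0r. Qed.

Lemma cosum_notin s b : b \notin [seq t.2 | t <- s] -> cosum s b = 0.
Proof.
elim: s => [|t s IH]; first by rewrite /cosum big_nil.
by rewrite inE negb_or cosum_cons eq_sym => /andP[/negbTE -> /IH ->]; rewrite addr0.
Qed.

Lemma cosum_sum (s : seq (K * V)) (r : seq V) : uniq r -> (forall t, t \in s -> t.2 \in r) ->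
  \sum_(t <- s) t.1 *: t.2 = \sum_(b <- r) cosum s b *: b.
Proof.
move=> ur; elim: s => [|t s IH] h; first by rewrite big_nil big1 // => b _; rewrite /cosum big_nil scale0r.
rewrite big_cons IH; last by move=> u us; apply: h; rewrite inE us orbT.
rewrite (bigD1_seq t.2) ?h ?mem_head //= [RHS](bigD1_seq t.2) ?h ?mem_head //=.
rewrite cosum_cons eqxx scalerDl addrA; congr (_ + _).
by apply: eq_bigr => b bt; rewrite cosum_cons eq_sym (negbTE bt) add0r.
Qed.

Lemma cosum_uniq (s s' : seq (K * V)) b :
  (forall t, t \in s -> D t.2) -> (forall t, t \in s' -> D t.2) ->
  \sum_(t <- s) t.1 *: t.2 = \sum_(t <- s') t.1 *: t.2 -> cosum s b = cosum s' b.
Proof.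
move=> hs hs'; pose r := undup ([seq t.2 | t <- s] ++ [seq t.2 | t <- s']).
have ur : uniq r by apply: undup_uniq.
rewrite (cosum_sum ur); last by move=> t ts; rewrite mem_undup mem_cat (map_f snd).
rewrite (cosum_sum (s := s') ur); last first.
  by move=> t ts; rewrite mem_undup mem_cat; apply/orP; right; apply: (map_f snd).
move/eqP; rewrite -subr_eq0 -sumrB => /eqP E.
have [br|br] := boolP (b \in r).
  apply/eqP; rewrite -subr_eq0; apply/eqP.
  apply: (hD.1 _ (fun b => cosum s b - cosum s' b) ur _ _ _ br).
    move=> c; rewrite mem_undup mem_cat => /orP[]/mapP[t ts ->]; [exact: hs|exact: hs'].
  by rewrite -[RHS]E; apply: eq_bigr => c _; rewrite scalerBl.
move: br; rewrite mem_undup mem_cat negb_or => /andP[b1 b2].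
by rewrite !cosum_notin.
Qed.

Lemma coord_ex x : exists s : seq (K * V), (forall t, t \in s -> D t.2) /\ x = \sum_(t <- s) t.1 *: t.2.
Proof.
have [s [h ->]] := hD.2 x; exists s; split=> // t /h[_ [y Dy <-]].
exact: Dy.
Qed.

Definition coordl x : seq (K * V) := projT1 (cid (coord_ex x)).
Definition coordf (b x : V) : K := cosum (coordl x) b.

Lemma coordlP x : (forall t, t \in coordl x -> D t.2) /\ x = \sum_(t <- coordl x) t.1 *: t.2.
Proof. exact: projT2 (cid (coord_ex x)). Qed.

Lemma coordE s b : (forall t, t \in s -> D t.2) -> coordf b (\sum_(t <- s) t.1 *: t.2) = cosum s b.
Proof.
by move=> h; have [h1 h2] := coordlP (\sum_(t <- s) t.1 *: t.2); apply: cosum_uniq.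
Qed.

Lemma coord_lin b k x y : coordf b (k *: x + y) = k * coordf b x + coordf b y.
Proof.
have [hx Ex] := coordlP x; have [hy Ey] := coordlP y.
pose s := [seq (k * t.1, t.2) | t <- coordl x] ++ coordl y.
have -> : k *: x + y = \sum_(t <- s) t.1 *: t.2.
  rewrite big_cat big_map /= -Ey {1}Ex scaler_sumr; congr (_ + _).
  by apply: eq_bigr => t _; rewrite scalerA.
rewrite coordE => [|t]; last by rewrite mem_cat => /orP[/mapP[u /hx h ->]|/hy].
by rewrite /cosum big_cat big_map /= -mulr_sumr.
Qed.

Lemma coordf_basis b b' : D b -> coordf b' b = (b == b')%:R.
Proof.
move=> Db; have -> : b = \sum_(t <- [:: (1 : K, b)]) t.1 *: t.2 by rewrite big_seq1 scale1r.
rewrite coordE => [|t]; last by rewrite inE => /eqP ->.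
by rewrite /cosum big_cons big_nil big_seq1 scale1r; case: eqP; rewrite ?addr0.
Qed.

Lemma coord_supp x : exists2 r : seq V, uniq r /\ (forall b, b \in r -> D b) &
  forall r', uniq r' -> {subset r <= r'} -> x = \sum_(b <- r') coordf b x *: b.
Proof.
have [hx Ex] := coordlP x; exists (undup [seq t.2 | t <- coordl x]).
  by split=> [|b]; rewrite ?undup_uniq // mem_undup => /mapP[t /hx h ->].
move=> r' ur' h; rewrite {1}Ex (cosum_sum (r := r')) // => t tx.
by apply: h; rewrite mem_undup map_f.
Qed.

Lemma coordf0 x : (forall b, D b -> coordf b x = 0) -> x = 0.
Proof.
move=> h; have [r [ur rD] E] := coord_supp x; rewrite (E r) // big_seq big1 // => b /rD Db.
by rewrite h // scale0r.
Qed.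

Lemma coord_mem (S : set K) x b : S 0 -> (forall a a', S a -> S a' -> S (a + a')) ->
  lincomb S D x -> S (coordf b x).
Proof.
move=> S0 SD [s [h ->]]; rewrite coordE; last by move=> t /h[].
rewrite /cosum big_seq_cond; apply: big_ind => // t /andP[/h[] //].
Qed.

End Coordinates.

(** * Kashiwara operators and homogeneity *)

Section CanonicalBasis.
Variables (Kv : fieldType) (q : Kv) (I : finType) (C : I -> I -> int) (d : I -> nat).
Hypothesis q0 : q != 0.
Hypothesis q_nroot : forall n, q ^+ n.+1 != 1.
Hypothesis hC : finite_cartan C d.
Local Notation vi := (vi q d).
Local Notation f := (fAlg q C d).
Local Notation B := (Bhat q C d).
Local Notation ftheta := (ftheta q C d).
Local Notation N := (Nroot I).
Variable phi : B -> B -> Kv.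
Hypothesis hphi : hopf_pairing phi.
Local Notation dL := (dL phi).
Local Notation den := (den q d).
Local Notation homf := (homog (@deg_f I)).
Local Notation fpr := (@fpr Kv q I C d).
Local Notation ldp := (ldp q C d).
Local Notation ltheta := (ltheta q C d).

(** The axioms determine a skew derivation on words, so the operator quantified over in
    [kashiwara_f] is a fixed multiple of [dL i]; the factor is the ratio of $\vartheta_i$ to
    $\theta_i$. *)
Lemma skew_dL i D : skew_derivation i D -> forall x, D x = den i *: dL i x.
Proof.
move=> hD; have Dn j := den_neq0 q0 q_nroot hC j.
have DZ k y : D (k *: y) = k *: D y.
  have D0 : D 0 = 0 by have := skew_lin hD (-1) 0 0; rewrite scaler0 addr0 scaleN1r addNr.
  by have := skew_lin hD k y 0; rewrite D0 !addr0.
elim/f_indl => [|k a IH|a b IHa IHb|j a IH].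
- by rewrite (skew_one hD) dL1 // scaler0.
- by rewrite DZ IH dLZ // !scalerA mulrC.
- by have := skew_lin hD 1 a b; rewrite !scale1r => ->; rewrite IHa IHb dLD // scalerDr.
have -> : ftheta j = den j *: ltheta j by rewrite /Defs.ltheta scalerA mulfV ?scale1r.
have hl : homf (sroot j) (ltheta j) by apply/homogZ/homog_theta.
rewrite -scalerAl DZ (skew_mul hD _ hl) (skew_theta hD) IH dLZ //.
rewrite dL_mul // /Defs.ltheta dLZ // dL_theta // kapZ // kap_theta // viC //.
have -> : (i == j)%:R * a = (i == j)%:R *: a :> f.
  by case: eqP; rewrite ?mul1r ?scale1r // mul0r scale0r.
rewrite -!scalerAl -!scalerAr !scalerDr !scalerA; congr (_ + _).
  case: eqP => [->|_]; last by rewrite mulr0 mul0r !scale0r scaler0.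
  by rewrite mulr1 mul1r -/(den j) mulfK.
by congr (_ *: _); ring.
Qed.

Lemma dL_ldpM i n (z : f) : dL i z = 0 ->
  dL i (ldp i n.+1 * z) = (vi i ^+ n * (den i)^-1) *: (ldp i n * z).
Proof.
move=> z0; have Dn := den_neq0 q0 q_nroot hC i.
have u0 := vi_neq0 d q0 i; have uq := vi_qint q0 q_nroot hC i.
have P k : dL i (ftheta i ^+ k.+1 * z) = (vi i ^+ k * qint (vi i) k.+1) *: (ftheta i ^+ k * z).
  elim: k => [|k IH].
    by rewrite expr1 expr0 dL_thetaM // eqxx z0 mulr0 scaler0 addr0 !mul1r (qint1 uq).
  rewrite exprS -mulrA dL_thetaM // IH eqxx -scalerAr [ftheta i * (_ * z)]mulrA -exprS scalerA -scalerDl.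
  rewrite (cartan_diag hC); congr (_ *: _).
  have h := qden_neq0' u0 uq.
  have um : vi i ^+ k != 0 by rewrite expf_neq0.
  rewrite -[true%:R]/(1 : Kv) -exprnP /qint !exprS expr0 mulr1.
  move: (vi i) (vi i ^+ k) u0 um h => u a u0 um h.
  by field; rewrite u0 um h.
have E k : ldp i k = ((qfact (vi i) k)^-1 * den i ^- k) *: ftheta i ^+ k.
  by rewrite /Defs.ldp /divpow /Defs.ltheta exprZn scalerA exprVn.
rewrite !E -!scalerAl dLZ // P !scalerA; congr (_ *: _).
have Dk : den i ^+ n != 0 by rewrite expf_neq0.
rewrite qfactS exprS; have := uq n; have := qfact_neq0 uq n.
move: (qfact _ n) (qint _ _) (den i ^+ n) (vi i ^+ n) (den i) Dk Dn => a b D w D' Dk Dn ha hb'.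
by field; rewrite ha hb' Dk Dn.
Qed.

(** [dL i] kills the term $n=0$ and lowers every other divided power by one with a nonzero factor,
    so induction applies to the shifted family. *)
Lemma ldp_uniq i M (Z : nat -> f) : (forall n, dL i (Z n) = 0) ->
  \sum_(n < M) ldp i n * Z n = 0 -> forall n, (n < M)%N -> Z n = 0.
Proof.
elim: M Z => [//|M IH] Z Z0 E.
have Dn := den_neq0 q0 q_nroot hC i; have u0 := vi_neq0 d q0 i.
have l0 : ldp i 0 = 1 by rewrite /Defs.ldp (dp0 (vi i)).
have E' : \sum_(n < M) ldp i n * (vi i ^+ n *: Z n.+1) = 0.
  have := congr1 (fun z => den i *: dL i z) E.
  rewrite dL0 // scaler0 big_ord_recl /= l0 mul1r dLD // Z0 add0r dL_sum // scaler_sumr => H; rewrite -[RHS]H.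
  apply: eq_bigr => n _; rewrite /bump leq0n add1n dL_ldpM // scalerA -scalerAr; congr (_ *: _).
  by rewrite mulrCA mulfV ?mulr1.
have ZS n : (n < M)%N -> Z n.+1 = 0.
  move=> nM; have ZZ m : dL i (vi i ^+ m *: Z m.+1) = 0 by rewrite dLZ // Z0 scaler0.
  move: (IH (fun n => vi i ^+ n *: Z n.+1) ZZ E' n nM) => /eqP; rewrite scaler_eq0 expf_eq0 (negbTE u0) andbF /=; by move/eqP.
case=> [_|n]; last exact: ZS.
move: E; rewrite big_ord_recl /= l0 mul1r big1 ?addr0 // => n _.
by rewrite /bump leq0n add1n ZS ?mulr0.
Qed.

Lemma sum_by_nat (s : seq (nat * f)) (F : nat -> f) M : (forall t, t \in s -> (t.1 < M)%N) ->
  \sum_(t <- s) F t.1 * t.2 = \sum_(n < M) F n * \sum_(t <- s | t.1 == n) t.2.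
Proof.
elim: s => [|t s IH] h; first by rewrite big_nil big1 // => n _; rewrite big_nil mulr0.
rewrite big_cons IH; last by move=> u us; apply: h; rewrite inE us orbT.
have tM := h _ (mem_head _ _).
rewrite (bigD1 (Ordinal tM)) //= [RHS](bigD1 (Ordinal tM)) //= [in RHS]big_cons eqxx.
rewrite mulrDr addrA; congr (_ + _); apply: eq_bigr => n /negbTE nt.
by rewrite big_cons; case: eqP => // E; case/negP: nt; apply/eqP/val_inj.
Qed.

(** Grouped by exponent, the terms vanish separately by [ldp_uniq]. In other words $\tilde f_i$ does
    not depend on the decomposition used. *)
Lemma ldp_shift i (s : seq (nat * f)) : (forall t, t \in s -> dL i t.2 = 0) ->
  \sum_(t <- s) ldp i t.1 * t.2 = 0 -> \sum_(t <- s) ldp i t.1.+1 * t.2 = 0.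
Proof.
move=> s0; pose M := (\max_(t <- s) t.1).+1.
have hM t : t \in s -> (t.1 < M)%N by move=> ts; rewrite ltnS; apply: (leq_bigmax_seq _ ts).
rewrite (sum_by_nat _ hM) => E; rewrite (sum_by_nat (fun n => ldp i n.+1) hM) big1 // => n _.
rewrite (@ldp_uniq i M (fun n => \sum_(t <- s | t.1 == n) t.2) _ E) ?mulr0 // => m.
rewrite dL_sum // big_seq_cond big1 // => t /andP[/s0 -> //].
Qed.

Lemma fpr_dL i c y : fpr c (dL i y) = dL i (fpr (c + sroot i) y).
Proof.
have key b : fpr c (dL i (fpr b y)) = if b == c + sroot i then dL i (fpr b y) else 0.
  have hby := homog_fpr b y.
  have [e he [E|E]] := homog_dL_lower q0 q_nroot hC hphi i hby.
    by rewrite E /fpr gproj0; [case: ifP|exact: f_rel_homog].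
  rewrite (fpr_homog _ he) E; congr (if _ then _ else _).
  by apply/eqP/eqP => [-> //|/NaddI].
have [s us ds] := @gproj_decomp _ _ _ (f_pres q C d) (@deg_f I) y.
have E := ds (undup (c + sroot i :: s)) (undup_uniq _) _.
rewrite {1}E => [|e es]; last by rewrite mem_undup inE es orbT.
rewrite dL_sum // fpr_sum (bigD1_seq (c + sroot i)) ?undup_uniq ?mem_undup ?mem_head //=.
by rewrite key eqxx big1 ?addr0 // => b /negbTE bc; rewrite key bc.
Qed.
Lemma dL_fpr i c y : dL i y = 0 -> dL i (fpr c y) = 0.
Proof.
move=> y0; have [c0|/N_split[b ->]] := eqVneq (c i) 0%N.
  exact: (homog_dL0 q0 q_nroot hC hphi (homog_fpr c y) c0).
by rewrite -fpr_dL y0 /fpr gproj0 //; exact: f_rel_homog.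
Qed.

Definition fquo (c a : N) (y : f) : f :=
  if [forall j, (a j <= c j)%N] then fpr [ffun j => (c j - a j)%N] y else 0.

Lemma fquo_shift c a b y : fquo (c + b) (a + b) y = fquo c a y.
Proof.
rewrite /fquo; congr (if _ then _ else _).
  by apply: eq_forallb => j; rewrite !ffunE leq_add2r.
by congr (fpr _ _); apply/ffunP => j; rewrite !ffunE subnDr.
Qed.

Lemma fpr_homogM c a (x y : f) : homf a x -> fpr c (x * y) = x * fquo c a y.
Proof.
move=> hx; have [s us ds] := @gproj_decomp _ _ _ (f_pres q C d) (@deg_f I) y.
have key b : fpr c (x * fpr b y) = x * (if a + b == c then fpr b y else 0).
  by rewrite (fpr_homog _ (homogM hx (homog_fpr b y))); case: eqP; rewrite ?mulr0.
rewrite /fquo; case: ifP => [/forallP ac|/negbT ac].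
  set b := finfun _; have ab : a + b = c.
    by apply/ffunP => j; rewrite !ffunE; apply: subnKC.
  have E := ds (undup (b :: s)) (undup_uniq _) _.
  rewrite {1}E => [|e es]; last by rewrite mem_undup inE es orbT.
  rewrite mulr_sumr fpr_sum (bigD1_seq b) ?undup_uniq ?mem_undup ?mem_head //= key ab eqxx.
  rewrite big1 ?addr0 // => e eb; rewrite key; case: eqP; rewrite ?mulr0 // => E'.
  by case/eqP: eb; move: E'; rewrite -ab ![a + _]addrC => /NaddI.
rewrite mulr0 (ds s us (fun _ => id)) mulr_sumr fpr_sum big1 // => e _; rewrite key.
case: eqP; rewrite ?mulr0 // => E'; case/negP: ac; apply/forallP => j.
by rewrite -E' ffunE; apply: leq_addr.
Qed.

(** The pieces of the decomposition may be inhomogeneous. Still, the component of $y$ in degree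
    $c+\alpha_i$ arises from that of $x$ in degree $c$ by shifting divided powers, so it vanishes
    together with it. *)
Lemma kashiwara_homog i a (x y : f) : homf a x -> kashiwara_f i x y -> exists b, homf b y.
Proof.
move=> hx [D [s [hD s0 Ex Ey]]]; exists (a + sroot i).
have Dn := den_neq0 q0 q_nroot hC i.
have {}s0 t : t \in s -> dL i t.2 = 0.
  by move=> /s0; rewrite (skew_dL hD) => /eqP; rewrite scaler_eq0 (negbTE Dn) => /eqP.
have hl n : homf (sroot i *+ n) (ldp i n) by apply/homogZ/homogX/homogZ/homog_theta.
have dLq c b z : dL i z = 0 -> dL i (fquo c b z) = 0.
  rewrite /fquo; case: ifP => _; last by rewrite dL0.
  exact: dL_fpr.
have [r ur dr] := @gproj_decomp _ _ _ (f_pres q C d) (@deg_f I) y.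
rewrite (dr r ur (fun _ => id)); apply: homog_sum => g _.
have [<-|ga] := eqVneq g (a + sroot i); first exact: homog_gproj.
suff -> : gproj (@deg_f I) g y = 0 by apply: homog0.
rewrite -/(fpr g y) Ey fpr_sum.
have [g0|/N_split[c Ec]] := eqVneq (g i) 0%N.
  apply: big1 => t _; rewrite (fpr_homogM _ _ (hl _)) /fquo; case: forallP; rewrite ?mulr0 // => h.
  by have := h i; rewrite g0 mulrSr ffunE [sroot i i]ffunE eqxx leqn0 addn_eq0 andbF.
have ca : a != c by apply: contraNneq ga => ->; rewrite Ec.
pose s' := [seq (t.1, fquo c (sroot i *+ t.1) t.2) | t <- s].
have := @ldp_shift i s' _ _; rewrite !big_map /= => H.
transitivity (\sum_(t <- s) ldp i t.1.+1 * fquo c (sroot i *+ t.1) t.2).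
  by apply: eq_bigr => t _; rewrite (fpr_homogM _ _ (hl _)) Ec mulrSr fquo_shift.
apply: H => [t /mapP[u /s0 us ->]|]; first exact: dLq.
transitivity (fpr c x); last by rewrite (fpr_homog _ hx) (negbTE ca).
by rewrite Ex fpr_sum; apply: eq_bigr => t _; rewrite (fpr_homogM _ _ (hl _)).
Qed.
End CanonicalBasis.

(** * Homogeneity of the canonical basis and integrality of its dual *)

Section DualBasis.
Variables (Kv : fieldType) (q : Kv) (I : finType) (C : I -> I -> int) (d : I -> nat).
Hypothesis q0 : q != 0.
Hypothesis q_nroot : forall n, q ^+ n.+1 != 1.
Hypothesis hC : finite_cartan C d.
Local Notation v := (v q).
Local Notation vi := (vi q d).
Local Notation f := (fAlg q C d).
Local Notation B := (Bhat q C d).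
Local Notation ftheta := (ftheta q C d).
Local Notation N := (Nroot I).
Variable phi : B -> B -> Kv.
Hypothesis hphi : hopf_pairing phi.
Local Notation ip := (ip phi).
Local Notation den := (den q d).
Local Notation homf := (homog (@deg_f I)).
Local Notation fpr := (@fpr Kv q I C d).
Local Notation ltheta := (ltheta q C d).
Local Notation fw := (@fword Kv I (f_pres q C d)).
Local Notation dword := (@dword Kv q I C d).
Local Notation fZd := (fZd phi).
Variable conj : {rmorphism Kv -> Kv}.
Hypothesis conj_q : conj q = q^-1.
Hypothesis conj_semi : forall (V : lmodType Kv) (T : V -> V), {morph T : x y / x + y} ->
  (forall a, T (q *: a) = q^-1 *: T a) -> forall c a, T (c *: a) = conj c *: T a.
Hypothesis reg_add : forall a b, regular_oo q a -> regular_oo q b -> regular_oo q (a + b).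
Hypothesis lz_sep : forall c r, laurentZ q c -> regular_oo q r -> c = v^-1 * r -> conj c = c -> c = 0.
Variable Ccan : set f.
Hypothesis hcan : canonical_basis Ccan.
Let hb := can_basis hcan.
Let v0 : v != 0. Proof. exact: v_neq0. Qed.
Local Notation co := (coordf hb).

Lemma crystal_homog (x : f) : crystal_elt x -> exists a, homf a x.
Proof.
elim=> [|i y z _ [a hy] /(kashiwara_homog q0 q_nroot hC hphi hy)//].
by exists 0; apply: homog1.
Qed.

Lemma homog_dword s : homf (\sum_(t <- s) (sroot t.1 *+ t.2)) (dword s).
Proof.
rewrite /dword; elim: s => [|t s IH]; first by rewrite !big_nil; apply: homog1.
by rewrite !big_cons; apply: homogM => //; apply/homogZ/homogX/homogZ/homog_theta.
Qed.

Lemma lincomb_fpr (R : set Kv) (S : set f) c x : (forall y, S y -> exists a, homf a y) ->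
  lincomb R S x -> lincomb R S (fpr c x).
Proof.
move=> hS [s [h ->]]; exists [seq t <- s | fpr c t.2 != 0]; split.
  by move=> t; rewrite mem_filter => /andP[_ /h].
rewrite fpr_sum big_filter [RHS]big_mkcond [LHS]big_seq [RHS]big_seq; apply: eq_bigr => t /h[_ /hS[a ha]].
rewrite fprZ (fpr_homog _ ha); case: (a == c); last by rewrite eqxx scaler0.
by case: eqP => //= ->; rewrite scaler0.
Qed.

Section Bar.
Variable psi : f -> f.
Hypothesis hpsi : bar_f psi.

Lemma psiZ c x : psi (c *: x) = conj c *: psi x.
Proof. exact: (conj_semi (bar_f_add hpsi) (bar_f_vhalf hpsi)). Qed.
Lemma psi0 : psi 0 = 0. Proof. by have := psiZ 0 0; rewrite rmorph0 !scale0r. Qed.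
Lemma psi_sum J (s : seq J) (Q : pred J) (F : J -> f) :
  psi (\sum_(j <- s | Q j) F j) = \sum_(j <- s | Q j) psi (F j).
Proof. exact: (big_morph psi (bar_f_add hpsi) psi0). Qed.

Lemma conj_v : conj v = v^-1. Proof. by rewrite /Defs.v rmorphXn /= conj_q exprVn. Qed.
Lemma conj_vi i : conj (vi i) = (vi i)^-1.
Proof. by rewrite /Defs.vi rmorphXn /= conj_v exprVn. Qed.
Lemma conj_den i : conj (den i) = - den i.
Proof. by rewrite rmorphB fmorphV /= conj_vi invrK opprB. Qed.

Lemma psi_theta i : psi (ftheta i) = - ftheta i.
Proof.
have D := den_neq0 q0 q_nroot hC i.
have E : ftheta i = den i *: ltheta i by rewrite /Defs.ltheta scalerA mulfV ?scale1r.
by rewrite E psiZ (bar_f_theta hpsi) conj_den scaleNr.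
Qed.

Lemma homog_psi a x : homf a x -> homf a (psi x).
Proof.
move: x; apply: homog_ind => [|k y|y z|s <-].
- by rewrite psi0; apply: homog0.
- by rewrite psiZ; apply: homogZ.
- by rewrite (bar_f_add hpsi); apply: homogD.
elim: s => [|i s IH]; first by rewrite /fword !big_nil (bar_f_one hpsi); apply: homog1.
rewrite /fword !big_cons (bar_f_mul hpsi) psi_theta; apply: homogM => //.
exact/homogN/homog_theta.
Qed.

Lemma psi_fpr c x : psi (fpr c x) = fpr c (psi x).
Proof.
have key b : fpr c (psi (fpr b x)) = if b == c then psi (fpr b x) else 0.
  exact/fpr_homog/homog_psi/homog_fpr.
have [s us ds] := @gproj_decomp _ _ _ (f_pres q C d) (@deg_f I) x.
have E := ds (undup (c :: s)) (undup_uniq _) _.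
rewrite {2}E => [|e es]; last by rewrite mem_undup inE es orbT.
rewrite psi_sum fpr_sum (bigD1_seq c) ?undup_uniq ?mem_undup ?mem_head //= key eqxx.
by rewrite big1 ?addr0 // => b /negbTE bc; rewrite key bc.
Qed.

Lemma psi_coord b x : (forall b', Ccan b' -> psi b' = b') -> co b (psi x) = conj (co b x).
Proof.
move=> hB; have [h E] := coordlP hb x; rewrite {1}E psi_sum.
transitivity (co b (\sum_(t <- [seq (conj t.1, t.2) | t <- coordl hb x]) t.1 *: t.2)).
  rewrite big_map; congr (co b _); rewrite big_seq [RHS]big_seq; apply: eq_bigr => t /h Bt.
  by rewrite psiZ hB.
rewrite (coordE hb); last by move=> t /mapP[u /h Bu ->].
by rewrite /coordf /cosum big_map rmorph_sum.
Qed.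
End Bar.

Lemma reg0 : regular_oo q 0.
Proof. by exists 0, 1; rewrite oner_eq0 size_poly0 /map_poly size_poly0 poly_def big_ord0 horner0 mul0r. Qed.

Lemma can_f_integral b : Ccan b -> @f_integral Kv q I C d b.
Proof.
move=> Bb; rewrite (can_integral hcan); exists [:: (1, b)]; rewrite big_seq1 scale1r; split=> // t.
by rewrite inE => /eqP ->; split=> //; apply: lz1.
Qed.

Lemma co_sum b J (s : seq J) (Q : pred J) (F : J -> f) :
  co b (\sum_(j <- s | Q j) F j) = \sum_(j <- s | Q j) co b (F j).
Proof.
have co0 : co b 0 = 0.
  by have := coord_lin hb b (-1) 0 0; rewrite scaler0 addr0 mulN1r addNr.
by apply: (big_morph (co b)) => // x y; have := coord_lin hb b 1 x y; rewrite scale1r mul1r.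
Qed.
Lemma co0 b : co b 0 = 0.
Proof. by have := coord_lin hb b (-1) 0 0; rewrite scaler0 addr0 mulN1r addNr. Qed.
Lemma coZ b c x : co b (c *: x) = c * co b x.
Proof. by have := coord_lin hb b c x 0; rewrite addr0 => ->; rewrite co0 addr0. Qed.

(** A component of $b$ in a degree other than that of its crystal element is bar-invariant, integral
    and in $v^{-1}L(\infty)$. Each of its coefficients is then an invariant Laurent polynomial that
    vanishes at $v=\infty$, hence 0 by [lz_sep]. *)
Lemma can_homog b : Ccan b -> exists a, homf a b.
Proof.
move=> Bb; have [x cx [z Lz E]] := can_crystal hcan Bb.
have [a hx] := crystal_homog cx; exists a.
have [psi hpsi psiB] := can_bar hcan.
have [r ur dr] := @gproj_decomp _ _ _ (f_pres q C d) (@deg_f I) b.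
rewrite (dr r ur (fun _ => id)); apply: homog_sum => g _.
have [<-|ga] := eqVneq g a; first exact: homog_gproj.
suff -> : gproj (@deg_f I) g b = 0 by apply: homog0.
rewrite -/(fpr g b); apply: (coordf0 (hD := hb)) => b' Bb'.
have Ib : f_integral (fpr g b).
  apply: lincomb_fpr => [_ [s _ <-]|]; first by eexists; apply: homog_dword.
  exact: (can_f_integral Bb).
have Lg : crystal_lattice (fpr g z) by apply: lincomb_fpr Lz => y; apply: crystal_homog.
move: Ib Lg; rewrite (can_integral hcan) (can_lattice hcan) => Ib Lg.
apply: (@lz_sep _ (co b' (fpr g z))).
- by apply: coord_mem Ib; [apply: lz0|apply: lzD].
- by apply: coord_mem Lg; [apply: reg0|apply: reg_add].
- have -> : fpr g b = v^-1 *: fpr g z.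
    rewrite -fprZ -E; have -> : b - x = b + (-1) *: x by rewrite scaleN1r.
    by rewrite fprD fprZ (fpr_homog _ hx) eq_sym (negbTE ga) scaler0 addr0.
  by rewrite coZ.
by rewrite -(psi_coord hpsi) // (psi_fpr hpsi) psiB.
Qed.
Lemma can_neq0 b : Ccan b -> b != 0.
Proof.
move=> Bb; apply/eqP => b0; have := coordf_basis hb b Bb; rewrite {2}b0 co0 eqxx.
by move/esym/eqP; rewrite -[true%:R]/(1 : Kv) oner_eq0.
Qed.

Lemma can_wt b : Ccan b -> homf (wt_f b) b.
Proof.
move=> Bb; have [a ha] := can_homog Bb.
by rewrite /wt_f (weight_homog (@f_rel_homog Kv q I C d) ha) // can_neq0.
Qed.

Lemma co_weight a b x : homf a x -> Ccan b -> co b x != 0 -> wt_f b = a.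
Proof.
move=> hx Bb; have <- : fpr a x = x by rewrite (fpr_homog _ hx) eqxx.
have [r [ur rD] E] := coord_supp hb x; rewrite (E r) // fpr_sum co_sum; apply: contraNeq => ba.
rewrite big_seq big1 // => b' /rD Bb'; rewrite fprZ (fpr_homog _ (can_wt Bb')) coZ.
case: eqP => [E'|_]; last by rewrite co0 mulr0.
rewrite (coordf_basis hb b Bb'); case: (eqVneq b' b) => [bb|_]; last by rewrite /= mulr0.
by move: ba; rewrite -bb E' eqxx.
Qed.

Lemma hgt_wdg (s : seq I) : hgt (\sum_(y <- s) deg_f y) = size s.
Proof.
elim: s => [|i s IH]; last by rewrite big_cons hgtD hgt_sroot IH.
by rewrite big_nil /hgt big1 // => i _; rewrite ffunE.
Qed.

(** Words of length $n$ span the part of height $n$, so each canonical basis element of that height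
    occurs in the expansion of one of them. This is how weight spaces get a finite enumerated
    basis. *)
Definition can_pool (n : nat) : seq f :=
  flatten [seq [seq t.2 | t <- coordl hb (fw w)] | w <- [seq tval w | w <- enum {: n.-tuple I}]].
Definition can_seq (a : N) : seq f :=
  undup [seq b <- can_pool (hgt a) | `[< Ccan b /\ wt_f b = a >]].

Lemma can_seqP a b : (b \in can_seq a) = `[< Ccan b /\ wt_f b = a >].
Proof.
rewrite mem_undup mem_filter; case: asboolP => //= -[Bb ba].
have ha : homf a b by rewrite -ba; apply: can_wt.
suff H x : homf a x -> co b x != 0 -> b \in can_pool (hgt a).
  by apply: (H b) => //; rewrite coordf_basis // eqxx oner_eq0.
move=> hx; apply: contraNT => nb; apply/eqP; move: x hx.
apply: homog_ind => [|k y E|y z E E'|s E]; first exact: co0.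
- by rewrite coZ E mulr0.
- by have := coord_lin hb b 1 y z; rewrite scale1r => ->; rewrite E E' mulr0 addr0.
rewrite /coordf cosum_notin //; apply: contra nb => bs; apply/flattenP.
exists [seq t.2 | t <- coordl hb (fw s)] => //; apply/mapP; exists s => //.
have sz : size s == hgt a by rewrite -E hgt_wdg.
by apply/mapP; exists (Tuple sz); rewrite ?mem_enum.
Qed.

Lemma can_seq_uniq a : uniq (can_seq a). Proof. exact: undup_uniq. Qed.

Lemma can_expand a x : homf a x -> x = \sum_(b <- can_seq a) co b x *: b.
Proof.
move=> hx; have [r [ur rD] E] := coord_supp hb x.
rewrite {1}(E (undup (r ++ can_seq a)) (undup_uniq _)); last first.
  by move=> b br; rewrite mem_undup mem_cat br.
rewrite (bigID (mem (can_seq a))) /= [X in _ + X]big_seq_cond [X in _ + X]big1 ?addr0.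
  rewrite -big_filter; apply: perm_big; apply: uniq_perm; rewrite ?filter_uniq ?undup_uniq //.
  by move=> b; move: (can_seq a) => cs; rewrite mem_filter mem_undup mem_cat; case: (b \in cs); rewrite ?orbT.
move=> b; rewrite mem_undup mem_cat => /andP[/orP[/rD Bb nb|->//]].
case: (eqVneq (co b x) 0) => [->|nz]; first by rewrite scale0r.
by case/negP: nb; rewrite can_seqP; apply/asboolP; split=> //; apply: (co_weight hx).
Qed.

Lemma dual_elt_uniq b y z : dual_elt phi Ccan b y -> dual_elt phi Ccan b z -> y = z.
Proof.
move=> hy hz; apply/eqP; rewrite -subr_eq0; apply/eqP.
apply: (ip_nondeg q0 q_nroot hC hphi) => w.
have [r [ur rD] E] := coord_supp hb w; rewrite (E r) // ip_suml // big_seq big1 // => c /rD Bc.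
by rewrite ipZl // ipBr // !(ipC hphi c) !ipE hy // hz // subrr mulr0.
Qed.

Lemma dual_ex b : Ccan b -> exists2 y, homf (wt_f b) y & dual_elt phi Ccan b y.
Proof.
move=> Bb; set a := wt_f b; pose s := can_seq a; pose n := size s.
have sP (i : 'I_n) : Ccan s`_i /\ wt_f s`_i = a.
  by apply/asboolP; rewrite -can_seqP; apply: mem_nth.
have hs (i : 'I_n) : homf a s`_i by have [h <-] := sP i; apply: can_wt.
(* The Gram matrix of one weight space. A kernel vector would be orthogonal to that weight space,
   hence to everything; so [G] is invertible, and a row of its inverse gives the dual vector. *)
pose G : 'M[Kv]_n := \matrix_(i, j) ip s`_i s`_j.
have Gu : G \in unitmx.
  rewrite -row_free_unit; apply: inj_row_free => u uG.
  pose y := \sum_(i < n) u 0 i *: s`_i.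
  have y0 : y = 0.
    apply: (ip_nondeg q0 q_nroot hC hphi) => z; rewrite ipC //.
    have hy : homf a y by apply: homog_sum => i _; apply/homogZ/hs.
    rewrite -(ip_fpr q0 q_nroot hC hphi _ hy) (can_expand (homog_fpr a z)) ip_sumr //.
    rewrite (big_nth 0) big_mkord big1 // => j _; rewrite ipZr // /y ip_suml //.
    have /rowP/(_ j) := uG; rewrite !mxE => E; rewrite (_ : \sum_(_ < _) _ = 0) ?mulr0 //.
    by rewrite -[RHS]E; apply: eq_bigr => i _; rewrite ipZl // mxE.
  apply/rowP => i; rewrite mxE.
  have := hb.1 s (fun c => u 0 (insubd i (index c s))) (can_seq_uniq a) _ _ s`_i (mem_nth 0 (ltn_ord i)).
  rewrite index_uniq ?can_seq_uniq // (_ : insubd i _ = i); last by apply/val_inj; rewrite val_insubd ltn_ord.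
  apply; first by move=> c; rewrite can_seqP => /asboolP[].
  rewrite -[RHS]y0 /y (big_nth 0) big_mkord; apply: eq_bigr => j _.
  rewrite index_uniq ?can_seq_uniq // (_ : insubd i _ = j) //.
  by apply/val_inj; rewrite val_insubd ltn_ord.
have bs : b \in s by rewrite can_seqP; apply/asboolP.
have kn : (index b s < n)%N by rewrite index_mem.
pose k := Ordinal kn; pose y := \sum_(i < n) invmx G k i *: s`_i.
have hy : homf a y by apply: homog_sum => i _; apply/homogZ/hs.
exists y => // b' Bb'; rewrite -ipE.
have [ab|ab] := eqVneq a (wt_f b'); last first.
  rewrite (ip_orth q0 q_nroot hC hphi hy (can_wt Bb') ab); case: eqP => // bb.
  by rewrite -bb eqxx in ab.
have bs' : b' \in s by rewrite can_seqP; apply/asboolP.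
have jn : (index b' s < n)%N by rewrite index_mem.
have -> : b' = s`_(Ordinal jn) by rewrite /= nth_index.
rewrite /y ip_suml //; transitivity ((invmx G *m G) k (Ordinal jn)).
  by rewrite mxE; apply: eq_bigr => i _; rewrite ipZl // [G _ _]mxE.
rewrite mulVmx // mxE; congr (nat_of_bool _)%:R.
have := nth_uniq 0 kn jn (can_seq_uniq a); rewrite (nth_index 0 bs) => ->.
by rewrite -val_eqE.
Qed.

Definition dualf (b : f) : f := xget 0 [set y | dual_elt phi Ccan b y].
Lemma dualP b : Ccan b -> dual_elt phi Ccan b (dualf b).
Proof. by move=> /dual_ex[y _ hy]; rewrite /dualf; case: xgetP => [//|/(_ y)]. Qed.
Lemma dualE b y : dual_elt phi Ccan b y -> y = dualf b.
Proof. by move=> hy; apply: (dual_elt_uniq hy); exact: (@xgetPex _ 0 [set z | dual_elt phi Ccan b z] (ex_intro _ y hy)). Qed.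
Lemma homog_dual b : Ccan b -> homf (wt_f b) (dualf b).
Proof. by move=> /dual_ex[y hy /dualE <-]. Qed.
Lemma ip_dual b b' : Ccan b -> Ccan b' -> ip (dualf b) b' = (b == b')%:R.
Proof. by move=> Bb Bb'; apply: dualP. Qed.

Lemma co_ip b x : Ccan b -> co b x = ip x (dualf b).
Proof.
move=> Bb; have [r [ur rD] E] := coord_supp hb x; rewrite (E r) // co_sum ip_suml //.
rewrite big_seq [RHS]big_seq; apply: eq_bigr => c /rD Bc.
by rewrite coZ ipZl // (coordf_basis hb b Bc) (ipC hphi c) ip_dual // eq_sym.
Qed.

Lemma can_expand_ip a x : homf a x -> x = \sum_(b <- can_seq a) ip x (dualf b) *: b.
Proof.
move=> /can_expand {1}->; rewrite big_seq [RHS]big_seq; apply: eq_bigr => b.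
by rewrite can_seqP => /asboolP[Bb _]; rewrite co_ip.
Qed.
Lemma dual_expand a x : homf a x -> x = \sum_(b <- can_seq a) ip x b *: dualf b.
Proof.
move=> hx; apply/eqP; rewrite -subr_eq0; apply/eqP.
apply: (ip_nondeg q0 q_nroot hC hphi) => z; rewrite ipBr // ip_sumr //.
rewrite ipC // -(ip_fpr q0 q_nroot hC hphi z hx) {1}(can_expand_ip (homog_fpr a z)) ip_sumr //.
rewrite -sumrB big_seq big1 // => b; rewrite can_seqP => /asboolP[Bb ba].
rewrite !ipZr // mulrC (ipC hphi z) -(ip_fpr q0 q_nroot hC hphi z (a := a)); last by rewrite -ba; apply: homog_dual.
by rewrite (ipC hphi (dualf b)) subrr.
Qed.

(** By [co_ip], pairing with $b^*$ reads off a canonical coordinate, and on the integral form these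
    lie in $\mathbb Z[v,v^{-1}]$. *)
Lemma fZd_dual b : Ccan b -> fZd (dualf b).
Proof.
move=> Bb s; rewrite -co_ip //.
have Is : f_integral (dword s).
  exists [:: (1, dword s)]; rewrite big_seq1 scale1r; split=> // t.
  by rewrite inE => /eqP ->; split; [apply: lz1|exists s].
by move: Is; rewrite (can_integral hcan) => Is; apply: coord_mem Is; [apply: lz0|apply: lzD].
Qed.

(** The coordinates of $b^*$ are the pairings of $b^*$ with the $c^*$, all in the dual lattice, so
    [lz_ip] applies. *)
Lemma dual_f_integral b : Ccan b -> @f_integral Kv q I C d (dualf b).
Proof.
move=> Bb; rewrite (can_integral hcan) (can_expand_ip (homog_dual Bb)).
exists [seq (ip (dualf b) (dualf c), c) | c <- can_seq (wt_f b)]; rewrite big_map; split=> // t.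
move=> /mapP[c]; rewrite can_seqP => /asboolP[Bc _ ->]; split=> //=.
by apply: (lz_ip q0 q_nroot hC hphi (homog_dual Bb)); apply: fZd_dual.
Qed.
End DualBasis.

(** * The iHopf product and its bar involution *)

Section Triangular.
Variables (Kv : fieldType) (q : Kv) (I : finType) (C : I -> I -> int) (d : I -> nat).
Hypothesis q0 : q != 0.
Hypothesis q_nroot : forall n, q ^+ n.+1 != 1.
Hypothesis hC : finite_cartan C d.
Local Notation v := (v q).
Local Notation f := (fAlg q C d).
Local Notation B := (Bhat q C d).
Local Notation hh := (hh q C d).
Local Notation ftheta := (ftheta q C d).
Local Notation iota := (@iotaB Kv q I C d).
Local Notation N := (Nroot I).
Local Notation nf := (nform C d).
Variable phi : B -> B -> Kv.
Hypothesis hphi : hopf_pairing phi.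
Local Notation kap := (@kap Kv q I C d).
Local Notation homf := (homog (@deg_f I)).
Local Notation hr := (@hroot Kv q I C d).

Let v0 : v != 0. Proof. exact: v_neq0. Qed.

Lemma N_ind (P : N -> Prop) : P 0 -> (forall b i, P b -> P (b + sroot i)) -> forall a, P a.
Proof.
move=> P0 PS a; have [n] := ubnP (hgt a); elim: n a => // n IH a an.
have [->//|a0] := eqVneq a 0.
have [i ai] : exists i, a i != 0%N.
  apply/existsP; apply: contraNT a0; rewrite negb_exists => /forallP h.
  by apply/eqP/ffunP => i; rewrite ffunE; apply/eqP; have := h i; rewrite negbK.
have [b E] := N_split ai; rewrite E; apply/PS/IH.
by move: an; rewrite E hgtD hgt_sroot addn1.
Qed.

Lemma hroot0 : hr 0 = 1.
Proof. by rewrite /hroot big1 // => i _; rewrite ffunE expr0. Qed.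
Lemma hrootD a b : hr (a + b) = hr a * hr b.
Proof.
rewrite /hroot -prodrM_comm; first by apply: eq_bigr => i _; rewrite ffunE exprD.
by move=> i j _ _; apply/commrX/commr_sym/commrX/hhC.
Qed.
Lemma hroot_sroot i : hr (sroot i) = hh i.
Proof.
rewrite /hroot; have E j : hh j ^+ (sroot i) j = if j == i then hh j else 1.
  by rewrite ffunE; case: eqP => _; rewrite ?expr1 ?expr0.
rewrite (eq_bigr _ (fun j _ => E j)) -big_mkcond big_pred1_eq.
by [].
Qed.

Lemma hh_iota i y : hh i * iota y = iota (kap i y) * hh i.
Proof.
elim/f_indl: y => [|k a IH|a b IHa IHb|j a IH].
- by rewrite kap1 // iB1 // mulr1 mul1r.
- by rewrite kapZ // !iBZ // -scalerAr IH scalerAl.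
- by rewrite kapD // !iBD // mulrDr IHa IHb mulrDl.
rewrite kapM // kap_theta // -scalerAl iBZ // !iBM // iB_theta // mulrA hh_theta.
by rewrite -!scalerAl -!mulrA IH.
Qed.

Lemma hroot_iota a b y : homf b y -> hr a * iota y = v ^ nf a b *: (iota y * hr a).
Proof.
move=> hy; elim/N_ind: a => [|a i IH]; first by rewrite hroot0 nform0l // expr0z scale1r mul1r mulr1.
rewrite hrootD hroot_sroot -mulrA hh_iota (kap_homog q0 hC i hy) iBZ //.
rewrite -scalerAl -scalerAr [hr a * (_ * _)]mulrA IH -scalerAl scalerA -mulrA; congr (_ *: _).
by rewrite -vD // nformDl // addrC.
Qed.

(** All terms of a relation contain the same generators with the same multiplicities, so any choice
    of degrees works; [deg_h] and [deg_B] are the ones used. *)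
Lemma B_rel_homog (deg : Bgen I -> N) (r : freeAlg Kv (Bgen I)) :
  prels (B_pres q C d) r -> exists a, fhomog deg a r.
Proof.
move=> [[i [j [_ ->]]]|[i [j ->]]|[i [j ->]]].
- exact: (@fhomog_serre Kv q I C d _ deg (fun i => inl i : Bgen I)).
- exists (deg (inr i) + deg (inr j)); apply: fhomogD.
    by apply: fhomogM; apply: fhomog_gen.
  by apply: fhomogN; rewrite addrC; apply: fhomogM; apply: fhomog_gen.
exists (deg (inr i) + deg (inl j)); apply: fhomogD.
  by apply: fhomogM; apply: fhomog_gen.
by apply/fhomogN/fhomogZ; rewrite addrC; apply: fhomogM; apply: fhomog_gen.
Qed.

Definition deg_h (x : Bgen I) : N := match x with inl _ => 0 | inr i => sroot i end.
Definition hpr (a : N) (x : B) : B := gproj deg_h a x.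

Lemma homog_iota_deg (deg : Bgen I -> N) (degf : I -> N) a y :
  (forall i, deg (inl i) = degf i) -> homog degf a y -> homog deg a (iota y).
Proof.
move=> E; move: y; apply: homog_ind => [|k y|y z|s <-].
- by rewrite iB0 //; apply: homog0.
- by rewrite iBZ //; apply: homogZ.
- by rewrite iBD //; apply: homogD.
elim: s => [|i s IH]; first by rewrite /fword !big_nil iB1 //; apply: homog1.
rewrite /fword !big_cons iBM //; apply: homogM => //; rewrite -E.
rewrite -[pgen _ i]/(ftheta i) iB_theta //; exact: (@homog_gen _ _ _ (B_pres q C d)).
Qed.

Lemma homog_h_iota y : homog deg_h 0 (iota y).
Proof.
elim/f_indl: y => [|k a IH|a b IHa IHb|j a IH].
- by rewrite iB1 //; apply: homog1.
- by rewrite iBZ //; apply: homogZ.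
- by rewrite iBD //; apply: homogD.
rewrite iBM // iB_theta // -[0]addr0; apply: homogM => //.
exact: (@homog_gen _ _ _ (B_pres q C d) deg_h (inl j)).
Qed.
Lemma homog_hroot (deg : Bgen I -> N) (s : N -> N) a : s 0 = 0 ->
  (forall b c, s (b + c) = s b + s c) -> (forall i, deg (inr i) = s (sroot i)) ->
  homog deg (s a) (hr a).
Proof.
move=> s0 sD E; elim/N_ind: a => [|a i IH]; first by rewrite s0 hroot0; apply: homog1.
rewrite sD hrootD hroot_sroot; apply: homogM => //; rewrite -E.
exact: (@homog_gen _ _ _ (B_pres q C d)).
Qed.
Lemma homog_h y a : homog deg_h a (iota y * hr a).
Proof.
rewrite -[a in homog _ a _]add0r; apply: homogM; first exact: homog_h_iota.
exact: (homog_hroot (s := id)).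
Qed.

Lemma hh_shift i y a : hh i * (iota y * hr a) = iota (kap i y) * hr (a + sroot i).
Proof. by rewrite mulrA hh_iota -mulrA addrC hrootD hroot_sroot. Qed.

Lemma hpr_ex a X : exists y, hpr a X = iota y * hr a.
Proof.
have hpD x y : hpr a (x + y) = hpr a x + hpr a y by apply/gprojD/B_rel_homog.
have hpZ k x : hpr a (k *: x) = k *: hpr a x by apply/gprojZ/B_rel_homog.
have hpE b y : hpr a (iota y * hr b) = iota (if b == a then y else 0) * hr a.
  rewrite /hpr (gproj_homog (@B_rel_homog deg_h) _ (homog_h y b)).
  by case: eqP => [->|_] //; rewrite iB0 // mul0r.
suff : exists s : seq (f * N), X = \sum_(t <- s) iota t.1 * hr t.2.
  move=> [s ->]; elim: s => [|t s [y IH]].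
    by exists 0; rewrite big_nil iB0 // mul0r /hpr gproj0 //; apply: B_rel_homog.
  by rewrite big_cons hpD hpE IH -mulrDl -iBD //; eexists.
elim/B_indl: X => [|k X [s ->]|X Y [s ->] [t ->]|i X [s ->]|i X [s ->]].
- by exists [:: (1, 0)]; rewrite big_seq1 iB1 // hroot0 mulr1.
- exists [seq (k *: t.1, t.2) | t <- s]; rewrite big_map scaler_sumr.
  by apply: eq_bigr => t _; rewrite iBZ // scalerAl.
- by exists (s ++ t); rewrite big_cat.
- exists [seq (ftheta i * t.1, t.2) | t <- s]; rewrite big_map mulr_sumr.
  by apply: eq_bigr => t _; rewrite iBM // iB_theta // mulrA.
exists [seq (kap i t.1, t.2 + sroot i) | t <- s]; rewrite big_map mulr_sumr.
by apply: eq_bigr => t _; rewrite hh_shift.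
Qed.

Lemma cR_phih_iota i z : cR (phi (hh i)) (iota z) = iota z.
Proof.
have hl := linf_phir hphi (hh i).
have cZ k x : cR (phi (hh i)) (k *: x) = k *: cR (phi (hh i)) x.
  have c0 : cR (phi (hh i)) 0 = 0 :> B.
    have := cRD q0 q_nroot hC (-1) 0 0 hl; rewrite scaler0 addr0 => ->.
    by rewrite scaleN1r addNr.
  by have := cRD q0 q_nroot hC k x 0 hl; rewrite c0 !addr0.
elim/f_indl: z => [|k a IH|a b IHa IHb|j a IH].
- by rewrite iB1 // cR1 // (phi_sym hphi) (phi_unit hphi) counit_h scale1r.
- by rewrite iBZ // cZ IH.
- by rewrite iBD // -[iota a]scale1r cRD // IHa IHb scale1r.
rewrite iBM // iB_theta // (cR_mul q0 q_nroot hC (l := phi (hh i)) (a1 := phi (hh i))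
  (b1 := phi (hh i)) (a2 := fun _ => 0) (b2 := fun _ => 0)); try exact: linf0; try exact: hl.
  rewrite IH !cR_theta //; try exact: linf0.
  rewrite (phi_h_theta hphi) (phi_sym hphi) (phi_unit hphi) counit_h.
  by rewrite !scale0r !addr0 scale1r mul0r addr0.
by move=> x y; rewrite (phi_h_mul q0 q_nroot hC hphi) mul0r addr0.
Qed.

(** Contracting the second leg with $\varphi(h_i,-)$ fixes the image of [f], so pairing with [f]
    does not see $h_a$. With nondegeneracy this gives the freeness [iota_hroot_inj]. *)
Lemma phi_hroot_iota X a z : phi (X * hr a) (iota z) = phi X (iota z).
Proof.
elim/N_ind: a X => [|a i IH] X; first by rewrite hroot0 mulr1.
by rewrite hrootD hroot_sroot mulrA (phiMR hphi) cR_phih_iota IH.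
Qed.

Lemma iota_hroot_inj a y : iota y * hr a = 0 -> y = 0.
Proof.
move=> E; apply: (ip_nondeg q0 q_nroot hC hphi) => z; rewrite ipC // !ipE.
rewrite -(phi_hroot_iota _ a) E; have := phi_linl hphi 0 0 0 (iota z).
by rewrite scale0r addr0 mul0r add0r => ->; have := ip0l hphi z; rewrite !ipE iB0.
Qed.

(** The coefficient of $h_a$, with [f] on the left, in the triangular decomposition; a chosen one,
    unique by [iota_hroot_inj]. *)
Definition bco (a : N) (X : B) : f := projT1 (cid (hpr_ex a X)).
Lemma bcoP a X : hpr a X = iota (bco a X) * hr a.
Proof. exact: projT2 (cid (hpr_ex a X)). Qed.

Lemma bco_uniq a X y : hpr a X = iota y * hr a -> bco a X = y.
Proof.
rewrite bcoP => E; apply/eqP; rewrite -subr_eq0; apply/eqP.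
by apply: (@iota_hroot_inj a); rewrite iBB // mulrBl E subrr.
Qed.

Lemma bcoE a b y : bco a (iota y * hr b) = if b == a then y else 0.
Proof.
apply: bco_uniq; rewrite /hpr (gproj_homog (@B_rel_homog deg_h) _ (homog_h y b)).
by case: eqP => [->|_] //; rewrite iB0 // mul0r.
Qed.
Lemma bcoD a X Y : bco a (X + Y) = bco a X + bco a Y.
Proof.
apply: bco_uniq; rewrite /hpr (gprojD (@B_rel_homog deg_h)) -!/(hpr _ _) !bcoP.
by rewrite iBD // mulrDl.
Qed.
Lemma bcoZ a k X : bco a (k *: X) = k *: bco a X.
Proof.
apply: bco_uniq; rewrite /hpr (gprojZ (@B_rel_homog deg_h)) -!/(hpr _ _) !bcoP.
by rewrite iBZ // scalerAl.
Qed.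
Lemma bco0 a : bco a 0 = 0.
Proof. by have := bcoZ a 0 0; rewrite !scale0r. Qed.

Lemma bco_decomp X : exists2 s : seq N, uniq s & forall t : seq N, uniq t ->
  {subset s <= t} -> X = \sum_(a <- t) iota (bco a X) * hr a.
Proof.
have [s us ds] := @gproj_decomp _ _ _ (B_pres q C d) deg_h X.
exists s => // t ut st; rewrite {1}(ds t ut st).
by apply: eq_bigr => a _; rewrite -bcoP.
Qed.

Lemma Bhat_ind (Q : B -> Prop) : (forall X Y, Q X -> Q Y -> Q (X + Y)) ->
  (forall y a, Q (iota y * hr a)) -> forall X, Q X.
Proof.
move=> QD QE X; have [s us ds] := bco_decomp X.
rewrite (ds s us (fun _ => id)); apply: big_ind => //.
by have := QE 0 0; rewrite iB0 // mul0r.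
Qed.
End Triangular.

(** * The iHopf product with generators *)

Section StarProduct.
Variables (Kv : fieldType) (q : Kv) (I : finType) (C : I -> I -> int) (d : I -> nat).
Hypothesis q0 : q != 0.
Hypothesis q_nroot : forall n, q ^+ n.+1 != 1.
Hypothesis hC : finite_cartan C d.
Local Notation v := (v q).
Local Notation vi := (vi q d).
Local Notation serre := (serre q C d).
Local Notation B := (Bhat q C d).
Local Notation theta := (theta q C d).
Local Notation hh := (hh q C d).
Local Notation ftheta := (ftheta q C d).
Local Notation iota := (@iotaB Kv q I C d).
Local Notation N := (Nroot I).
Local Notation nf := (nform C d).
Variable phi : B -> B -> Kv.
Hypothesis hphi : hopf_pairing phi.
Local Notation dL := (dL phi).
Local Notation dR := (dR phi).
Local Notation den := (den q d).
Local Notation homf := (homog (@deg_f I)).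
Variable tau : I -> I.
Hypothesis htau : diagram_involution C d tau.
Local Notation hr := (@hroot Kv q I C d).
Local Notation tauB := (@tauB Kv q I C d tau).
Local Notation tauN := (tauN tau).
Local Notation star := (star tau phi).
Let v0 : v != 0. Proof. exact: v_neq0. Qed.

Lemma vi_tau i : vi (tau i) = vi i. Proof. by rewrite /Defs.vi (tau_d htau). Qed.
Lemma tauNK : involutive tauN.
Proof. by move=> a; apply/ffunP => i; rewrite !ffunE (tauK htau). Qed.
Lemma tauND a b : tauN (a + b) = tauN a + tauN b.
Proof. by apply/ffunP => i; rewrite !ffunE. Qed.
Lemma tauN0 : tauN 0 = 0.
Proof. by apply/ffunP => i; rewrite !ffunE. Qed.
Lemma tauN_sroot i : tauN (sroot i) = sroot (tau i).
Proof. by apply/ffunP => j; rewrite !ffunE (can2_eq (tauK htau) (tauK htau)). Qed.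
Lemma nf_tau a b : nf (tauN a) (tauN b) = nf a b.
Proof.
rewrite !nformE (reindex_inj (inv_inj (tauK htau))); apply: eq_bigr => i _ /=.
rewrite (reindex_inj (inv_inj (tauK htau))); apply: eq_bigr => j _ /=.
by rewrite !ffunE !(tauK htau) (tau_d htau) (tau_cartan htau).
Qed.

Definition tau_gen (y : Bgen I) : B := match y with inl i => theta (tau i) | inr i => hh (tau i) end.
Lemma tau_rel : forall r, prels (B_pres q C d) r -> feval tau_gen r = 0.
Proof.
apply: B_hom => /= [i j ij|i j|i j].
- have : serre theta (tau i) (tau j) = 0.
    by apply: serre_theta; apply: contraNneq ij => /(inv_inj (tauK htau)) ->.
  by rewrite /Defs.serre vi_tau (tau_cartan htau).
- exact: hhC.
by rewrite hh_theta vi_tau (tau_cartan htau).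
Qed.
Lemma tB1 : tauB 1 = 1. Proof. exact: (peval1 tau_rel). Qed.
Lemma tBM x y : tauB (x * y) = tauB x * tauB y. Proof. exact: (pevalM tau_rel). Qed.
Lemma tBD x y : tauB (x + y) = tauB x + tauB y. Proof. exact: (pevalD tau_rel). Qed.
Lemma tBZ k x : tauB (k *: x) = k *: tauB x. Proof. exact: (pevalZ tau_rel). Qed.
Lemma tB_theta i : tauB (theta i) = theta (tau i). Proof. exact: (peval_gen tau_rel). Qed.
Lemma tB_h i : tauB (hh i) = hh (tau i). Proof. exact: (peval_gen tau_rel). Qed.
Lemma tB_hroot a : tauB (hr a) = hr (tauN a).
Proof.
elim/N_ind: a => [|a i IH]; first by rewrite hroot0 tB1 tauN0 hroot0.
by rewrite hrootD hroot_sroot tBM IH tB_h tauND hrootD tauN_sroot hroot_sroot.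
Qed.

Lemma counit_tau y : counit (tauB y) = counit y.
Proof.
have cZ k (x : B) : counit (k *: x) = k * counit x by rewrite -!(phi_unit hphi) (linfZ _ _ (linf_phir hphi _)).
have cD (x z : B) : counit (x + z) = counit x + counit z.
  by have := linf_counit hphi 1 x z; rewrite scale1r mul1r.
elim/B_indl: y => [|k a IH|a b IHa IHb|i a IH|i a IH].
- by rewrite tB1.
- by rewrite tBZ !cZ IH.
- by rewrite tBD !cD IHa IHb.
- by rewrite tBM !counitM tB_theta !counit_theta !mul0r.
by rewrite tBM !counitM IH tB_h !counit_h.
Qed.

Lemma phi_tau_h y i : phi (tauB y) (hh i) = phi y (hh (tau i)).
Proof.
rewrite !(phi_sym hphi _ (hh _)).
elim/B_indl: y => [|k a IH|a b IHa IHb|j a IH|j a IH].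
- by rewrite tB1 !(phi_sym hphi _ 1) !(phi_unit hphi) !counit_h.
- by rewrite tBZ !(linfZ _ _ (linf_phir hphi _)) IH.
- have D z x w : phi z (x + w) = phi z x + phi z w.
    by have := phi_linr hphi 1 z x w; rewrite scale1r mul1r.
  by rewrite tBD !D IHa IHb.
- by rewrite tBM !(phi_h_mul q0 q_nroot hC hphi) tB_theta !(phi_h_theta hphi) !mul0r.
rewrite tBM !(phi_h_mul q0 q_nroot hC hphi) IH tB_h !(phi_h hphi) vi_tau; congr (_ ^ _ * _).
by rewrite -{1}(tauK htau i) (tau_cartan htau).
Qed.

Lemma phi_tau_theta y i : phi (tauB y) (theta i) = phi y (theta (tau i)).
Proof.
have D z x w : phi z (x + w) = phi z x + phi z w.
  by have := phi_linr hphi 1 z x w; rewrite scale1r mul1r.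
rewrite !(phi_sym hphi _ (theta _)).
elim/B_indl: y => [|k a IH|a b IHa IHb|j a IH|j a IH].
- by rewrite tB1 !(phi_sym hphi _ 1) !(phi_unit hphi) !counit_theta.
- by rewrite tBZ !(linfZ _ _ (linf_phir hphi _)) IH.
- by rewrite tBD !D IHa IHb.
- rewrite tBM (phi_theta_mul q0 q_nroot hC hphi i (tauB _)) (phi_theta_mul q0 q_nroot hC hphi (tau i) (theta j)) counit_tau IH tB_theta !(phi_theta hphi).
  rewrite !(phi_h_theta hphi) !mul0r !addr0 vi_tau.
  by rewrite (can2_eq (tauK htau) (tauK htau)).
rewrite tBM (phi_theta_mul q0 q_nroot hC hphi i (tauB _)) (phi_theta_mul q0 q_nroot hC hphi (tau i) (hh j)) counit_tau IH tB_h !(phi_theta_h hphi) !mul0r !add0r.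
rewrite !(phi_h hphi) vi_tau; congr (_ ^ _ * _).
by rewrite -{1}(tauK htau i) (tau_cartan htau).
Qed.

Lemma starE a b : star a b = \sum_(t <- coprod b) cL (phi (tauB t.2)) a * t.1.
Proof.
rewrite /Defs.star exchange_big; apply: eq_bigr => t _; rewrite /cL mulr_suml.
by apply: eq_bigr => s _; rewrite scalerAl.
Qed.

Lemma cLl_lin a k x y : cL (phi (k *: x + y)) a = k *: cL (phi x) a + cL (phi y) a.
Proof.
rewrite /cL scaler_sumr -big_split; apply: eq_bigr => t _.
by rewrite (phi_linl hphi) scalerDl scalerA.
Qed.

Lemma bilin_star a : bilin (fun x y : B => cL (phi (tauB y)) a * x).
Proof.
split=> k x y z; first by rewrite mulrDr -scalerAr.
by rewrite tBD tBZ cLl_lin mulrDl scalerAl.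
Qed.

Local Notation Dl := (peval (@Dgen Kv q I C d)).
Let D_rel := Dgen_rel q0 q_nroot hC.

Lemma star_tevq a b : star a b = tevq (fun x y : B => cL (phi (tauB y)) a * x) (Dl b).
Proof. by rewrite starE -coprodE //; apply: bilin_star. Qed.

Lemma star_linr a k b c : star a (k *: b + c) = k *: star a b + star a c.
Proof.
have bm := bilin_star a.
by rewrite !star_tevq (pevalD D_rel) (pevalZ D_rel) tevq_add // tevq_scale.
Qed.
Lemma star_linl k a b c : star (k *: a + b) c = k *: star a c + star b c.
Proof.
rewrite !starE scaler_sumr -big_split; apply: eq_bigr => t _.
by rewrite cLD //; [rewrite mulrDl -scalerAl|exact: linf_phir].
Qed.

Lemma star_theta_r a i : star a (theta i) = cL (phi 1) a * theta i + cL (phi (theta (tau i))) a * hh i.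
Proof.
have bm := bilin_star a; rewrite star_tevq (peval_gen D_rel) tevq_add // !tevq_pure //.
by rewrite tB1 tB_theta.
Qed.

Lemma Dl_hroot a : Dl (hr a) = pure (hr a) (hr a).
Proof.
elim/N_ind: a => [|a i IH]; first by rewrite hroot0 (peval1 D_rel).
by rewrite hrootD hroot_sroot (pevalM D_rel) (peval_gen D_rel) /= IH pureM.
Qed.

Lemma star_hroot_r a g : star a (hr g) = cL (phi (hr (tauN g))) a * hr g.
Proof.
by rewrite star_tevq Dl_hroot tevq_pure ?tB_hroot //; apply: bilin_star.
Qed.

Lemma phi_hroot_mul g a b : phi (hr g) (a * b) = phi (hr g) a * phi (hr g) b.
Proof.
elim/N_ind: g a b => [|g i IH] a b.
  by rewrite hroot0 !(phi_unit hphi) counitM.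
have hl := linf_phir hphi.
rewrite hrootD hroot_sroot !(phiML hphi).
rewrite (cL_mul q0 q_nroot hC (l := phi (hr g)) (a1 := phi (hr g))
  (b1 := phi (hr g)) (a2 := fun _ => 0) (b2 := fun _ => 0)); try exact: linf0; try exact: hl.
  have c0 (x : B) : cL (fun _ => 0) x = 0 by rewrite /cL big1 // => t _; rewrite scale0r.
  by rewrite !c0 mulr0 addr0 (phi_h_mul q0 q_nroot hC hphi).
by move=> x y; rewrite IH mul0r addr0.
Qed.

Lemma phi_hroot_theta g j : phi (hr g) (theta j) = 0.
Proof.
elim/N_ind: g => [|g i IH]; first by rewrite hroot0 (phi_unit hphi) counit_theta.
rewrite hrootD hroot_sroot (phiML hphi) cL_theta //; last exact: linf_phir.
by rewrite IH scale0r add0r (linfZ _ _ (linf_phir hphi _)) (phi_h_theta hphi) mulr0.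
Qed.

Lemma phi_hroot_h g j : phi (hr g) (hh j) = v ^ nf g (sroot j).
Proof.
elim/N_ind: g => [|g i IH]; first by rewrite hroot0 (phi_unit hphi) counit_h nform0l // expr0z.
rewrite hrootD hroot_sroot (phiML hphi) cL_h //; last exact: linf_phir.
by rewrite IH (linfZ _ _ (linf_phir hphi _)) (phi_h hphi) nformDl // vD // viC.
Qed.

Lemma phi_hroot1 g : phi (hr g) 1 = 1.
Proof.
elim/N_ind: g => [|g i IH]; first by rewrite hroot0 (phi_unit hphi) counit1.
rewrite hrootD hroot_sroot (phiML hphi) cL1 //; last exact: linf_phir.
by rewrite IH scale1r (phi_sym hphi) (phi_unit hphi) counit_h.
Qed.

Section GroupLike.
Variable g : N.
Local Notation l := (phi (hr g)).
Let hl : linf l := linf_phir hphi _.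

Lemma cLg_mul x y : cL l (x * y) = cL l x * cL l y.
Proof.
rewrite (cL_mul q0 q_nroot hC (l := l) (a1 := l) (b1 := l) (a2 := fun _ => 0) (b2 := fun _ => 0));
  try exact: linf0; try exact: hl.
  have c0 (z : B) : cL (fun _ => 0) z = 0 by rewrite /cL big1 // => t _; rewrite scale0r.
  by rewrite !c0 mulr0 addr0.
by move=> a b; rewrite phi_hroot_mul mul0r addr0.
Qed.
Lemma cRg_mul x y : cR l (x * y) = cR l x * cR l y.
Proof.
rewrite (cR_mul q0 q_nroot hC (l := l) (a1 := l) (b1 := l) (a2 := fun _ => 0) (b2 := fun _ => 0));
  try exact: linf0; try exact: hl.
  have c0 (z : B) : cR (fun _ => 0) z = 0 by rewrite /cR big1 // => t _; rewrite scale0r.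
  by rewrite !c0 mulr0 addr0.
by move=> a b; rewrite phi_hroot_mul mul0r addr0.
Qed.
Lemma cRZ k x : cR l (k *: x) = k *: cR l x.
Proof.
have c0 : cR l 0 = 0 :> B.
  have := cRD q0 q_nroot hC (-1) 0 0 hl; rewrite scaler0 addr0 => ->.
  by rewrite scaleN1r addNr.
by have := cRD q0 q_nroot hC k x 0 hl; rewrite c0 !addr0.
Qed.
Lemma cLg_hroot a : cL l (hr a) = v ^ nf g a *: hr a.
Proof.
elim/N_ind: a => [|a i IH].
  by rewrite hroot0 cL1 // phi_hroot1 nform0r // expr0z.
rewrite hrootD hroot_sroot cLg_mul IH cL_h // phi_hroot_h nformDr // vD //.
by rewrite -scalerAl -scalerAr scalerA.
Qed.
Lemma cRg_hroot a : cR l (hr a) = v ^ nf g a *: hr a.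
Proof.
elim/N_ind: a => [|a i IH].
  by rewrite hroot0 cR1 // phi_hroot1 nform0r // expr0z.
rewrite hrootD hroot_sroot cRg_mul IH cR_h // phi_hroot_h nformDr // vD //.
by rewrite -scalerAl -scalerAr scalerA.
Qed.
Lemma cRg_iota y : cR l (iota y) = iota y.
Proof.
elim/f_indl: y => [|k a IH|a b IHa IHb|j a IH].
- by rewrite iB1 // cR1 // phi_hroot1 scale1r.
- by rewrite iBZ // cRZ IH.
- by rewrite iBD // -[iota a]scale1r cRD // IHa IHb scale1r.
rewrite iBM // iB_theta // cRg_mul IH cR_theta // phi_hroot1 phi_hroot_theta.
by rewrite scale1r scale0r addr0.
Qed.
Lemma cLg_iota b y : homf b y -> cL l (iota y) = v ^ nf g b *: iota y.
Proof.
move: y; apply: homog_ind => [|k y IH|y z IH IH'|s <-].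
- rewrite iB0 // scaler0; have := cLZ q0 q_nroot hC 0 0 hl.
  by rewrite !scale0r.
- by rewrite iBZ // cLZ // IH !scalerA mulrC.
- by rewrite iBD // -[iota y]scale1r cLD // IH IH' scale1r scalerDr scale1r.
elim: s => [|i s IH].
  by rewrite /fword !big_nil iB1 // cL1 // phi_hroot1 nform0r // expr0z.
rewrite /fword !big_cons -[pgen _ i]/(ftheta i) iBM // iB_theta // cLg_mul IH cL_theta //.
rewrite phi_hroot_theta phi_hroot_h scale0r add0r nformDr // vD //.
by rewrite -scalerAl -scalerAr scalerA.
Qed.
End GroupLike.

Lemma phi_tau_hroot g y : phi (hr g) (tauB y) = phi (hr (tauN g)) y.
Proof.
have D z x w : phi z (x + w) = phi z x + phi z w.
  by have := phi_linr hphi 1 z x w; rewrite scale1r mul1r.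
elim/B_indl: y => [|k a IH|a b IHa IHb|j a IH|j a IH].
- by rewrite tB1 !phi_hroot1.
- by rewrite tBZ !(linfZ _ _ (linf_phir hphi _)) IH.
- by rewrite tBD !D IHa IHb.
- by rewrite tBM !phi_hroot_mul tB_theta !phi_hroot_theta !mul0r.
by rewrite tBM !phi_hroot_mul tB_h !phi_hroot_h IH -tauN_sroot -{1}(tauNK g) nf_tau.
Qed.

Lemma cL_grouplike l a : linf l -> cL l (hr a) = l (hr a) *: hr a.
Proof. by move=> hl; rewrite cLE // Dl_hroot tevq_pure //; apply: bilin_cL. Qed.

Lemma star_hroot_l g X : star (hr g) X = hr g * cR (phi (hr (tauN g))) X.
Proof.
rewrite starE /cR mulr_sumr; apply: eq_bigr => t _.
rewrite (cL_grouplike _ (linf_phir hphi _)) -phi_tau_hroot (phi_sym hphi (hr g)).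
by rewrite -scalerAl -scalerAr.
Qed.

Lemma star_hroot_lE g y a : star (hr g) (iota y * hr a) = v ^ nf (tauN g) a *: (hr g * iota y * hr a).
Proof. by rewrite star_hroot_l cRg_mul cRg_iota cRg_hroot -!scalerAr mulrA. Qed.

Lemma star_hroot_rE g b y a : homf b y ->
  star (iota y * hr a) (hr g) = v ^ (nf (tauN g) b + nf (tauN g) a) *: (iota y * hr (a + g)).
Proof.
move=> hy; rewrite star_hroot_r cLg_mul (cLg_iota _ hy) cLg_hroot hrootD vD //.
by rewrite -!scalerAl -!scalerAr -!scalerAl !scalerA -mulrA.
Qed.

Lemma cL_phi1 a : cL (phi 1) a = cL (@counit Kv q I C d) a.
Proof. by rewrite /cL; apply: eq_bigr => t _; rewrite (phi_unit hphi). Qed.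

(** The second leg of $\Delta(\vartheta_i)$ is 1 or $\vartheta_i$; in the latter case $y$ is
    contracted with $\varphi(\vartheta_{\tau i},-)$, whence [dL (tau i)] and the companion leg
    $h_i$. *)
Lemma star_iota_theta y i : star (iota y) (theta i) =
  iota (y * ftheta i) + den i *: (iota (dL (tau i) y) * hh i).
Proof.
rewrite star_theta_r cL_phi1 (cL_counit q0 q_nroot hC hphi) // cL_thetaE // iBM // iB_theta // denE vi_tau.
by rewrite -scalerAl.
Qed.

Lemma cR_counit x : cR (@counit Kv q I C d) x = x.
Proof.
have hl := linf_counit hphi.
have c0 : cR (@counit Kv q I C d) 0 = 0 :> B.
  have := cRD q0 q_nroot hC (-1) 0 0 hl; rewrite scaler0 addr0 => ->.
  by rewrite scaleN1r addNr.
have cM (a b : B) : cR (@counit Kv q I C d) (a * b) =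
    cR (@counit Kv q I C d) a * cR (@counit Kv q I C d) b.
  rewrite (cR_mul q0 q_nroot hC (l := @counit _ q _ C d) (a1 := @counit _ q _ C d)
  (b1 := @counit _ q _ C d) (a2 := fun _ => 0) (b2 := fun _ => 0)); try exact: linf0; try exact: hl.
    have cc0 (z : B) : cR (fun _ => 0) z = 0 by rewrite /cR big1 // => t _; rewrite scale0r.
    by rewrite !cc0 mulr0 addr0.
  by move=> y z; rewrite counitM mul0r addr0.
elim/B_indl: x => [|k a IH|a b IHa IHb|i a IH|i a IH].
- by rewrite cR1 // counit1 scale1r.
- by have := cRD q0 q_nroot hC k a 0 hl; rewrite c0 !addr0 => ->; rewrite IH.
- by rewrite -[a]scale1r cRD // IHa IHb !scale1r.
- by rewrite cM IH cR_theta // counit1 counit_theta scale1r scale0r addr0.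
by rewrite cM IH cR_h // counit_h scale1r.
Qed.

Lemma cR_phi_theta_mul j x y : cR (phi (theta j)) (x * y) =
  cR (phi (theta j)) x * y + cR (phi (hh j)) x * cR (phi (theta j)) y.
Proof.
rewrite (cR_mul q0 q_nroot hC (a1 := phi (theta j)) (b1 := @counit Kv q I C d)
  (a2 := phi (hh j)) (b2 := phi (theta j))); try exact: (linf_phir hphi).
- by rewrite cR_counit.
- by move=> a b; rewrite (phi_theta_mul q0 q_nroot hC hphi).
- exact: (linf_counit hphi).
Qed.

Lemma cR_theta_iota j y : cR (phi (theta j)) (iota y) = den j *: (iota (dR j y) * hh j).
Proof.
have hl := linf_phir hphi (theta j).
have cZ k x : cR (phi (theta j)) (k *: x) = k *: cR (phi (theta j)) x.
  have c0 : cR (phi (theta j)) 0 = 0 :> B.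
    have := cRD q0 q_nroot hC (-1) 0 0 hl; rewrite scaler0 addr0 => ->.
    by rewrite scaleN1r addNr.
  by have := cRD q0 q_nroot hC k x 0 hl; rewrite c0 !addr0.
elim/f_indl: y => [|k a IH|a b IHa IHb|i a IH].
- rewrite iB1 // cR1 // (phi_sym hphi) (phi_unit hphi) counit_theta scale0r.
  by rewrite dR1 // iB0 // mul0r scaler0.
- by rewrite iBZ // cZ IH dRZ // iBZ // -scalerAl !scalerA mulrC.
- by rewrite iBD // -[iota a]scale1r cRD // IHa IHb dRD // iBD // mulrDl scalerDr scale1r.
rewrite iBM // iB_theta // cR_phi_theta_mul IH.
rewrite !cR_theta //; last exact: (linf_phir hphi).
rewrite (phi_theta hphi) (phi_h_theta hphi) !(phi_sym hphi _ 1) !(phi_unit hphi).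
rewrite counit_theta counit_h !scale0r add0r addr0 scale1r dR_mul // dR_theta //.
rewrite iBD // !iBM // iB_theta // [_ + _ * (_ *: _)]addrC mulrDl scalerDr; congr (_ + _).
  by rewrite -scalerAr mulrA.
case: eqP => [->|_]; first by rewrite iB1 // mul1r -hh_iota // -scalerAl.
by rewrite scale0r mul0r iB0 // !mul0r scaler0.
Qed.

(** Here the first leg of $\Delta(\vartheta_i)$ meets the second leg of the right factor, and that
    contraction gives [dR (tau i)] with an additional $h_{\tau i}$ ([cR_theta_iota]). *)
Lemma star_theta_l i y a : star (theta i) (iota y * hr a) =
  v ^ nf (sroot (tau i)) a *: (iota (ftheta i * y) * hr a)
  + den i *: (iota (dR (tau i) y) * hr (a + sroot (tau i))).
Proof.
have E X : star (theta i) X = cR (phi (theta (tau i))) X + theta i * cR (phi (hh (tau i))) X.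
  rewrite starE /cR mulr_sumr -big_split; apply: eq_bigr => t _ /=.
  rewrite cL_theta //; last exact: linf_phir.
  rewrite phi_tau_theta phi_tau_h mulrDl -scalerAl mul1r -scalerAl -scalerAr.
  by rewrite !(phi_sym hphi t.2).
rewrite E cR_phi_theta_mul.
have -> : cR (phi (theta (tau i))) (hr a) = 0.
  rewrite cRE; last exact: linf_phir.
  rewrite Dl_hroot tevq_pure; last exact/bilin_cR/linf_phir.
  by rewrite (phi_sym hphi) phi_hroot_theta scale0r.
rewrite mulr0 addr0 cR_theta_iota -hroot_sroot cRg_mul cRg_iota cRg_hroot.
rewrite addrC iBM // iB_theta // denE vi_tau; congr (_ + _).
  by rewrite -!scalerAr mulrA.
by rewrite -scalerAl -mulrA -hrootD [sroot _ + _]addrC.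
Qed.

End StarProduct.

(** * Adjoints of left and right multiplication on f *)

Section AdjointOperators.
Variables (Kv : fieldType) (q : Kv) (I : finType) (C : I -> I -> int) (d : I -> nat).
Hypothesis q0 : q != 0.
Hypothesis q_nroot : forall n, q ^+ n.+1 != 1.
Hypothesis hC : finite_cartan C d.
Local Notation v := (v q).
Local Notation f := (fAlg q C d).
Local Notation B := (Bhat q C d).
Local Notation ftheta := (ftheta q C d).
Local Notation N := (Nroot I).
Local Notation nf := (nform C d).
Variable phi : B -> B -> Kv.
Hypothesis hphi : hopf_pairing phi.
Local Notation dL := (dL phi).
Local Notation dR := (dR phi).
Local Notation ip := (ip phi).
Local Notation den := (den q d).
Local Notation homf := (homog (@deg_f I)).
Local Notation fpr := (@fpr Kv q I C d).
Local Notation ltheta := (ltheta q C d).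
Local Notation fw := (@fword Kv I (f_pres q C d)).
Variable tau : I -> I.
Hypothesis htau : diagram_involution C d tau.
Let v0 : v != 0. Proof. exact: v_neq0. Qed.
Let nondeg := ip_nondeg q0 q_nroot hC hphi.

Lemma ip_ext x y : (forall z, ip z x = ip z y) -> x = y.
Proof.
move=> h; apply/eqP; rewrite -subr_eq0; apply/eqP; apply: nondeg => z.
by rewrite ipBr // h subrr.
Qed.

(** Adjoints compose, so existence follows from [dL] by induction on $u$; uniqueness, by
    nondegeneracy, later makes [DL] linear in both arguments. *)
Lemma DL_ex u : exists g : f -> f, forall z y, ip z (g y) = ip (u * z) y.
Proof.
elim/f_indl: u => [|k a [g IH]|a b [g IHa] [g' IHb]|i a [g IH]].
- by exists id => z y; rewrite mul1r.
- by exists (fun y => k *: g y) => z y; rewrite ipZr // IH -scalerAl ipZl.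
- by exists (fun y => g y + g' y) => z y; rewrite ipDr // IHa IHb mulrDl ipDl.
exists (fun y => g (den i *: dL i y)) => z y.
by rewrite IH ipZr // -ip_thetaM // mulrA.
Qed.
Lemma DR_ex u : exists g : f -> f, forall z y, ip z (g y) = ip (z * u) y.
Proof.
elim/f_indr: u => [|k a [g IH]|a b [g IHa] [g' IHb]|i a [g IH]].
- by exists id => z y; rewrite mulr1.
- by exists (fun y => k *: g y) => z y; rewrite ipZr // IH -scalerAr ipZl.
- by exists (fun y => g y + g' y) => z y; rewrite ipDr // IHa IHb mulrDr ipDl.
exists (fun y => g (den i *: dR i y)) => z y.
by rewrite IH ipZr // -ip_Mtheta // mulrA.
Qed.
Definition DL u : f -> f := projT1 (cid (DL_ex u)).
Definition DR u : f -> f := projT1 (cid (DR_ex u)).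
Lemma ip_DL u z y : ip z (DL u y) = ip (u * z) y. Proof. exact: projT2 (cid (DL_ex u)) z y. Qed.
Lemma ip_DR u z y : ip z (DR u y) = ip (z * u) y. Proof. exact: projT2 (cid (DR_ex u)) z y. Qed.

Lemma DL_lin u k x y : DL u (k *: x + y) = k *: DL u x + DL u y.
Proof. by apply: ip_ext => z; rewrite ipDr // ipZr // !ip_DL ipDr // ipZr. Qed.
Lemma DR_lin u k x y : DR u (k *: x + y) = k *: DR u x + DR u y.
Proof. by apply: ip_ext => z; rewrite ipDr // ipZr // !ip_DR ipDr // ipZr. Qed.
Lemma DLl_lin u w k y : DL (k *: u + w) y = k *: DL u y + DL w y.
Proof. by apply: ip_ext => z; rewrite ipDr // ipZr // !ip_DL mulrDl ipDl // -scalerAl ipZl. Qed.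
Lemma DRl_lin u w k y : DR (k *: u + w) y = k *: DR u y + DR w y.
Proof. by apply: ip_ext => z; rewrite ipDr // ipZr // !ip_DR mulrDr ipDl // -scalerAr ipZl. Qed.
Lemma DL_M u w y : DL (u * w) y = DL w (DL u y).
Proof. by apply: ip_ext => z; rewrite !ip_DL mulrA. Qed.
Lemma DR_M u w y : DR (u * w) y = DR u (DR w y).
Proof. by apply: ip_ext => z; rewrite !ip_DR mulrA. Qed.
Lemma DL_DR u w y : DL u (DR w y) = DR w (DL u y).
Proof. by apply: ip_ext => z; rewrite ip_DL !ip_DR ip_DL mulrA. Qed.
Lemma DL1 y : DL 1 y = y. Proof. by apply: ip_ext => z; rewrite ip_DL mul1r. Qed.
Lemma DR1 y : DR 1 y = y. Proof. by apply: ip_ext => z; rewrite ip_DR mulr1. Qed.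
Lemma DL_theta i y : DL (ftheta i) y = den i *: dL i y.
Proof. by apply: ip_ext => z; rewrite ip_DL ip_thetaM // ipZr. Qed.
Lemma DR_theta i y : DR (ftheta i) y = den i *: dR i y.
Proof. by apply: ip_ext => z; rewrite ip_DR ip_Mtheta // ipZr. Qed.
Lemma DR_ltheta i y : DR (ltheta i) y = dR i y.
Proof. by apply: ip_ext => z; rewrite ip_DR ip_Mltheta. Qed.
Lemma DLu0 u : DL u 0 = 0. Proof. by apply: ip_ext => z; rewrite ip_DL !ip0r. Qed.
Lemma DRu0 u : DR u 0 = 0. Proof. by apply: ip_ext => z; rewrite ip_DR !ip0r. Qed.
Lemma DL0 y : DL 0 y = 0. Proof. by apply: ip_ext => z; rewrite ip_DL mul0r ip0l // ip0r. Qed.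
Lemma DR0 y : DR 0 y = 0. Proof. by apply: ip_ext => z; rewrite ip_DR mulr0 ip0l // ip0r. Qed.
Lemma DLD u x y : DL u (x + y) = DL u x + DL u y.
Proof. by have := DL_lin u 1 x y; rewrite !scale1r. Qed.
Lemma DRD u x y : DR u (x + y) = DR u x + DR u y.
Proof. by have := DR_lin u 1 x y; rewrite !scale1r. Qed.
Lemma DLZ u k x : DL u (k *: x) = k *: DL u x.
Proof. by have := DL_lin u k x 0; rewrite !addr0 DLu0 addr0. Qed.
Lemma DRZ u k x : DR u (k *: x) = k *: DR u x.
Proof. by have := DR_lin u k x 0; rewrite !addr0 DRu0 addr0. Qed.
Lemma DLlZ u k x : DL (k *: u) x = k *: DL u x.
Proof. by have := DLl_lin u 0 k x; rewrite !addr0 DL0 addr0. Qed.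
Lemma DRlZ u k x : DR (k *: u) x = k *: DR u x.
Proof. by have := DRl_lin u 0 k x; rewrite !addr0 DR0 addr0. Qed.
Lemma DLlD u w x : DL (u + w) x = DL u x + DL w x.
Proof. by have := DLl_lin u w 1 x; rewrite !scale1r. Qed.
Lemma DRlD u w x : DR (u + w) x = DR u x + DR w x.
Proof. by have := DRl_lin u w 1 x; rewrite !scale1r. Qed.

(** Orthogonality of weight spaces: the adjoint of a map raising degrees by $a$ lowers them by
    $a$. *)
Lemma homog_adj (g : f -> f) (G : f -> f) a :
  (forall z y, ip z (g y) = ip (G z) y) -> (forall c z, homf c z -> homf (a + c) (G z)) ->
  forall b y, homf b y -> g y = 0 \/ exists2 c, b = a + c & homf c (g y).
Proof.
move=> hg hG b y hy.
have [/forallP ab|ab] := boolP [forall j, (a j <= b j)%N].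
  right; exists [ffun j => (b j - a j)%N].
    by apply/ffunP => j; rewrite !ffunE [RHS]subnKC.
  set c := finfun _; have bc : b = a + c by apply/ffunP => j; rewrite !ffunE [RHS]subnKC.
  suff -> : g y = fpr c (g y) by apply: homog_fpr.
  apply: ip_ext => z; have [s us ds] := @gproj_decomp _ _ _ (f_pres q C d) (@deg_f I) z.
  rewrite (ds s us (fun _ => id)) !ip_suml //; apply: eq_bigr => e _.
  have he := homog_gproj (@deg_f I) e z; have [ec|ec] := eqVneq e c.
    by rewrite ec in he *; rewrite (ip_fpr q0 q_nroot hC hphi _ he).
  rewrite (ip_orth q0 q_nroot hC hphi he (homog_fpr _ _) ec) hg.
  apply: (ip_orth q0 q_nroot hC hphi (hG _ _ he) hy); apply: contraNneq ec => E.
  by apply/eqP; apply: (@NaddI _ a); rewrite ![_ + a]addrC E; exact: bc.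
left; apply: nondeg => z; have [s us ds] := @gproj_decomp _ _ _ (f_pres q C d) (@deg_f I) z.
rewrite (ds s us (fun _ => id)) ip_suml // big1 // => e _; rewrite hg.
apply: (ip_orth q0 q_nroot hC hphi (hG _ _ (homog_gproj (@deg_f I) e z)) hy).
apply: contraNneq ab => <-; apply/forallP => j; rewrite ffunE.
exact: leq_addr.
Qed.

Lemma homog_DR a u b y : homf a u -> homf b y -> DR u y = 0 \/ exists2 c, b = a + c & homf c (DR u y).
Proof.
move=> hu; apply: (homog_adj (G := fun z => z * u)); first exact: ip_DR.
by move=> c z hz; rewrite addrC; apply: homogM.
Qed.

(** Left multiplication by $\vartheta_i$ passes through every [dR k] except [dR i], which leaves an
    additional [kap i], a scalar at the weight reached there. The letters $\vartheta_i$ of $w$ where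
    this happens are collected by [dL i w]. *)
Lemma DR_thetaM i a w b y : homf a w -> homf b y -> DR w (ftheta i * y) =
  ftheta i * DR w y + (den i * v ^ (nf (sroot i) b - nf (sroot i) a + nf (sroot i) (sroot i))) *:
    DR (dL i w) y.
Proof.
move=> hw hy; move: w hw; apply: homog_ind => [|k w IH|w w' IH IH'|s].
- by rewrite dL0 // !DR0 mulr0 scaler0 addr0.
- by rewrite dLZ // !DRlZ IH scalerDr -scalerAr !scalerA; congr (_ + _ *: _); ring.
- by rewrite dLD // !DRlD IH IH' mulrDr scalerDr addrACA.
elim: s a => [|k s IH] a.
  by rewrite /fword !big_nil dL1 // DR0 !DR1 scaler0 addr0.
rewrite /fword !big_cons -/(fw s) -[pgen _ k]/(ftheta k) -[deg_f k]/(sroot k) => E.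
have hs : homf (\sum_(y <- s) deg_f y) (fw s) by apply: homog_fword.
rewrite [LHS]DR_M (IH _ erefl) [DR (_ * _) y]DR_M dL_thetaM // DRlD !DRlZ.
rewrite [DR (ftheta k * dL i (fw s)) y]DR_M -E nformDr //.
have := homog_DR hs hy.
move: (\sum_(y0 <- s) _) (DR (fw s) y) (DR (dL i (fw s)) y) => a' W V HW.
rewrite DRD DRZ !DR_theta dR_mul // dR_theta // viC //.
rewrite !scalerDr !scalerA -scalerAr -addrA; congr (_ + _).
have -> c : c - (nf (sroot i) (sroot k) + nf (sroot i) a') + nf (sroot i) (sroot i) =
    c - nf (sroot i) a' + nf (sroot i) (sroot i) - nf (sroot i) (sroot k) by ring.
congr (_ + _); last first.
  congr (_ *: _); set X := _ + nf (sroot i) (sroot i).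
  by rewrite -{1}(subrK (nf (sroot i) (sroot k)) X) vD //; ring.
case: (eqVneq i k) => [<-|ik]; last first.
  by rewrite ?(eq_sym k) ?(negbTE ik) mul0r scaler0 mulr0 scale0r.
rewrite ?eqxx mul1r mulr1; case: HW => [->|[c Ec hc]]; first by rewrite kap0 // !scaler0.
rewrite (kap_homog q0 hC i hc) scalerA Ec !nformDr //; congr (_ *: _); congr (_ * v ^ _).
by ring.
Qed.

Lemma DL_thetaM i a u y : homf a u -> DL u (ftheta i * y) =
  v ^ nf (sroot i) a *: (ftheta i * DL u y) + den i *: DL (dL i u) y.
Proof.
move: u; apply: homog_ind => [|k w IH|w w' IH IH'|s].
- by rewrite dL0 // !DL0 mulr0 !scaler0 addr0.
- by rewrite dLZ // !DLlZ IH scalerDr -scalerAr !scalerA; congr (_ *: _ + _ *: _); ring.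
- by rewrite dLD // !DLlD IH IH' mulrDr !scalerDr addrACA.
elim/last_ind: s a => [|s k IH] a.
  rewrite /fword !big_nil => <-; rewrite dL1 // DL0 !DL1 scaler0 addr0 nform0r // expr0z scale1r.
  by [].
rewrite /fword -cats1 !big_cat !big_seq1 -/(fw s) -[pgen _ k]/(ftheta k) -[deg_f k]/(sroot k) /= => E.
have hs : homf (\sum_(y <- s) deg_f y) (fw s) by apply: homog_fword.
rewrite [LHS]DL_M (IH _ erefl) [DL (_ * _) y]DL_M dL_mul // dL_theta // (kap_homog q0 hC i hs).
have -> : v ^ nf (sroot i) (\sum_(y0 <- s) deg_f y0) *: fw s * (i == k)%:R =
    (v ^ nf (sroot i) (\sum_(y0 <- s) deg_f y0) * (i == k)%:R) *: fw s.
  by case: eqP; rewrite ?mulr1 // !mulr0 scale0r.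
rewrite DLlD DLlZ [DL (dL i (fw s) * _) y]DL_M -E nformDr // vD //.
move: (\sum_(y0 <- s) _) (DL (fw s) y) (DL (dL i (fw s)) y) => a' W V.
rewrite DLD !DLZ !DL_theta dL_thetaM // viC //.
rewrite !scalerDr !scalerA -scalerAr scalerA [nf (sroot k) _]nformC //.
rewrite -!addrA [LHS]addrCA; congr (_ *: _ + _); first by ring.
rewrite addrC; congr (_ + _ *: _).
case: (eqVneq i k) => [<-|ik]; first by rewrite ?eqxx !mulr1; ring.
by rewrite ?(eq_sym k) ?(negbTE ik) !mulr0.
Qed.
End AdjointOperators.

(** * Casimir operators on f and their recursion *)

Section CoordinateOperators.
Variables (Kv : fieldType) (q : Kv) (I : finType) (C : I -> I -> int) (d : I -> nat).
Hypothesis q0 : q != 0.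
Hypothesis q_nroot : forall n, q ^+ n.+1 != 1.
Hypothesis hC : finite_cartan C d.
Local Notation v := (v q).
Local Notation serre := (serre q C d).
Local Notation f := (fAlg q C d).
Local Notation B := (Bhat q C d).
Local Notation ftheta := (ftheta q C d).
Local Notation N := (Nroot I).
Local Notation nf := (nform C d).
Variable phi : B -> B -> Kv.
Hypothesis hphi : hopf_pairing phi.
Local Notation dL := (dL phi).
Local Notation dR := (dR phi).
Local Notation ip := (ip phi).
Local Notation den := (den q d).
Local Notation homf := (homog (@deg_f I)).
Local Notation ldp := (ldp q C d).
Local Notation ltheta := (ltheta q C d).
Local Notation A := (laurentZ q).
Local Notation dword := (@dword Kv q I C d).
Local Notation fZd := (fZd phi).
Variable tau : I -> I.
Hypothesis htau : diagram_involution C d tau.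
Local Notation tauN := (tauN tau).
Variables (cs : N -> seq f) (dl : f -> f).
Hypothesis cs_homog : forall a b, b \in cs a -> homf a b.
Hypothesis dl_homog : forall a b, b \in cs a -> homf a (dl b).
Hypothesis cs_expand : forall a x, homf a x -> x = \sum_(b <- cs a) ip x (dl b) *: b.
Hypothesis dl_expand : forall a x, homf a x -> x = \sum_(b <- cs a) ip x b *: dl b.
Hypothesis cs_int : forall a b, b \in cs a -> @f_integral Kv q I C d b.
Hypothesis dl_int : forall a b, b \in cs a -> @f_integral Kv q I C d (dl b).
Local Notation DL := (DL q0 q_nroot hC hphi).
Local Notation DR := (DR q0 q_nroot hC hphi).
Let v0 : v != 0. Proof. exact: v_neq0. Qed.

Lemma tf_rel : forall r, prels (f_pres q C d) r -> feval (fun i => ftheta (tau i)) r = 0.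
Proof.
apply: f_hom => i j ij; have : serre ftheta (tau i) (tau j) = 0.
  by apply: serre_ftheta; apply: contraNneq ij => /(inv_inj (tauK htau)) ->.
by rewrite /Defs.serre (vi_tau q htau) (tau_cartan htau).
Qed.
Definition tf : f -> f := peval (fun i => ftheta (tau i)).
Lemma tf1 : tf 1 = 1. Proof. exact: (peval1 tf_rel). Qed.
Lemma tfM x y : tf (x * y) = tf x * tf y. Proof. exact: (pevalM tf_rel). Qed.
Lemma tfD x y : tf (x + y) = tf x + tf y. Proof. exact: (pevalD tf_rel). Qed.
Lemma tfZ k x : tf (k *: x) = k *: tf x. Proof. exact: (pevalZ tf_rel). Qed.
Lemma tf0 : tf 0 = 0. Proof. exact: (peval0 tf_rel). Qed.
Lemma tf_sum J (s : seq J) (Q : pred J) (F : J -> f) :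
  tf (\sum_(j <- s | Q j) F j) = \sum_(j <- s | Q j) tf (F j).
Proof. exact: (peval_sum tf_rel). Qed.
Lemma tfX x n : tf (x ^+ n) = tf x ^+ n. Proof. exact: (peval_exp tf_rel). Qed.
Lemma tf_theta i : tf (ftheta i) = ftheta (tau i). Proof. exact: (peval_gen tf_rel). Qed.

Lemma homog_tf a x : homf a x -> homf (tauN a) (tf x).
Proof.
move: x; apply: homog_ind => [|k y|y z|s <-].
- by rewrite tf0; apply: homog0.
- by rewrite tfZ; apply: homogZ.
- by rewrite tfD; apply: homogD.
elim: s => [|i s IH]; first by rewrite /fword !big_nil tf1 tauN0; apply: homog1.
rewrite /fword !big_cons tfM tauND; apply: homogM => //.
rewrite -[pgen _ i]/(ftheta i) tf_theta -[deg_f i]/(sroot i) (tauN_sroot htau).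
exact: homog_theta.
Qed.

Lemma dL_tf i x : dL i (tf x) = tf (dL (tau i) x).
Proof.
elim/f_indl: x => [|k a IH|a b IHa IHb|j a IH].
- by rewrite tf1 !dL1 // tf0.
- by rewrite tfZ !dLZ // tfZ IH.
- by rewrite tfD !dLD // tfD IHa IHb.
rewrite tfM tf_theta !dL_thetaM // IH tfD !tfZ tfM tf_theta (can2_eq (tauK htau) (tauK htau)).
rewrite (vi_tau q htau); congr (_ + _ ^ _ *: _).
by rewrite -[RHS](tau_cartan htau) (tauK htau).
Qed.

Lemma tf_dword s : tf (dword s) = dword [seq (tau t.1, t.2) | t <- s].
Proof.
rewrite !dwordE; elim: s => [|t s IH]; first by rewrite !big_nil tf1.
rewrite /= !big_cons tfM IH; congr (_ * _) => /=.
by rewrite /Defs.ldp /divpow tfZ tfX /Defs.ltheta tfZ tf_theta (vi_tau q htau).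
Qed.

Lemma f_integralM x y : @f_integral Kv q I C d x -> @f_integral Kv q I C d y ->
  @f_integral Kv q I C d (x * y).
Proof.
move=> [s [hs ->]] [t [ht ->]].
exists [seq (a.1 * b.1, a.2 * b.2) | a <- s, b <- t]; split.
  move=> _ /allpairsP[[a b] [/= /hs[Aa [wa _ Ea]] /ht[Ab [wb _ Eb]] ->]] /=; split; first exact: lzM.
  by exists (wa ++ wb); rewrite // big_cat Ea Eb.
rewrite big_allpairs_dep mulr_suml; apply: eq_bigr => a _; rewrite mulr_sumr.
by apply: eq_bigr => b _ /=; rewrite -scalerAl -scalerAr scalerA.
Qed.

Lemma f_integral_tf x : @f_integral Kv q I C d x -> @f_integral Kv q I C d (tf x).
Proof.
move=> [s [hs ->]]; exists [seq (t.1, tf t.2) | t <- s]; split.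
  move=> _ /mapP[t /hs[At [w _ <-]] ->] /=; split=> //.
  by rewrite -[\prod_(u <- w) _]/(dword w) tf_dword; eexists.
by rewrite big_map tf_sum; apply: eq_bigr => t _; rewrite tfZ.
Qed.

Lemma lz_ip_integral x y : @f_integral Kv q I C d x -> fZd y -> A (ip x y).
Proof.
move=> [s [hs ->]] hy; rewrite ip_suml // big_seq; apply: lz_sum => // t /hs[At [w _ <-]].
by rewrite ipZl //; apply: lzM => //; apply: hy.
Qed.

(* The Casimir element of weight a, acting through the adjoints of left and right
   multiplication; [bar_coord] identifies it with the coefficient of h_a in the bar involution. *)
Definition Sop a (y : f) : f := \sum_(b <- cs a) DL (tf (dl b)) (DR b y).

Lemma Sop_lin a k x y : Sop a (k *: x + y) = k *: Sop a x + Sop a y.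
Proof.
rewrite /Sop scaler_sumr -big_split; apply: eq_bigr => b _.
by rewrite DR_lin DL_lin.
Qed.
Lemma Sop0 a : Sop a 0 = 0.
Proof. by have := Sop_lin a (-1) 0 0; rewrite scaler0 addr0 scaleN1r addNr. Qed.
Lemma SopZ a k x : Sop a (k *: x) = k *: Sop a x.
Proof. by have := Sop_lin a k x 0; rewrite !addr0 Sop0 addr0. Qed.
Lemma SopD a x y : Sop a (x + y) = Sop a x + Sop a y.
Proof. by have := Sop_lin a 1 x y; rewrite !scale1r. Qed.

(** Paired with a word $w$ in divided powers, a summand becomes the pairing of $y$ with the product
    of $\tau b^*$, $w$ and $b$. All three are integral; for the first this is the integrality of the
    dual basis. *)
Lemma fZd_Sop a y : fZd y -> fZd (Sop a y).
Proof.
move=> hy; rewrite /Sop big_seq; apply: fZd_sum => // b bs s.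
rewrite ip_DL ip_DR; apply: lz_ip_integral => //.
apply: f_integralM; last exact: cs_int bs.
apply: f_integralM; first exact/f_integral_tf/(dl_int bs).
exists [:: (1, dword s)]; rewrite big_seq1 scale1r; split=> // t.
by rewrite inE => /eqP ->; split; [apply: lz1|exists s].
Qed.

Section Bilinear.
Variable F : f -> f -> f.
Hypothesis F1 : forall k x y z, F (k *: x + y) z = k *: F x z + F y z.
Hypothesis F2 : forall k x y z, F z (k *: x + y) = k *: F z x + F z y.

Lemma F_suml (s : seq f) (k : f -> Kv) (g : f -> f) z :
  F (\sum_(b <- s) k b *: g b) z = \sum_(b <- s) k b *: F (g b) z.
Proof.
have F0 : F 0 z = 0 by have := F1 (-1) 0 0 z; rewrite scaler0 addr0 scaleN1r addNr.
by elim: s => [|b s IH]; rewrite ?big_nil // !big_cons F1 IH.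
Qed.
Lemma F_sumr (s : seq f) (k : f -> Kv) (g : f -> f) z :
  F z (\sum_(b <- s) k b *: g b) = \sum_(b <- s) k b *: F z (g b).
Proof.
have F0 : F z 0 = 0 by have := F2 (-1) 0 0 z; rewrite scaler0 addr0 scaleN1r addNr.
by elim: s => [|b s IH]; rewrite ?big_nil // !big_cons F2 IH.
Qed.

(** Invariance of the canonical tensor $\sum_b b^*\otimes b$: [dL j] on one leg and left
    multiplication by $\theta_j$ on the other have the same matrix because they are adjoint.
    [casimir_cs] exchanges the legs. *)
Lemma casimir_dl a j : \sum_(b <- cs (a + sroot j)) F (dL j (dl b)) b =
  \sum_(b <- cs a) F (dl b) (ltheta j * b).
Proof.
have E1 b : b \in cs (a + sroot j) ->
    F (dL j (dl b)) b = \sum_(b' <- cs a) ip (dL j (dl b)) b' *: F (dl b') b.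
  move=> bs; rewrite -F_suml -dl_expand //.
  exact: (homog_dL q0 q_nroot hC hphi (dl_homog bs)).
have E2 b' : b' \in cs a ->
    F (dl b') (ltheta j * b') = \sum_(b <- cs (a + sroot j)) ip (dL j (dl b)) b' *: F (dl b') b.
  move=> bs; have h : homf (a + sroot j) (ltheta j * b').
    by rewrite addrC; apply: homogM; [apply/homogZ/homog_theta|apply: cs_homog].
  rewrite {1}(cs_expand h) F_sumr; apply: eq_bigr => b _.
  by rewrite ip_lthetaM // ipC.
rewrite big_seq (eq_bigr _ E1) -big_seq exchange_big /= [RHS]big_seq [RHS](eq_bigr _ E2).
by rewrite -[RHS]big_seq.
Qed.

Lemma casimir_cs a j : \sum_(b <- cs (a + sroot j)) F (dl b) (den j *: dL j b) =
  \sum_(b <- cs a) F (ftheta j * dl b) b.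
Proof.
have E1 b : b \in cs (a + sroot j) ->
    F (dl b) (den j *: dL j b) = \sum_(b' <- cs a) (den j * ip (dL j b) (dl b')) *: F (dl b) b'.
  move=> bs; rewrite -F_sumr; congr (F _ _).
  have h := homog_dL q0 q_nroot hC hphi (cs_homog bs).
  by rewrite {1}(cs_expand h) scaler_sumr; apply: eq_bigr => b' _; rewrite scalerA.
have E2 b' : b' \in cs a ->
    F (ftheta j * dl b') b' = \sum_(b <- cs (a + sroot j)) (den j * ip (dL j b) (dl b')) *: F (dl b) b'.
  move=> bs; have h : homf (a + sroot j) (ftheta j * dl b').
    by rewrite addrC; apply: homogM; [apply: homog_theta|apply: dl_homog].
  rewrite {1}(dl_expand h) F_suml; apply: eq_bigr => b _.
  by rewrite ip_thetaM // ipC.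
rewrite big_seq (eq_bigr _ E1) -big_seq exchange_big /= [RHS]big_seq [RHS](eq_bigr _ E2).
by rewrite -[RHS]big_seq.
Qed.
End Bilinear.

Definition Nsub (a : N) j : N := [ffun k => (a k - (k == j))%N].
Definition Sop' (j : I) (a : N) (y : f) : f := if a j == 0%N then 0 else Sop (Nsub a j) y.
Lemma Sop'E j a y : Sop' j a y = if a j == 0%N then 0 else Sop (Nsub a j) y. Proof. by []. Qed.

Lemma NsubK (a : N) j : a j != 0%N -> a = Nsub a j + sroot j.
Proof.
move=> aj; apply/ffunP => k; rewrite !ffunE.
case: (eqVneq k j) => [->|_]; last by rewrite subn0 [RHS]addn0.
by rewrite [RHS]subnK // lt0n.
Qed.

(** Moving $\vartheta_i$ through the two adjoints gives a main term and two corrections, which the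
    invariance of the canonical tensor turns back into Casimir operators of weights $a-\alpha_{\tau
    i}$ and $a-\alpha_i$. The shape is that of [bco_star_theta] and [bco_star_hh]. *)
Lemma Sop_theta i a b y : homf b y -> Sop a (ftheta i * y) =
  v ^ nf (sroot (tau i)) a *: (ftheta i * Sop a y)
  + den i *: dR (tau i) (Sop' (tau i) a y)
  + (den i * v ^ (nf (sroot i) b - nf (sroot i) a + nf (sroot i) (sroot i))) *: Sop' i a (dL (tau i) y).
Proof.
move=> hy; set k := v ^ (_ - _ + _).
have E e : e \in cs a -> DL (tf (dl e)) (DR e (ftheta i * y)) =
   v ^ nf (sroot (tau i)) a *: (ftheta i * DL (tf (dl e)) (DR e y)) +
   den i *: DL (tf (dL (tau i) (dl e))) (DR e y) +
   k *: DL (tf (dl e)) (DR (den i *: dL i e) y).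
  move=> es; rewrite (DR_thetaM _ _ _ _ i (cs_homog es) hy) DLD DLZ.
  rewrite (DL_thetaM _ _ _ _ i _ (homog_tf (dl_homog es))) DRlZ DLZ dL_tf scalerA -/k.
  rewrite [k * _]mulrC; congr (_ *: _ + _ + _).
  by rewrite -(nf_tau htau) (tauNK htau) (tauN_sroot htau).
rewrite /Sop big_seq (eq_bigr _ E) -big_seq !big_split /= -!scaler_sumr -!mulr_sumr.
congr (_ + _ + _).
  congr (_ *: _); rewrite /Sop'; case: (eqVneq (a (tau i)) 0%N) => [a0|a1].
    rewrite dR0 // big_seq big1 // => e es.
    by rewrite (homog_dL0 q0 q_nroot hC hphi (dl_homog es) a0) tf0 DL0.
  rewrite {1}(NsubK a1) (casimir_dl (F := fun x z => DL (tf x) (DR z y))).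
  - rewrite /Sop dR_sum //; apply: eq_bigr => e _.
    by rewrite DR_M DL_DR DR_ltheta.
  - by move=> c x z w; rewrite tfD tfZ DLl_lin.
  by move=> c x z w; rewrite DRl_lin DL_lin.
rewrite mulrC -scalerA; congr (_ *: _); rewrite /Sop'; case: (eqVneq (a i) 0%N) => [a0|a1].
  rewrite scaler0 big_seq big1 // => e es.
  by rewrite (homog_dL0 q0 q_nroot hC hphi (cs_homog es) a0) scaler0 DR0 DLu0.
rewrite {1}(NsubK a1) (casimir_cs (F := fun x z => DL (tf x) (DR z y))).
- rewrite -SopZ /Sop; apply: eq_bigr => e _.
  by rewrite tfM tf_theta DL_M DL_DR DL_theta denE (vi_tau q htau).
- by move=> c x z w; rewrite tfD tfZ DLl_lin.
by move=> c x z w; rewrite DRl_lin DL_lin.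
Qed.

Lemma Sop_one a : Sop a 1 = if a == 0 then 1 else 0.
Proof.
case: (eqVneq a 0) => [->|a0]; last first.
  rewrite /Sop big_seq big1 // => e es.
  suff -> : DR e 1 = 0 by rewrite DLu0.
  apply: (ip_nondeg q0 q_nroot hC hphi) => z.
  by rewrite ip_DR ipC // ip1 // epsM // (eps_homog hphi (cs_homog es) a0) mulr0.
have hc : homf 0 (1 : f) by apply: homog1.
(* In weight 0 all entries are scalars, and the sum of their products is the expansion of
   $\varphi(1,1)=1$. *)
transitivity (\sum_(b <- cs 0) (ip 1 b * ip 1 (dl b)) *: (1 : f)).
  rewrite /Sop big_seq [RHS]big_seq; apply: eq_bigr => b bs.
  have [c Ec] := homog_weight0 (cs_homog bs); have [c' Ec'] := homog_weight0 (dl_homog bs).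
  rewrite Ec' Ec tfZ tf1 DLlZ DL1 DRlZ DR1 scalerA !ipZr // ip1 // eps1 // !mulr1.
  by rewrite mulrC.
rewrite -scaler_suml.
have E := dl_expand hc; have := ip1 hphi 1; rewrite {2}E ip_sumr // eps1 // => E2.
rewrite (eq_bigr (fun b => ip 1 (ip 1 b *: dl b))) ?E2 ?scale1r // => b _.
by rewrite ipZr.
Qed.
End CoordinateOperators.

(** * Recursions for the bar involution in triangular coordinates *)

Section BarInvolution.
Variables (Kv : fieldType) (q : Kv) (I : finType) (C : I -> I -> int) (d : I -> nat).
Hypothesis q0 : q != 0.
Hypothesis q_nroot : forall n, q ^+ n.+1 != 1.
Hypothesis hC : finite_cartan C d.
Local Notation v := (v q).
Local Notation vi := (vi q d).
Local Notation f := (fAlg q C d).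
Local Notation B := (Bhat q C d).
Local Notation theta := (theta q C d).
Local Notation hh := (hh q C d).
Local Notation ftheta := (ftheta q C d).
Local Notation iota := (@iotaB Kv q I C d).
Local Notation N := (Nroot I).
Local Notation nf := (nform C d).
Variable phi : B -> B -> Kv.
Hypothesis hphi : hopf_pairing phi.
Local Notation dL := (dL phi).
Local Notation dR := (dR phi).
Local Notation den := (den q d).
Local Notation homf := (homog (@deg_f I)).
Local Notation fw := (@fword Kv I (f_pres q C d)).
Variable tau : I -> I.
Hypothesis htau : diagram_involution C d tau.
Local Notation hr := (@hroot Kv q I C d).
Local Notation tauN := (tauN tau).
Local Notation star := (star tau phi).
Variable conj : {rmorphism Kv -> Kv}.
Hypothesis conj_q : conj q = q^-1.
Hypothesis conj_semi : forall (V : lmodType Kv) (T : V -> V), {morph T : x y / x + y} ->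
  (forall a, T (q *: a) = q^-1 *: T a) -> forall c a, T (c *: a) = conj c *: T a.
Variable bar : B -> B.
Hypothesis hbar : bar_involution tau phi bar.
Local Notation bco := (@bco Kv q I C d).
Local Notation degB := (deg_B tau).
Let v0 : v != 0. Proof. exact: v_neq0. Qed.

Lemma conjv : conj v = v^-1. Proof. by rewrite /Defs.v rmorphXn /= conj_q exprVn. Qed.
Lemma conj_vz z : conj (v ^ z) = v ^ (- z).
Proof. by rewrite fmorphXz conjv exprz_inv. Qed.
Lemma conj_qz z : conj (q ^ z) = q ^ (- z).
Proof. by rewrite fmorphXz conj_q exprz_inv. Qed.
Lemma conjden i : conj (den i) = - den i.
Proof.
have E : conj (vi i) = (vi i)^-1 by rewrite /Defs.vi rmorphXn /= conjv exprVn.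
by rewrite rmorphB fmorphV /= E invrK opprB.
Qed.

Lemma barZ c X : bar (c *: X) = conj c *: bar X.
Proof. exact: (conj_semi (bar_add hbar) (bar_vhalf hbar)). Qed.
Lemma bar0 : bar 0 = 0. Proof. by have := barZ 0 0; rewrite rmorph0 !scale0r. Qed.
Lemma bar_one : bar 1 = 1.
Proof. by have := bar_h hbar 0; rewrite hroot0 tauN0 nform0l // expr0z scale1r. Qed.

Lemma Bhat_indh (Q : B -> Prop) : Q 0 -> (forall X Y, Q X -> Q Y -> Q (X + Y)) ->
  (forall b y a, homf b y -> Q (iota y * hr a)) -> forall X, Q X.
Proof.
move=> Q0 QD QE; apply: (@Bhat_ind Kv q I C d Q) => // y a.
have [s us ds] := @gproj_decomp _ _ _ (f_pres q C d) (@deg_f I) y.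
rewrite (ds s us (fun _ => id)) iB_sum // mulr_suml; apply: big_ind => // e _.
exact: (QE e _ _ (homog_gproj _ e y)).
Qed.

Lemma homog_B b y a : homf b y -> homog degB (b + (a + tauN a)) (iota y * hr a).
Proof.
move=> hy; apply: homogM; first exact: (homog_iota_deg (degf := @deg_f I)).
apply: (@homog_hroot Kv q I C d degB (fun a : N => a + tauN a) a) => [|c c'|i] /=.
- by rewrite tauN0 addr0.
- by rewrite tauND addrACA.
by rewrite (tauN_sroot htau).
Qed.

(** The weight $b-a-\tau a$ expected of the coefficient of $h_a$ in an element of weight $b$; the
    alternative 0 covers differences outside $\mathbb N^{\mathbb I}$. *)
Definition lowered (b a : N) (y : f) : Prop := y = 0 \/ exists2 c, b = c + (a + tauN a) & homf c y.

Lemma loweredD b a x y : lowered b a x -> lowered b a y -> lowered b a (x + y).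
Proof.
move=> [->|[c Ec hc]] [->|[c' Ec' hc']]; rewrite ?addr0 ?add0r; try by left.
- by right; exists c'.
- by right; exists c.
right; exists c => //; apply: homogD => //; suff -> : c = c' by [].
by apply: (@NaddI _ (a + tauN a)); rewrite -Ec -Ec'.
Qed.

Lemma bco_lowered b a X : homog degB b X -> lowered b a (bco a X).
Proof.
move=> hX; have <- : gproj degB b X = X.
  by rewrite (gproj_homog (@B_rel_homog Kv q I C d degB) b hX) eqxx.
elim/Bhat_indh: {hX}X => [|X Y IHX IHY|c y e hy].
- by rewrite gproj0 ?(bco0 q0 q_nroot hC hphi) //; [left|exact: B_rel_homog].
- by rewrite gprojD ?(bcoD q0 q_nroot hC hphi); [apply: loweredD|exact: B_rel_homog].
rewrite (gproj_homog (@B_rel_homog Kv q I C d degB) b (homog_B e hy)).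
case: (eqVneq (c + (e + tauN e)) b) => [E|_]; last by rewrite (bco0 q0 q_nroot hC hphi); left.
rewrite (bcoE q0 q_nroot hC hphi); case: (eqVneq e a) => [ea|_]; last by left.
by right; exists c; rewrite -?ea.
Qed.

Lemma homogB_ind (Q : B -> Prop) b : (forall X Y, Q X -> Q Y -> Q (X + Y)) ->
  Q 0 -> (forall c y a, b = c + (a + tauN a) -> homf c y -> Q (iota y * hr a)) ->
  forall X, homog degB b X -> Q X.
Proof.
move=> QD Q0 QE X hX; have [s us ds] := bco_decomp X.
rewrite (ds s us (fun _ => id)); apply: big_ind => // a _.
have [->|[c Ec hc]] := bco_lowered a hX; first by rewrite iB0 // mul0r.
exact: QE Ec hc.
Qed.

Lemma starDl X Y Z : star (X + Y) Z = star X Z + star Y Z.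
Proof. by have := star_linl q0 q_nroot hC hphi tau 1 X Y Z; rewrite !scale1r. Qed.
Lemma starDr X Y Z : star Z (X + Y) = star Z X + star Z Y.
Proof. by have := star_linr q0 q_nroot hC hphi htau Z 1 X Y; rewrite !scale1r. Qed.
Lemma star0l Z : star 0 Z = 0.
Proof. by have := star_linl q0 q_nroot hC hphi tau (-1) 0 0 Z; rewrite scaler0 addr0 scaleN1r addNr. Qed.
Lemma star0r Z : star Z 0 = 0.
Proof. by have := star_linr q0 q_nroot hC hphi htau Z (-1) 0 0; rewrite scaler0 addr0 scaleN1r addNr. Qed.
Lemma starZr k X Z : star Z (k *: X) = k *: star Z X.
Proof. by have := star_linr q0 q_nroot hC hphi htau Z k X 0; rewrite star0r !addr0. Qed.

Lemma nf_tauC a b : nf (tauN a) b = nf a (tauN b).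
Proof. by rewrite -(nf_tau htau) (tauNK htau). Qed.

(** Each $h_g$ is central up to a power of $v$ depending only on the weight; the products reversed
    by [bar] can thus be put back in order. *)
Lemma star_hroot_comm b g X : homog degB b X ->
  star X (hr g) = v ^ (nf (tauN g) b - nf g b) *: star (hr g) X.
Proof.
move: X; apply: homogB_ind => [Y Z EY EZ||c y a -> hy].
- by rewrite starDl starDr scalerDr EY EZ.
- by rewrite star0l star0r scaler0.
rewrite (star_hroot_rE q0 q_nroot hC hphi htau g a hy) (star_hroot_lE q0 q_nroot hC hphi htau).
rewrite (hroot_iota q0 hC g hy) -scalerAl -mulrA -hrootD [g + a]addrC !scalerA.
congr (_ *: _); rewrite -!vD // !nformDr //; congr (v ^ _).
by rewrite (nf_tau htau) -nf_tauC; ring.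
Qed.

Lemma homog_star_theta b i X : homog degB b X -> homog degB (b + sroot i) (star (theta i) X).
Proof.
move: X; apply: homogB_ind => [Y Z EY EZ||c y a -> hy].
- by rewrite starDr; apply: homogD.
- by rewrite star0r; apply: homog0.
rewrite (star_theta_l q0 q_nroot hC hphi htau); apply: homogD; apply: homogZ.
  by rewrite addrAC [c + _]addrC; apply: homog_B; apply: homogM => //; apply: homog_theta.
have [c' hc' [->|->]] := homog_dR_lower q0 q_nroot hC hphi (tau i) hy.
  by rewrite iB0 // mul0r; apply: homog0.
have -> : c' + sroot (tau i) + (a + tauN a) + sroot i =
  c' + ((a + sroot (tau i)) + tauN (a + sroot (tau i))).
  rewrite tauND (tauN_sroot htau) (tauK htau) -!addrA; congr (_ + _).
  by rewrite addrCA; congr (_ + _).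
exact: homog_B.
Qed.

Lemma homog_star_hroot b g X : homog degB b X -> homog degB (b + (g + tauN g)) (star (hr g) X).
Proof.
move: X; apply: homogB_ind => [Y Z EY EZ||c y a -> hy].
- by rewrite starDr; apply: homogD.
- by rewrite star0r; apply: homog0.
rewrite (star_hroot_lE q0 q_nroot hC hphi htau) (hroot_iota q0 hC g hy).
rewrite -scalerAl -mulrA -hrootD; do 2 apply: homogZ.
rewrite -addrA; have -> : a + tauN a + (g + tauN g) = (g + a) + tauN (g + a).
  by rewrite tauND addrACA [a + g]addrC [tauN a + _]addrC.
exact: homog_B.
Qed.

Definition bcs j (a : N) X : f := if a j == 0%N then 0 else bco (Nsub a j) X.
Lemma bcs_def j a X : bcs j a X = if a j == 0%N then 0 else bco (Nsub a j) X. Proof. by []. Qed.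

Lemma Nsub_eq (a c : N) j : (c + sroot j == a) = (a j != 0%N) && (c == Nsub a j).
Proof.
apply/eqP/andP => [<-|[/NsubK {2}-> /eqP ->] //]; split.
  by rewrite !ffunE eqxx addn_eq0 andbF.
by apply/eqP/ffunP => k; rewrite !ffunE [RHS]addnK.
Qed.

Lemma bcsE j a c y : bcs j a (iota y * hr c) = if c + sroot j == a then y else 0.
Proof. by rewrite /bcs (bcoE q0 q_nroot hC hphi) Nsub_eq; case: (a j == 0%N). Qed.
Lemma bcsD j a X Y : bcs j a (X + Y) = bcs j a X + bcs j a Y.
Proof.
rewrite /bcs; case: (a j == 0%N); last exact: (bcoD q0 q_nroot hC hphi).
by rewrite [RHS]addr0.
Qed.
Lemma bcs0 j a : bcs j a 0 = 0.
Proof. by rewrite /bcs (bco0 q0 q_nroot hC hphi); case: ifP. Qed.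

Lemma bco_star_theta a i X : bco a (star (theta i) X) =
  v ^ nf (sroot (tau i)) a *: (ftheta i * bco a X) + den i *: dR (tau i) (bcs (tau i) a X).
Proof.
move: X; apply: (@Bhat_ind Kv q I C d) => [X Y IH IH'|y c].
  by rewrite starDr !(bcoD q0 q_nroot hC hphi) IH IH' bcsD dRD // mulrDr !scalerDr addrACA.
rewrite (star_theta_l q0 q_nroot hC hphi htau) (bcoD q0 q_nroot hC hphi) !(bcoZ q0 q_nroot hC hphi) !(bcoE q0 q_nroot hC hphi) bcsE; congr (_ + _).
  by case: eqP => [->//|_]; rewrite mulr0 !scaler0.
by case: eqP => // _; rewrite dR0.
Qed.

Lemma bco_star_hh a b i X : homog degB b X -> bco a (star (hh i) X) =
  v ^ (nf (sroot i) b - nf (sroot i) a + nf (sroot i) (sroot i)) *: bcs i a X.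
Proof.
move: X; apply: homogB_ind => [Y Z EY EZ||c y e -> hy].
- by rewrite starDr (bcoD q0 q_nroot hC hphi) bcsD scalerDr EY EZ.
- by rewrite star0r (bco0 q0 q_nroot hC hphi) bcs0 scaler0.
rewrite -hroot_sroot (star_hroot_lE q0 q_nroot hC hphi htau) (hroot_iota q0 hC _ hy).
rewrite -scalerAl -mulrA -hrootD [sroot i + e]addrC !(bcoZ q0 q_nroot hC hphi) (bcoE q0 q_nroot hC hphi) bcsE scalerA -vD //.
case: eqP => [<-|_]; last by rewrite !scaler0.
congr (v ^ _ *: _); rewrite !nformDr // nf_tauC.
by ring.
Qed.

Lemma bar_iota_hh i g y : homf g y -> homog degB g (bar (iota y)) ->
  bar (iota y * hh i) = v ^ (nf (sroot i) (sroot (tau i)) + nf (sroot (tau i)) g) *: star (hh i) (bar (iota y)).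
Proof.
move=> hy hb.
have E : iota y * hh i = v ^ (- nf (sroot i) g) *: star (hh i) (iota y).
  have := star_hroot_lE q0 q_nroot hC hphi htau (sroot i) y 0.
  rewrite hroot0 !mulr1 nform0r // expr0z scale1r (hroot_iota q0 hC _ hy) hroot_sroot => ->.
  by rewrite scalerA -vD // addNr expr0z scale1r.
rewrite E barZ conj_vz opprK (bar_star hbar) -!hroot_sroot (bar_h hbar) starZr.
rewrite (star_hroot_comm _ hb) (tauN_sroot htau) !scalerA -!vD //; congr (v ^ _ *: _).
by ring.
Qed.

(** [bar] applied to the formula for $x*\vartheta_i$ reverses the product and changes the sign of
    $v_i-v_i^{-1}$. *)
Lemma bar_iota_Mtheta i x : bar (iota (x * ftheta i)) =
  star (theta i) (bar (iota x)) + den i *: bar (iota (dL (tau i) x) * hh i).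
Proof.
have := congr1 bar (star_iota_theta q0 q_nroot hC hphi htau x i).
rewrite (bar_star hbar) (bar_theta hbar) (bar_add hbar) barZ conjden scaleNr => ->.
by rewrite subrK.
Qed.

(** By [bar_iota_Mtheta], passing to $x\vartheta_i$ involves both $x$ and [dL (tau i) x]; the last
    hypothesis of the step covers the latter, of weight $b-\alpha_{\tau i}$. *)
Lemma bar_iota_ind (Q : N -> f -> Prop) :
  (forall b, Q b 0) -> (forall b k x, Q b x -> Q b (k *: x)) ->
  (forall b x y, Q b x -> Q b y -> Q b (x + y)) -> Q 0 1 ->
  (forall b i x, homf b x -> Q b x -> (forall c y, b = c + sroot (tau i) -> homf c y -> Q c y) ->
     Q (b + sroot i) (x * ftheta i)) ->
  forall b x, homf b x -> Q b x.
Proof.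
move=> Q0 QZ QD Q1 QM b x; have [n] := ubnP (hgt b); elim: n b x => // n IH b x bn.
move: x; apply: homog_ind => [|k x|x y|s]; [exact: Q0|exact: QZ|exact: QD|].
case/lastP: s => [|s i]; rewrite /fword -?cats1 ?big_cat ?big_nil ?big_seq1 => E; first by rewrite -E.
move: E; rewrite /= -[deg_f i]/(sroot i) -/(fw s) -[pgen _ i]/(ftheta i) => E; rewrite -E.
have hs : homf (\sum_(y <- s) deg_f y) (fw s) by apply: homog_fword.
move: bn; rewrite -E hgtD hgt_sroot addn1 ltnS => bn.
apply: QM => //; first exact: IH.
move=> c y Ec hy; apply: IH => //; move: bn.
by rewrite Ec hgtD hgt_sroot addn1 => /ltnW.
Qed.
End BarInvolution.

(** * The bar involution on f *)

Section BarFormula.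
Variables (Kv : fieldType) (q : Kv) (I : finType) (C : I -> I -> int) (d : I -> nat).
Hypothesis q0 : q != 0.
Hypothesis q_nroot : forall n, q ^+ n.+1 != 1.
Hypothesis hC : finite_cartan C d.
Local Notation v := (v q).
Local Notation f := (fAlg q C d).
Local Notation B := (Bhat q C d).
Local Notation ftheta := (ftheta q C d).
Local Notation iota := (@iotaB Kv q I C d).
Local Notation N := (Nroot I).
Local Notation nf := (nform C d).
Variable phi : B -> B -> Kv.
Hypothesis hphi : hopf_pairing phi.
Local Notation dL := (dL phi).
Local Notation dR := (dR phi).
Local Notation ip := (ip phi).
Local Notation homf := (homog (@deg_f I)).
Variable tau : I -> I.
Hypothesis htau : diagram_involution C d tau.
Local Notation tauN := (tauN tau).
Variable conj : {rmorphism Kv -> Kv}.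
Hypothesis conj_q : conj q = q^-1.
Hypothesis conj_semi : forall (V : lmodType Kv) (T : V -> V), {morph T : x y / x + y} ->
  (forall a, T (q *: a) = q^-1 *: T a) -> forall c a, T (c *: a) = conj c *: T a.
Variable bar : B -> B.
Hypothesis hbar : bar_involution tau phi bar.
Variables (cs : N -> seq f) (dl : f -> f).
Hypothesis cs_homog : forall a b, b \in cs a -> homf a b.
Hypothesis dl_homog : forall a b, b \in cs a -> homf a (dl b).
Hypothesis cs_expand : forall a x, homf a x -> x = \sum_(b <- cs a) ip x (dl b) *: b.
Hypothesis dl_expand : forall a x, homf a x -> x = \sum_(b <- cs a) ip x b *: dl b.
Local Notation bco := (@bco Kv q I C d).
Local Notation Sop := (Sop q0 q_nroot hC hphi tau cs dl).
Local Notation Sop' := (Sop' q0 q_nroot hC hphi tau cs dl).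
Local Notation degB := (deg_B tau).
Local Notation bcs := (@bcs Kv q I C d).
Let v0 : v != 0. Proof. exact: v_neq0. Qed.
Let bZ := barZ conj_semi hbar.
Let bD := bar_add hbar.
Let b0 := bar0 conj_semi hbar.

Lemma bar_homog b x : homf b x -> homog degB b (bar (iota x)).
Proof.
move: b x; apply: (bar_iota_ind (tau := tau)) => [b|b k x IH|b x y IH IH'||b i x hx IH IHy].
- by rewrite iB0 // b0; apply: homog0.
- by rewrite iBZ // bZ; apply: homogZ.
- by rewrite iBD // bD; apply: homogD.
- by rewrite iB1 // (bar_one hbar); apply: homog1.
rewrite (bar_iota_Mtheta q0 q_nroot hC hphi htau conj_q conj_semi hbar); apply: homogD.
  exact: (homog_star_theta q0 q_nroot hC hphi htau).
apply: homogZ; have [a0|/N_split[c Ec]] := eqVneq (b (tau i)) 0%N.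
  by rewrite (homog_dL0 q0 q_nroot hC hphi hx a0) iB0 // mul0r b0; apply: homog0.
have hy : homf c (dL (tau i) x) by apply: homog_dL => //; rewrite -Ec.
rewrite (bar_iota_hh q0 q_nroot hC hphi htau conj_q conj_semi hbar i hy (IHy _ _ Ec hy)).
apply: homogZ; rewrite -hroot_sroot.
have -> : b + sroot i = c + (sroot i + tauN (sroot i)).
  by rewrite Ec (tauN_sroot htau) -addrA [sroot i + _]addrC.
by apply: (homog_star_hroot q0 q_nroot hC hphi htau); apply: IHy.
Qed.

(* The h-free part of the bar involution; [ip_rho_psi] makes it dual to Lusztig's bar involution. *)
Definition rho : f -> f := locked_with dL_key (fun x => bco 0 (bar (iota x))).
Lemma rhoE x : rho x = bco 0 (bar (iota x)).
Proof. by rewrite /rho unlock. Qed.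

Lemma rhoD x y : rho (x + y) = rho x + rho y.
Proof. by rewrite !rhoE iBD // bD (bcoD q0 q_nroot hC hphi). Qed.
Lemma rhoZ k x : rho (k *: x) = conj k *: rho x.
Proof. by rewrite !rhoE iBZ // bZ (bcoZ q0 q_nroot hC hphi). Qed.
Lemma rho0 : rho 0 = 0.
Proof. by rewrite rhoE iB0 // b0 (bco0 q0 q_nroot hC hphi). Qed.
Lemma rho1 : rho 1 = 1.
Proof.
rewrite rhoE iB1 // (bar_one hbar); have := bcoE q0 q_nroot hC hphi 0 0 1.
by rewrite iB1 // hroot0 mulr1 eqxx.
Qed.

Lemma bcs_at0 j X : bcs j 0 X = 0. Proof. by rewrite !bcs_def ffunE. Qed.

(** The correction in [bar_iota_Mtheta] is a left multiple of $h_i$, so it has no $h$-free part.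
    Hence [rho] is the semilinear anti-automorphism fixing every $\vartheta_i$. *)
Lemma rho_Mtheta b i x : homf b x -> rho (x * ftheta i) = ftheta i * rho x.
Proof.
move=> hx; rewrite !rhoE (bar_iota_Mtheta q0 q_nroot hC hphi htau conj_q conj_semi hbar).
rewrite (bcoD q0 q_nroot hC hphi) (bco_star_theta q0 q_nroot hC hphi htau) bcs_at0 dR0 // scaler0 addr0.
rewrite nform0r // expr0z scale1r -[RHS]addr0; congr (_ + _).
rewrite (bcoZ q0 q_nroot hC hphi).
have [a0|/N_split[c Ec]] := eqVneq (b (tau i)) 0%N.
  by rewrite (homog_dL0 q0 q_nroot hC hphi hx a0) iB0 // mul0r b0 (bco0 q0 q_nroot hC hphi) scaler0.
have hy : homf c (dL (tau i) x) by apply: homog_dL => //; rewrite -Ec.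
have hB := bar_homog hy.
rewrite (bar_iota_hh q0 q_nroot hC hphi htau conj_q conj_semi hbar i hy hB) (bcoZ q0 q_nroot hC hphi).
by rewrite (bco_star_hh q0 q_nroot hC hphi htau _ _ hB) bcs_at0 !scaler0.
Qed.

Lemma homog_rho b x : homf b x -> homf b (rho x).
Proof.
move: b x; apply: (bar_iota_ind (tau := tau)) => [b|b k x IH|b x y IH IH'||b i x hx IH IHy].
- by rewrite rho0; apply: homog0.
- by rewrite rhoZ; apply: homogZ.
- by rewrite rhoD; apply: homogD.
- by rewrite rho1; apply: homog1.
by rewrite (rho_Mtheta i hx) addrC; apply: homogM => //; apply: homog_theta.
Qed.

Lemma dL_rho j b x : homf b x ->
  dL j (rho x) = v ^ (nf (sroot j) b - nf (sroot j) (sroot j)) *: rho (dL j x).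
Proof.
move: b x; apply: (bar_iota_ind (tau := tau)) => [b|b k x IH|b x y IH IH'||b i x hx IH IHy].
- by rewrite dL0 // rho0 dL0 // scaler0.
- by rewrite dLZ // !rhoZ dLZ // IH !scalerA mulrC.
- by rewrite dLD // !rhoD dLD // IH IH' scalerDr.
- by rewrite dL1 // rho0 rho1 dL1 // scaler0.
rewrite (rho_Mtheta i hx) dL_thetaM // dL_mul // dL_theta // (kap_homog q0 hC j hx) rhoD.
have [c hc _] := homog_dL_lower q0 q_nroot hC hphi j hx.
rewrite (rho_Mtheta i hc) IH viC // scalerDr -scalerAr scalerA -vD // addrC; congr (_ + _).
  by congr (v ^ _ *: _); rewrite nformDr //; ring.
case: (eqVneq j i) => [<-|_]; last by rewrite scale0r mulr0 rho0 scaler0.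
rewrite scale1r mulr1 rhoZ (conj_vz conj_q) scalerA -vD // nformDr //.
by rewrite addrK subrr expr0z scale1r.
Qed.

(** Both sides obey one recursion for $x\mapsto x\vartheta_i$: [bar_iota_Mtheta] on the left,
    [Sop_theta] for $\vartheta_i\rho(x)$ on the right, with [dL_rho] matching the powers of $v$. *)
Lemma bar_coord b x : homf b x -> forall a, bco a (bar (iota x)) = Sop a (rho x).
Proof.
move: b x; apply: (bar_iota_ind (tau := tau)) => [b a|b k x IH a|b x y IH IH' a|a|b i x hx IH IHy a].
- by rewrite rho0 iB0 // b0 (bco0 q0 q_nroot hC hphi) Sop0.
- by rewrite rhoZ SopZ iBZ // bZ (bcoZ q0 q_nroot hC hphi) IH.
- by rewrite rhoD SopD iBD // bD (bcoD q0 q_nroot hC hphi) IH IH'.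
- rewrite iB1 // (bar_one hbar) rho1 (Sop_one q0 q_nroot hC hphi htau cs_homog dl_homog dl_expand).
  have := bcoE q0 q_nroot hC hphi a 0 1; rewrite iB1 // hroot0 mulr1 => ->.
  by rewrite eq_sym.
rewrite (rho_Mtheta i hx) (bar_iota_Mtheta q0 q_nroot hC hphi htau conj_q conj_semi hbar).
rewrite (bcoD q0 q_nroot hC hphi) (bco_star_theta q0 q_nroot hC hphi htau) (bcoZ q0 q_nroot hC hphi).
have hr' := homog_rho hx.
rewrite (Sop_theta q0 q_nroot hC hphi htau cs_homog dl_homog cs_expand dl_expand i a hr').
have Eb j a' y : (forall e, bco e (bar (iota y)) = Sop e (rho y)) ->
    bcs j a' (bar (iota y)) = Sop' j a' (rho y).
  by move=> h; rewrite !bcs_def Sop'E h.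
rewrite (Eb _ _ _ IH) IH; congr (_ + _).
have S0 : Sop' i a 0 = 0 by rewrite !Sop'E Sop0; case: ifP.
have [a0|/N_split[c Ec]] := eqVneq (b (tau i)) 0%N.
  rewrite (homog_dL0 q0 q_nroot hC hphi hx a0) (homog_dL0 q0 q_nroot hC hphi hr' a0) S0 iB0 // mul0r.
  by rewrite b0 (bco0 q0 q_nroot hC hphi) !scaler0.
have hy : homf c (dL (tau i) x) by apply: homog_dL => //; rewrite -Ec.
have hB := bar_homog hy.
rewrite (bar_iota_hh q0 q_nroot hC hphi htau conj_q conj_semi hbar i hy hB) (bcoZ q0 q_nroot hC hphi).
rewrite (bco_star_hh q0 q_nroot hC hphi htau _ _ hB) (Eb _ _ _ (IHy _ _ Ec hy)) (dL_rho (tau i) hx).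
have -> k y : Sop' i a (k *: y) = k *: Sop' i a y.
  by rewrite !Sop'E; case: ifP => _; rewrite ?scaler0 // SopZ.
rewrite !scalerA -!mulrA -!vD //; congr (_ * v ^ _ *: _).
by rewrite Ec !nformDr //; ring.
Qed.

Lemma Nfun0 : Nfun C d 0 = 0.
Proof. by rewrite /Nfun nform0l // div0z /ht big1 ?subr0 // => i _; rewrite ffunE mulr0. Qed.
Lemma ht_sroot i : ht d (sroot i) = (d i)%:Z.
Proof.
rewrite /ht (bigD1 i) //= ffunE eqxx mulr1 big1 ?addr0 // => j ji.
by rewrite ffunE (negbTE ji) mulr0.
Qed.
Lemma htD a b : ht d (a + b) = ht d a + ht d b.
Proof. by rewrite /ht -big_split; apply: eq_bigr => i _; rewrite ffunE PoszD mulrDr. Qed.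
Lemma Nfun_sroot b i : Nfun C d (b + sroot i) = Nfun C d b + nf b (sroot i).
Proof.
rewrite /Nfun htD ht_sroot !nformDl // !nformDr // nform_sroot // (cartan_diag hC).
rewrite [nf (sroot i) b]nformC //.
(* The increment of $(b,b)$ is even, so it leaves the integer quotient whatever the parity of
   $(b,b)$. *)
have -> : nf b b + nf b (sroot i) + (nf b (sroot i) + (d i)%:Z * 2) =
  nf b b + (nf b (sroot i) + (d i)%:Z) * 2 by ring.
by rewrite [nf b b + _]addrC divzMDl //; ring.
Qed.

Section Psi.
Variable psi : f -> f.
Hypothesis hpsi : bar_f psi.

Lemma psi_Mtheta x i : psi (x * ftheta i) = - (psi x * ftheta i).
Proof. by rewrite (bar_f_mul hpsi) (psi_theta q0 q_nroot hC conj_q conj_semi hpsi) mulrN. Qed.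

Lemma dL_psi i c z : homf c z ->
  dL i (psi z) = - (v ^ (nf (sroot i) c - nf (sroot i) (sroot i)) *: psi (dR i z)).
Proof.
have pZ := psiZ conj_semi hpsi; have p0 := psi0 conj_semi hpsi.
move: c z; apply: (bar_iota_ind (tau := tau)) => [b|b k x IH|b x y IH IH'||b j x hx IH IHy].
- by rewrite dR0 // p0 dL0 // scaler0 oppr0.
- by rewrite dRZ // !pZ dLZ // IH scalerN !scalerA mulrC.
- by rewrite dRD // !(bar_f_add hpsi) dLD // IH IH' scalerDr opprD.
- by rewrite dR1 // p0 (bar_f_one hpsi) dL1 // scaler0 oppr0.
have hp := homog_psi q0 q_nroot hC conj_q conj_semi hpsi hx.
rewrite psi_Mtheta -scaleN1r dLZ // scaleN1r dL_mul // dL_theta // IH (kap_homog q0 hC i hp).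
rewrite dR_Mtheta // (bar_f_add hpsi) !pZ psi_Mtheta viC // (conj_vz conj_q).
congr (- _); rewrite scalerDr mulNr -[(_ *: _) * ftheta j]scalerAl !scalerN.
rewrite [v ^ _ *: (v ^ _ *: _)]scalerA -vD // addrC; congr (_ - _).
  case: (eqVneq i j) => [<-|_]; last by rewrite mulr0 rmorph0 scale0r scaler0.
  by rewrite mulr1 rmorph1 scale1r nformDr // addrK.
by congr (v ^ _ *: _); rewrite nformDr //; ring.
Qed.

(** Each $\vartheta_i$ removed from $x$ costs two cancelling signs, from the conjugate of
    $v_i-v_i^{-1}$ and from [psi], and a power of $v$; by [Nfun_sroot] these powers add up to
    $\mathtt N$. *)
Lemma ip_rho_psi b x z : homf b x -> homf b z ->
  ip (rho x) (psi z) = v ^ Nfun C d b * conj (ip x z).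
Proof.
move=> hx; move: z; move: b x hx.
have pZ := psiZ conj_semi hpsi; have p0 := psi0 conj_semi hpsi.
apply: (bar_iota_ind (tau := tau)) => [b z _|b k x IH z hz|b x y IH IH' z hz|z hz|b i x hx IH _ z hz].
- by rewrite rho0 !ip0l // rmorph0 mulr0.
- by rewrite rhoZ !ipZl // rmorphM IH // mulrCA.
- by rewrite rhoD !ipDl // rmorphD mulrDr IH // IH'.
- rewrite rho1 Nfun0 expr0z mul1r; have [c ->] := homog_weight0 hz.
  by rewrite pZ (bar_f_one hpsi) !ipZr // ip1 // eps1 // !mulr1.
rewrite (rho_Mtheta i hx) ip_thetaM // (dL_psi i hz) ipNr // ipZr //.
have hd : homf b (dR i z) by apply: homog_dR.
rewrite nformDr // addrK IH // ip_Mtheta // rmorphM conjden // Nfun_sroot vD //.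
by rewrite [nf b _]nformC //; ring.
Qed.
End Psi.
End BarFormula.

(** * Bar-invariant lifts of a unitriangular semilinear involution *)

Section TriangularInvolution.
Variables (Kv : fieldType) (conj : {rmorphism Kv -> Kv}) (A L : set Kv).
Variables (V : lmodType Kv) (J : choiceType) (D : set J) (K : J -> V) (bar : V -> V).
Variables (prec : J -> J -> Prop) (lev : J -> nat) (U : J -> seq J) (R : J -> J -> Kv).
Variable kc : J -> V -> Kv.
Hypothesis A_D : forall a b, A a -> A b -> A (a + b).
Hypothesis A_M : forall a b, A a -> A b -> A (a * b).
Hypothesis A_N : forall a, A a -> A (- a).
Hypothesis A_conj : forall a, A a -> A (conj a).
Hypothesis L_A : forall a, L a -> A a.
Hypothesis L_0 : L 0.
Hypothesis L_D : forall a b, L a -> L b -> L (a + b).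
Hypothesis L_N : forall a, L a -> L (- a).
Hypothesis L_sep : forall a, L a -> conj a = a -> a = 0.
Hypothesis L_split : forall a, A a -> conj a = - a -> exists2 p, L p & a = p - conj p.
Hypothesis bar_D : {morph bar : x y / x + y}.
Hypothesis bar_Z : forall c x, bar (c *: x) = conj c *: bar x.
Hypothesis bar_K : involutive bar.
Hypothesis kc_lin : forall w k x y, kc w (k *: x + y) = k * kc w x + kc w y.
Hypothesis kc_K : forall w w', D w -> D w' -> kc w (K w') = (w == w')%:R.
Hypothesis K_span : forall x, lincomb setT (K @` D) x.
Hypothesis U_uniq : forall u, uniq (U u).
Hypothesis U_D : forall u w, D u -> w \in U u -> D w.
Hypothesis U_id : forall u, D u -> u \in U u.
Hypothesis U_eq : forall u w, D u -> w \in U u -> U w = U u.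
Hypothesis prec_U : forall u w, D u -> D w -> prec u w -> w \in U u.
Hypothesis prec_lev : forall u w, prec u w -> (lev u < lev w)%N.
Hypothesis prec_trans : forall u w z, prec u w -> prec w z -> prec u z.
Hypothesis bar_R : forall u, D u -> bar (K u) = \sum_(w <- U u) R u w *: K w.
Hypothesis R_A : forall u w, D u -> A (R u w).
Hypothesis R_id : forall u, D u -> R u u = 1.
Hypothesis R_prec : forall u w, D u -> w \in U u -> w != u -> R u w != 0 -> prec u w.

Lemma kc0 w : kc w 0 = 0.
Proof. by have := kc_lin w (-1) 0 0; rewrite scaler0 addr0 mulN1r addNr. Qed.
Lemma kc_sum w (s : seq J) (k : J -> Kv) (F : J -> V) :
  kc w (\sum_(j <- s) k j *: F j) = \sum_(j <- s) k j * kc w (F j).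
Proof. by elim: s => [|j s IH]; rewrite ?big_nil ?kc0 // !big_cons kc_lin IH. Qed.

Lemma kc_U u w (k : J -> Kv) : D u -> w \in U u -> kc w (\sum_(j <- U u) k j *: K j) = k w.
Proof.
move=> Du wu; rewrite kc_sum (bigD1_seq w) //= kc_K ?eqxx; try exact: (U_D Du wu).
rewrite mulr1 big_seq_cond big1 ?addr0 // => j /andP[ju jw].
by rewrite kc_K; [rewrite eq_sym (negbTE jw) mulr0|exact: (U_D Du wu)|exact: (U_D Du ju)].
Qed.

Lemma bar_0 : bar 0 = 0. Proof. by have := bar_Z 0 0; rewrite rmorph0 !scale0r. Qed.
Lemma bar_N x : bar (- x) = - bar x.
Proof. by rewrite -scaleN1r bar_Z rmorphN1 scaleN1r. Qed.
Lemma bar_bigsum (s : seq J) (F : J -> V) : bar (\sum_(j <- s) F j) = \sum_(j <- s) bar (F j).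
Proof. exact: (big_morph bar bar_D bar_0). Qed.

Lemma A0 : A 0. Proof. exact: L_A. Qed.
Lemma A_sum (s : seq J) (k : J -> Kv) : (forall j, j \in s -> A (k j)) -> A (\sum_(j <- s) k j).
Proof. by move=> h; rewrite big_seq; apply: big_ind => //; exact: A0. Qed.

Definition vec u (x : J -> Kv) : V := \sum_(w <- U u) x w *: K w.
Definition barc u (x : J -> Kv) (w : J) : Kv := \sum_(j <- U u) conj (x j) * R j w.

Lemma vecD u x y : vec u (fun w => x w + y w) = vec u x + vec u y.
Proof. by rewrite -big_split; apply: eq_bigr => w _; rewrite scalerDl. Qed.
Lemma vecB u x y : vec u (fun w => x w - y w) = vec u x - vec u y.
Proof. by rewrite -sumrB; apply: eq_bigr => w _; rewrite scalerBl. Qed.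

Lemma bar_vec u x : D u -> bar (vec u x) = vec u (barc u x).
Proof.
move=> Du; rewrite /vec bar_bigsum.
transitivity (\sum_(j <- U u) \sum_(w <- U u) (conj (x j) * R j w) *: K w).
  rewrite big_seq [RHS]big_seq; apply: eq_bigr => j ju.
  rewrite bar_Z (bar_R (U_D Du ju)) (U_eq Du ju) scaler_sumr.
  by apply: eq_bigr => w _; rewrite scalerA.
by rewrite exchange_big; apply: eq_bigr => w _; rewrite -scaler_suml.
Qed.

(** By unitriangularity [bar] merely conjugates the coefficients at the lowest level of a vector. *)
Lemma barc_low u x n w : D u -> (forall j, j \in U u -> (lev j < n)%N -> x j = 0) ->
  w \in U u -> (lev w <= n)%N -> barc u x w = conj (x w).
Proof.
move=> Du x0 wu wn; rewrite /barc (bigD1_seq w) //= (R_id (U_D Du wu)) mulr1.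
rewrite big_seq_cond big1 ?addr0 // => j /andP[ju jw].
have [->|r0] := eqVneq (R j w) 0; first by rewrite mulr0.
have Pjw : prec j w by apply: R_prec r0; [exact: U_D ju|rewrite (U_eq Du ju)|rewrite eq_sym].
by rewrite x0 ?rmorph0 ?mul0r // (leq_trans (prec_lev Pjw)).
Qed.

(** [S] is closed upwards; taken to be [prec u], it keeps the whole construction strictly above
    [u]. *)
Lemma barc_supp u x (S : J -> Prop) w : D u -> (forall j, j \in U u -> x j != 0 -> S j) ->
  (forall j w, S j -> prec j w -> S w) -> w \in U u -> barc u x w != 0 -> S w.
Proof.
move=> Du xS Sup wu bw; apply: contrapT => nS; case/negP: bw; apply/eqP.
rewrite /barc big_seq big1 // => j ju.
have [->|xj] := eqVneq (x j) 0; first by rewrite rmorph0 mul0r.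
have [jw|jw] := eqVneq w j; first by case: nS; rewrite jw; apply: xS.
have [->|r0] := eqVneq (R j w) 0; first by rewrite mulr0.
by case: nS; apply: (Sup j); [apply: xS|apply: R_prec r0; [exact: U_D ju|rewrite (U_eq Du ju)|]].
Qed.

(* The coefficients of lowest level of an anti-invariant vector are themselves anti-invariant, so
   [L_split] removes them; induct on the level. *)
Lemma solve_anti u (S : J -> Prop) : D u -> (forall j w, S j -> prec j w -> S w) ->
  forall n x, (forall w, w \in U u -> A (x w)) -> (forall w, w \in U u -> (lev w < n)%N -> x w = 0) ->
  (forall w, w \in U u -> x w != 0 -> S w) -> bar (vec u x) = - vec u x ->
  exists p : J -> Kv, [/\ forall w, w \in U u -> L (p w), forall w, w \in U u -> p w != 0 -> S w
    & vec u p - bar (vec u p) = vec u x].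
Proof.
move=> Du Sup n; pose M := (\max_(w <- U u) lev w).+1.
have levM w : w \in U u -> (lev w < M)%N by move=> wu; rewrite ltnS; apply: (leq_bigmax_seq _ wu).
have [m] := ubnP (M - n)%N; elim: m n => // m IH n nm x xA x0 xS xbar.
have [Mn|nM] := leqP M n.
  exists (fun _ => 0); split=> // [w _|]; first by rewrite eqxx.
  have -> : vec u (fun=> 0) = 0 by rewrite /vec big1 // => w _; rewrite scale0r.
  rewrite bar_0 subr0 /vec big_seq big1 // => w wu; rewrite x0 ?scale0r //.
  exact: leq_trans (levM w wu) Mn.
have xn w : w \in U u -> lev w = n -> conj (x w) = - x w.
  move=> wu wn; have := congr1 (kc w) xbar.
  rewrite (bar_vec _ Du) (kc_U _ Du wu) (barc_low Du x0 wu) ?wn // => ->.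
  have := kc_lin w (-1) (vec u x) 0; rewrite addr0 scaleN1r kc0 addr0 mulN1r => ->.
  by rewrite (kc_U _ Du wu).
have Hp w : exists p, w \in U u -> lev w = n -> L p /\ x w = p - conj p.
  have [wu|wu] := boolP (w \in U u); last by exists 0.
  have [wn|wn] := eqVneq (lev w) n; last by exists 0 => _ /eqP; rewrite (negbTE wn).
  by have [p Lp E] := L_split (xA w wu) (xn w wu wn); exists p.
have [p0 Hp0] := choice Hp.
have nz (c : Kv) (P : Prop) : (c != 0 -> P) -> ~ P -> c = 0.
  by move=> h nP; apply/eqP; apply: contrapT => /negP /h.
(* Restricting to nonzero coefficients keeps the support of the correction inside that of [x]. *)
pose p1 w := if (lev w == n) && (x w != 0) then p0 w else 0.
have Lp1 w : w \in U u -> L (p1 w).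
  rewrite /p1; case: eqP => //= wn wu; case: ifP => // _.
  exact: (Hp0 w wu wn).1.
have Sp1 w : w \in U u -> p1 w != 0 -> S w.
  by move=> wu; rewrite /p1; case: ifP => [/andP[_ xw] _|_]; [exact: xS|rewrite eqxx].
pose x' w := x w - (p1 w - barc u p1 w).
have Ex' : vec u x' = vec u x - (vec u p1 - bar (vec u p1)).
  by rewrite (bar_vec _ Du) -!vecB.
have [|||w||p [Lp Sp Ep]] := IH n.+1 _ x'.
- by move: nm nM; clear; lia.
- move=> w wu; apply: A_D; first exact: xA.
  apply/A_N/A_D; first exact/L_A/Lp1.
  apply/A_N/A_sum => j ju; apply: A_M; first exact/A_conj/L_A/Lp1.
  exact/R_A/(U_D Du ju).
- move=> w wu wn; rewrite /x' (@barc_low u p1 n w) //; first last.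
    by move=> j ju jn; rewrite /p1 (ltn_eqF jn).
  rewrite /p1; move: wn; rewrite ltnS leq_eqVlt => /orP[/eqP wn|wn].
    rewrite wn eqxx /=; case: eqP => [->|_] /=; first by rewrite rmorph0 !subrr.
    by rewrite {1}(Hp0 w wu wn).2 subrr.
  by rewrite (ltn_eqF wn) /= x0 // rmorph0 !subrr.
- move=> wu xw; apply: contrapT => nS; case/negP: xw; rewrite /x'.
  rewrite (nz _ _ (xS w wu) nS) (nz _ _ (Sp1 w wu) nS).
  by rewrite (nz _ _ (barc_supp Du Sp1 Sup wu) nS) !subr0.
- rewrite Ex' bar_D bar_N bar_D bar_N bar_K xbar !opprD !opprK; congr (_ + _).
  by rewrite addrC.
exists (fun w => p1 w + p w); split.
- by move=> w wu; apply: L_D; [exact: Lp1|exact: Lp].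
- move=> w wu pw; apply: contrapT => nS; case/negP: pw.
  by rewrite (nz _ _ (Sp1 w wu) nS) (nz _ _ (Sp w wu) nS) addr0.
rewrite vecD bar_D opprD addrACA Ep Ex'.
by rewrite [_ - bar _ + _]addrC subrK.
Qed.

Local Notation up u := [set K w | w in [set w | D w /\ prec u w]].

Lemma lincomb_vec u (M : set Kv) (p : J -> Kv) : D u -> (forall w, w \in U u -> M (p w)) ->
  (forall w, w \in U u -> p w != 0 -> prec u w) -> lincomb M (up u) (vec u p).
Proof.
move=> Du Mp Pp; exists [seq (p w, K w) | w <- [seq w <- U u | p w != 0]]; split.
  move=> _ /mapP[w + ->] /=; rewrite mem_filter => /andP[pw wu]; split; first exact: Mp.
  by exists w => //; split; [exact: U_D wu|exact: Pp].
rewrite big_map big_filter big_mkcond; apply: eq_bigr => w _.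
by case: eqP => [->|]; rewrite ?scale0r.
Qed.

Lemma vec_lincomb u (M : set Kv) x : D u -> M 0 -> (forall a b, M a -> M b -> M (a + b)) ->
  lincomb M (up u) x -> exists p : J -> Kv, [/\ forall w, w \in U u -> M (p w),
    forall w, w \in U u -> p w != 0 -> prec u w & x = vec u p].
Proof.
move=> Du M0 MD [s [hs ->]]; elim: s hs => [|t s IH] hs.
  exists (fun _ => 0); split=> // [w _|]; first by rewrite eqxx.
  by rewrite big_nil /vec big1 // => w _; rewrite scale0r.
have [|p [Mp Pp Ep]] := IH; first by move=> t' ts; apply: hs; rewrite inE ts orbT.
have [Mt [w [Dw uw] Ew]] := hs t (mem_head _ _); have wu := prec_U Du Dw uw.
exists (fun j => (if j == w then t.1 else 0) + p j); split.
- by move=> j ju; apply: MD; [case: eqP|exact: Mp].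
- by move=> j ju; case: (eqVneq j w) => [-> _ //|_]; rewrite add0r; apply: Pp.
rewrite vecD big_cons Ep -Ew; congr (_ + _).
rewrite /vec (bigD1_seq w) //= eqxx big1 ?addr0 // => j jw.
by rewrite (negbTE jw) scale0r.
Qed.

Definition dcan u (x : V) : Prop := bar x = x /\ lincomb L (up u) (x - K u).

(** The vector $\overline{K_u}-K_u$ is anti-invariant, so it has the form $p-\overline p$ with
    coefficients of $p$ in [L], and then $K_u+p$ is invariant. *)
Lemma dcan_ex u : D u -> exists x, dcan u x.
Proof.
move=> Du; pose x w := if w == u then 0 else R u w.
have Ex : bar (K u) = K u + vec u x.
  rewrite (bar_R Du) (bigD1_seq u) ?U_id //= (R_id Du) scale1r; congr (_ + _).
  rewrite /vec (bigD1_seq u) ?U_id //= /x eqxx scale0r add0r.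
  by apply: eq_bigr => w /negbTE ->.
have [|||||p [Lp Sp Ep]] := @solve_anti u (prec u) Du _ 0 x.
- by move=> j w; apply: prec_trans.
- by move=> w wu; rewrite /x; case: eqP => _; [exact: A0|exact: R_A].
- by [].
- move=> w wu; rewrite /x; case: (eqVneq w u) => [_|wn]; first by rewrite eqxx.
  exact: R_prec.
- have -> : vec u x = bar (K u) - K u by rewrite Ex [X in X - _]addrC addrK.
  by rewrite bar_D bar_N bar_K opprB.
exists (K u + vec u p); split; last first.
  by rewrite [X in X - _]addrC addrK; apply: lincomb_vec.
by rewrite bar_D Ex -Ep -addrA subrK.
Qed.

(** The difference is invariant with coefficients in [L]; level by level they are fixed by [conj],
    hence 0 by [L_sep]. *)
Lemma dcan_uniq u x y : D u -> dcan u x -> dcan u y -> x = y.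
Proof.
move=> Du [bx hx] [bY hy].
have [p [Lp Pp Ep]] := vec_lincomb Du L_0 L_D hx; have [r [Lr Pr Er]] := vec_lincomb Du L_0 L_D hy.
pose z w := p w - r w.
have Ez : x - y = vec u z by rewrite vecB -Ep -Er opprB addrA subrK.
have bz : bar (vec u z) = vec u z by rewrite -Ez bar_D bar_N bx bY.
suff z0 n w : w \in U u -> (lev w < n)%N -> z w = 0.
  apply/eqP; rewrite -subr_eq0 Ez /vec big_seq big1 // => w wu.
  by rewrite (z0 (lev w).+1) ?scale0r.
elim: n w => // n IH w wu; rewrite ltnS => wn; apply: L_sep.
  by apply: L_D; [exact: Lp|apply/L_N/Lr].
have := congr1 (kc w) bz; rewrite (bar_vec _ Du) !(kc_U _ Du wu) (barc_low Du _ wu wn) //.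
Qed.

Lemma tri_basis (Cf : J -> V) : (forall u, D u -> lincomb setT (up u) (Cf u - K u)) -> is_basis D Cf.
Proof.
move=> hC; have E u : D u -> exists p : J -> Kv, (forall w, w \in U u -> p w != 0 -> prec u w)
    /\ Cf u = K u + vec u p.
  move=> Du; have [p [_ Pp Ep]] := vec_lincomb Du I (fun _ _ _ _ => I) (hC u Du).
  by exists p; split=> //; rewrite -Ep addrC subrK.
have kcC u w : D u -> D w -> ~ prec u w -> kc w (Cf u) = (w == u)%:R.
  move=> Du Dw nP; have [p [Pp ->]] := E u Du.
  have := kc_lin w 1 (K u) (vec u p); rewrite scale1r mul1r kc_K // => ->.
  rewrite /vec kc_sum big_seq big1 ?addr0 // => j ju; rewrite kc_K //; last exact: U_D ju.
  case: eqP => [wj|_]; last by rewrite mulr0.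
  by have [->|pj] := eqVneq (p j) 0; rewrite ?mul0r //; case: nP; rewrite wj; apply: Pp.
split=> [s k us sD s0 | x].
  suff k0 n j : j \in s -> (lev j < n)%N -> k j = 0 by move=> j js; apply: (k0 (lev j).+1).
  elim: n j => // n IH j js; rewrite ltnS => jn.
  have := congr1 (kc j) s0; rewrite kc_sum kc0 (bigD1_seq j) //= kcC; try exact: sD.
    rewrite eqxx mulr1 big_seq_cond big1 ?addr0 // => w /andP[ws wj].
    have [P|nP] := pselect (prec w j).
      by rewrite (IH w) ?mul0r // (leq_trans (prec_lev P)).
    by rewrite kcC; [rewrite eq_sym (negbTE wj) mulr0|exact: sD|exact: sD|].
  by move=> /prec_lev; rewrite ltnn.
have cD y z : lincomb setT (Cf @` D) y -> lincomb setT (Cf @` D) z -> lincomb setT (Cf @` D) (y + z).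
  move=> [s [hs ->]] [t [ht ->]]; exists (s ++ t); rewrite big_cat; split=> // r.
  by rewrite mem_cat => /orP[/hs|/ht].
have cZ k y : lincomb setT (Cf @` D) y -> lincomb setT (Cf @` D) (k *: y).
  move=> [s [hs ->]]; exists [seq (k * t.1, t.2) | t <- s]; split.
    by move=> _ /mapP[t /hs[_ h] ->].
  by rewrite big_map scaler_sumr; apply: eq_bigr => t _; rewrite scalerA.
have c0 : lincomb setT (Cf @` D) 0 by exists [::]; rewrite big_nil.
(* Levels are bounded on the finite block [U u], so $K_w$ is recovered from [Cf w] by descending
   induction on the level. *)
have cK u : D u -> lincomb setT (Cf @` D) (K u).
  move=> Du; pose M := (\max_(w <- U u) lev w).+1.
  have levM w : w \in U u -> (lev w < M)%N by move=> wu; rewrite ltnS; apply: (leq_bigmax_seq _ wu).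
  have H n w : w \in U u -> (M - lev w < n)%N -> lincomb setT (Cf @` D) (K w).
    elim: n w => // n IH w wu wn; have Dw := U_D Du wu; have [p [Pp Ep]] := E w Dw.
    have -> : K w = Cf w + (-1) *: vec w p by rewrite Ep scaleN1r addrK.
    apply: (cD); first by exists [:: (1, Cf w)]; rewrite big_seq1 scale1r; split=> // t;
      rewrite inE => /eqP ->; split=> //; exists w.
    apply: (cZ); rewrite /vec big_seq; apply: big_ind => [|y z|j jw]; [exact: c0|exact: cD|].
    have [->|pj] := eqVneq (p j) 0; first by rewrite scale0r.
    apply: (cZ); apply: IH; first by rewrite -(U_eq Du wu).
    have := prec_lev (Pp j jw pj); have := levM w wu; move: wn; clear; lia.
  exact: (H (M - lev u).+1 u (U_id Du)).
have [s [hs ->]] := K_span x; rewrite big_seq; apply: big_ind => [|y z|t /hs[_ [u Du <-]]]; [exact: c0|exact: cD|].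
exact/cZ/cK.
Qed.
End TriangularInvolution.

(** * The scalars *)

Lemma frac_ex (R : idomainType) (c : {fraction R}) :
  exists nd : R * R, nd.2 != 0 /\ c = tofrac nd.1 / tofrac nd.2.
Proof.
elim/quotW: c => x; exists (frac x); split; first exact: denom_ratioP.
have d0 : tofrac (frac x).2 != 0 by rewrite tofrac_eq0 denom_ratioP.
apply: (canRL (mulfK d0)); rewrite -[X in tofrac X]/(\d_x) -/(\n_x).
unlock FracField.tofrac; rewrite -[LHS]FracField.pi_mul.
apply/eqmodP => /=; rewrite FracField.equivfE /FracField.mulf.
by rewrite !numden_Ratio ?mulr1 ?mulf_neq0 ?oner_eq0 ?denom_ratioP // mulrC.
Qed.

Section RationalFunctions.
Variables (F : fieldType) (tof : {rmorphism {poly rat} -> F}).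
Hypothesis tof_inj : injective tof.
Hypothesis fracs : forall c : F, exists nd : {poly rat} * {poly rat}, nd.2 != 0 /\ c = tof nd.1 / tof nd.2.
Local Notation q := (tof 'X).
Local Notation v := (v q).
Local Notation cst := (tof \o polyC).

Lemma tof_eq0 p : (tof p == 0) = (p == 0).
Proof. by rewrite -(inj_eq tof_inj) rmorph0. Qed.
Lemma q0 : q != 0. Proof. by rewrite tof_eq0 polyX_eq0. Qed.
Lemma q_nroot n : q ^+ n.+1 != 1.
Proof.
rewrite -rmorphXn -(rmorph1 tof) (inj_eq tof_inj); apply/eqP => /(congr1 (fun p : {poly rat} => size p)).
by rewrite size_polyXn size_poly1.
Qed.

Lemma tofrac_horner (p : {poly rat}) : (map_poly cst p).[q] = tof p.
Proof.
rewrite map_poly_comp horner_map /= -[map_poly _ p]/(p^:P) -/(comp_poly 'X p).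
by rewrite comp_polyXr.
Qed.
Lemma ratr_cst (r : rat) : ratr r = cst r :> F.
Proof. exact/esym/(fmorph_eq_rat cst). Qed.

(* The substitutions v^(1/2) -> v and v^(1/2) -> v^(-1/2). *)
Definition evv (p : {poly rat}) : F := tof (p \Po 'X^2).
Definition evi (p : {poly rat}) : F := (map_poly cst p).[q^-1].

Lemma evv_ratr (p : {poly rat}) : (map_poly ratr p).[v] = evv p.
Proof.
rewrite (eq_map_poly ratr_cst) map_poly_comp /= /Defs.v -rmorphXn horner_map.
by rewrite /evv /comp_poly.
Qed.
Lemma evv_intr (p : {poly int}) : (map_poly intr p).[v] = evv (map_poly intr p).
Proof.
rewrite -evv_ratr (eq_map_poly ratr_cst) -map_poly_comp; congr (_.[v]); apply: eq_map_poly => z /=.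
by rewrite -[tof _]/(cst z%:~R) rmorph_int.
Qed.
Lemma evvD p r : evv (p + r) = evv p + evv r.
Proof. by rewrite /evv comp_polyD rmorphD. Qed.
Lemma evvM p r : evv (p * r) = evv p * evv r.
Proof. by rewrite /evv comp_polyM rmorphM. Qed.
Lemma evvX : evv 'X = v.
Proof. by rewrite /evv comp_polyX rmorphXn. Qed.
Lemma evvXn n : evv 'X^n = v ^+ n.
Proof. by rewrite /evv comp_Xn_poly -exprM rmorphXn /Defs.v exprM. Qed.
Lemma evv_inj p r : evv p = evv r -> p = r.
Proof.
move/eqP; rewrite (inj_eq tof_inj) -subr_eq0 -comp_polyB comp_poly_eq0 ?size_polyXn //.
by rewrite subr_eq0 => /eqP.
Qed.
Lemma evv0 : evv 0 = 0. Proof. by rewrite /evv comp_poly0 rmorph0. Qed.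

Lemma eviD p r : evi (p + r) = evi p + evi r.
Proof. by rewrite /evi rmorphD hornerD. Qed.
Lemma eviM p r : evi (p * r) = evi p * evi r.
Proof. by rewrite /evi rmorphM hornerM. Qed.
Lemma eviC c : evi c%:P = cst c.
Proof. by rewrite /evi map_polyC hornerC. Qed.
Lemma evi1 : evi 1 = 1. Proof. by rewrite -[1]/(1%:P) eviC /= (rmorph1 tof). Qed.
Lemma evi0 : evi 0 = 0. Proof. by rewrite /evi rmorph0 horner0. Qed.
Lemma eviX : evi 'X = q^-1. Proof. by rewrite /evi map_polyX hornerX. Qed.

(** Coefficient reversal turns evaluation at $q^{-1}$ into a polynomial, after multiplication by
    $q^m$ ([evi_rev]). *)
Definition revp (m : nat) (p : {poly rat}) : {poly rat} := \poly_(k < m.+1) p`_(m - k).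

Lemma evi_rev m (p : {poly rat}) : (size p <= m.+1)%N -> evi p * q ^+ m = tof (revp m p).
Proof.
move=> pm; rewrite -[RHS]tofrac_horner /evi !horner_coef.
have pm' : (size (map_poly cst p) <= m.+1)%N by rewrite (leq_trans (size_poly _ _)).
have rm : (size (map_poly cst (revp m p)) <= m.+1)%N.
  by rewrite (leq_trans (size_poly _ _)) // size_poly.
have E (r : {poly F}) (x : F) : (size r <= m.+1)%N ->
    \sum_(i < size r) r`_i * x ^+ i = \sum_(i < m.+1) r`_i * x ^+ i.
  by move=> rs; rewrite -horner_coef (horner_coef_wide _ rs).
rewrite (E _ _ pm') (E _ _ rm) mulr_suml (reindex_inj rev_ord_inj) /=; apply: eq_bigr => i _.
rewrite !coef_map coef_poly ltn_ord /= subSS -mulrA; congr (_ * _).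
have im : (i <= m)%N by rewrite -ltnS.
have -> : q ^+ m = q ^+ (m - i) * q ^+ i by rewrite -exprD subnK.
by rewrite exprVn mulKf // expf_neq0 // q0.
Qed.

Lemma evi_eq0 p : evi p = 0 -> p = 0.
Proof.
move=> p0; have := evi_rev (leqnSn (size p)); rewrite p0 mul0r => /esym/eqP.
rewrite tof_eq0 => /eqP r0; apply/polyP => i; rewrite coef0.
case: (ltnP i (size p)) => [ip|]; last exact: nth_default.
have := congr1 (fun r : {poly rat} => r`_(size p - i)) r0; rewrite coef0 coef_poly.
by rewrite ltnS leq_subr subKn // ltnW.
Qed.

Definition numden (c : F) : {poly rat} * {poly rat} := projT1 (cid (fracs c)).
(** The automorphism inverting $v^{1/2}$, computed on a chosen fraction; by [qconjE] the choice does
    not matter. *)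
Definition qconj (c : F) : F := evi (numden c).1 / evi (numden c).2.

Lemma evi_neq0 p : p != 0 -> evi p != 0.
Proof. by apply: contraNneq => /evi_eq0 ->. Qed.
Lemma tof_neq0 (p : {poly rat}) : p != 0 -> tof p != 0.
Proof. by rewrite tof_eq0. Qed.

Lemma qconjE n d : d != 0 -> qconj (tof n / tof d) = evi n / evi d.
Proof.
move=> d0; rewrite /qconj /numden; case: cid => -[n' d'] /= [d'0 E].
have d0' := tof_neq0 d0; have d'0' := tof_neq0 d'0.
have {}E : n * d' = n' * d.
  by apply/eqP; rewrite -(inj_eq tof_inj) !rmorphM -eqr_div // E.
apply/eqP; rewrite eqr_div ?evi_neq0 // -!eviM E mulrC.
by rewrite mulrC.
Qed.
Lemma qconj_tof p : qconj (tof p) = evi p.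
Proof.
have := @qconjE p 1 (oner_neq0 _); rewrite (rmorph1 tof) divr1 => ->.
by rewrite evi1 divr1.
Qed.

Lemma qconj_zmod : zmod_morphism qconj.
Proof.
move=> a b; have [[n d] /= [d0 ->]] := fracs a; have [[m e] /= [e0 ->]] := fracs b.
have d0' := tof_neq0 d0; have e0' := tof_neq0 e0.
have eN p : evi (- p) = - evi p by apply/eqP; rewrite -subr_eq0 opprK -eviD addNr evi0.
rewrite -mulNr -rmorphN addf_div // -!rmorphM -rmorphD !qconjE ?mulf_neq0 //.
by rewrite -[- (evi m / _)]mulNr addf_div ?evi_neq0 // eviD !eviM eN.
Qed.
Lemma qconj_monoid : monoid_morphism qconj.
Proof.
split; first by rewrite -{1}(rmorph1 tof) qconj_tof evi1.
move=> a b; have [[n d] /= [d0 ->]] := fracs a; have [[m e] /= [e0 ->]] := fracs b.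
rewrite mulf_div -!rmorphM !qconjE ?mulf_neq0 // !eviM mulf_div.
by [].
Qed.
HB.instance Definition _ := GRing.isZmodMorphism.Build F F qconj qconj_zmod.
HB.instance Definition _ := GRing.isMonoidMorphism.Build F F qconj qconj_monoid.

Definition qconj_rmorphism : {rmorphism F -> F} := qconj.

Lemma qconj_q : qconj q = q^-1. Proof. by rewrite qconj_tof eviX. Qed.
Lemma qconj_cst r : qconj (cst r) = cst r. Proof. by rewrite qconj_tof eviC. Qed.
Lemma qconj_evi p : qconj (evi p) = tof p.
Proof.
rewrite -tofrac_horner /evi -horner_map fmorphV /= qconj_q invrK; congr (_.[_]).
by rewrite -map_poly_comp; apply: eq_map_poly => r; rewrite /= -[tof _]/(cst r) qconj_cst.
Qed.
Lemma qconjK : involutive qconj.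
Proof.
move=> c; have [[n d] /= [d0 ->]] := fracs c.
by rewrite qconjE // fmorph_div /= !qconj_evi.
Qed.
Lemma qconj_v : qconj v = v^-1. Proof. by rewrite rmorphXn /= qconj_q exprVn. Qed.
Lemma qconj_intr (p : {poly int}) x : qconj (map_poly intr p).[x] = (map_poly intr p).[qconj x].
Proof.
rewrite -horner_map; congr (_.[_]); rewrite -map_poly_comp; apply: eq_map_poly => z /=.
by rewrite rmorph_int.
Qed.

(** An additive map is $\mathbb Q$-linear since denominators can be cleared; the rule for $q$ then
    gives polynomials by induction, and fractions by division. *)
Lemma qconj_semi (V : lmodType F) (T : V -> V) : {morph T : x y / x + y} ->
  (forall a, T (q *: a) = q^-1 *: T a) -> forall c a, T (c *: a) = qconj c *: T a.
Proof.
move=> TD Tq; have T0 : T 0 = 0 by apply: (addrI (T 0)); rewrite -TD !addr0.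
have TN x : T (- x) = - T x by apply: (addrI (T x)); rewrite -TD !subrr.
have Tn x n : T (x *+ n) = T x *+ n by elim: n => [|n IH]; rewrite ?mulr0n // !mulrS TD IH.
have Tz (z : int) x : T (z%:~R *: x) = z%:~R *: T x.
  case: z => n; first by rewrite -!pmulrn !scaler_nat Tn.
  by rewrite NegzE !mulrNz -!pmulrn !scaleNr !scaler_nat TN Tn.
have Tc r x : T (cst r *: x) = cst r *: T x.
  have d0 : (denq r)%:~R != 0 :> F.
    have <- : cst (denq r)%:~R = (denq r)%:~R by rewrite rmorph_int.
    by rewrite tof_eq0 polyC_eq0 intr_eq0 denq_neq0.
  have E : (denq r)%:~R * cst r = (numq r)%:~R :> F.
    have -> : (denq r)%:~R = cst (denq r)%:~R by rewrite rmorph_int.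
    by rewrite -rmorphM mulrC -{1}(divq_num_den r) mulfVK ?intr_eq0 ?denq_neq0 // rmorph_int.
  have : (denq r)%:~R *: T (cst r *: x) = (denq r)%:~R *: (cst r *: T x).
    by rewrite -Tz !scalerA E Tz.
  by move/(scalerI d0).
have Tp p x : T (tof p *: x) = evi p *: T x.
  elim/poly_ind: p x => [|p c IH] x; first by rewrite rmorph0 evi0 !scale0r.
  rewrite rmorphD rmorphM eviD eviM eviX eviC !scalerDl TD -!scalerA IH Tq.
  by rewrite -[tof c%:P]/(cst c) Tc.
move=> c x; have [[n d] /= [d0 ->]] := fracs c.
rewrite qconjE //; have dd := evi_neq0 d0; have d0' := tof_neq0 d0.
have : evi d *: T ((tof n / tof d) *: x) = evi n *: T x.
  by rewrite -Tp scalerA mulrC mulfVK // Tp.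
move=> /(congr1 (fun y => (evi d)^-1 *: y)); rewrite !scalerA mulVf // scale1r => ->.
by rewrite mulrC.
Qed.

Lemma regular_add a b : regular_oo q a -> regular_oo q b -> regular_oo q (a + b).
Proof.
move=> [n [d [d0 nd ->]]] [m [e [e0 me ->]]].
exists (n * e + m * d), (d * e); split; first exact: mulf_neq0.
  have s1 := size_polyMleq n e; have s2 := size_polyMleq m d.
  have d1 : (0 < size d)%N by rewrite size_poly_gt0.
  have e1 : (0 < size e)%N by rewrite size_poly_gt0.
  rewrite size_mul // (leq_trans (size_polyD _ _)) // geq_max.
  move: nd me s1 s2 d1 e1; move: (size (n * e)%R) (size (m * d)%R) (size n) (size d) (size m) (size e).
  by clear; lia.
have N0 p : p != 0 -> evv p != 0 by apply: contraNneq => E; apply/eqP/evv_inj; rewrite E evv0.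
by rewrite !evv_ratr evvD !evvM addf_div // ?N0.
Qed.

(** Without constant term, $p$ has only positive powers of $q$ and its conjugate only negative
    ones. *)
Lemma qconj_odd (s : F) p : s = 1 \/ s = -1 -> tof p = s * evi p -> p`_0 = 0 -> p = 0.
Proof.
move=> hs E p0; set m := size p.
have {}E : tof (p * 'X^m) = s * tof (revp m p).
  by rewrite rmorphM rmorphXn E -evi_rev ?leqnSn // mulrA.
have {}E : p * 'X^m = (if s == 1 then 1 else -1) * revp m p.
  apply: tof_inj; rewrite E rmorphM; congr (_ * _).
  case: eqP => [->|]; first by rewrite rmorph1.
  by case: hs => // -> _; rewrite rmorphN1.
apply/polyP => i; rewrite coef0; case: i => // i.
have := congr1 (fun r : {poly rat} => r`_(m + i.+1)) E.
rewrite coefMXn ltnNge leq_addr /= addKn => ->.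
have r0 : (revp m p)`_(m + i.+1) = 0 by rewrite coef_poly ltnNge addnS ltnS leq_addr.
by case: ifP => _; rewrite ?mul1r ?mulN1r ?coefN r0 ?oppr0.
Qed.

Lemma qconj_anti_coef0 p : tof p = - evi p -> p`_0 = 0.
Proof.
move=> E; set m := size p.
have {}E : p * 'X^m = - revp m p.
  by apply: tof_inj; rewrite rmorphM rmorphXn E rmorphN -evi_rev ?leqnSn // mulNr.
have := congr1 (fun r : {poly rat} => r`_m) E.
rewrite coefMXn ltnn subnn coefN coef_poly leqnn subnn => /eqP.
by rewrite -subr_eq0 opprK -mulr2n mulrn_eq0 /= => /eqP.
Qed.

Lemma comp_X2_coef0 p : (p \Po 'X^2 : {poly rat})`_0 = p`_0.
Proof. by rewrite -!horner_coef0 horner_comp hornerXn expr0n. Qed.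

Lemma evv_odd (s : F) (p : {poly int}) : s = 1 \/ s = -1 ->
  (map_poly intr p).[v] = s * qconj (map_poly intr p).[v] -> p`_0 = 0 -> (map_poly intr p).[v] = 0.
Proof.
move=> hs; rewrite evv_intr /evv qconj_tof => E p0.
rewrite (qconj_odd hs E) ?rmorph0 // comp_X2_coef0 coef_map p0.
exact: (mulr0z (1 : rat)).
Qed.

Lemma qconj_lz c : laurentZ q c -> laurentZ q (qconj c).
Proof.
move=> [p [n ->]]; rewrite rmorphM fmorphV rmorphXn /= qconj_v exprVn invrK qconj_intr qconj_v.
apply: lzM; last by rewrite exprnP; apply: lz_v.
rewrite horner_coef; apply: (lz_sum q0) => i _; apply: lzM; last by apply: lzX; apply: (lz_v q (-1)).
by rewrite coef_map; apply: lz_int.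
Qed.

Lemma vinv_lz c : vinvZ q c -> laurentZ q c.
Proof.
move=> [p ->]; apply: lzM; first exact: (lz_v _ (- 1%:Z)).
rewrite horner_coef; apply: (lz_sum q0) => i _; apply: lzM; last by apply: lzX; apply: (lz_v q (-1)).
by rewrite coef_map; apply: lz_int.
Qed.

Lemma vinv_sep a : vinvZ q a -> qconj a = a -> a = 0.
Proof.
move=> [p Ea] Ec.
have E : qconj a = (map_poly intr ('X * p)).[v].
  by rewrite Ea rmorphM fmorphV /= qconj_v invrK qconj_intr fmorphV /= qconj_v invrK rmorphM /= map_polyX hornerM hornerX.
rewrite -Ec E; apply: (@evv_odd 1); [by left|by rewrite mul1r -E qconjK Ec|].
by rewrite mulrC coefMX.
Qed.

Lemma lz_split a : laurentZ q a -> qconj a = - a -> exists2 p, vinvZ q p & a = p - qconj p.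
Proof.
move=> [P [n Ea]] Ec; pose pp := \poly_(j < n) P`_(n.-1 - j).
(* [p] is the part of $a$ with negative powers of $v$, and [e] is the rest. Anti-invariance of $a$
   makes $e+\overline p$ an anti-invariant polynomial in $v$; its constant term is its own negative,
   so the polynomial is 0. *)
pose p := v^-1 * (map_poly intr pp).[v^-1]; have Lp : vinvZ q p by exists pp.
pose e := (map_poly intr (drop_poly n P)).[v].
have v0 : v != 0 by rewrite /Defs.v expf_neq0 ?q0.
have Epe : a = p + e.
  rewrite Ea -{1}(poly_take_drop n P) rmorphD rmorphM rmorphXn /= map_polyX hornerD hornerM hornerXn.
  rewrite mulrDl (mulfK (expf_neq0 n v0)) -[X in _ + X]/e; apply: (congr1 (+%R^~ e)).
  have E1 : (size (map_poly (intr : int -> F) (take_poly n P)) <= n)%N.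
    by rewrite (leq_trans (size_poly _ _)) // size_take_poly.
  have E2 : (size (map_poly (intr : int -> F) pp) <= n)%N.
    by rewrite (leq_trans (size_poly _ _)) // size_poly.
  rewrite (horner_coef_wide _ E1) /p (horner_coef_wide _ E2) mulr_suml mulr_sumr.
  rewrite (reindex_inj rev_ord_inj) /=; apply: eq_bigr => i _.
  rewrite !coef_map coef_take_poly coef_poly ltn_ord /=.
  have -> : (n - i.+1 < n)%N by have := ltn_ord i; lia.
  have -> : (n.-1 - i = n - i.+1)%N by have := ltn_ord i; lia.
  rewrite mulrCA -mulrA; congr (_ * _).
  have -> : v ^+ n = v ^+ (n - i.+1) * v ^+ i.+1 by rewrite -exprD subnK // ltn_ord.
  have h1 : v ^+ (n - i.+1) != 0 by rewrite expf_neq0.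
  by rewrite invfM mulrA mulfV // mul1r exprS invfM exprVn.
exists p => //; rewrite Epe; congr (_ + _); apply/eqP; rewrite -subr_eq0 opprK; apply/eqP.
have Ep : qconj p = (map_poly intr ('X * pp)).[v].
  by rewrite rmorphM fmorphV /= qconj_v invrK qconj_intr fmorphV /= qconj_v invrK rmorphM /= map_polyX hornerM hornerX.
have Ez : e + qconj p = (map_poly intr (drop_poly n P + 'X * pp)).[v].
  by rewrite rmorphD hornerD -Ep.
have zc : e + qconj p = -1 * qconj (e + qconj p).
  move: Ec; rewrite Epe !rmorphD /= qconjK mulN1r => Ec.
  have -> : qconj e = - (p + e) - qconj p by rewrite -Ec addrC addKr.
  by rewrite !opprD !opprK; ring.
have c0 : (drop_poly n P + 'X * pp)`_0 = 0.
  move: zc; rewrite Ez evv_intr /evv qconj_tof; set G := map_poly _ _ => zc.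
  have : (G \Po 'X^2 : {poly rat})`_0 = 0 by apply: qconj_anti_coef0; rewrite zc mulN1r.
  by rewrite comp_X2_coef0 coef_map => /eqP; rewrite intr_eq0 => /eqP.
by rewrite Ez in zc *; apply: (@evv_odd (-1)) => //; right.
Qed.

(** Regularity of $vc$ at infinity leaves only negative powers of $v$ in $c$, and invariance then
    leaves none. *)
Lemma lz_sep_q c r : laurentZ q c -> regular_oo q r -> c = v^-1 * r -> qconj c = c -> c = 0.
Proof.
move=> [P [n Ec]] [N [D [D0 ND Er]]] Ecr cc.
have v0 : v != 0 by rewrite /Defs.v expf_neq0 ?q0.
pose G : {poly rat} := map_poly intr P.
have EG : (map_poly intr P).[v] = evv G by rewrite evv_intr.
have [G0|G0] := eqVneq G 0; first by rewrite Ec EG G0 evv0 mul0r.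
have N0 p : p != 0 -> evv p != 0 by apply: contraNneq => E; apply/eqP/evv_inj; rewrite E evv0.
have E1 : 'X * (G * D) = N * 'X^n.
  apply: evv_inj; rewrite !evvM evvX evvXn.
  have : evv G / v ^+ n = v^-1 * (evv N / evv D) by rewrite -EG -Ec Ecr Er !evv_ratr.
  have := N0 _ D0; have vn : v ^+ n != 0 by rewrite expf_neq0.
  move: (evv G) (evv N) (evv D) (v ^+ n) vn => g a b w vn b0 E.
  have -> : g = v^-1 * (a / b) * w by rewrite -E mulfVK.
  by field; rewrite v0 b0.
have sG : (size G <= n)%N.
  have := congr1 (fun p : {poly rat} => size p) E1.
  rewrite mulrC size_mulX ?mulf_neq0 // size_mul //.
  have := size_polyMleq N 'X^n; rewrite size_polyXn.
  have : (0 < size G)%N by rewrite size_poly_gt0.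
  have : (0 < size D)%N by rewrite size_poly_gt0.
  by move: ND; move: (size (N * _)%R) (size N) (size D) (size G); clear; lia.
have sG2 : (size (G \Po 'X^2) <= 2 * n)%N.
  rewrite (leq_trans (size_comp_poly_leq _ _)) // size_polyXn /=.
  have : (0 < size G)%N by rewrite size_poly_gt0.
  by move: sG; move: (size G); clear; lia.
(* Since $v^{2n}=q^{4n}$, invariance makes this polynomial its own reversal in degree $4n$; as its
   size is at most $2n$, it must vanish. *)
have E2 : G \Po 'X^2 = revp (4 * n) (G \Po 'X^2).
  apply: tof_inj; rewrite -evi_rev; last by move: sG2; clear; lia.
  rewrite -qconj_tof -/(evv G); move: cc; rewrite Ec EG rmorphM fmorphV rmorphXn /= qconj_v exprVn invrK => cc.
  have -> : q ^+ (4 * n) = v ^+ n * v ^+ n by rewrite /Defs.v -!exprM -exprD; congr (_ ^+ _); lia.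
  by rewrite mulrA cc mulfVK // expf_neq0.
have : G \Po 'X^2 = 0.
  apply/polyP => k; rewrite coef0; case: (ltnP k (2 * n)) => kn; last first.
    by apply: nth_default; apply: leq_trans kn.
  rewrite E2 coef_poly; case: ifP => // _; apply: nth_default.
  by apply: leq_trans sG2 _; move: kn; clear; lia.
by move/eqP; rewrite comp_poly_eq0 ?size_polyXn // (negbTE G0).
Qed.
End RationalFunctions.

(** * The dual canonical basis of the iHopf algebra *)

Section DiamondAction.
Variables (Kv : fieldType) (q : Kv) (I : finType) (C : I -> I -> int) (d : I -> nat).
Hypothesis q0 : q != 0.
Hypothesis q_nroot : forall n, q ^+ n.+1 != 1.
Hypothesis hC : finite_cartan C d.
Local Notation v := (v q).
Local Notation B := (Bhat q C d).
Local Notation iota := (@iotaB Kv q I C d).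
Local Notation nf := (nform C d).
Variable phi : B -> B -> Kv.
Hypothesis hphi : hopf_pairing phi.
Local Notation homf := (homog (@deg_f I)).
Variable tau : I -> I.
Hypothesis htau : diagram_involution C d tau.
Local Notation hr := (@hroot Kv q I C d).
Local Notation tauN := (tauN tau).
Local Notation star := (star tau phi).
Variable conj : {rmorphism Kv -> Kv}.
Hypothesis conj_q : conj q = q^-1.
Hypothesis conj_semi : forall (V : lmodType Kv) (T : V -> V), {morph T : x y / x + y} ->
  (forall a, T (q *: a) = q^-1 *: T a) -> forall c a, T (c *: a) = conj c *: T a.
Variable bar : B -> B.
Hypothesis hbar : bar_involution tau phi bar.
Local Notation degB := (deg_B tau).
Local Notation Kd := (Kdia tau phi).
Local Notation qD := (expfzDr _ _ q0).

Lemma v_q z : v ^ z = q ^ (z + z).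
Proof. by rewrite /Defs.v (exprnP q 2) exprz_exp; congr (q ^ _); ring. Qed.

Lemma Kdia_homog a b X : homog degB b X ->
  Kd a X = q ^ (nf a (tauN a) + nf a b - nf (tauN a) b) *: star (hr (tauN a)) X.
Proof.
(* [wt_B] has no meaning at 0, where both sides vanish anyway. *)
move=> hX; have [->|X0] := eqVneq X 0.
  by rewrite /Kdia /hdia (star0r q0 q_nroot hC hphi htau) !scaler0.
rewrite /Kdia /hdia scalerA -qD (tauNK htau); congr (q ^ _ *: _).
have -> : wt_B tau X = b by rewrite /wt_B (weight_homog (@B_rel_homog Kv q I C d _) hX).
rewrite -addrA; congr (_ + _); rewrite /nform /zform -sumrB; apply: eq_bigr => i _.
by rewrite -sumrB; apply: eq_bigr => j _; rewrite !ffunE; ring.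
Qed.

Lemma Kdia_iota a b x : homf b x ->
  Kd a (iota x) = q ^ (nf a (tauN a) + nf a b + nf (tauN a) b) *: (iota x * hr (tauN a)).
Proof.
move=> hx; have hX : homog degB b (iota x) by apply: (homog_iota_deg (degf := @deg_f I)).
rewrite (Kdia_homog _ hX) -{1}[iota x]mulr1 -(hroot0 q C d).
rewrite (star_hroot_lE q0 q_nroot hC hphi htau) (nform0r hC) expr0z scale1r hroot0 mulr1.
rewrite (hroot_iota q0 hC _ hx) scalerA v_q -qD; congr (q ^ _ *: _).
by ring.
Qed.

Lemma Kdia_lin a b k X Y : homog degB b X -> homog degB b Y ->
  Kd a (k *: X + Y) = k *: Kd a X + Kd a Y.
Proof.
move=> hX hY; rewrite (Kdia_homog _ hX) (Kdia_homog _ hY) (@Kdia_homog a b); last first.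
  by apply: homogD => //; apply: homogZ.
rewrite (starDr q0 q_nroot hC hphi htau) (starZr q0 q_nroot hC hphi htau) scalerDr !scalerA.
by rewrite [k * _]mulrC.
Qed.

Lemma homog_Kdia a b X : homog degB b X -> homog degB (b + (a + tauN a)) (Kd a X).
Proof.
move=> hX; rewrite (Kdia_homog _ hX); apply: homogZ.
by rewrite [a + _]addrC -{2}[a](tauNK htau); apply: (homog_star_hroot q0 q_nroot hC hphi htau).
Qed.

Lemma Kdia_Kdia a a' b x : homf b x -> Kd a (Kd a' (iota x)) = Kd (a + a') (iota x).
Proof.
move=> hx; have hX : homog degB b (iota x) by apply: (homog_iota_deg (degf := @deg_f I)).
rewrite (Kdia_homog _ (homog_Kdia a' hX)) !(Kdia_iota _ hx).
rewrite (starZr q0 q_nroot hC hphi htau) (star_hroot_lE q0 q_nroot hC hphi htau).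
rewrite (hroot_iota q0 hC _ hx) -scalerAl -mulrA -hrootD -(tauND tau) !scalerA !v_q -!qD.
congr (q ^ _ *: _).
rewrite !(tauND tau) !(nformDl C d) !(nformDr hC) ?(tauNK htau) (nf_tau htau) (nf_tauC htau a a').
by rewrite (nformC hC a' (tauN a)) (nf_tauC htau a a'); ring.
Qed.

(** Conjugation inverts the half powers, while reordering the reversed product returns twice their
    exponent ([star_hroot_comm]); in the same way [bar_h] restores the prefactor of $\mathbb
    K_a$. *)
Lemma bar_Kdia a b X : homog degB b X -> homog degB b (bar X) -> bar (Kd a X) = Kd a (bar X).
Proof.
move=> hX hbX; rewrite (Kdia_homog _ hX) (Kdia_homog _ hbX) (barZ conj_semi hbar) (bar_star hbar).
rewrite (bar_h hbar) (starZr q0 q_nroot hC hphi htau) (star_hroot_comm q0 q_nroot hC hphi htau _ hbX).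
rewrite (tauNK htau) !scalerA (conj_qz conj_q) !v_q -!qD; congr (q ^ _ *: _).
by rewrite (nformC hC (tauN a) a); ring.
Qed.

Lemma NfunD a b : Nfun C d (a + b) = Nfun C d a + Nfun C d b + nf a b.
Proof.
elim/N_ind: b => [|b i IH]; first by rewrite addr0 (Nfun0 C d) (nform0r hC) !addr0.
by rewrite addrA !(Nfun_sroot hC) IH (nformDl C d) (nformDr hC); ring.
Qed.
Lemma Nfun_tau a : Nfun C d (tauN a) = Nfun C d a.
Proof.
rewrite /Nfun (nf_tau htau); congr (_ - _); rewrite /ht (reindex_inj (inv_inj (tauK htau))).
by apply: eq_bigr => i _; rewrite ffunE (tauK htau) (tau_d htau).
Qed.

End DiamondAction.

Section VinvZ.
Variables (Kv : fieldType) (q : Kv).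
Lemma vinv0 : vinvZ q 0. Proof. by exists 0; rewrite rmorph0 horner0 mulr0. Qed.
Lemma vinvD a b : vinvZ q a -> vinvZ q b -> vinvZ q (a + b).
Proof. by move=> [p ->] [r ->]; exists (p + r); rewrite rmorphD hornerD mulrDr. Qed.
Lemma vinvN a : vinvZ q a -> vinvZ q (- a).
Proof. by move=> [p ->]; exists (- p); rewrite rmorphN hornerN mulrN. Qed.
End VinvZ.

(** * Unitriangularity of the bar involution and the dual canonical basis *)

Section DualCanonicalBasis.
Variables (Kv : fieldType) (q : Kv) (I : finType) (C : I -> I -> int) (d : I -> nat).
Hypothesis q0 : q != 0.
Hypothesis q_nroot : forall n, q ^+ n.+1 != 1.
Hypothesis hC : finite_cartan C d.
Local Notation v := (v q).
Local Notation f := (fAlg q C d).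
Local Notation B := (Bhat q C d).
Local Notation iota := (@iotaB Kv q I C d).
Local Notation N := (Nroot I).
Local Notation nf := (nform C d).
Variable phi : B -> B -> Kv.
Hypothesis hphi : hopf_pairing phi.
Local Notation ip := (ip phi).
Local Notation homf := (homog (@deg_f I)).
Local Notation A := (laurentZ q).
Variable tau : I -> I.
Hypothesis htau : diagram_involution C d tau.
Local Notation hr := (@hroot Kv q I C d).
Local Notation tauN := (tauN tau).
Variable conj : {rmorphism Kv -> Kv}.
Hypothesis conj_q : conj q = q^-1.
Hypothesis conj_semi : forall (V : lmodType Kv) (T : V -> V), {morph T : x y / x + y} ->
  (forall a, T (q *: a) = q^-1 *: T a) -> forall c a, T (c *: a) = conj c *: T a.
Hypothesis reg_add : forall a b, regular_oo q a -> regular_oo q b -> regular_oo q (a + b).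
Hypothesis lz_sep : forall c r, laurentZ q c -> regular_oo q r -> c = v^-1 * r -> conj c = c -> c = 0.
Variable bar : B -> B.
Hypothesis hbar : bar_involution tau phi bar.
Hypothesis conj_lz : forall c, A c -> A (conj c).
Hypothesis vinv_lz : forall c, vinvZ q c -> A c.
Hypothesis vinv_sep : forall c, vinvZ q c -> conj c = c -> c = 0.
Hypothesis lz_split : forall c, A c -> conj c = - c -> exists2 p, vinvZ q p & c = p - conj p.
Variable Ccan : set f.
Hypothesis hcan : canonical_basis Ccan.
Local Notation bco := (@bco Kv q I C d).
Local Notation degB := (deg_B tau).
Local Notation Kd := (Kdia tau phi).
Local Notation cs := (can_seq hcan).
Local Notation dl := (dualf phi Ccan).
Local Notation Cdual := (dual_can phi Ccan).
Local Notation Nf := (Nfun C d).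
Local Notation qD := (expfzDr _ _ q0).

Lemma mem_can_seq a b : (b \in cs a) = `[< Ccan b /\ wt_f b = a >].
Proof. exact: (can_seqP q0 q_nroot hC hphi conj_q conj_semi reg_add lz_sep). Qed.
Let cs_homog a b : b \in cs a -> homf a b.
Proof.
rewrite mem_can_seq => /asboolP[hb <-].
exact: (can_wt q0 q_nroot hC hphi conj_q conj_semi reg_add lz_sep hcan).
Qed.
Let dl_homog a b : b \in cs a -> homf a (dl b).
Proof.
rewrite mem_can_seq => /asboolP[hb <-].
exact: (homog_dual q0 q_nroot hC hphi conj_q conj_semi reg_add lz_sep hcan).
Qed.
Let cs_expand a x : homf a x -> x = \sum_(b <- cs a) ip x (dl b) *: b.
Proof. exact: (can_expand_ip q0 q_nroot hC hphi conj_q conj_semi reg_add lz_sep). Qed.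
Let dl_expand a x : homf a x -> x = \sum_(b <- cs a) ip x b *: dl b.
Proof. exact: (dual_expand q0 q_nroot hC hphi conj_q conj_semi reg_add lz_sep). Qed.
Let cs_int a b : b \in cs a -> @f_integral Kv q I C d b.
Proof. by rewrite mem_can_seq => /asboolP[hb _]; apply: (can_f_integral hcan). Qed.
Let dl_int a b : b \in cs a -> @f_integral Kv q I C d (dl b).
Proof.
rewrite mem_can_seq => /asboolP[hb _].
exact: (dual_f_integral q0 q_nroot hC hphi conj_q conj_semi reg_add lz_sep hcan).
Qed.
Let ipdl b b' : Ccan b -> Ccan b' -> ip (dl b) b' = (b == b')%:R.
Proof. exact: (ip_dual q0 q_nroot hC hphi conj_q conj_semi reg_add lz_sep hcan). Qed.

(* The rescaled dual basis, locked for the same reason as [dL]. *)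
Fact ndual_key : unit. Proof. by []. Qed.
Definition ndual : f -> f := locked_with ndual_key (fun b => q ^ Nf (wt_f b) *: dl b).
Lemma ndualE b : ndual b = q ^ Nf (wt_f b) *: dl b. Proof. by rewrite /ndual unlock. Qed.

Lemma dual_canP x : Cdual x -> exists2 b, Ccan b & x = ndual b.
Proof.
move=> [b [y [Cb hy ->]]]; exists b => //; rewrite ndualE.
by rewrite (dualE q0 q_nroot hC hphi hcan hy).
Qed.
Lemma dual_can_ndual b : Ccan b -> Cdual (ndual b).
Proof.
move=> Cb; exists b, (dl b); rewrite ndualE; split=> //.
exact: (dualP q0 q_nroot hC hphi conj_q conj_semi reg_add lz_sep hcan).
Qed.
Lemma homog_ndual b : Ccan b -> homf (wt_f b) (ndual b).
Proof. by move=> Cb; rewrite ndualE; apply/homogZ/dl_homog; rewrite mem_can_seq; apply/asboolP. Qed.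
Lemma ip_ndual b b' : Ccan b -> Ccan b' -> ip (ndual b) b' = q ^ Nf (wt_f b) * (b == b')%:R.
Proof. by move=> Cb Cb'; rewrite ndualE ipZl // ipdl. Qed.
Lemma ndual_neq0 b : Ccan b -> ndual b != 0.
Proof.
move=> Cb; have: ip (ndual b) b != 0 by rewrite ip_ndual // eqxx mulr1 expfz_neq0.
by apply: contraNneq => ->; rewrite ip0l.
Qed.
Lemma wt_ndual b : Ccan b -> wt_f (ndual b) = wt_f b.
Proof.
by move=> Cb; rewrite /wt_f (weight_homog (@f_rel_homog Kv q I C d) (homog_ndual Cb)) // ndual_neq0.
Qed.

Definition undual (x : f) : f := xget 0 [set b | Ccan b /\ x = ndual b].
Lemma ndualK b : Ccan b -> undual (ndual b) = b.
Proof.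
move=> Cb; rewrite /undual; case: xgetP => [b' _ [Cb' E]|/(_ b)[]//].
have : ip (ndual b) b' = ip (ndual b') b' by rewrite -E.
rewrite (ip_ndual Cb Cb').
rewrite (ip_ndual Cb' Cb').
have [-> //|_] := eqVneq b b'; rewrite [b' == b']eqxx mulr0 mulr1 => /esym/eqP.
by rewrite (negbTE (expfz_neq0 _ q0)).
Qed.

Lemma homog_dual_can x : Cdual x -> homf (wt_f x) x.
Proof. by move=> /dual_canP[b Cb ->]; rewrite wt_ndual //; apply: homog_ndual. Qed.

(** Tested against canonical basis elements, which [psi] fixes, [ip_rho_psi] gives
    $\rho(b^{*})=v^{\mathtt N}b^{*}$. As [rho] inverts scalars $q^m$, multiplying $b^*$ by half of
    that power yields a fixed vector. *)
Lemma rho_ndual b : Ccan b -> rho bar (ndual b) = ndual b.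
Proof.
move=> Cb; have bs : b \in cs (wt_f b) by rewrite mem_can_seq; apply/asboolP.
have hd := dl_homog bs.
have hr1 := homog_rho q0 q_nroot hC hphi htau conj_q conj_semi hbar hd.
have [psi hpsi psiC] := can_bar hcan.
have -> : ndual b = \sum_(b' <- cs (wt_f b)) ip (ndual b) b' *: dl b'.
  exact/dl_expand/homog_ndual.
have E : rho bar (dl b) = v ^ Nf (wt_f b) *: dl b.
  rewrite (dl_expand hr1) [in RHS](dl_expand hd) scaler_sumr big_seq [RHS]big_seq.
  apply: eq_bigr => b' b's; rewrite scalerA; congr (_ *: _).
  move: (b's); rewrite mem_can_seq => /asboolP[Cb' _].
  rewrite -{1}(psiC b' Cb').
  rewrite (ip_rho_psi q0 q_nroot hC hphi htau conj_q conj_semi hbar hpsi hd (cs_homog b's)).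
  by rewrite ipdl // rmorph_nat.
rewrite -dl_expand; last exact: homog_ndual.
rewrite ndualE (rhoZ q0 q_nroot hC hphi conj_semi hbar) E (conj_qz conj_q) scalerA v_q -qD.
by congr (q ^ _ *: _); ring.
Qed.

Definition dia_elt (u : N * f) : B := Kd u.1 (iota u.2).
Definition dia_wt (u : N * f) : N := u.1 + tauN u.1 + wt_f u.2.
Definition dia_exp (a b : N) : int := nf a (tauN a) + nf a b + nf (tauN a) b.
(** The coordinate of [dia_elt w]: the coefficient of the matching $h$ is paired with the canonical
    element from which [w.2] comes, and the scalar undoes the powers of $q$ in [dia_eltE] and
    [ndualE]. *)
Definition dia_coef (w : N * f) (X : B) : Kv :=
  q ^ (- (dia_exp w.1 (wt_f w.2) + Nf (wt_f w.2))) * ip (bco (tauN w.1) X) (undual w.2).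

Lemma dia_coef_lin w k X Y : dia_coef w (k *: X + Y) = k * dia_coef w X + dia_coef w Y.
Proof.
by rewrite /dia_coef (bcoD q0 q_nroot hC hphi) (bcoZ q0 q_nroot hC hphi) ip_linl // mulrDr mulrCA.
Qed.

Lemma dia_eltE a b : Ccan b -> dia_elt (a, ndual b) = q ^ dia_exp a (wt_f b) *: (iota (ndual b) * hr (tauN a)).
Proof. by move=> Cb; rewrite /dia_elt (Kdia_iota q0 q_nroot hC hphi htau _ (homog_ndual Cb)). Qed.

Lemma iota_hroot_expand a b y : homf b y -> iota y * hr a =
  \sum_(b' <- cs b) (ip y b' * q ^ (- (dia_exp (tauN a) (wt_f b') + Nf (wt_f b')))) *: dia_elt (tauN a, ndual b').
Proof.
move=> hy; transitivity (iota (\sum_(b' <- cs b) ip y b' *: dl b') * hr a).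
  by rewrite -(dl_expand hy).
rewrite iB_sum // mulr_suml big_seq [RHS]big_seq; apply: eq_bigr => b'.
rewrite mem_can_seq => /asboolP[Cb _]; rewrite dia_eltE // ndualE !iBZ // -!scalerAl !scalerA (tauNK htau).
rewrite -!mulrA -!qD; congr (_ *: _).
by rewrite addrA [X in q ^ X](_ : _ = 0) ?mulr1 //; ring.
Qed.

Lemma dia_coef_elt w w' : Cdual w.2 -> Cdual w'.2 -> dia_coef w (dia_elt w') = (w == w')%:R.
Proof.
case: w w' => [a x] [a' x'] /= /dual_canP[b Cb ->] /dual_canP[b' Cb' ->].
rewrite dia_eltE // /dia_coef /= wt_ndual // ndualK // (bcoZ q0 q_nroot hC hphi) (bcoE q0 q_nroot hC hphi).
rewrite (inj_eq (inv_inj (tauNK htau))) xpair_eqE.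
case: (eqVneq a' a) => [->|aa]; last by rewrite scaler0 ip0l // mulr0.
rewrite andTb ipZl // ip_ndual //.
have [->|bb] := eqVneq b' b; last first.
  rewrite !mulr0; case: eqP => // E; case/eqP: bb.
  by rewrite -(ndualK Cb) E ndualK.
by rewrite eqxx mulr1 -!qD addNr expr0z.
Qed.

Lemma homog_dia_elt u : Cdual u.2 -> homog degB (dia_wt u) (dia_elt u).
Proof.
move=> hu; rewrite /dia_wt addrC; apply: (homog_Kdia q0 q_nroot hC hphi htau).
exact/(homog_iota_deg (degf := @deg_f I))/homog_dual_can.
Qed.

Definition box (n : nat) : seq N := [seq [ffun i => (g i : nat)] | g : {ffun I -> 'I_n.+1}].
Lemma mem_box n (a : N) : (forall i, a i <= n)%N -> a \in box n.
Proof.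
move=> an; apply/mapP; exists [ffun i => inord (a i)]; first by rewrite mem_enum.
by apply/ffunP => i; rewrite !ffunE inordK ?ltnS.
Qed.
Lemma le_hgt (a : N) i : (a i <= hgt a)%N.
Proof. by rewrite /hgt (bigD1 i) //= leq_addr. Qed.

(** Truncated subtraction can put pairs of the wrong total weight into the pool; the filter in
    [dia_seq] removes them. *)
Definition dia_rest (T a : N) : N := [ffun i => (T i - (a i + a (tau i)))%N].
Definition dia_pool (T : N) : seq (N * f) :=
  [seq (a, ndual b) | a <- box (hgt T), b <- cs (dia_rest T a)].
Definition dia_seq (u : N * f) : seq (N * f) := undup [seq w <- dia_pool (dia_wt u) | dia_wt w == dia_wt u].

Lemma mem_dia_seq u w : w \in dia_seq u <-> Cdual w.2 /\ dia_wt w = dia_wt u.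
Proof.
rewrite mem_undup mem_filter; split=> [/andP[/eqP -> /allpairsPdep[a [b [_ bs ->]]]]|[Dw Ew]].
  by split=> //=; apply: dual_can_ndual; move: bs; rewrite mem_can_seq => /asboolP[].
rewrite Ew eqxx /=; case: w Dw Ew => a x /= /dual_canP[b Cb ->] Ew.
have E i : (dia_wt u i = a i + a (tau i) + wt_f b i)%N by rewrite -Ew /dia_wt /= !ffunE wt_ndual.
apply/allpairsPdep; exists a, b; split=> //.
  by apply: mem_box => i; apply: leq_trans (le_hgt _ i); rewrite E -addnA leq_addr.
rewrite mem_can_seq; apply/asboolP; split=> //; apply/ffunP => i.
by rewrite ffunE E addKn.
Qed.

Lemma dia_expand u X : homog degB (dia_wt u) X -> X = \sum_(w <- dia_seq u) dia_coef w X *: dia_elt w.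
Proof.
have kD X' Y w : dia_coef w (X' + Y) = dia_coef w X' + dia_coef w Y.
  by have := dia_coef_lin w 1 X' Y; rewrite scale1r mul1r.
have k0 w : dia_coef w 0 = 0 by have := dia_coef_lin w (-1) 0 0; rewrite scaler0 addr0 mulN1r addNr.
have kZ k X' w : dia_coef w (k *: X') = k * dia_coef w X'.
  by have := dia_coef_lin w k X' 0; rewrite !addr0 k0 addr0.
have QD X' Y : X' = \sum_(w <- dia_seq u) dia_coef w X' *: dia_elt w -> Y = \sum_(w <- dia_seq u) dia_coef w Y *: dia_elt w ->
    X' + Y = \sum_(w <- dia_seq u) dia_coef w (X' + Y) *: dia_elt w.
  move=> {1}-> {1}->; rewrite -big_split; apply: eq_bigr => w _.
  by rewrite kD scalerDl.
have QZ k X' : X' = \sum_(w <- dia_seq u) dia_coef w X' *: dia_elt w ->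
    k *: X' = \sum_(w <- dia_seq u) dia_coef w (k *: X') *: dia_elt w.
  by move=> {1}->; rewrite scaler_sumr; apply: eq_bigr => w _; rewrite kZ scalerA.
have Q0 : 0 = \sum_(w <- dia_seq u) dia_coef w 0 *: dia_elt w.
  by rewrite big1 // => w _; rewrite k0 scale0r.
have QK w0 : w0 \in dia_seq u -> dia_elt w0 = \sum_(w <- dia_seq u) dia_coef w (dia_elt w0) *: dia_elt w.
  move=> w0u; have [D0 _] := (mem_dia_seq _ _).1 w0u.
  rewrite (bigD1_seq w0) ?undup_uniq //= dia_coef_elt // eqxx scale1r big_seq_cond big1 ?addr0 //.
  move=> w /andP[/mem_dia_seq[Dw _] ww]; rewrite dia_coef_elt //.
  by rewrite (negbTE ww) scale0r.
move: X; apply: (homogB_ind q0 q_nroot hC hphi htau) => [|//|c y a Ec hy]; first exact: QD.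
rewrite (iota_hroot_expand _ hy) big_seq.
apply: (big_ind (fun X => X = \sum_(w <- dia_seq u) dia_coef w X *: dia_elt w)); [exact: Q0|exact: QD|move=> b].
rewrite mem_can_seq => /asboolP[Cb wb].
apply: QZ; apply: QK; apply/mem_dia_seq; split; first exact: dual_can_ndual.
by rewrite {1}/dia_wt /= (tauNK htau) wt_ndual // wb Ec addrC [tauN a + a]addrC.
Qed.

Lemma dia_span X : lincomb setT (dia_elt @` [set u | Cdual u.2]) X.
Proof.
apply: (@Bhat_indh Kv q I C d) => [|X' Y [s [hs ->]] [t [ht ->]]|b y a hy].
- by exists [::]; rewrite big_nil.
- exists (s ++ t); rewrite big_cat; split=> // r.
  by rewrite mem_cat => /orP[/hs|/ht].
rewrite (iota_hroot_expand _ hy).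
exists [seq (ip y b' * q ^ (- (dia_exp (tauN a) (wt_f b') + Nf (wt_f b'))), dia_elt (tauN a, ndual b')) | b' <- cs b].
split=> [_ /mapP[b' bs ->]|]; last by rewrite big_map.
split=> //; exists (tauN a, ndual b') => //; apply: dual_can_ndual.
by move: bs; rewrite mem_can_seq => /asboolP[].
Qed.

Lemma dia_elt0 x : Cdual x -> dia_elt (0, x) = iota x.
Proof.
move=> hx; rewrite /dia_elt /= (Kdia_iota q0 q_nroot hC hphi htau _ (homog_dual_can hx)).
by rewrite tauN0 hroot0 mulr1 !(nform0l C d) !addr0 expr0z scale1r.
Qed.

(** The $h$-free part of the conjugate is given by [rho], which fixes [ndual b]; this provides the
    diagonal entries and the triangularity at once. *)
Lemma dia_coef_bar0 b w : Ccan b -> Cdual w.2 -> w.1 = 0 ->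
  dia_coef w (bar (iota (ndual b))) = (w == (0, ndual b))%:R.
Proof.
move=> Cb Dw w0; have Db := dual_can_ndual Cb.
have E : bco 0 (bar (iota (ndual b))) = bco 0 (dia_elt (0, ndual b)).
  rewrite (dia_elt0 Db) -rhoE (rho_ndual Cb) -[iota (ndual b)]mulr1 -(hroot0 q C d).
  by rewrite (bcoE q0 q_nroot hC hphi) eqxx.
transitivity (dia_coef w (dia_elt (0, ndual b))); last exact: (@dia_coef_elt w (0, ndual b) Dw Db).
by rewrite /dia_coef w0 tauN0 E.
Qed.

Lemma dia_coef_bar_lz b w : Ccan b -> w \in dia_seq (0, ndual b) -> A (dia_coef w (bar (iota (ndual b)))).
Proof.
case: w => c x Cb /mem_dia_seq[/= /dual_canP[b' Cb' ->]].
rewrite /dia_wt /= tauN0 !add0r !wt_ndual // => Ew.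
rewrite /dia_coef /= wt_ndual // ndualK //.
rewrite (bar_coord q0 q_nroot hC hphi htau conj_q conj_semi hbar cs_homog dl_homog cs_expand dl_expand (homog_ndual Cb)).
rewrite rho_ndual // ndualE (SopZ q0 q_nroot hC hphi tau) ipZl // mulrA -qD.
(* Since $\mathtt N$ has polar form $(\,,)$ and the weight of $b$ is $c+\tau c$ plus that of $b'$,
   the half powers combine to $q^{2\mathtt N(c)}=v^{\mathtt N(c)}$, an integral power of $v$. *)
have -> : - (dia_exp c (wt_f b') + Nf (wt_f b')) + Nf (wt_f b) = Nf c + Nf c.
  rewrite -Ew !(NfunD hC) (Nfun_tau htau) (nformDl C d) /dia_exp; ring.
rewrite -v_q; apply: lzM; first exact: lz_v.
rewrite ipC //; apply: (lz_ip_integral q0 hphi); first exact: (can_f_integral hcan).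
apply: (fZd_Sop q0 q_nroot hC hphi htau cs_int dl_int).
exact: (fZd_dual q0 q_nroot hC hphi conj_q conj_semi reg_add lz_sep hcan).
Qed.

Lemma Kdia_sum a T (s : seq (Kv * B)) : (forall t, t \in s -> homog degB T t.2) ->
  Kd a (\sum_(t <- s) t.1 *: t.2) = \sum_(t <- s) t.1 *: Kd a t.2.
Proof.
have K0 : Kd a 0 = 0.
  have h0 : homog degB T (0 : B) by apply: homog0.
  have := Kdia_lin q0 q_nroot hC hphi htau a (-1) h0 h0.
  by rewrite scaler0 addr0 scaleN1r addNr.
elim: s => [|t s IH] hs; first by rewrite !big_nil.
have hs' t' : t' \in s -> homog degB T t'.2 by move=> ts; apply: hs; rewrite inE ts orbT.
have hS : homog degB T (\sum_(t' <- s) t'.1 *: t'.2).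
  by rewrite big_seq; apply: homog_sum => t' ts; apply/homogZ/hs'.
by rewrite !big_cons (Kdia_lin q0 q_nroot hC hphi htau a _ (hs t (mem_head _ _)) hS) IH.
Qed.

Lemma Kdia_dia_elt a w : Cdual w.2 -> Kd a (dia_elt w) = dia_elt (a + w.1, w.2).
Proof. by move=> Dw; rewrite /dia_elt (Kdia_Kdia q0 q_nroot hC hphi htau _ _ (homog_dual_can Dw)). Qed.

Lemma bar_dia_elt a b : Ccan b -> bar (dia_elt (a, ndual b)) =
  \sum_(w <- dia_seq (0, ndual b)) dia_coef w (bar (iota (ndual b))) *: dia_elt (a + w.1, w.2).
Proof.
move=> Cb; have hb := homog_ndual Cb.
have hX : homog degB (wt_f b) (iota (ndual b)) by apply: (homog_iota_deg (degf := @deg_f I)).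
have hbX := bar_homog q0 q_nroot hC hphi htau conj_q conj_semi hbar hb.
rewrite /dia_elt /= (bar_Kdia q0 q_nroot hC hphi htau conj_q conj_semi hbar _ hX hbX).
have ET : dia_wt (0, ndual b) = wt_f b by rewrite /dia_wt /= tauN0 !add0r wt_ndual.
have hbX' : homog degB (dia_wt (0, ndual b)) (bar (iota (ndual b))) by rewrite ET.
have E := dia_expand hbX'.
transitivity (Kd a (\sum_(t <- [seq (dia_coef w (bar (iota (ndual b))), dia_elt w) | w <- dia_seq (0, ndual b)]) t.1 *: t.2)).
  by congr (Kd a _); rewrite big_map.
rewrite (@Kdia_sum _ (dia_wt (0, ndual b))).
  rewrite big_map big_seq [RHS]big_seq; apply: eq_bigr => w /mem_dia_seq[Dw _].
  by rewrite Kdia_dia_elt.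
by move=> _ /mapP[w /mem_dia_seq[Dw <-] ->]; apply: homog_dia_elt.
Qed.

(** Set to 0 outside the block, so that integrality holds for all [w]. *)
Definition bar_coef (u w : N * f) : Kv := if w \in dia_seq u then dia_coef w (bar (dia_elt u)) else 0.

Lemma dia_coef0 w : dia_coef w 0 = 0.
Proof. by have := dia_coef_lin w (-1) 0 0; rewrite scaler0 addr0 mulN1r addNr. Qed.

(** The row of $(a,b)$ is the row of $(0,b)$ with its first indices translated by $a$, which reduces
    integrality and triangularity to $a=0$. *)
Lemma bar_coefE a b w : Ccan b -> w \in dia_seq (a, ndual b) ->
  bar_coef (a, ndual b) w = \sum_(w' <- dia_seq (0, ndual b)) dia_coef w' (bar (iota (ndual b))) * (w == (a + w'.1, w'.2))%:R.
Proof.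
move=> Cb wu; have [Dw _] := (mem_dia_seq _ _).1 wu; rewrite /bar_coef wu bar_dia_elt //.
have kD (s : seq (N * f)) (k : N * f -> Kv) (g : N * f -> B) :
    dia_coef w (\sum_(j <- s) k j *: g j) = \sum_(j <- s) k j * dia_coef w (g j).
  by elim: s => [|j s IH]; rewrite ?big_nil ?dia_coef0 // !big_cons dia_coef_lin IH.
rewrite kD big_seq [RHS]big_seq; apply: eq_bigr => w' /mem_dia_seq[Dw' _].
by rewrite dia_coef_elt.
Qed.

Lemma bar_coef_lz u w : Cdual u.2 -> A (bar_coef u w).
Proof.
case: u => a x /= /dual_canP[b Cb ->].
case: (boolP (w \in dia_seq (a, ndual b))) => wu; last by rewrite /bar_coef (negbTE wu); apply: lz0.
rewrite bar_coefE // big_seq; apply: (lz_sum q0) => w' wu'; apply: lzM; first exact: dia_coef_bar_lz.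
by case: eqP => _; [apply: lz1|apply: lz0].
Qed.

Lemma dia_seq_id u : Cdual u.2 -> u \in dia_seq u.
Proof. by move=> Du; apply/mem_dia_seq. Qed.

Lemma bar_coef_id u : Cdual u.2 -> bar_coef u u = 1.
Proof.
case: u => a x /= /dual_canP[b Cb ->]; have Db := dual_can_ndual Cb.
have u0 : (0, ndual b) \in dia_seq (0, ndual b) by apply: dia_seq_id.
rewrite bar_coefE //; last exact: dia_seq_id.
rewrite (bigD1_seq (0, ndual b)) ?undup_uniq //= addr0 eqxx mulr1 dia_coef_bar0 // eqxx.
rewrite big_seq_cond big1 ?addr0 // => -[c y] /andP[_ cy] /=.
case: eqP; rewrite ?mulr0 // => -[Ea Ey]; case/eqP: cy.
by rewrite Ey; congr (_, _); apply: (@NaddI _ a); rewrite add0r addrC -Ea.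
Qed.

Lemma bar_coef_prec u w : Cdual u.2 -> w \in dia_seq u -> w != u -> bar_coef u w != 0 -> prec tau u w.
Proof.
case: u => a x /= /dual_canP[b Cb ->] wu wneq; have [Dw Tw] := (mem_dia_seq _ _).1 wu.
rewrite bar_coefE // => Rn; have [w' wu' Ew] : exists2 w', w' \in dia_seq (0, ndual b) &
    w = (a + w'.1, w'.2) /\ dia_coef w' (bar (iota (ndual b))) != 0.
  apply: contrapT => nE; case/negP: Rn; apply/eqP; rewrite big_seq big1 // => w' wu'.
  case: eqP => [Ew|]; last by rewrite mulr0.
  rewrite mulr1; apply/eqP; apply: contrapT => /negP kn; apply: nE; exists w' => //.
case: Ew => Ew kn; split; first by rewrite -/(dia_wt w) Tw.
  apply/eqP => /= Ea; have w0 : w'.1 = 0.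
    by apply: (@NaddI _ a); rewrite add0r addrC [a in RHS]Ea Ew.
  have [Dw' _] := (mem_dia_seq _ _).1 wu'; case/negP: kn; rewrite dia_coef_bar0 //.
  case: (w' =P (0, ndual b)) => [E'|_]; last exact: eqxx.
  case/eqP: wneq; rewrite Ew E' /=.
  by rewrite addr0.
by move=> i; rewrite Ew /= ffunE leq_addr.
Qed.

Lemma prec_hgt (u w : N * f) : prec tau u w -> (hgt u.1 < hgt w.1)%N.
Proof.
move=> [_ ne le]; pose r : N := [ffun i => (w.1 i - u.1 i)%N].
have E : w.1 = u.1 + r by apply/ffunP => i; rewrite !ffunE; apply/esym/subnKC/le.
rewrite E hgtD -[X in (X < _)%N]addn0 ltn_add2l lt0n; apply: contraNneq ne => /hgt_eq0 r0.
by rewrite E r0 addr0.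
Qed.

Lemma prec_trans (u w z : N * f) : prec tau u w -> prec tau w z -> prec tau u z.
Proof.
move=> [T1 n1 l1] [T2 n2 l2]; split; first by rewrite T1.
  apply: contraNneq n1 => E; apply/eqP/ffunP => i; apply/eqP.
  by rewrite eqn_leq l1 /= E l2.
by move=> i; apply: leq_trans (l1 i) (l2 i).
Qed.

Lemma dia_seq_uniq u : uniq (dia_seq u). Proof. exact: undup_uniq. Qed.
Lemma dia_seq_D u w : Cdual u.2 -> w \in dia_seq u -> Cdual w.2. Proof. by move=> _ /mem_dia_seq[]. Qed.
Lemma dia_seq_eq u w : Cdual u.2 -> w \in dia_seq u -> dia_seq w = dia_seq u.
Proof. by move=> _ /mem_dia_seq[_ E]; rewrite /dia_seq E. Qed.
Lemma prec_dia_seq (u w : N * f) : Cdual u.2 -> Cdual w.2 -> prec tau u w -> w \in dia_seq u.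
Proof. by move=> _ Dw [E _ _]; apply/mem_dia_seq. Qed.

Lemma bar_dia_elt_expand u : Cdual u.2 -> bar (dia_elt u) = \sum_(w <- dia_seq u) bar_coef u w *: dia_elt w.
Proof.
move=> Du; have hu := homog_dual_can Du.
have hX : homog degB (wt_f u.2) (iota u.2) by apply: (homog_iota_deg (degf := @deg_f I)).
have hbX := bar_homog q0 q_nroot hC hphi htau conj_q conj_semi hbar hu.
have hK : homog degB (dia_wt u) (bar (dia_elt u)).
  rewrite /dia_elt (bar_Kdia q0 q_nroot hC hphi htau conj_q conj_semi hbar _ hX hbX) /dia_wt addrC.
  exact: (homog_Kdia q0 q_nroot hC hphi htau).
transitivity (\sum_(w <- dia_seq u) dia_coef w (bar (dia_elt u)) *: dia_elt w); first exact: dia_expand.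
by rewrite big_seq [RHS]big_seq; apply: eq_bigr => w wu; rewrite /bar_coef wu.
Qed.

Let J : choiceType := (N * f)%type.
Let DJ : set J := [set u | Cdual u.2].
Local Notation dcw := (dcan (vinvZ q) DJ dia_elt bar (prec tau : J -> J -> Prop)).
Let bZ := barZ conj_semi hbar.

Lemma dual_canonical_ex u : DJ u -> exists x, dcw u x.
Proof.
apply: (@dcan_ex Kv conj A (vinvZ q) B J DJ dia_elt bar (prec tau) (fun u => hgt u.1) dia_seq bar_coef dia_coef
  _ _ _ conj_lz vinv_lz (vinv0 q) _ lz_split (bar_add hbar) bZ (bar_bar hbar)
  dia_coef_lin dia_coef_elt dia_seq_uniq dia_seq_D dia_seq_id dia_seq_eq prec_hgt prec_trans bar_dia_elt_expand bar_coef_lz bar_coef_id bar_coef_prec u).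
- exact: lzD.
- exact: lzM.
- exact: lzN.
- exact: vinvD.
Qed.

Lemma dual_canonical_uniq u x y : DJ u -> dcw u x -> dcw u y -> x = y.
Proof.
apply: (@dcan_uniq Kv conj (vinvZ q) B J DJ dia_elt bar (prec tau) (fun u => hgt u.1) dia_seq bar_coef dia_coef
  (vinv0 q) _ _ vinv_sep (bar_add hbar) bZ
  dia_coef_lin dia_coef_elt dia_seq_uniq dia_seq_D dia_seq_eq prec_dia_seq prec_hgt bar_dia_elt_expand bar_coef_id bar_coef_prec u).
- exact: vinvD.
- exact: vinvN.
Qed.

Theorem dual_canonical_basis : exists Cab : N -> f -> B,
  [/\ forall a b, Cdual b -> unique (dual_canonical tau phi bar Cdual a b) (Cab a b),
      forall a b, Cdual b -> Cab a b = Kd a (Cab 0 b)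
    & is_basis [set u | Cdual u.2] (fun u => Cab u.1 u.2)].
Proof.
(* The default value 0 can only be taken outside [Cdual], where nothing is claimed. *)
pose C0 x := xget 0 [set y | dcw (0, x) y].
have hC0 x : Cdual x -> dcw (0, x) (C0 x).
  by move=> Dx; have [y hy] := @dual_canonical_ex (0, x) Dx; apply: (xgetPex 0 (P := [set y | dcw (0, x) y])); exists y.
have T0 x : dia_wt (0, x) = wt_f x by rewrite /dia_wt /= tauN0 !add0r.
have K0 x : Cdual x -> exists s : seq (Kv * B), C0 x = \sum_(t <- (1, dia_elt (0, x)) :: s) t.1 *: t.2 /\
    forall t, t \in s -> vinvZ q t.1 /\ exists2 w, DJ w /\ prec tau (0, x) w & dia_elt w = t.2.
  move=> Dx; have [_ [s [hs E]]] := hC0 x Dx; exists s; split; last by move=> t /hs.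
  by rewrite big_cons scale1r -E addrC subrK.
have hs0 x s : Cdual x -> (forall t, t \in s ->
    vinvZ q t.1 /\ exists2 w, DJ w /\ prec tau (0, x) w & dia_elt w = t.2) ->
    forall t : Kv * B, t \in (1, dia_elt (0, x)) :: s -> homog degB (wt_f x) t.2.
  move=> Dx hs t; rewrite inE => /orP[/eqP ->|/hs[_ [w [Dw [Tw _ _]] <-]]].
    by rewrite -T0; apply: homog_dia_elt.
  by rewrite -T0 [dia_wt (0, x)]Tw; apply: homog_dia_elt.
have homC0 x : Cdual x -> homog degB (wt_f x) (C0 x).
  move=> Dx; have [s [-> hs]] := K0 x Dx; rewrite big_seq; apply: homog_sum => t ts.
  exact/homogZ/(hs0 x s).
have dK a x : Cdual x -> dcw (a, x) (Kd a (C0 x)).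
  move=> Dx; have [bC _] := hC0 x Dx; have hX := homC0 x Dx; split.
    by rewrite (bar_Kdia q0 q_nroot hC hphi htau conj_q conj_semi hbar _ hX) bC.
  have [s [E hs]] := K0 x Dx; exists [seq (t.1, Kd a t.2) | t <- s]; split.
    move=> _ /mapP[t ts ->] /=; have [Lt [w [Dw [Tw nw lw]] <-]] := hs t ts; split=> //.
    exists (a + w.1, w.2); last by rewrite Kdia_dia_elt.
    split=> //; split=> /=.
    - rewrite tauND (_ : _ + wt_f w.2 = a + tauN a + (w.1 + tauN w.1 + wt_f w.2)); last first.
        by rewrite [in RHS]addrA [X in X + wt_f _]addrACA.
      by rewrite -Tw tauN0 !add0r.
    - apply: contraNneq nw => /= Ea; apply/eqP/(@NaddI _ a).
      by rewrite add0r addrC.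
    by move=> i; rewrite ffunE leq_addr.
  rewrite E (@Kdia_sum a (wt_f x) _ (hs0 x s Dx hs)) big_cons /= Kdia_dia_elt //= addr0 scale1r.
  by rewrite [X in X - _]addrC addrK big_map.
(* The action of $\mathbb K_0$ is trivial on these elements by uniqueness, so the family below
   restricts to [C0] at $a=0$. *)
have C00 x : Cdual x -> Kd 0 (C0 x) = C0 x.
  by move=> Dx; apply: (@dual_canonical_uniq (0, x)) => //; [exact: dK|exact: hC0].
exists (fun a x => Kd a (C0 x)); split.
- move=> a x Dx; split; first exact: dK.
  by move=> y hy; apply: (@dual_canonical_uniq (a, x)) => //; exact: dK.
- by move=> a x Dx; rewrite C00.
apply: (@tri_basis Kv B J DJ dia_elt (prec tau) (fun u => hgt u.1) dia_seq dia_coef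
  dia_coef_lin dia_coef_elt dia_span dia_seq_uniq dia_seq_D dia_seq_id dia_seq_eq prec_dia_seq prec_hgt) => -[a x] Dx.
have [_ [s [hs E]]] := dK a x Dx; exists s; split=> // t /hs[_ h]; split=> //.
Qed.

End DualCanonicalBasis.

Lemma tofrac_inj (R : idomainType) : injective (@tofrac R).
Proof. by move=> p r /eqP; rewrite tofrac_eq => /eqP. Qed.

Theorem theoremB (I : finType) (C : I -> I -> int) (d : I -> nat) (tau : I -> I)
    (hC : finite_cartan C d) (htau : diagram_involution C d tau)
    (phi : Bhat vhalf C d -> Bhat vhalf C d -> Qvhalf) (hphi : hopf_pairing phi)
    (bar : Bhat vhalf C d -> Bhat vhalf C d) (hbar : bar_involution tau phi bar)
    (Ccan : set (fAlg vhalf C d)) (hcan : canonical_basis Ccan) :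
  let Cdual := dual_can phi Ccan in
  exists Cab : Nroot I -> fAlg vhalf C d -> Bhat vhalf C d,
    [/\ forall a b, Cdual b ->
          unique (dual_canonical tau phi bar Cdual a b) (Cab a b),
        forall a b, Cdual b -> Cab a b = Kdia tau phi a (Cab 0 b)
      & is_basis [set u | Cdual u.2] (fun u => Cab u.1 u.2)].
Proof.
pose frs := @frac_ex {poly rat}; pose inj := @tofrac_inj {poly rat}.
exact: (dual_canonical_basis (q0 inj) (q_nroot inj) hC hphi htau
  (conj := qconj_rmorphism inj frs) (qconj_q inj frs) (qconj_semi inj frs) (regular_add inj) (lz_sep_q inj (fracs := frs))
  hbar (qconj_lz inj frs) (vinv_lz inj) (vinv_sep inj (fracs := frs)) (lz_split inj (fracs := frs)) hcan).
Qed.
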